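(* Let $\mathbf K$ be a field of characteristic zero, let $e,g\ge1$ be integers, $f=e+g$, let $F$ and $G$ be $\mathbf K$-vector spaces of dimensions $f$ and $g$, let $\bar A=\mathrm{Sym}(F\otimes G^* )$, and let $\psi:F\otimes_{\mathbf K}\bar A\to G\otimes_{\mathbf K}\bar A$ be the natural (generic) map. Let $\nu=(\nu_1\ge\dots\ge\nu_{g-1})$ be a dominant weight with $\nu\subset[-1,e+1]^{g-1}$ (that is, $-1\le\nu_i\le e+1$ for all $i$), and let $\mathbf t_\nu$ be the complex of free $\bar A$-modules defined in the context. Then (a) $H_0(\mathbf t_\nu)$ is a perfect $\bar A$-module with $$\mathrm{Ext}^{e+1}_{\bar A}(H_0(\mathbf t_\nu),\bar A)=H_0(\mathbf t_\mu)\quad\text{for }\mu=(e-\nu_{g-1},\dots,e-\nu_1),$$ and (b) $H_0(\mathbf t_\nu)$ is a maximal Cohen–Macaulay $\bar A/I_g(\psi)$-module, where $I_g(\psi)$ is the ideal generated by the $g\times g$ minors of $\psi$.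
   Context: For a vector space $W$ of dimension $n$ and a dominant weight $\lambda=(\lambda_1\ge\dots\ge\lambda_n)\in\mathbb Z^n$, $S_\lambda W$ is the irreducible $\mathrm{GL}(W)$-representation of highest weight $\lambda$ ($S_{1^d}W=\bigwedge^dW$). For an integer $k$ and a dominant weight $\nu=(\nu_1\ge\dots\ge\nu_{g-1})$, let $\nu'_k$ be the number of indices $j$ with $\nu_j\ge k$, and with $i=\nu'_k$ put $$p(\nu;k)=(\nu_1,\dots,\nu_i,k,\nu_{i+1}+1,\dots,\nu_{g-1}+1),\qquad N(\nu;k)=g-1-\nu'_k+k,$$ $$t_{\nu;k}=\bigwedge^{N(\nu;k)}F\otimes_{\mathbf K}S_{p(\nu;k)}G^*\otimes_{\mathbf K}\bar A$$ (with $\bigwedge^mF=0$ unless $0\le m\le f$). The map $t_{\nu;k}\to t_{\nu;k-1}$: let $N=1+\nu'_{k-1}-\nu'_k$, so $N(\nu;k-1)=N(\nu;k)-N$, and there are dominant weights $\alpha,\beta$ with $\alpha_{\rm last}\ge k>\beta_1$, $p(\nu;k)=(\alpha,k^N,\beta)$ and $p(\nu;k-1)=(\alpha,(k-1)^N,\beta)$. The map is the composition $$\bigwedge^{N(\nu;k)}F\otimes S_{p(\nu;k)}G^*\otimes\bar A\to\bigwedge^{N(\nu;k)}F\otimes S_{1^N}G^*\otimes S_{p(\nu;k-1)}G^*\otimes\bar A\to\bigwedge^{N(\nu;k)}F\otimes S_{1^N}F^*\otimes S_{p(\nu;k-1)}G^*\otimes\bar A\to\bigwedge^{N(\nu;k)-N}F\otimes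 S_{p(\nu;k-1)}G^*\otimes\bar A,$$ where the first map is induced by the Pieri map $S_{p(\nu;k)}G^*\to S_{1^N}G^*\otimes S_{p(\nu;k-1)}G^*$ (the nonzero $\mathrm{GL}(G)$-equivariant map, unique up to scalar), the second by $\bigwedge^N\psi^*$, and the third by the module action of $\bigwedge^\bullet F^*$ on $\bigwedge^\bullet F$. The complex $\mathbf t_\nu$ is $\cdots\to t_{\nu;k}\to t_{\nu;k-1}\to\cdots$ with $t_{\nu;k}$ in position $k$. A finitely generated $\bar A$-module $M$ is perfect if its projective dimension equals the grade of its annihilator. The equality of modules in (a) means isomorphism. *)

(* Defs.v *)
From HB Require Import structures.
From mathcomp Require Import all_boot all_order all_algebra.
From mathcomp Require Import generic_quotient ring_quotient boolp.
From mathcomp Require Import mpoly.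

Set Implicit Arguments.
Unset Strict Implicit.
Unset Printing Implicit Defensive.

Import Order.TTheory GRing.Theory Num.Theory.
Local Open Scope ring_scope.
Local Open Scope quotient_scope.

Section Homology.
Variables (R : comNzRingType) (U V W : lmodType R).
Variables (f : {linear U -> V}) (g : {linear V -> W}).

Definition cycle : {pred V} := fun x => g x == 0.

Lemma cycle_submod_closed : submod_closed cycle.
Proof.
split=> [|a x y]; rewrite /in_mem /= /cycle ?linear0 ?eqxx // => /eqP gx /eqP gy.
by rewrite linearP gx gy scaler0 addr0.
Qed.
HB.instance Definition _ := GRing.isSubmodClosed.Build R V cycle
  cycle_submod_closed.

Record cycles := Cycle { cycle_val : V; _ : cycle_val \in cycle }.
HB.instance Definition _ := [isSub for cycle_val].
HB.instance Definition _ := [Choice of cycles by <:].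
HB.instance Definition _ :=
  [SubChoice_isSubLmodule of cycles by <:].

Definition boundary : {pred cycles} :=
  fun z : cycles => `[< exists u : U, f u = val z >].

Lemma boundary_submod_closed : submod_closed boundary.
Proof.
split=> [|a x y]; rewrite /in_mem /= /boundary.
  by apply/asboolP; exists 0; rewrite linear0 raddf0.
move=> /asboolP[u fu] /asboolP[v fv]; apply/asboolP.
by exists (a *: u + v); rewrite linearP fu fv linearP.
Qed.
HB.instance Definition _ := GRing.isSubmodClosed.Build R cycles boundary
  boundary_submod_closed.

Definition homology := Quotient.quot boundary.
HB.instance Definition _ := ZmodQuotient.on homology.

Definition homology_scale (a : R) (x : homology) : homology :=
  \pi_homology (a *: repr x).

Lemma homology_scale_pi a (z : cycles) :
  homology_scale a (\pi_homology z) = \pi_homology (a *: z).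
Proof.
apply/eqP; rewrite /homology_scale -Quotient.idealrBE -scalerBr rpredZ //.
by rewrite Quotient.idealrBE reprK.
Qed.

Lemma homology_scaleA a b x :
  homology_scale a (homology_scale b x) = homology_scale (a * b) x.
Proof.
by rewrite -[x]reprK (homology_scale_pi b (repr x)) !homology_scale_pi scalerA.
Qed.

Lemma homology_scale1 : left_id 1 homology_scale.
Proof. by move=> x; rewrite -[x]reprK homology_scale_pi scale1r. Qed.

Lemma homology_scaleDr : right_distributive homology_scale +%R.
Proof.
move=> a x y; rewrite -[x]reprK -[y]reprK.
have piD u v : \pi_homology (u + v) = \pi_homology u + \pi_homology v.
  exact: raddfD.
by rewrite -piD (homology_scale_pi a (repr x + repr y)) scalerDr piD
  (homology_scale_pi a (repr x)) (homology_scale_pi a (repr y)).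
Qed.

Lemma homology_scaleDl x : {morph homology_scale^~ x : a b / a + b}.
Proof.
have piD u v : \pi_homology (u + v) = \pi_homology u + \pi_homology v.
  exact: raddfD.
by move=> a b; rewrite -[x]reprK !(homology_scale_pi _ (repr x)) scalerDl piD.
Qed.

HB.instance Definition _ := GRing.Zmodule_isLmodule.Build R homology
  homology_scaleA homology_scale1 homology_scaleDr homology_scaleDl.

End Homology.

Section Modules.
Variable R : comNzRingType.
Implicit Types M N E : lmodType R.

Definition finitely_generated M :=
  exists n (x : 'I_n -> M), forall y, exists c : 'I_n -> R,
    y = \sum_(i < n) c i *: x i.

Definition annihilator M : R -> Prop := fun a => forall x : M, a *: x = 0.

Definition projective M :=
  forall (U V : lmodType R) (p : {linear U -> V}) (f : {linear M -> V}),
    (forall v, exists u, p u = v) ->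
    exists g : {linear M -> U}, forall x, p (g x) = f x.

Record proj_resolution M := ProjResolution {
  pr_obj :> nat -> lmodType R;
  pr_d : forall i, {linear pr_obj i.+1 -> pr_obj i};
  pr_aug : {linear pr_obj 0 -> M};
  pr_proj : forall i, projective (pr_obj i);
  pr_aug_surj : forall y, exists x, pr_aug x = y;
  pr_exact0 : forall x, pr_aug x = 0 <-> exists y, pr_d 0 y = x;
  pr_exact : forall i x, pr_d i x = 0 <-> exists y, pr_d i.+1 y = x
}.

Definition pdim_le M n :=
  exists P : proj_resolution M, forall i, (n < i)%N -> forall x : P i, x = 0.

Definition pdim_eq M n :=
  pdim_le M n /\ forall m, pdim_le M m -> (n <= m)%N.

Section Ext.
Variables (M N : lmodType R) (P : proj_resolution M).

Definition cocycle i (f : {linear P i -> N}) :=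
  forall x, f (pr_d P i x) = 0.

Definition coboundary i : {linear P i -> N} -> Prop :=
  match i with
  | 0 => fun f => forall x, f x = 0
  | j.+1 => fun f => exists h : {linear P j -> N},
                       forall x, f x = h (pr_d P j x)
  end.
End Ext.

(* E is isomorphic to Ext^i(M, N), the i-th cohomology of Hom(P, N) for a
   projective resolution P of M; the isomorphism is given as a surjection
   theta from the cocycles onto E whose kernel consists of the coboundaries. *)
Definition is_Ext i M N E :=
  exists (P : proj_resolution M) (theta : {linear P i -> N} -> E),
  [/\ forall (a : R) (f f' f'' : {linear P i -> N}),
        cocycle f -> cocycle f' -> (forall x, f'' x = a *: f x + f' x) ->
        theta f'' = a *: theta f + theta f',
      forall z, exists2 f, cocycle f & theta f = z
    & forall f, cocycle f -> (theta f = 0 <-> coboundary f)].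

Definition in_seq_mul (xs : seq R) M (y : M) :=
  exists z : 'I_(size xs) -> M, y = \sum_(i < size xs) xs`_i *: z i.

Definition regular_seq (xs : seq R) M :=
  (forall i, (i < size xs)%N -> forall y : M,
     in_seq_mul (take i xs) (xs`_i *: y) -> in_seq_mul (take i xs) y)
  /\ exists y : M, ~ in_seq_mul xs y.

(* The maximal length of an M-regular sequence in the ideal I. *)
Definition grade_eq (I : R -> Prop) M n :=
  (exists xs, [/\ size xs = n, forall x, x \in xs -> I x & regular_seq xs M])
  /\ forall xs, (forall x, x \in xs -> I x) -> regular_seq xs M ->
       (size xs <= n)%N.

Definition perfect M :=
  finitely_generated M /\
  exists n, pdim_eq M n /\ grade_eq (annihilator M) R^o n.

(* prime_chain I: chains of n + 1 primes containing I; krull_dim_eq I: the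
   Krull dimension of R / I. *)
Definition prime_chain (I : R -> Prop) n (p : 'I_n.+1 -> prime_idealr R) :=
  (forall i x, I x -> x \in p i) /\
  forall i j : 'I_n.+1, (i < j)%N ->
    {subset p i <= p j} /\ exists2 x, x \in p j & x \notin p i.

Definition krull_dim_eq (I : R -> Prop) n :=
  (exists p, @prime_chain I n p) /\
  forall m p, @prime_chain I m p -> (m <= n)%N.

Definition is_maximal (m : idealr R) :=
  forall J : idealr R, {subset m <= J} -> {subset J <= m}.

End Modules.

(* For a Noetherian local ring (S, m): depth M = dim M = dim S. *)
Definition local_maxCM (S : comNzRingType) (m : idealr S) (M : lmodType S) :=
  exists n, [/\ grade_eq (fun x => x \in m) M n,
                krull_dim_eq (annihilator M) n
              & krull_dim_eq (fun x : S => x = 0) n].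

Section Localization.
Variables (R : comNzRingType) (m : idealr R).

Definition is_ring_localization (S : comNzRingType) (phi : {rmorphism R -> S}) :=
  [/\ forall s, s \notin m -> exists t, phi s * t = 1,
      forall z, exists a s, s \notin m /\ phi s * z = phi a
    & forall a, phi a = 0 -> exists2 s, s \notin m & s * a = 0].

Definition is_module_localization (S : comNzRingType) (phi : {rmorphism R -> S})
    (M : lmodType R) (M' : lmodType S) (h : {additive M -> M'}) :=
  [/\ forall a x, h (a *: x) = phi a *: h x,
      forall z, exists s x, s \notin m /\ phi s *: z = h x
    & forall x, h x = 0 -> exists2 s, s \notin m & s *: x = 0].
End Localization.

(* Over a Noetherian ring that need not be local, a maximal Cohen-Macaulay
   module is one whose localization at every maximal ideal m is maximal
   Cohen-Macaulay over R_m.  Here S = R_m, with maximal ideal n. *)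
Definition maxCM (R : comNzRingType) (M : lmodType R) :=
  finitely_generated M /\
  forall m : idealr R, is_maximal m ->
  exists (S : comNzRingType) (n : idealr S) (phi : {rmorphism R -> S})
         (M' : lmodType S) (h : {additive M -> M'}),
    [/\ is_ring_localization m phi,
        is_module_localization m phi h,
        is_maximal n
      & local_maxCM n M'].

(* The A-module M is, through A -> A / J, a maximal Cohen-Macaulay
   A / J-module.  This includes J M = 0. *)
Definition maxCM_quotient (A : comNzRingType) (J : A -> Prop)
    (M : lmodType A) :=
  exists I : idealr A, (forall a, a \in I <-> J a) /\
  exists (M' : lmodType (Quotient.quot I)) (h : {additive M -> M'}),
    [/\ bijective h,
        forall a x, h (a *: x) = \pi_(Quotient.quot I) a *: h x
      & maxCM M'].

Section Representations.
Variables (K : fieldType) (g : nat).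

(* A rational representation of GL_g(K) on 'cV[K]_gl_dim; the values of gl_mx
   outside unitmx are irrelevant. *)
Record GLrep := GLRep {
  gl_dim : nat;
  gl_mx : 'M[K]_g -> 'M[K]_gl_dim;
  gl_mx1 : gl_mx 1%:M = 1%:M;
  gl_mxM : {in unitmx &, forall x y, gl_mx (x *m y) = gl_mx x *m gl_mx y};
  gl_rational : exists r (q : 'I_gl_dim -> 'I_gl_dim -> {mpoly K[g * g]}),
    {in unitmx, forall x i j,
       gl_mx x i j = (q i j).@[fun t => mxvec x 0 t] / \det x ^+ r}
}.

Definition gl_irreducible (V : GLrep) :=
  (0 < gl_dim V)%N /\
  forall U : {vspace 'cV[K]_(gl_dim V)},
    {in unitmx, forall x v, v \in U -> gl_mx V x *m v \in U} ->
    U = 0%VS \/ U = fullv.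

Definition upper_unitriangular (x : 'M[K]_g) :=
  forall i j : 'I_g, (j <= i)%N -> x i j = (i == j)%:R.

Definition has_highest_weight (V : GLrep) (lambda : seq int) :=
  exists v : 'cV[K]_(gl_dim V),
  [/\ v != 0,
      forall x, upper_unitriangular x -> gl_mx V x *m v = v
    & forall t : 'rV[K]_g, (forall i, t 0 i != 0) ->
        gl_mx V (diag_mx t) *m v = (\prod_(i < g) t 0 i ^ lambda`_i) *: v].

(* V is S_lambda W for W = 'cV[K]_g. *)
Definition is_Schur (lambda : seq int) (V : GLrep) :=
  gl_irreducible V /\ has_highest_weight V lambda.

End Representations.

Definition dominant (n : nat) (lambda : seq int) :=
  (size lambda == n) && sorted (fun x y => y <= x) lambda.

(* Basis e_I of the m-th exterior power of an n-dimensional space, for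
   I = {i_1 < ... < i_m}; e_I is the wedge of the e_i in increasing order. *)
Definition ext (n m : nat) := {I : {set 'I_n} | #|I| == m}.

(* The same for an integer degree: there is no basis vector, so that the
   exterior power is 0, unless 0 <= m <= n. *)
Definition extz (n : nat) (m : int) := {I : {set 'I_n} | #|I|%:Z == m}.

Definition ext_nth n m (I : ext n m) (i : 'I_m) : 'I_n :=
  enum_val (cast_ord (esym (eqP (valP I))) i).

(* Matrix entries of the m-th exterior power of the linear map x. *)
Definition minor (R : comNzRingType) n n' m (x : 'M[R]_(n, n'))
    (I : ext n m) (J : ext n' m) : R :=
  \det (mxsub (ext_nth I) (ext_nth J) x).

(* The module action of e_L^* on e_I, for which e_l^* acts as the
   antiderivation extending evaluation, is contract_sign L I * e_(I \ L) if L
   is contained in I, and 0 otherwise. *)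
Definition contract_sign (R : comNzRingType) n (L I : {set 'I_n}) : R :=
  (-1) ^+ (\sum_(l in L) #|[set i in I | (i < l)%N]|).

Section Pieri.
Variables (K : fieldType) (g N : nat) (V V' : GLrep K g).

(* A linear map V -> (exterior power N of W) (x) V', W = 'cV[K]_g, given by
   its components V -> V' along the basis of the exterior power. *)
Definition ext_tensor_map := ext g N -> 'M[K]_(gl_dim V', gl_dim V).

Definition is_Pieri (P : ext_tensor_map) :=
  (exists L, P L != 0) /\
  {in unitmx, forall x L, P L *m gl_mx V x =
     \sum_(L' : ext g N) minor x L L' *: (gl_mx V' x *m P L')}.
End Pieri.

Section Weights.
Variable g : nat.

Definition nu_prime (nu : seq int) (k : int) : nat := count (>= k) nu.

Definition p_weight (nu : seq int) (k : int) : seq int :=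
  let i := nu_prime nu k in take i nu ++ k :: [seq x + 1 | x <- drop i nu].

Definition N_degree (nu : seq int) (k : int) : int :=
  g%:Z - 1 - (nu_prime nu k)%:Z + k.

Definition N_step (nu : seq int) (k : int) : nat :=
  (1 + nu_prime nu (k - 1) - nu_prime nu k)%N.
End Weights.

Section Complex.
Variables (K : fieldType) (f g : nat).

(* F = K^f has basis e_i and G = K^g has basis b_j, whose dual basis c_j
   identifies the dual of G with 'cV[K]_g; GL(G) acts on the latter through
   the contragredient isomorphism from GL(G) to GL_g.  Sym(F (x) G^* ) is the
   polynomial ring whose variable of index mxvec_index i j is e_i (x) c_j. *)
Definition symA : comNzRingType := {mpoly K[f * g]}.

(* psi (e_i) = \sum_j psi i j *: b_j, so that the dual map is
   c_j |-> \sum_i psi i j *: e_i^*. *)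
Definition psi : 'M[symA]_(f, g) :=
  \matrix_(i, j) ('X_(mxvec_index i j) : {mpoly K[f * g]}).

(* The selections s of g rows that are not increasing only add 0 and the
   opposites of g x g minors to the generators. *)
Definition minors_ideal (a : symA) : Prop :=
  exists c : {ffun 'I_g -> 'I_f} -> symA,
    a = \sum_s c s * \det (rowsub s psi).

Variable S : seq int -> GLrep K g.

Definition Pieri_family := forall (nu : seq int) (k : int),
  ext_tensor_map (N_step nu k) (S (p_weight nu k)) (S (p_weight nu (k - 1))).

Variables (P : Pieri_family) (nu : seq int).

Local Notation s k := 'I_(gl_dim (S (p_weight nu k))).
Local Notation N k := (N_degree g nu k).

(* The free module on a finite basis is the module of functions on it. *)
Definition t_obj (k : int) : lmodType symA := {ffun extz f (N k) * s k -> symA^o}.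

Section Differential.
Variable k : int.
Local Notation n := (N_step nu k).

Definition t_Pieri (x : t_obj k) :
    {ffun extz f (N k) * ext g n * s (k - 1) -> symA^o} :=
  [ffun u : extz f (N k) * ext g n * s (k - 1) => let: (D, L, b) := u in
     \sum_(a : s k) ((P L b a)%:MP : {mpoly K[f * g]}) * x (D, a)].

Definition t_psi_dual
    (x : {ffun extz f (N k) * ext g n * s (k - 1) -> symA^o}) :
    {ffun extz f (N k) * ext f n * s (k - 1) -> symA^o} :=
  [ffun u : extz f (N k) * ext f n * s (k - 1) => let: (D, L, b) := u in
     \sum_(L' : ext g n) minor psi L L' * x (D, L', b)].

Definition t_contract
    (x : {ffun extz f (N k) * ext f n * s (k - 1) -> symA^o}) : t_obj (k - 1) :=
  [ffun u : extz f (N (k - 1)) * s (k - 1) => let: (E, b) := u in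
     \sum_(D : extz f (N k)) \sum_(L : ext f n
         | (val L \subset val D) && (val D :\: val L == val E))
       contract_sign symA (val L) (val D) * x (D, L, b)].

Definition t_map (x : t_obj k) : t_obj (k - 1) :=
  t_contract (t_psi_dual (t_Pieri x)).

Lemma t_map_linear : linear t_map.
Proof.
have linP : linear t_Pieri.
  move=> c x y; apply/ffunP=> -[[D L] b]; rewrite !ffunE.
  rewrite scaler_sumr -big_split; apply: eq_bigr => a _.
  by rewrite !ffunE mulrDr; congr (_ + _); apply: mulrCA.
have linpsi : linear t_psi_dual.
  move=> c x y; apply/ffunP=> -[[D L] b]; rewrite !ffunE.
  rewrite scaler_sumr -big_split; apply: eq_bigr => L' _.
  by rewrite !ffunE mulrDr; congr (_ + _); apply: mulrCA.
have lincon : linear t_contract.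
  move=> c x y; apply/ffunP=> -[E b]; rewrite !ffunE.
  rewrite scaler_sumr -big_split; apply: eq_bigr => D _.
  rewrite scaler_sumr -big_split; apply: eq_bigr => L _.
  by rewrite !ffunE mulrDr; congr (_ + _); apply: mulrCA.
by move=> c x y; rewrite /t_map linP linpsi lincon.
Qed.
HB.instance Definition _ := GRing.isLinear.Build symA (t_obj k) (t_obj (k - 1))
  *:%R t_map t_map_linear.

End Differential.

Definition t_H0 : lmodType symA :=
  homology (t_map (k := 1) : {linear t_obj 1 -> t_obj 0}) (t_map (k := 0)).

End Complex.

(* Main.v *)
Require Import Defs.
From HB Require Import structures.
From mathcomp Require Import all_boot all_order all_algebra.
From mathcomp Require Import fingroup perm generic_quotient ring_quotient boolp mpoly zify ring.
From mathcomp Require classical_sets freeg.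

Set Implicit Arguments.
Unset Strict Implicit.
Unset Printing Implicit Defensive.

Import Order.TTheory GRing.Theory Num.Theory.
Local Open Scope ring_scope.

(** The contractions J_j = sum_i psi_ij iota_i of the exterior algebra of F by the images under
    psi^* of the basis of G^* anticommute, and the differential of t_nu is sum_L P_L J_L with
    constant Pieri coefficients P_L ([dP], [t_map_res]). The same formula makes sense for every
    anticommuting family, and the proof compares three of them: the generic psi, the identity of G
    ([dF]), and the split surjection (psi, 1) from F + G to G ([itot]).

    For the identity, the formula gives a complex of gl_g-modules, the exterior algebra of G
    tensored with the irreducible modules of highest weight p(nu;k). Such a tensor product is
    multiplicity free, its highest weights being lambda - 1_J, so products and exactness of
    differentials can be tested on single highest weight vectors. A product of two differentials
    would have to lower some coordinate of the weight twice ([d_d]); a highest weight vector whose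
    type J contains the first index of the block moved by the differential survives ([d_hw_ne0]);
    the other ones are boundaries ([d_exact]). The group representations enter through their
    derivatives ([is_Schur_hwm], [pext_equi]).

    For (psi, 1), exactness follows by perturbation, because its contractions differ from those of
    the identity by terms lowering the degree in F ([tot_exact]). For a set L of g rows, the
    iterated commutators of multiplication by e_L with the J_j assemble into a map from the exterior
    algebra of F + G back to that of F which commutes with the contractions and is, up to sign,
    multiplication by the minor of L on the exterior algebra of F ([collapse_itot],
    [collapse_incl]). Hence each maximal minor kills the homology of t_nu, even modulo an arbitrary
    sequence of ring elements ([minor_homotopy]).

    The bounds on nu confine t_nu to the positions 0, ..., e+1. The e+1 minors on consecutive rows
    form a regular sequence: after a change of coordinates their leading monomials are powers of
    distinct variables ([lead_delta], [wreg_lead]). An acyclicity argument ([acyclic_mod]) turns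
    this into exactness, so t_nu is a free resolution of H_0 of length e+1, and the minors
    annihilate H_0. Since a regular sequence in the annihilator of a nonzero module is no longer
    than a projective resolution ([projdim_grade]), both invariants equal e+1 and H_0 is perfect.

    That H_0 is nonzero, even at every point of the locus of rank less than g, is seen by
    specialization: such a matrix factors as YZ with the last column of Y equal to 0, and for such Y
    an explicit functional kills the boundaries but not the whole of t_{nu;0} ([phi_dK],
    [annihilator_in_maximal]).

    Together with the minors these form a regular sequence, hence they are regular on H_0
    ([wreg_t_H0]). A regular sequence produces a chain of primes above the annihilator
    ([regular_prime_chain]), and counting monomials bounds every chain of primes above the minors by
    fg - e - 1 ([chain_bound]). So depth and both dimensions coincide locally.

    For Ext, the module of weight p(mu;j) is the dual of that of weight p(nu;k) twisted by the power
    e+1 of the determinant when j + k = e + 1. Uniqueness of Pieri maps makes these isomorphisms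
    compatible with the differentials up to scalars ([Pieri_dual]), and the wedge pairing on F then
    identifies the end of the dual of t_nu with the beginning of t_mu ([t_H0_Ext]). *)

Lemma disjoint_setU1l (T : finType) (a : T) (A B : {set T}) :
  [disjoint a |: A & B] = (a \notin B) && [disjoint A & B].
Proof. by rewrite !disjoints_subset subUset sub1set inE. Qed.

Lemma disjoint_setU1r (T : finType) (a : T) (A B : {set T}) :
  [disjoint A & a |: B] = (a \notin A) && [disjoint A & B].
Proof. by rewrite disjoint_sym disjoint_setU1l disjoint_sym. Qed.

(** * Contraction and exterior multiplication on an exterior algebra *)

Section Fermions.
Variables (R : comNzRingType) (n : nat) (X : lmodType R).
Implicit Types (a b : 'I_n) (I L E : {set 'I_n}) (x : {ffun {set 'I_n} -> X}).

Definition sg a I : R := (-1) ^+ #|[set j in I | (j < a)%N]|.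

Lemma sgK a I : sg a I * sg a I = 1.
Proof. by rewrite /sg -exprD addnn -mul2n exprM sqrrN !expr1n. Qed.

Lemma card_ltU1 a b I : b \notin I ->
  #|[set j in b |: I | (j < a)%N]| = ((b < a)%N + #|[set j in I | (j < a)%N]|)%N.
Proof.
move=> bI; have [ba|ba] := boolP (b < a)%N.
  have -> : [set j in b |: I | (j < a)%N] = b |: [set j in I | (j < a)%N].
    by apply/setP=> j; rewrite !inE; case: eqP => [->|] //=; rewrite ba.
  by rewrite cardsU1 inE (negbTE bI).
rewrite add0n; apply: eq_card => j; rewrite !inE.
by case: eqP => [->|] //=; rewrite (negbTE ba) (negbTE bI).
Qed.

Lemma sgU1 a b I : b \notin I -> sg a (b |: I) = (-1) ^+ (b < a)%N * sg a I.
Proof. by move=> bI; rewrite /sg card_ltU1 // exprD. Qed.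

Lemma sgU1_eq a I : sg a (a |: I) = sg a I.
Proof.
have [aI|aI] := boolP (a \in I); first by rewrite (setUidPr _) // sub1set.
by rewrite sgU1 // ltnn mul1r.
Qed.

Lemma sgD1_eq a I : sg a (I :\ a) = sg a I.
Proof.
have [aI|aI] := boolP (a \in I); first by rewrite -[in RHS](setD1K aI) sgU1_eq.
by congr sg; apply/setP=> j; rewrite !inE; case: eqP => [->|] //; rewrite (negbTE aI).
Qed.

Lemma sgD1 a b I : a \in I -> sg b (I :\ a) = (-1) ^+ (a < b)%N * sg b I.
Proof.
move=> aI; rewrite -{2}(setD1K aI) sgU1 ?inE ?eqxx // mulrA -exprD addnn -mul2n.
by rewrite exprM sqrrN !expr1n mul1r.
Qed.

(** An element of the exterior algebra with coefficients in X is encoded as a function on subsets,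
    the value at I being the coefficient of e_I. In these coordinates [iota a] is contraction by the
    a-th dual basis vector and [eps a] is left multiplication by e_a. *)
Definition iota a x : {ffun {set 'I_n} -> X} :=
  [ffun I : {set 'I_n} => if a \in I then 0 else sg a I *: x (a |: I)].

Definition eps a x : {ffun {set 'I_n} -> X} :=
  [ffun I : {set 'I_n} => if a \in I then sg a I *: x (I :\ a) else 0].

Lemma iota_linear a : linear (iota a).
Proof.
move=> c x y; apply/ffunP=> I; rewrite !ffunE; case: ifP => _.
  by rewrite scaler0 addr0.
by rewrite scalerDr !scalerA mulrC.
Qed.
HB.instance Definition _ a := GRing.isLinear.Build R _ _ _ (iota a) (iota_linear a).

Lemma eps_linear a : linear (eps a).
Proof.
move=> c x y; apply/ffunP=> I; rewrite !ffunE; case: ifP => _.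
  by rewrite scalerDr !scalerA mulrC.
by rewrite scaler0 addr0.
Qed.
HB.instance Definition _ a := GRing.isLinear.Build R _ _ _ (eps a) (eps_linear a).

Lemma iota_sqr a x : iota a (iota a x) = 0.
Proof.
by apply/ffunP=> I; rewrite !ffunE; case: ifP => // _; rewrite setU11 scaler0.
Qed.

Lemma eps_sqr a x : eps a (eps a x) = 0.
Proof.
by apply/ffunP=> I; rewrite !ffunE; case: ifP => // _; rewrite !inE eqxx scaler0.
Qed.

Lemma sg_swap a b : a != b -> (-1) ^+ (b < a)%N = - (-1) ^+ (a < b)%N :> R.
Proof.
move=> ab; case: (ltngtP a b) => [_|_|/val_inj e].
- by rewrite expr0 expr1 opprK.
- by rewrite expr0 expr1.
- by rewrite e eqxx in ab.
Qed.

Lemma iotaC a b x : iota a (iota b x) = - iota b (iota a x).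
Proof.
have [->|ab] := eqVneq a b; first by rewrite iota_sqr oppr0.
apply/ffunP=> I; rewrite !ffunE !inE (negbTE ab) eq_sym (negbTE ab) /=.
case: ifP => aI; case: ifP => bI; rewrite ?scaler0 ?oppr0 //.
rewrite !scalerA setUCA -scaleNr; congr (_ *: _).
rewrite !sgU1 ?aI ?bI // (sg_swap ab); ring.
Qed.

Lemma epsC a b x : eps a (eps b x) = - eps b (eps a x).
Proof.
have [->|ab] := eqVneq a b; first by rewrite eps_sqr oppr0.
apply/ffunP=> I; rewrite !ffunE !inE (negbTE ab) eq_sym (negbTE ab) /=.
case: ifP => aI; case: ifP => bI; rewrite ?scaler0 ?oppr0 //.
have -> : I :\ b :\ a = I :\ a :\ b by apply/setP=> j; rewrite !inE andbCA.
by rewrite !scalerA -scaleNr; congr (_ *: _); rewrite !sgD1 // (sg_swap ab); ring.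
Qed.

Lemma iota_eps a b x :
  iota a (eps b x) = (a == b)%:R *: x - eps b (iota a x).
Proof.
apply/ffunP=> I; rewrite !ffunE !inE.
have [->|ab] := eqVneq a b.
  rewrite /= scale1r; case: ifP => bI.
    by rewrite sgD1_eq setD1K // scalerA sgK scale1r subrr.
  rewrite subr0 scalerA sgU1_eq sgK scale1r.
  congr (x _); apply/setP=> j; rewrite !inE.
  by case: eqP => // ->; rewrite bI.
rewrite /= scale0r sub0r.
case: ifP => aI; case: ifP => bI; rewrite ?scaler0 ?oppr0 ?aI //=.
rewrite !scalerA -scaleNr.
have -> : (a |: I) :\ b = a |: I :\ b.
  by apply/setP=> j; rewrite !inE; case: (eqVneq j a) => [->|] //=; rewrite ab.
congr (_ *: _); rewrite sgU1 ?aI // sgD1 // (sg_swap ab); ring.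
Qed.

(** Contraction by the dual of e_L with the sign used in the differential of t_nu. [comps_iota]
    identifies it with the product of the [iota l], the smallest index being applied last. *)
Definition iotaS L x : {ffun {set 'I_n} -> X} :=
  [ffun E : {set 'I_n} => if [disjoint L & E] then contract_sign R L (L :|: E) *: x (L :|: E)
             else 0].

Lemma iotaS_linear L : linear (iotaS L).
Proof.
move=> c x y; apply/ffunP=> I; rewrite !ffunE; case: ifP => _.
  by rewrite scalerDr !scalerA mulrC.
by rewrite scaler0 addr0.
Qed.
HB.instance Definition _ L := GRing.isLinear.Build R _ _ _ (iotaS L) (iotaS_linear L).

Lemma iotaS0 x : iotaS set0 x = x.
Proof.
apply/ffunP=> I; rewrite !ffunE disjoints_subset sub0set set0U.
by rewrite /contract_sign big_set0 scale1r.
Qed.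

Lemma iota_iotaS l L x : l \notin L -> iota l (iotaS L x) = sg l L *: iotaS (l |: L) x.
Proof.
move=> lL; apply/ffunP=> E; rewrite !ffunE.
rewrite disjoint_setU1r disjoint_setU1l lL /=.
case: ifP => lE; first by rewrite scaler0.
case: ifP => LE; last by rewrite !scaler0.
have -> : L :|: (l |: E) = l |: L :|: E by rewrite setUCA setUA.
rewrite !scalerA; congr (_ *: _).
rewrite /contract_sign big_setU1 //= exprD mulrA; congr (_ * _).
set D := _ :|: E.
have -> : #|[set i in D | (i < l)%N]| =
   (#|[set i in L | (i < l)%N]| + #|[set i in E | (i < l)%N]|)%N.
  rewrite -cardsUI -[LHS]addn0; congr (_ + _)%N; last first.
    symmetry; apply/eqP; rewrite cards_eq0 -subset0; apply/subsetP=> j.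
    rewrite !inE => /andP[/andP[jL _] /andP[jE _]].
    by rewrite (disjointFr LE jL) in jE.
  apply: eq_card => j; rewrite !inE.
  by case: (eqVneq j l) => [->|_] /=; rewrite ?ltnn ?andbF // -andb_orl.
rewrite exprD /sg mulrA -exprD addnn -mul2n exprM sqrrN !expr1n mul1r //.
Qed.

Lemma iota_iotaS0 l L x : l \in L -> iota l (iotaS L x) = 0.
Proof.
move=> lL; apply/ffunP=> E; rewrite !ffunE; case: ifP => // lE.
case: ifP => LE; last by rewrite scaler0.
by have := disjointFr LE lL; rewrite setU11.
Qed.

End Fermions.

(** * Increasing enumeration of subsets *)

Section SetEnum.
Variable n : nat.
Implicit Types (I L : {set 'I_n}).

Lemma enum_set_sorted L : sorted (fun i j : 'I_n => (i < j)%N) (enum L).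
Proof.
rewrite /enum_mem -enumT; apply: sorted_filter => [y x z /=|]; first exact: ltn_trans.
by have := iota_ltn_sorted 0 n; rewrite -val_enum_ord sorted_map.
Qed.

Lemma enum_setU1_min (a : 'I_n) L : (forall j, j \in L -> (a < j)%N) ->
  enum (a |: L) = a :: enum L.
Proof.
move=> aL; have aNL : a \notin L by apply/negP => /aL; rewrite ltnn.
apply: (@irr_sorted_eq _ (fun i j : 'I_n => (i < j)%N)).
- by move=> y x z /=; apply: ltn_trans.
- by move=> x; rewrite /= ltnn.
- exact: enum_set_sorted.
- rewrite /= path_min_sorted ?enum_set_sorted //.
  by apply/allP=> j; rewrite mem_enum => /aL.
- by move=> j; rewrite mem_enum !inE mem_enum.
Qed.

(** Adjoining a new minimum puts one more letter in front of the increasing enumeration, so this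
    induction follows the recursion of [foldr] in [comps] and produces no sign. *)
Lemma set_min_ind (P : {set 'I_n} -> Prop) : P set0 ->
  (forall (a : 'I_n) L, (forall j, j \in L -> (a < j)%N) -> P L -> P (a |: L)) ->
  forall L, P L.
Proof.
move=> P0 PS L; have [m] := ubnP #|L|; elim: m L => // m IH L.
have [->|/set0Pn[x xL]] := eqVneq L set0; first by [].
case: (arg_minnP (fun j : 'I_n => j : nat) xL) => a aL amin Lm.
have {}aL : a \in L by []. rewrite -(setD1K aL); apply: PS => [j|].
  rewrite !inE => /andP[ja jL]; rewrite ltn_neqAle amin // andbT.
  by apply: contraNneq ja => /val_inj ->.
by apply: IH; move: Lm; rewrite (cardsD1 a L) aL.
Qed.

Lemma ext_nth_nth m (I : ext n m) (k : 'I_m) x0 :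
  ext_nth I k = nth x0 (enum (val I)) k.
Proof. by rewrite /ext_nth (enum_val_nth x0). Qed.

Lemma ext_nth_in m (I : ext n m) (k : 'I_m) : ext_nth I k \in val I.
Proof. exact: enum_valP. Qed.

Lemma size_enum_ext m (I : ext n m) : size (enum (val I)) = m.
Proof. by rewrite -cardE (eqP (valP I)). Qed.

Lemma ext_nth_lt m (I : ext n m) (k k' : 'I_m) :
  (ext_nth I k < ext_nth I k')%N = (k < k')%N.
Proof.
have H : forall a b : 'I_m, (a < b)%N -> (ext_nth I a < ext_nth I b)%N.
  move=> a b ab; have [x0 _] : exists x0 : 'I_n, True by exists (ext_nth I a).
  rewrite (ext_nth_nth I a x0) (ext_nth_nth I b x0).
  apply: (sorted_ltn_nth (leT := fun i j : 'I_n => (i < j)%N)) => //.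
  - by move=> y x z /=; apply: ltn_trans.
  - exact: enum_set_sorted.
  - by rewrite inE size_enum_ext.
  - by rewrite inE size_enum_ext.
case: (ltngtP k k') => [/H -> //|/H|/val_inj ->]; last by rewrite ltnn.
by move=> h; apply/negbTE; rewrite -leqNgt ltnW.
Qed.

Lemma ext_nth_inj m (I : ext n m) : injective (ext_nth I).
Proof.
move=> k k' e; apply: val_inj => /=; have h := ext_nth_lt I k k'; have h' := ext_nth_lt I k' k.
by rewrite e ltnn in h h'; lia.
Qed.

Lemma ext_nth_surj m (I : ext n m) i : i \in val I -> exists k, i = ext_nth I k.
Proof.
move=> iI; exists (cast_ord (eqP (valP I)) (enum_rank_in iI i)).
by rewrite /ext_nth cast_ordK enum_rankK_in.
Qed.

Lemma card_lt_ext_nth m (I : ext n m) (k : 'I_m) :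
  #|[set j in val I | (j < ext_nth I k)%N]| = k.
Proof.
have -> : [set j in val I | (j < ext_nth I k)%N] = ext_nth I @: [set k' : 'I_m | (k' < k)%N].
  apply/setP=> j; rewrite inE; apply/andP/imsetP => [[/ext_nth_surj[k' ->]]|[k']].
    by rewrite ext_nth_lt => kk; exists k'; rewrite ?inE.
  by rewrite inE => kk ->; rewrite ext_nth_in ext_nth_lt.
rewrite card_imset; last exact: ext_nth_inj.
rewrite cardsE -sum1_card (eq_bigl (fun k' : 'I_m => (k' < k)%N)) //.
by rewrite (big_ord_narrow (ltnW (ltn_ord k))) sum1_card card_ord.
Qed.

Lemma big_ext_nth (V : nmodType) m (I : ext n m) (F : 'I_n -> V) :
  \sum_(i in val I) F i = \sum_(k < m) F (ext_nth I k).
Proof.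
rewrite big_enum_val (reindex (cast_ord (esym (eqP (valP I))))) //=.
by apply: onW_bij; exists (cast_ord (eqP (valP I))); [apply: cast_ordKV|apply: cast_ordK].
Qed.

Lemma ext_del_subproof m (I : ext n m.+1) (k : 'I_m.+1) :
  #|val I :\ ext_nth I k| == m.
Proof.
by have /eqP := valP I; rewrite (cardsD1 (ext_nth I k)) ext_nth_in add1n => -[] /eqP.
Qed.
Definition ext_del m (I : ext n m.+1) (k : 'I_m.+1) : ext n m :=
  exist _ (val I :\ ext_nth I k) (ext_del_subproof I k).

Lemma ext_nth_del m (I : ext n m.+1) (k : 'I_m.+1) (j : 'I_m) :
  ext_nth (ext_del I k) j = ext_nth I (lift k j).
Proof.
have [x0 x0E] : exists x0, x0 = ext_nth I k by exists (ext_nth I k).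
rewrite (ext_nth_nth _ j x0) (ext_nth_nth I _ x0).
have E : enum (val (ext_del I k)) = rem x0 (enum (val I)).
  apply: (@irr_sorted_eq _ (fun i j : 'I_n => (i < j)%N)).
  - by move=> y x z /=; apply: ltn_trans.
  - by move=> x; rewrite /= ltnn.
  - exact: enum_set_sorted.
  - apply: (subseq_sorted _ (rem_subseq _ _)); last exact: enum_set_sorted.
    by move=> y x z /=; apply: ltn_trans.
  - by move=> i; rewrite mem_enum mem_rem_uniq ?enum_uniq // !inE mem_enum x0E.
have ik : index x0 (enum (val I)) = k.
  by rewrite {1}x0E (ext_nth_nth _ _ x0) index_uniq ?enum_uniq // size_enum_ext.
rewrite E remE ik nth_cat size_take size_enum_ext ltn_ord /= /bump.
case: (leqP k j) => kj; first by rewrite nth_drop; congr (nth _ _ _); lia.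
by rewrite nth_take.
Qed.

End SetEnum.

Lemma sum_alternating (V : zmodType) n (F : 'I_n -> 'I_n -> V) :
  (forall i, F i i = 0) -> (forall i k, F i k = - F k i) ->
  \sum_i \sum_k F i k = 0.
Proof.
move=> F0 FN; rewrite pair_big /=.
rewrite (bigID (fun p : 'I_n * 'I_n => (p.1 < p.2)%N)) /=.
rewrite [X in _ + X](bigID (fun p : 'I_n * 'I_n => (p.2 < p.1)%N)) /=.
rewrite [X in _ + (_ + X)]big1 ?addr0; last first.
  move=> [i k] /= /andP[ik ki]; have -> : i = k by apply: val_inj => /=; lia.
  exact: F0.
rewrite [X in _ + X](reindex (fun p : 'I_n * 'I_n => (p.2, p.1))) /=; last first.
  by apply: onW_bij; exists (fun p : 'I_n * 'I_n => (p.2, p.1)) => -[].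
rewrite [X in _ + X](eq_bigl (fun p : 'I_n * 'I_n => (p.1 < p.2)%N)) /=; last first.
  by move=> [i k] /=; lia.
by rewrite -big_split big1 // => -[i k] _ /=; rewrite [in X in _ + X]FN subrr.
Qed.

(** * Iterated contractions along a matrix, and its minors *)

Section Expansion.
Variables (R : comNzRingType) (f g : nat).
Implicit Types (psi : 'M[R]_(f, g)).

(** Minors indexed by bare sets, with value 0 when a cardinality is not m, so that sums may run over
    all sets. *)
Definition minorS psi m (L : {set 'I_f}) (L' : {set 'I_g}) : R :=
  match (insub L : option (ext f m)), (insub L' : option (ext g m)) with
  | Some I1, Some J1 => minor psi I1 J1
  | _, _ => 0
  end.

Lemma minorS_ext psi m (I : ext f m) (J : ext g m) :
  minorS psi m (val I) (val J) = minor psi I J.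
Proof. by rewrite /minorS !valK. Qed.

Lemma minorS0 psi : minorS psi 0 set0 set0 = 1.
Proof.
rewrite /minorS; case: insubP => [I _ _|]; last by rewrite cards0.
by case: insubP => [J _ _|]; [rewrite /minor det_mx00 | rewrite cards0].
Qed.

Lemma minorS_laplace psi m (L : {set 'I_f}) (a : 'I_g) (L' : {set 'I_g}) :
  #|L| = m.+1 -> #|L'| = m -> (forall j, j \in L' -> (a < j)%N) ->
  minorS psi m.+1 L (a |: L') =
  \sum_(i in L) sg R i L * psi i a * minorS psi m (L :\ i) L'.
Proof.
move=> cL cL' aL'; have aNL : a \notin L' by apply/negP => /aL'; rewrite ltnn.
have pL : #|L| == m.+1 by rewrite cL.
have pL' : #|a |: L'| == m.+1 by rewrite cardsU1 aNL cL'.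
pose I : ext f m.+1 := exist _ L pL; pose J : ext g m.+1 := exist _ (a |: L') pL'.
have J0 : ext_nth J ord0 = a.
  by rewrite (ext_nth_nth _ _ a) /= enum_setU1_min.
have JD : val (ext_del J ord0) = L'.
  by rewrite /= J0 setU1K.
rewrite -[L]/(val I) -[a |: L']/(val J) minorS_ext /minor (expand_det_col _ ord0).
rewrite (big_ext_nth I); apply: eq_bigr => k _; rewrite mxE /cofactor addn0 J0.
have -> : minorS psi m (val I :\ ext_nth I k) L' = minor psi (ext_del I k) (ext_del J ord0).
  by rewrite -minorS_ext JD.
rewrite /minor /sg card_lt_ext_nth mulrCA mulrA; congr (_ * \det _).
by apply/matrixP=> i j; rewrite !mxE !ext_nth_del.
Qed.

Variable X : lmodType R.
Implicit Types (x : {ffun {set 'I_f} -> X}).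

(** Contraction by the image of the j-th basis vector of G^* under the dual of psi. *)
Definition iotam psi (j : 'I_g) x : {ffun {set 'I_f} -> X} :=
  \sum_i psi i j *: iota i x.

Lemma iotam_linear psi j : linear (iotam psi j).
Proof.
move=> c x y; rewrite /iotam scaler_sumr -big_split; apply: eq_bigr => i _.
by rewrite linearP scalerDr !scalerA mulrC.
Qed.
HB.instance Definition _ psi j :=
  GRing.isLinear.Build R _ _ _ (iotam psi j) (iotam_linear psi j).

Lemma iotam_iotam psi a b x : iotam psi a (iotam psi b x) =
  \sum_i \sum_k (psi i a * psi k b) *: iota i (iota k x).
Proof.
rewrite {1}/iotam; apply: eq_bigr => i _; rewrite linear_sum scaler_sumr /=.
by apply: eq_bigr => k _; rewrite linearZ /= scalerA.
Qed.

Lemma iotamC psi a b x : iotam psi a (iotam psi b x) = - iotam psi b (iotam psi a x).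
Proof.
rewrite !iotam_iotam exchange_big -sumrN; apply: eq_bigr => i _.
rewrite -sumrN; apply: eq_bigr => k _.
by rewrite iotaC scalerN mulrC.
Qed.

Lemma iotam_sqr psi a x : iotam psi a (iotam psi a x) = 0.
Proof.
rewrite iotam_iotam; apply: sum_alternating => [i|i k].
  by rewrite iota_sqr scaler0.
by rewrite iotaC scalerN mulrC.
Qed.

End Expansion.

Section Composite.
Variables (R : comNzRingType) (n : nat).

Definition comps (X : Type) (J : 'I_n -> X -> X) (L : {set 'I_n}) (x : X) : X :=
  foldr J x (enum L).

Lemma comps0 X (J : 'I_n -> X -> X) x : comps J set0 x = x.
Proof. by rewrite /comps enum_set0. Qed.

Lemma compsU1 X (J : 'I_n -> X -> X) (a : 'I_n) (L : {set 'I_n}) x : (forall j, j \in L -> (a < j)%N) ->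
  comps J (a |: L) x = J a (comps J L x).
Proof. by move=> aL; rewrite /comps enum_setU1_min. Qed.

Lemma comps_nat X Y (J : 'I_n -> X -> X) (J' : 'I_n -> Y -> Y) (h : X -> Y) L x :
  (forall j y, h (J j y) = J' j (h y)) -> h (comps J L x) = comps J' L (h x).
Proof. by move=> H; rewrite /comps; elim: (enum L) => //= a s E; rewrite H E. Qed.

Lemma comps_iota (X : lmodType R) L (x : {ffun {set 'I_n} -> X}) :
  comps (@iota R n X) L x = iotaS L x.
Proof.
elim/set_min_ind: L => [|a L aL IH]; first by rewrite comps0 iotaS0.
have aNL : a \notin L by apply/negP => /aL; rewrite ltnn.
rewrite compsU1 // IH iota_iotaS // /sg (_ : [set j in L | (j < a)%N] = set0).
  by rewrite cards0 scale1r.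
apply/setP=> j; rewrite !inE; case jL: (j \in L) => //=.
by have := aL _ jL; lia.
Qed.

End Composite.

(** The exterior powers of the dual map act through minors. Adjoining a new minimal index to L'
    amounts to a Laplace expansion of the minors along their first column. *)
Lemma comps_iotam (R : comNzRingType) (f g : nat) (psi : 'M[R]_(f, g))
  (X : lmodType R) m (L' : {set 'I_g}) (x : {ffun {set 'I_f} -> X}) :
  #|L'| = m ->
  comps (@iotam R f g X psi) L' x =
  \sum_(L : {set 'I_f} | #|L| == m) minorS psi m L L' *: iotaS L x.
Proof.
elim/set_min_ind: L' m => [|a L' aL' IH] m.
  rewrite cards0 => <-; rewrite comps0 (big_pred1 set0) ?minorS0 ?scale1r ?iotaS0 //.
  by move=> L /=; rewrite cards_eq0.
have aNL : a \notin L' by apply/negP => /aL'; rewrite ltnn.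
rewrite cardsU1 aNL add1n; case: m => // m [cL'].
rewrite compsU1 // (IH m) // linear_sum /=.
transitivity (\sum_(L1 : {set 'I_f} | #|L1| == m) \sum_(i | i \notin L1)
   (minorS psi m L1 L' * psi i a * sg R i L1) *: iotaS (i |: L1) x).
  apply: eq_bigr => L1 _; rewrite linearZ /= /iotam scaler_sumr.
  rewrite [RHS]big_mkcond /=; apply: eq_bigr => i _.
  case: ifP => iL; last first.
    by rewrite iota_iotaS0 ?scaler0 //; apply: contraFT iL.
  by rewrite iota_iotaS // !scalerA; congr (_ *: _); ring.
rewrite (exchange_big_dep xpredT) //=.
transitivity (\sum_i \sum_(L : {set 'I_f} | (#|L| == m.+1) && (i \in L))
   (sg R i L * psi i a * minorS psi m (L :\ i) L') *: iotaS L x).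
  apply: eq_bigr => i _.
  rewrite (reindex_onto (fun L => L :\ i) (fun L => i |: L)) /=; last first.
    by move=> L1 /andP[_ iL]; rewrite setU1K.
  apply: eq_big => [L|L /andP[_ /eqP E]].
    rewrite !inE eqxx andbT /=.
    have [iL|iL] := boolP (i \in L).
      by rewrite setD1K // eqxx andbT (cardsD1 i L) iL eqSS andbT.
    rewrite andbF; apply/negbTE; apply: contra iL => /andP[_ /eqP <-].
    by rewrite setU11.
  by rewrite E sgD1_eq; congr (_ *: _); ring.
rewrite (exchange_big_dep (fun L : {set 'I_f} => #|L| == m.+1)) /=; last by move=> i L _ /andP[].
apply: eq_bigr => L /eqP cL; rewrite (minorS_laplace _ cL cL' aL') scaler_suml.
by rewrite cL eqxx.
Qed.

Section AntiCommuting.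
Variables (R : comNzRingType) (g : nat) (X : lmodType R) (J : 'I_g -> {linear X -> X}).
Hypothesis JC : forall a b x, J a (J b x) = - J b (J a x).
Hypothesis Jsqr : forall a x, J a (J a x) = 0.

Lemma comps_cons (a : 'I_g) (L : {set 'I_g}) x :
  J a (comps J L x) = if a \in L then 0 else sg R a L *: comps J (a |: L) x.
Proof.
elim/set_min_ind: L a => [|b L bL IH] a.
  rewrite inE compsU1 => [|j]; last by rewrite inE.
  rewrite /sg (_ : [set j in set0 | _] = set0) ?cards0 ?scale1r //.
  by apply/setP=> j; rewrite !inE.
have bNL : b \notin L by apply/negP => /bL; rewrite ltnn.
have [ab|ba|/val_inj ab] := ltngtP a b.
- have aL j : j \in b |: L -> (a < j)%N.
    by rewrite !inE => /orP[/eqP->|/bL] //; apply: ltn_trans.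
  rewrite (_ : (a \in _) = false); last first.
    by apply/negP => /aL; rewrite ltnn.
  rewrite [in RHS]compsU1 // /sg (_ : [set j in b |: L | _] = set0) ?cards0 ?scale1r //.
  apply/setP=> j; rewrite [RHS]inE inE; apply/negP => /andP[/aL aj ja]; lia.
- rewrite compsU1 // JC IH !inE; have -> : (a == b) = false by apply/eqP => E; rewrite E ltnn in ba.
  rewrite /=; case: ifP => aL; first by rewrite linear0 oppr0.
  rewrite linearZ /= setUCA [in RHS]compsU1; last first.
    by move=> j; rewrite !inE => /orP[/eqP->|/bL].
  by rewrite sgU1 ?aL // ba expr1 mulN1r scaleNr.
- by rewrite ab setU11 compsU1 // Jsqr.
Qed.

(** The sign of the shuffle that sorts the elements of L followed by those of L'. *)
Definition sgS (L L' : {set 'I_g}) : R := (-1) ^+ (\sum_(l in L) #|[set j in L' | (j < l)%N]|).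

Lemma comps_comps (L L' : {set 'I_g}) x : comps J L (comps J L' x) =
  if [disjoint L & L'] then sgS L L' *: comps J (L :|: L') x else 0.
Proof.
elim/set_min_ind: L => [|a L aL IH].
  by rewrite disjoints_subset sub0set comps0 set0U /sgS big_set0 scale1r.
have aNL : a \notin L by apply/negP => /aL; rewrite ltnn.
rewrite compsU1 // IH disjoint_setU1l; case: ifP => LL'; last by rewrite andbF linear0.
rewrite linearZ /= comps_cons inE (negbTE aNL) /= andbT.
case: ifP => aL' /=; first by rewrite scaler0.
rewrite scalerA setUA /sgS big_setU1 //= exprD mulrC; congr (_ * _ *: _).
rewrite /sg; congr (_ ^+ _); apply: eq_card => j; rewrite !inE.
by case jL: (j \in L) => //=; have := aL _ jL; case: ltngtP; rewrite ?andbF.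
Qed.
End AntiCommuting.

(** * Iterated graded commutators of multiplication operators with contractions *)

Section Adjoint.
Variables (R : comNzRingType) (f g : nat) (psi : 'M[R]_(f, g)).
Notation X := {ffun {set 'I_f} -> R^o}.
Notation J := (@iotam R f g R^o psi).
Implicit Types (T : X -> X).

(** The graded commutator of T with the contraction [J a]; only the parity of p matters, and p is to
    be read as the degree of T. *)
Definition ad (a : 'I_g) (p : nat) T : X -> X :=
  fun x => J a (T x) - (-1) ^+ p *: T (J a x).

Lemma ad_lin a p T : linear T -> linear (ad a p T).
Proof.
move=> lT c x y; rewrite /ad !linearP lT linearP lT /= scalerDr scalerA mulrC -scalerA.
by rewrite scalerBr opprD addrACA.
Qed.

Lemma lin0 (U V : lmodType R) (T : U -> V) : linear T -> T 0 = 0.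
Proof. by move=> lT; have := lT (-1) 0 0; rewrite scaleN1r addNr scaleN1r addNr. Qed.
Lemma linN (U V : lmodType R) (T : U -> V) x : linear T -> T (- x) = - T x.
Proof. by move=> lT; have := lT (-1) x 0; rewrite (lin0 lT) !addr0 !scaleN1r. Qed.
Lemma linD (U V : lmodType R) (T : U -> V) x y : linear T -> T (x + y) = T x + T y.
Proof. by move=> lT; have := lT 1 x y; rewrite !scale1r. Qed.
Lemma linB (U V : lmodType R) (T : U -> V) x y : linear T -> T (x - y) = T x - T y.
Proof. by move=> lT; rewrite linD // linN. Qed.
Lemma linZ (U V : lmodType R) (T : U -> V) c x : linear T -> T (c *: x) = c *: T x.
Proof. by move=> lT; have := lT c x 0; rewrite (lin0 lT) !addr0. Qed.

Lemma ad_expand a b p T : linear T ->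
  ad a p.+1 (ad b p T) = fun x => J a (J b (T x)) - (-1) ^+ p *: J a (T (J b x))
    + (-1) ^+ p *: J b (T (J a x)) - T (J b (J a x)).
Proof.
move=> lT; apply: funext => x; rewrite /ad linearB linearZ /=.
rewrite exprS mulN1r scaleNr opprK scalerBr scalerA -exprD addnn -mul2n exprM sqrrN !expr1n scale1r.
by rewrite addrA.
Qed.

Lemma adC a b p T : linear T -> ad a p.+1 (ad b p T) = fun x => - ad b p.+1 (ad a p T) x.
Proof.
move=> lT; rewrite !ad_expand //; apply: funext => x.
have -> : T (J b (J a x)) = - T (J a (J b x)) by rewrite iotamC (linN _ lT).
rewrite (iotamC psi a b (T x)); move: (J b (J a (T x))) (_ *: J a (T (J b x))) => P Q.
move: (_ *: J b (T (J a x))) (T (J a (J b x))) => S U.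
by rewrite !opprD !opprK; congr (_ + _); rewrite addrAC.
Qed.

Lemma ad_sqr a p T : linear T -> ad a p.+1 (ad a p T) = fun=> 0.
Proof.
move=> lT; rewrite !ad_expand //; apply: funext => x.
by rewrite !iotam_sqr (lin0 lT) subr0 sub0r addNr.
Qed.

(** Every commutator changes the degree of the operator by one, so the parity used at a letter is p
    plus the number of letters already applied. *)
Fixpoint adl (l : seq 'I_g) p T : X -> X :=
  if l is a :: l' then ad a (p + size l') (adl l' p T) else T.

Definition adS (L : {set 'I_g}) p T := adl (enum L) p T.

Lemma adS_lin (L : {set 'I_g}) p T : linear T -> linear (adS L p T).
Proof. by move=> lT; rewrite /adS; elim: (enum L) => //= a l IH; apply: ad_lin. Qed.

Lemma adSU1 (a : 'I_g) (L : {set 'I_g}) p T : (forall j, j \in L -> (a < j)%N) ->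
  adS (a |: L) p T = ad a (p + #|L|) (adS L p T).
Proof. by move=> aL; rewrite /adS enum_setU1_min //= -cardE. Qed.

Lemma adZ a p c T : ad a p (fun x => c *: T x) = fun x => c *: ad a p T x.
Proof.
apply: funext => x; rewrite /ad linearZ /= scalerBr; congr (_ - _).
by rewrite !scalerA mulrC.
Qed.

Lemma ad_adS (a : 'I_g) (L : {set 'I_g}) p T : linear T -> ad a (p + #|L|) (adS L p T) =
  fun x => if a \in L then 0 else sg R a L *: adS (a |: L) p T x.
Proof.
move=> lT; elim/set_min_ind: L a => [|b L bL IH] a.
  rewrite adSU1 => [|j]; last by rewrite inE.
  apply: funext => x; rewrite inE cards0 /sg (_ : [set j in set0 | _] = set0) ?cards0 ?scale1r //.
  by apply/setP=> j; rewrite !inE.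
have bNL : b \notin L by apply/negP => /bL; rewrite ltnn.
have [ab|ba|/val_inj ab] := ltngtP a b.
- have aL j : j \in b |: L -> (a < j)%N.
    by rewrite !inE => /orP[/eqP->|/bL] //; apply: ltn_trans.
  rewrite -adSU1 // (_ : (a \in _) = false); last first.
    by apply/negP => /aL; rewrite ltnn.
  apply: funext => x; rewrite /sg (_ : [set j in b |: L | _] = set0) ?cards0 ?scale1r //.
  apply/setP=> j; rewrite [RHS]inE inE; apply/negP => /andP[/aL aj ja]; lia.
- rewrite adSU1 // cardsU1 bNL add1n addnS adC; last exact: adS_lin.
  rewrite IH; have ab : (a == b) = false by apply/eqP => E; rewrite E ltnn in ba.
  apply: funext => x; rewrite !inE ab /=; case: ifP => aL.
    by rewrite /ad linear0 scaler0 subr0 oppr0.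
  rewrite adZ -addnS (_ : #|L|.+1 = #|a |: L|); last by rewrite cardsU1 aL.
  rewrite -adSU1; last by move=> j; rewrite !inE => /orP[/eqP->|/bL].
  by rewrite setUCA sgU1 ?aL // ba expr1 mulN1r scaleNr.
- apply: funext => x; rewrite ab setU11 adSU1 // cardsU1 bNL add1n addnS ad_sqr //.
  exact: adS_lin.
Qed.

Definition epsl (l : seq 'I_f) (x : X) : X := foldr (@eps R f R^o) x l.

Lemma epsl_lin l : linear (epsl l).
Proof. by move=> c x y; elim: l => //= a l ->; rewrite linearP. Qed.

Lemma iotam_eps a i (x : X) : J a (eps i x) = psi i a *: x - eps i (J a x).
Proof.
have -> : psi i a *: x = \sum_k psi k a *: ((k == i)%:R *: x).
  rewrite (bigD1 i) //= eqxx scale1r big1 ?addr0 // => k /negbTE ->.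
  by rewrite scale0r scaler0.
rewrite /iotam linear_sum /= -sumrB; apply: eq_bigr => k _.
by rewrite iota_eps scalerBr [eps i (_ *: _)]linearZ.
Qed.

(** Combinations of words in r left multiplications. A graded commutator with a contraction consumes
    one letter, so r of them leave a scalar. *)
Definition epspan r T := exists s : seq (R * seq 'I_f),
  all (fun q => size q.2 == r) s /\ forall x, T x = \sum_(q <- s) q.1 *: epsl q.2 x.

Lemma epspanD r T T' : epspan r T -> epspan r T' -> epspan r (fun x => T x + T' x).
Proof.
move=> [s [As Hs]] [s' [As' Hs']]; exists (s ++ s'); split; first by rewrite all_cat As.
by move=> x; rewrite big_cat Hs Hs'.
Qed.

Lemma epspan0 r : epspan r (fun=> 0).
Proof. by exists [::]; split=> // x; rewrite big_nil. Qed.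

Lemma epspanZ r c T : epspan r T -> epspan r (fun x => c *: T x).
Proof.
move=> [s [As Hs]]; exists [seq (c * q.1, q.2) | q <- s]; split.
  by rewrite all_map (eq_all (a2 := fun q => size q.2 == r)).
by move=> x; rewrite Hs big_map scaler_sumr; apply: eq_bigr => q _; rewrite scalerA.
Qed.

Lemma epspan_eps r i T : epspan r T -> epspan r.+1 (fun x => eps i (T x)).
Proof.
move=> [s [As Hs]]; exists [seq (q.1, i :: q.2) | q <- s]; split.
  by rewrite all_map; apply: sub_all As => q /= /eqP ->.
by move=> x; rewrite Hs big_map linear_sum; apply: eq_bigr => q _; rewrite linearZ.
Qed.

(** The graded commutator is a derivation, and on a single letter [eps i] it gives the scalar psi_ia
    by the anticommutation relation. *)
Lemma ad_epsl a l : epspan (size l).-1 (ad a (size l) (epsl l)).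
Proof.
elim: l => [|i l IH] /=.
  rewrite (_ : ad _ _ _ = fun=> 0); first exact: epspan0.
  by apply: funext => x; rewrite /ad /= expr0 scale1r subrr.
rewrite (_ : ad _ _ _ = fun x => psi i a *: epsl l x + (- 1) *: eps i (ad a (size l) (epsl l) x)).
  apply: epspanD.
    apply: epspanZ; exists [:: (1, l)]; split; first by rewrite /= eqxx.
    by move=> x; rewrite big_seq1 scale1r.
  apply: epspanZ; case: l IH => [|i' l'] IH; last exact: epspan_eps.
  rewrite (_ : (fun _ => _) = fun=> 0); first exact: epspan0.
  by apply: funext => x; rewrite /ad /= expr0 scale1r subrr linear0.
apply: funext => x; rewrite /ad /= iotam_eps scaleN1r linearB linearZ /=.
by rewrite exprS mulN1r scaleNr scalerN opprK linearZ opprB addrCA addrC.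
Qed.

Lemma ad_epspan a r p T : p = r %[mod 2] -> epspan r T -> epspan r.-1 (ad a p T).
Proof.
move=> pr [s [As Hs]].
have Ep : (-1) ^+ p = (-1) ^+ r :> R.
  by move: pr; rewrite !modn2 -(signr_odd _ p) -(signr_odd _ r); case: (odd p); case: (odd r).
rewrite (_ : ad a p T = fun x => \sum_(q <- s) q.1 *: ad a r (epsl q.2) x).
  elim: s As {Hs} => [|q s IH] /=.
    by move=> _; rewrite (_ : (fun _ => _) = fun=> 0); [exact: epspan0|apply: funext => x; rewrite big_nil].
  case/andP=> /eqP sq /IH{}IH.
  rewrite (_ : (fun _ => _) = fun x => q.1 *: ad a r (epsl q.2) x + \sum_(q <- s) q.1 *: ad a r (epsl q.2) x).
    by apply: epspanD => //; apply: epspanZ; rewrite -sq; apply: ad_epsl.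
  by apply: funext => x; rewrite big_cons.
apply: funext => x; rewrite /ad Ep !Hs linear_sum /= scaler_sumr -sumrB.
apply: eq_bigr => q _; rewrite linearZ /= scalerBr; congr (_ - _).
by rewrite !scalerA mulrC.
Qed.

Lemma adS_epspan (L : {set 'I_g}) r p T : p = r %[mod 2] -> (#|L| <= r)%N -> epspan r T ->
  epspan (r - #|L|)%N (adS L p T).
Proof.
move=> pr; elim/set_min_ind: L => [|a L aL IH].
  by move=> _; rewrite cards0 subn0 /adS enum_set0.
have aNL : a \notin L by apply/negP => /aL; rewrite ltnn.
rewrite cardsU1 aNL add1n => Lr eT; rewrite adSU1 // subnS; apply: ad_epspan.
  by move: #|L| Lr pr => m mr; lia.
by apply: IH => //; apply: ltnW.
Qed.

Definition vac : X := [ffun D : {set 'I_f} => (D == set0)%:R].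

Lemma iotam_vac a : J a vac = 0.
Proof.
apply: big1 => i _; apply/ffunP=> D; rewrite !ffunE; case: ifP => _; rewrite ?scaler0 //.
have -> : i |: D == set0 = false by apply/negbTE/set0Pn; exists i; rewrite setU11.
by rewrite !scaler0.
Qed.

Lemma adS_vac (L : {set 'I_g}) p T : linear T -> adS L p T vac = comps J L (T vac).
Proof.
move=> lT; elim/set_min_ind: L => [|a L aL IH]; first by rewrite /adS comps0 enum_set0.
by rewrite adSU1 // compsU1 // /ad IH iotam_vac lin0 ?scaler0 ?subr0 //; apply: adS_lin.
Qed.

Lemma epsl_vac (L : {set 'I_f}) : epsl (enum L) vac = [ffun D : {set 'I_f} => (D == L)%:R].
Proof.
elim/set_min_ind: L => [|a L aL IH]; first by rewrite enum_set0.
have aNL : a \notin L by apply/negP => /aL; rewrite ltnn.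
rewrite enum_setU1_min //= IH; apply/ffunP=> D; rewrite !ffunE.
case: ifP => aD; last first.
  by case: eqP => // E; rewrite E setU11 in aD.
have [E|E] := eqVneq (D :\ a) L.
  have -> : D = a |: L by rewrite -E setD1K.
  rewrite eqxx /sg (_ : [set j in _ | _] = set0) ?cards0 ?scale1r //.
  apply/setP=> j; rewrite !inE; apply/negP => /andP[/orP[/eqP->|/aL]]; lia.
by rewrite scaler0; case: eqP => // E2; rewrite E2 setU1K // eqxx in E.
Qed.

(** Multiplication by e_L is a word of g letters, so g commutators turn it into a scalar; evaluation
    on e_0, the basis vector of the empty set, shows which one, since there the commutators are just
    contractions of e_L. *)
Lemma adS_full (L : {set 'I_f}) : #|L| = g ->
  forall x, adS setT g (epsl (enum L)) x =
    (contract_sign R L L * minorS psi g L setT) *: x.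
Proof.
move=> cL; have eE : epspan g (epsl (enum L)).
  exists [:: (1, enum L)]; rewrite /= -cardE cL eqxx; split=> // x.
  by rewrite big_seq1 scale1r.
have := @adS_epspan setT g g _ erefl _ eE; rewrite cardsT card_ord leqnn subnn.
move=> /(_ isT)[s [As Hs]].
have Sx x : adS setT g (epsl (enum L)) x = (\sum_(q <- s) q.1) *: x.
  rewrite Hs scaler_suml [LHS]big_seq_cond [RHS]big_seq_cond.
  apply: eq_bigr => q /andP[/(allP As)/eqP/size0nil -> _]; by [].
move=> x; rewrite Sx; congr (_ *: _).
(* The operator is already known to be a scalar; one value, at [vac], determines it. *)
have := Sx vac; rewrite adS_vac; last exact: epsl_lin.
rewrite epsl_vac (@comps_iotam _ _ _ _ _ g) ?cardsT ?card_ord //.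
move/ffunP/(_ set0); rewrite [RHS]ffunE ffunE eqxx /GRing.scale /= mulr1 => <-.
rewrite sum_ffunE (bigD1 L) ?cL //= [X in _ + X]big1 ?addr0; last first.
  move=> L1 /andP[_ /negbTE LL1]; rewrite !ffunE setU0 LL1 scaler0.
  by case: ifP => _; rewrite scaler0.
rewrite !ffunE setU0 eqxx disjoints_subset setC0 subsetT /GRing.scale /= mulr1.
by rewrite mulrC.
Qed.

End Adjoint.

Section SeqMul.
Variables (R : comNzRingType) (ws : seq R).

Lemma in_seq_mul0 (M : lmodType R) : in_seq_mul ws (0 : M).
Proof. by exists (fun=> 0); rewrite big1 // => i _; rewrite scaler0. Qed.

Lemma in_seq_mulP (M : lmodType R) a (x y : M) :
  in_seq_mul ws x -> in_seq_mul ws y -> in_seq_mul ws (a *: x + y).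
Proof.
move=> [z ->] [t ->]; exists (fun i => a *: z i + t i).
rewrite scaler_sumr -big_split; apply: eq_bigr => i _.
by rewrite scalerDr !scalerA mulrC.
Qed.

Lemma in_seq_mulD (M : lmodType R) (x y : M) :
  in_seq_mul ws x -> in_seq_mul ws y -> in_seq_mul ws (x + y).
Proof. by move=> hx hy; rewrite -[x]scale1r; apply: in_seq_mulP. Qed.

Lemma in_seq_mulZ (M : lmodType R) a (x : M) : in_seq_mul ws x -> in_seq_mul ws (a *: x).
Proof. by move=> hx; rewrite -[a *: x]addr0; apply: in_seq_mulP => //; apply: in_seq_mul0. Qed.

Lemma in_seq_mulN (M : lmodType R) (x : M) : in_seq_mul ws x -> in_seq_mul ws (- x).
Proof. by rewrite -scaleN1r; apply: in_seq_mulZ. Qed.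

Lemma in_seq_mulB (M : lmodType R) (x y : M) :
  in_seq_mul ws x -> in_seq_mul ws y -> in_seq_mul ws (x - y).
Proof. by move=> hx hy; apply: in_seq_mulD => //; apply: in_seq_mulN. Qed.

Lemma lin_sum (U V : lmodType R) (T : U -> V) (I : Type) (r : seq I) (p : pred I) F : linear T ->
  T (\sum_(i <- r | p i) F i) = \sum_(i <- r | p i) T (F i).
Proof. by move=> lT; apply: (big_morph T (fun x y => linD x y lT) (lin0 lT)). Qed.

Lemma in_seq_mul_lin (M N : lmodType R) (h : M -> N) x :
  linear h -> in_seq_mul ws x -> in_seq_mul ws (h x).
Proof.
move=> lh [z ->]; exists (fun i => h (z i)); rewrite lin_sum //.
by apply: eq_bigr => i _; rewrite (linZ _ _ lh).
Qed.

End SeqMul.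

(** * Differentials with constant coefficients in an anticommuting family *)

Section PieriDiff.
Variables (K : fieldType) (A : comNzRingType) (c : {rmorphism K -> A}) (g : nat).

(** The shape common to all differentials of the proof. The coefficients P are kept over K while the
    anticommuting family J is a parameter, so that the generic map, the identity and the split map
    can be compared by naturality in J ([dP_nat]). *)
Definition dP (Y : lmodType A) (J : 'I_g -> Y -> Y) n n' (P : {set 'I_g} -> 'M[K]_(n', n))
    (x : {ffun 'I_n -> Y}) : {ffun 'I_n' -> Y} :=
  [ffun b => \sum_L \sum_a c (P L b a) *: comps J L (x a)].

Definition linfam (Y : lmodType A) (J : 'I_g -> Y -> Y) := forall j, linear (J j).

Lemma comps_lin (Y : lmodType A) (J : 'I_g -> Y -> Y) (L : {set 'I_g}) : linfam J -> linear (comps J L).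
Proof.
move=> lJ c' x y; rewrite /comps; elim: (enum L) => //= a s ->; exact: lJ.
Qed.

Lemma dP_lin (Y : lmodType A) (J : 'I_g -> Y -> Y) n n' (P : {set 'I_g} -> 'M[K]_(n', n)) :
  linfam J -> linear (dP J P).
Proof.
move=> lJ a x y; apply/ffunP=> b; rewrite !ffunE scaler_sumr -big_split; apply: eq_bigr => L _.
rewrite scaler_sumr -big_split; apply: eq_bigr => i _.
by rewrite !ffunE (comps_lin L lJ) scalerDr !scalerA mulrC.
Qed.

Definition fmap (Y Z : Type) n (h : Y -> Z) (x : {ffun 'I_n -> Y}) : {ffun 'I_n -> Z} :=
  [ffun a => h (x a)].

Lemma fmap_lin (Y Z : lmodType A) n (h : Y -> Z) : linear h -> linear (@fmap Y Z n h).
Proof. by move=> lh a x y; apply/ffunP=> b; rewrite !ffunE lh. Qed.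

Lemma dP_nat (Y Z : lmodType A) (J : 'I_g -> Y -> Y) (J' : 'I_g -> Z -> Z) (h : Y -> Z)
  n n' (P : {set 'I_g} -> 'M[K]_(n', n)) x : linear h ->
  (forall j y, h (J j y) = J' j (h y)) -> fmap h (dP J P x) = dP J' P (fmap h x).
Proof.
move=> lh H; apply/ffunP=> b; rewrite !ffunE lin_sum //; apply: eq_bigr => L _.
rewrite lin_sum //; apply: eq_bigr => a _.
by rewrite (linZ _ _ lh) (comps_nat _ _ H) ffunE.
Qed.

Definition PP n0 n1 n2 (P' : {set 'I_g} -> 'M[K]_(n0, n1)) (P : {set 'I_g} -> 'M[K]_(n1, n2))
   (U : {set 'I_g}) : 'M[K]_(n0, n2) :=
  \sum_(L' : {set 'I_g}) \sum_(L : {set 'I_g} | [disjoint L' & L] && (L' :|: L == U)) sgS K L' L *: (P' L' *m P L).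

Lemma rmorph_sgS (L L' : {set 'I_g}) : c (sgS K L L') = sgS A L L'.
Proof. by rewrite /sgS rmorphXn rmorphN1. Qed.

Lemma dP_dP (Y : lmodType A) (J : 'I_g -> {linear Y -> Y}) n0 n1 n2
   (P' : {set 'I_g} -> 'M[K]_(n0, n1)) (P : {set 'I_g} -> 'M[K]_(n1, n2)) x :
  (forall a b y, J a (J b y) = - J b (J a y)) -> (forall a y, J a (J a y) = 0) ->
  dP J P' (dP J P x) = dP J (PP P' P) x.
Proof.
move=> JC JS; apply/ffunP=> b; rewrite !ffunE.
have lJ : linfam (fun j => J j : Y -> Y) by move=> j; apply: linearP.
transitivity (\sum_L' \sum_L \sum_a c ((P' L' *m P L) b a) *: comps J L' (comps J L (x a))).
  apply: eq_bigr => L' _.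
  under eq_bigr => m _ do rewrite ffunE (lin_sum _ _ _ (comps_lin L' lJ)) scaler_sumr.
  rewrite exchange_big; apply: eq_bigr => L _ /=.
  under eq_bigr => m _ do rewrite (lin_sum _ _ _ (comps_lin L' lJ)) scaler_sumr.
  rewrite exchange_big; apply: eq_bigr => a _ /=.
  rewrite mxE rmorph_sum scaler_suml; apply: eq_bigr => m _.
  by rewrite (linZ _ _ (comps_lin L' lJ)) scalerA rmorphM.
transitivity (\sum_U \sum_(L' : {set 'I_g}) \sum_(L : {set 'I_g} | [disjoint L' & L] && (L' :|: L == U)) \sum_a
   c (sgS K L' L * (P' L' *m P L) b a) *: comps J U (x a)).
  rewrite [RHS]exchange_big; apply: eq_bigr => L' _ /=.
  rewrite (exchange_big_dep (fun L : {set 'I_g} => [disjoint L' & L])) /=; last by move=> U L _ /andP[].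
  rewrite [LHS](bigID (fun L : {set 'I_g} => [disjoint L' & L])) /= [X in _ + X]big1 ?addr0; last first.
    by move=> L /negbTE nd; apply: big1 => a _; rewrite comps_comps // nd scaler0.
  apply: eq_bigr => L dL; rewrite (big_pred1 (L' :|: L)); last first.
    by move=> U; rewrite dL /= eq_sym.
  apply: eq_bigr => a _; rewrite comps_comps // dL scalerA; congr (_ *: _).
  by rewrite rmorphM rmorph_sgS mulrC.
apply: eq_bigr => U _; rewrite /PP.
rewrite [RHS](eq_bigr (fun a => \sum_(L' : {set 'I_g}) \sum_(L : {set 'I_g} | [disjoint L' & L] && (L' :|: L == U))
   c (sgS K L' L * (P' L' *m P L) b a) *: comps J U (x a))); last first.
  move=> a _; rewrite summxE rmorph_sum scaler_suml; apply: eq_bigr => L' _.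
  rewrite summxE rmorph_sum scaler_suml; apply: eq_bigr => L _.
  by rewrite mxE.
rewrite [RHS]exchange_big; apply: eq_bigr => L' _ /=.
by rewrite exchange_big.
Qed.

End PieriDiff.

Section FieldComplex.
Variables (K : fieldType) (g : nat).
Notation F n := {ffun {set 'I_g} -> 'cV[K]_n}.

(** The differential attached to the identity matrix of size g, written on vector-valued functions
    instead of tuples of functions. *)
Definition dF n n' (P : {set 'I_g} -> 'M[K]_(n', n)) (x : F n) : F n' :=
  [ffun S => \sum_L P L *m iotaS L x S].

Lemma dF_linear n n' (P : {set 'I_g} -> 'M[K]_(n', n)) : linear (dF P).
Proof.
move=> a x y; apply/ffunP=> S; rewrite !ffunE scaler_sumr -big_split; apply: eq_bigr => L _ /=.
by rewrite iotaS_linear !ffunE mulmxDr scalemxAr.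
Qed.
HB.instance Definition _ n n' P := GRing.isLinear.Build K _ _ _ (@dF n n' P) (dF_linear P).

Lemma iotaS_mul n n' (L : {set 'I_g}) (B : 'M[K]_(n', n)) (x : F n) :
  iotaS L ([ffun S => B *m x S] : F n') = [ffun S => B *m iotaS L x S].
Proof.
by apply/ffunP=> S; rewrite !ffunE; case: ifP; rewrite ?mulmx0 // scalemxAr.
Qed.

Lemma iotaS_iotaS (X : lmodType K) (L' L : {set 'I_g}) (x : {ffun {set 'I_g} -> X}) :
  iotaS L' (iotaS L x) = if [disjoint L' & L] then sgS K L' L *: iotaS (L' :|: L) x else 0.
Proof.
have := @comps_comps _ _ _ (fun j => @iota K g X j : {linear _ -> _}) (@iotaC _ _ _) (@iota_sqr _ _ _) L' L x.
by rewrite !comps_iota.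
Qed.

Lemma dF_dF n0 n1 n2 (P' : {set 'I_g} -> 'M[K]_(n0, n1)) (P : {set 'I_g} -> 'M[K]_(n1, n2)) x :
  dF P' (dF P x) = dF (PP P' P) x.
Proof.
have dFE n n' (Q : {set 'I_g} -> 'M[K]_(n', n)) (y : F n) :
    dF Q y = \sum_L [ffun S => Q L *m iotaS L y S].
  by apply/ffunP=> S; rewrite sum_ffunE [LHS]ffunE; apply: eq_bigr => L _; rewrite [RHS]ffunE.
apply/ffunP=> S; rewrite [LHS]ffunE.
transitivity (\sum_L' \sum_L (P' L' *m P L) *m iotaS L' (iotaS L x) S).
  apply: eq_bigr => L' _; rewrite dFE linear_sum /= sum_ffunE mulmx_sumr.
  apply: eq_bigr => L _; rewrite iotaS_mul ffunE mulmxA; congr (_ *m _).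
transitivity (\sum_U \sum_(L' : {set 'I_g}) \sum_(L : {set 'I_g} | [disjoint L' & L] && (L' :|: L == U))
   (sgS K L' L *: (P' L' *m P L)) *m iotaS U x S).
  rewrite [RHS]exchange_big; apply: eq_bigr => L' _ /=.
  rewrite (exchange_big_dep (fun L : {set 'I_g} => [disjoint L' & L])) /=; last by move=> U L _ /andP[].
  rewrite [LHS](bigID (fun L : {set 'I_g} => [disjoint L' & L])) /= [X in _ + X]big1 ?addr0; last first.
    by move=> L /negbTE nd; rewrite iotaS_iotaS nd ffunE mulmx0.
  apply: eq_bigr => L dL; rewrite (big_pred1 (L' :|: L)); last first.
    by move=> U; rewrite dL /= eq_sym.
  by rewrite iotaS_iotaS dL ffunE -scalemxAr scalemxAl.
rewrite [RHS]ffunE; apply: eq_bigr => U _; rewrite /PP mulmx_suml; apply: eq_bigr => L' _.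
by rewrite mulmx_suml.
Qed.

Definition ebas n (S : {set 'I_g}) (v : 'cV[K]_n) : F n := [ffun S' => (S' == S)%:R *: v].

Lemma iotaS_at0 (X : lmodType K) (L : {set 'I_g}) (x : {ffun {set 'I_g} -> X}) :
  iotaS L x set0 = contract_sign K L L *: x L.
Proof. by rewrite ffunE setU0 disjoints_subset setC0 subsetT. Qed.

Lemma csignN0 (L I : {set 'I_g}) : contract_sign K L I != 0.
Proof. by rewrite /contract_sign signr_eq0. Qed.

(** Evaluating at the empty set on the vectors e_L tensored with basis vectors recovers each
    coefficient P_L up to sign. *)
Lemma dF0_eq0 n n' (P : {set 'I_g} -> 'M[K]_(n', n)) : (forall x, dF P x = 0) -> forall L, P L = 0.
Proof.
move=> H L; apply/matrixP=> i j; rewrite mxE.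
have /ffunP/(_ set0) := H (ebas L (delta_mx j 0)); rewrite !ffunE.
rewrite (bigD1 L) //= iotaS_at0 ffunE eqxx scale1r [X in _ + X]big1 ?addr0.
  move/matrixP/(_ i 0); rewrite -scalemxAr !mxE => /eqP; rewrite mulf_eq0 (negbTE (csignN0 _ _)) /=.
  rewrite (bigD1 j) //= big1 ?addr0 ?mxE ?eqxx ?mulr1 => [/eqP //|k /negbTE kj].
  by rewrite mxE kj mulr0.
by move=> L1 /negbTE LL1; rewrite iotaS_at0 ffunE LL1 scale0r scaler0 mulmx0.
Qed.

End FieldComplex.

(** * The split surjection from F + G to G, and its comparison with psi *)

Section TotalFermions.
Variables (A : comNzRingType) (f g : nat) (psi : 'M[A]_(f, g)).
Notation X := {ffun {set 'I_f} -> A^o}.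
Notation J := (@iotam A f g A^o psi).
Notation Xt := {ffun {set 'I_g} -> X}.

(** Contractions attached to the map (psi, 1) from F + G to G, the exterior algebra of F + G being
    written as that of G with coefficients in that of F; (-1)^|S| is the Koszul sign for passing
    e_S. *)
Definition itot (j : 'I_g) (y : Xt) : Xt :=
  [ffun S : {set 'I_g} => iota j y S + (-1) ^+ #|S| *: J j (y S)].

Lemma itot_linear j : linear (itot j).
Proof.
move=> a x y; apply/ffunP=> S; rewrite [LHS]ffunE iota_linear.
rewrite [(a *: x + y) S]ffunE [(a *: x) S]ffunE linearP [(_ + iota j y) S]ffunE.
rewrite [(a *: iota j x) S]ffunE [RHS]ffunE [itot j y S]ffunE [(a *: itot j x) S]ffunE [itot j x S]ffunE.
rewrite !scalerDr [in RHS]scalerA [a * _]mulrC -scalerA.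
by rewrite addrACA.
Qed.
HB.instance Definition _ j := GRing.isLinear.Build A _ _ _ (itot j) (itot_linear j).

Lemma itot_itot a b y S : itot a (itot b y) S =
  iota a (iota b y) S +
  (if a \in S then 0 else (sg A a S * (-1) ^+ #|S|.+1) *: J b (y (a |: S))) +
  (if b \in S then 0 else (sg A b S * (-1) ^+ #|S|) *: J a (y (b |: S))) +
  J a (J b (y S)).
Proof.
rewrite [LHS]ffunE [itot b y S]ffunE linearD /= linearZ /= scalerDr scalerA -exprD addnn -mul2n.
rewrite exprM sqrrN !expr1n scale1r addrA; congr (_ + _ + _).
  rewrite [LHS]ffunE [iota a (iota b y) S]ffunE; case: ifP => aS; first by rewrite addr0.
  rewrite [itot b y _]ffunE scalerDr cardsU1 aS add1n scalerA; congr (_ + _).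
rewrite [iota b y S]ffunE; case: ifP => bS; first by rewrite linear0 scaler0.
by rewrite linearZ /= scalerA mulrC.
Qed.

Lemma itotC a b y : itot a (itot b y) = - itot b (itot a y).
Proof.
apply/ffunP=> S; rewrite [RHS]ffunE.
apply: (eq_trans (itot_itot a b y S)); symmetry.
apply: (eq_trans (congr1 -%R (itot_itot b a y S))); symmetry.
have -> : iota a (iota b y) S = - iota b (iota a y) S by rewrite iotaC ffunE.
rewrite (iotamC psi a b (y S)).
rewrite !opprD; congr (_ + _).
rewrite -!addrA; congr (_ + _); rewrite addrC; congr (_ + _).
  by case: ifP => _; rewrite ?oppr0 // -scaleNr exprS mulN1r mulrN opprK.
by case: ifP => _; rewrite ?oppr0 // -scaleNr exprS mulN1r mulrN.
Qed.

Lemma itot_sqr a y : itot a (itot a y) = 0.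
Proof.
apply/ffunP=> S; apply: (eq_trans (itot_itot a a y S)).
rewrite iota_sqr iotam_sqr [(0 : Xt) S]ffunE add0r addr0.
by case: ifP => _; rewrite ?addr0 // -scalerDl exprS mulN1r mulrN addNr scale0r.
Qed.

Definition incl (x : X) : Xt := [ffun S : {set 'I_g} => if S == set0 then x else 0].

Lemma incl_linear : linear incl.
Proof.
by move=> a x y; apply/ffunP=> S; rewrite !ffunE; case: eqP => _; rewrite ?scaler0 ?addr0.
Qed.

Lemma incl_itot j x : incl (J j x) = itot j (incl x).
Proof.
apply/ffunP=> S; rewrite [LHS]ffunE [RHS]ffunE [iota j _ S]ffunE.
rewrite [incl x (j |: S)]ffunE [incl x S]ffunE.
have -> : (j |: S == set0) = false by apply/negbTE/set0Pn; exists j; rewrite setU11.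
rewrite scaler0 if_same add0r; case: eqP => [->|_]; last by rewrite linear0 scaler0.
by rewrite cards0 expr0 scale1r.
Qed.

Section Collapse.
Variable L : {set 'I_f}.
Hypothesis cL : #|L| = g.
Notation T I := (adS psi (~: I) g (epsl (enum L))).
Definition ssgn (I : {set 'I_g}) : A := (-1) ^+ (\sum_(i in I) (i : nat)).

(** A map back from the exterior algebra of F + G to that of F. Its component at e_I is
    multiplication by e_L after the commutators with all J_j for j outside I; at the empty set all g
    commutators occur and [adS_full] gives the minor. *)
Definition collapse (y : Xt) : X := \sum_I ssgn I *: T I (y I).

Lemma T_lin (I : {set 'I_g}) : linear (T I).
Proof. by apply: adS_lin; apply: epsl_lin. Qed.

Lemma collapse_linear : linear collapse.
Proof.
move=> a x y; rewrite /collapse scaler_sumr -big_split; apply: eq_bigr => I _.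
rewrite [(a *: x + y) I]ffunE [(a *: x) I]ffunE T_lin scalerDr !scalerA.
by rewrite [ssgn I * a]mulrC.
Qed.

Lemma collapse_incl x : collapse (incl x) =
   (contract_sign A L L * minorS psi g L setT) *: x.
Proof.
rewrite /collapse (bigD1 set0) //= big1 ?addr0 => [|I /negbTE I0]; last first.
  by rewrite ffunE I0 (lin0 (T_lin I)) scaler0.
by rewrite ffunE eqxx setC0 adS_full // /ssgn big_set0 expr0 scale1r.
Qed.

Lemma ssgnU1 (j : 'I_g) (I : {set 'I_g}) : j \notin I ->
  ssgn (j |: I) * sg A j (~: (j |: I)) = ssgn I * sg A j I.
Proof.
move=> jI; rewrite /ssgn big_setU1 //= exprD -mulrA [_ * (_ * sg _ _ _)]mulrCA; congr (_ * _).
rewrite /sg.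
have E : (j : nat) = (#|[set i in I | (i < j)%N]| + #|[set i in ~: (j |: I) | (i < j)%N]|)%N.
  rewrite -cardsUI [X in (_ + X)%N](_ : _ = 0)%N ?addn0; last first.
    apply/eqP; rewrite cards_eq0; apply/eqP/setP=> i; rewrite !inE negb_or.
    by case: (i \in I); rewrite ?andbF.
  have -> : [set i in I | (i < j)%N] :|: [set i in ~: (j |: I) | (i < j)%N] = [set i : 'I_g | (i < j)%N].
    apply/setP=> i; rewrite !inE negb_or; case: eqP => [->|_]; rewrite ?ltnn ?andbF //=.
    by case: (i \in I); rewrite ?orbF.
  rewrite cardsE -sum1_card (eq_bigl (fun k' : 'I_g => (k' < j)%N)) //.
  by rewrite (big_ord_narrow (ltnW (ltn_ord j))) sum1_card card_ord.
by rewrite {1}E exprD -mulrA -expr2 sqrr_sign mulr1.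
Qed.

(** Moving J_j to the left of T_I produces, besides T_I J_j, the commutator T_{I \ j}; these extra
    terms are exactly the contribution of [iota j] in [itot j]. *)
Lemma collapse_itot j y : collapse (itot j y) = J j (collapse y).
Proof.
have HT (I : {set 'I_g}) x : J j (T I x) = (-1) ^+ #|I| *: T I (J j x) +
   (if j \in I then sg A j (~: I) *: T (I :\ j) x else 0).
  have := @ad_adS _ _ _ psi j (~: I) g (epsl (enum L)) (@epsl_lin _ _ _) => /(congr1 (fun h => h x)).
  rewrite {1}/ad inE => /eqP; rewrite subr_eq addrC => /eqP ->; congr (_ *: _ + _).
    rewrite -signr_odd -[RHS]signr_odd; congr (_ ^+ (nat_of_bool _)).
    by have := cardsC I; rewrite card_ord => {1}<-; rewrite -addnA addnn oddD odd_double addbF.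
  rewrite if_neg; case: ifP => jI //; congr (_ *: adS _ _ _ _ _).
  by apply/setP=> i; rewrite !inE; case: eqP; case: (i \in I).
rewrite /collapse linear_sum /=.
transitivity (\sum_I ssgn I *: ((-1) ^+ #|I| *: T I (J j (y I)))
   + \sum_(I : {set 'I_g} | j \in I) (ssgn I * sg A j (~: I)) *: T (I :\ j) (y I)); last first.
  rewrite [X in _ + X]big_mkcond -big_split; apply: eq_bigr => I _ /=.
  rewrite [J j (_ *: _)]linearZ /= HT scalerDr; congr (_ + _).
  by case: ifP => _; rewrite ?scaler0 // scalerA.
rewrite [X in _ + X](reindex_onto (fun I : {set 'I_g} => j |: I) (fun I : {set 'I_g} => I :\ j)) /=; last by move=> I; apply: setD1K.
rewrite [X in _ + X](eq_bigl (fun I : {set 'I_g} => j \notin I)); last first.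
  move=> I; rewrite !inE eqxx /=; apply/eqP/idP => [<-|jI]; first by rewrite !inE eqxx.
  by rewrite setU1K.
rewrite [X in _ + X]big_mkcond -big_split; apply: eq_bigr => I _ /=.
rewrite ffunE addrC (linD _ _ (T_lin I)) scalerDr (linZ _ _ (T_lin I)); congr (_ + _).
rewrite ffunE if_neg; case: ifP => jI; first by rewrite (lin0 (T_lin I)) scaler0.
by rewrite (linZ _ _ (T_lin I)) scalerA setU1K ?jI // ssgnU1 ?jI.
Qed.

End Collapse.

(** Filtration by the degree in F. The part of [itot j] coming from psi lowers this degree, while
    [iota j] preserves it. *)
Definition flt r (y : Xt) := forall (S : {set 'I_g}) (D : {set 'I_f}), (r <= #|D|)%N -> y S D = 0.

Lemma iotam_flt j r (x : X) : (forall D : {set 'I_f}, (r.+1 <= #|D|)%N -> x D = 0) ->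
  forall D : {set 'I_f}, (r <= #|D|)%N -> J j x D = 0.
Proof.
move=> H D rD; rewrite /iotam sum_ffunE big1 // => i _; rewrite !ffunE.
by case: ifP => iD; rewrite ?scaler0 // H ?scaler0 // cardsU1 iD.
Qed.

Lemma flt_le r r' y : (r <= r')%N -> flt r y -> flt r' y.
Proof. by move=> rr H S D h; apply: H; apply: leq_trans h. Qed.

Lemma fltD r y z : flt r y -> flt r z -> flt r (y + z).
Proof. by move=> H1 H2 S D h; rewrite !ffunE H1 ?H2 ?addr0. Qed.

Lemma fltZ r a y : flt r y -> flt r (a *: y).
Proof. by move=> H1 S D h; rewrite !ffunE H1 ?scaler0. Qed.

Lemma flt0 r : flt r 0.
Proof. by move=> S D h; rewrite !ffunE. Qed.

Lemma flt_iota j r y : flt r y -> flt r (iota j y).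
Proof.
by move=> H S D h; rewrite !ffunE; case: ifP => _; rewrite !ffunE // H ?scaler0.
Qed.

Lemma flt_itot_iota j r y : flt r.+1 y -> flt r (itot j y - iota j y).
Proof.
move=> H S D h; rewrite [(itot j y - _) S]ffunE [itot j y S]ffunE [(- iota j y) S]ffunE.
rewrite addrC addKr ffunE (@iotam_flt _ r) ?scaler0 // => D' h'; exact: H.
Qed.

Lemma flt_comps (L : {set 'I_g}) r y : flt r.+1 y ->
  flt r.+1 (comps itot L y) /\ flt r (comps itot L y - comps (@iota A g X) L y).
Proof.
move=> H; elim/set_min_ind: L => [|a L aL [IH1 IH2]].
  by rewrite !comps0 subrr; split=> //; apply: flt0.
rewrite !compsU1 //; split.
  rewrite -(subrK (iota a (comps itot L y)) (itot a _)); apply: fltD; last exact: flt_iota.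
  have h := @flt_itot_iota a r _ IH1. apply: (@flt_le r r.+1 _ (leqnSn r)). exact h.
rewrite -(subrK (iota a (comps itot L y)) (itot a _)) -addrA -linearB.
apply: fltD; first exact: flt_itot_iota.
exact: flt_iota.
Qed.

End TotalFermions.

Section KernelAction.
Variables (K : fieldType) (A : comNzRingType) (c : {rmorphism K -> A}) (g : nat) (Y : lmodType A).
Notation F n := {ffun {set 'I_g} -> 'cV[K]_n}.

(** Extension of scalars of a K-linear map through its matrix, applied to functions with values in
    an A-module. *)
Definition actk n n' (phi : F n -> F n') (x : {ffun 'I_n -> {ffun {set 'I_g} -> Y}}) :
   {ffun 'I_n' -> {ffun {set 'I_g} -> Y}} :=
  [ffun b => [ffun S' => \sum_a \sum_S c (phi (ebas S (delta_mx a 0)) S' b 0) *: x a S]].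

Lemma actk_lin n n' (phi : F n -> F n') : linear (actk phi).
Proof.
move=> k x y; apply/ffunP=> b; apply/ffunP=> S'; rewrite !ffunE.
rewrite scaler_sumr -big_split; apply: eq_bigr => a _.
rewrite scaler_sumr -big_split; apply: eq_bigr => S _.
by rewrite !ffunE scalerDr !scalerA mulrC.
Qed.

Lemma F_expand n (y : F n) : y = \sum_S \sum_a y S a 0 *: ebas S (delta_mx a 0).
Proof.
apply/ffunP=> S'; rewrite sum_ffunE (bigD1 S') //= [X in _ + X]big1 ?addr0 => [|S /negbTE SS]; last first.
  by rewrite sum_ffunE big1 // => a _; rewrite !ffunE eq_sym SS scale0r scaler0.
rewrite sum_ffunE [LHS](matrix_sum_delta (y S')); apply: eq_bigr => a _.
by rewrite big_ord1 !ffunE eqxx scale1r.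
Qed.

Lemma actk_comp n n' n'' (phi : {linear F n -> F n'}) (phi' : {linear F n' -> F n''}) x :
  actk phi' (actk phi x) = actk (phi' \o phi) x.
Proof.
apply/ffunP=> b; apply/ffunP=> S'; rewrite !ffunE.
transitivity (\sum_m \sum_T \sum_a \sum_S
   (c (phi' (ebas T (delta_mx m 0)) S' b 0) * c (phi (ebas S (delta_mx a 0)) T m 0)) *: x a S).
  apply: eq_bigr => m _; apply: eq_bigr => T _; rewrite !ffunE scaler_sumr.
  apply: eq_bigr => a _; rewrite scaler_sumr; apply: eq_bigr => S _.
  by rewrite scalerA.
under eq_bigr => m _ do rewrite exchange_big.
rewrite exchange_big; apply: eq_bigr => a _ /=.
under eq_bigr => m _ do rewrite exchange_big.
rewrite exchange_big; apply: eq_bigr => S _ /=.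
have -> : phi' (phi (ebas S (delta_mx a 0))) S' b 0 =
    \sum_T \sum_m phi (ebas S (delta_mx a 0)) T m 0 * phi' (ebas T (delta_mx m 0)) S' b 0.
  rewrite {1}[phi _]F_expand linear_sum sum_ffunE summxE; apply: eq_bigr => T _.
  rewrite linear_sum sum_ffunE summxE; apply: eq_bigr => m _.
  by rewrite linearZ ffunE mxE.
rewrite rmorph_sum scaler_suml exchange_big /=.
apply: eq_bigr => T _; rewrite rmorph_sum scaler_suml /=.
by apply: eq_bigr => m _; rewrite rmorphM mulrC.
Qed.

Lemma actk_id n x : actk (@id (F n)) x = x.
Proof.
apply/ffunP=> b; apply/ffunP=> S'; rewrite !ffunE (bigD1 b) //= [X in _ + X]big1 ?addr0.
  rewrite (bigD1 S') //= big1 ?addr0 => [|S /negbTE SS]; last first.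
    by rewrite ffunE eq_sym SS scale0r mxE rmorph0 scale0r.
  by rewrite ffunE eqxx scale1r mxE !eqxx rmorph1 scale1r.
move=> a /negbTE ab; apply: big1 => S _.
by rewrite ffunE !mxE [b == a]eq_sym ab mulr0 rmorph0 scale0r.
Qed.

Lemma actkD n n' (phi phi' : F n -> F n') x :
  actk phi x + actk phi' x = actk (fun y => phi y + phi' y) x.
Proof.
apply/ffunP=> b; apply/ffunP=> S'; rewrite !ffunE -big_split; apply: eq_bigr => a _.
rewrite -big_split; apply: eq_bigr => S _.
by rewrite ffunE mxE rmorphD scalerDl.
Qed.

Lemma actk_ext n n' (phi phi' : F n -> F n') x : phi =1 phi' -> actk phi x = actk phi' x.
Proof.
move=> H; apply/ffunP=> b; apply/ffunP=> S'; rewrite !ffunE.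
by apply: eq_bigr => a _; apply: eq_bigr => S _; rewrite H.
Qed.

Lemma csign_rmorph (L I : {set 'I_g}) : c (contract_sign K L I) = contract_sign A L I.
Proof. by rewrite /contract_sign rmorphXn rmorphN1. Qed.

Lemma actk_dF n n' (P : {set 'I_g} -> 'M[K]_(n', n)) x :
  actk (dF P) x = dP c (@iota A g Y) P x.
Proof.
apply/ffunP=> b; apply/ffunP=> S'; rewrite [actk _ _ b]ffunE [LHS]ffunE [dP _ _ _ _ b]ffunE sum_ffunE.
rewrite [RHS](eq_bigr (fun L => \sum_a c (P L b a) *: iotaS L (x a) S')); last first.
  move=> L _; rewrite sum_ffunE; apply: eq_bigr => a _.
  by rewrite ffunE comps_iota.
rewrite [RHS]exchange_big; apply: eq_bigr => a _ /=.
transitivity (\sum_S \sum_L (c (P L b a) * c (if [disjoint L & S'] then contract_sign K L (L :|: S')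
    * (L :|: S' == S)%:R else 0)) *: x a S).
  apply: eq_bigr => S _; rewrite ffunE summxE rmorph_sum scaler_suml.
  apply: eq_bigr => L _; rewrite ffunE; case: ifP => dLS; last first.
    by rewrite mulmx0 mxE rmorph0 mulr0 scale0r.
  rewrite ffunE scalerA -scalemxAr mxE rmorphM mulrC; congr (c _ * _ *: _).
  rewrite mxE (bigD1 a) //= mxE !eqxx mulr1 big1 ?addr0 // => k /negbTE ka.
  by rewrite mxE ka mulr0.
rewrite exchange_big; apply: eq_bigr => L _ /=; rewrite ffunE.
case: ifP => dLS; last by rewrite scaler0 big1 // => S _; rewrite rmorph0 mulr0 scale0r.
rewrite (bigD1 (L :|: S')) //= big1 ?addr0 => [|S /negbTE SS]; last first.
  by rewrite eq_sym SS mulr0 rmorph0 mulr0 scale0r.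
by rewrite eqxx mulr1 csign_rmorph scalerA.
Qed.

End KernelAction.

(** One correction of a perturbation argument: if the cycle u' = u - d x - h0 (d' u) is a boundary
    modulo ws, then so is u, because h0 (d' u) already lies in the submodule generated by ws. *)
Lemma homotopy_step (A : comNzRingType) (ws : seq A) (M2 M1 M0 : lmodType A)
  (d : M2 -> M1) (d' : M1 -> M0) (h0 : M0 -> M1) (u : M1) (x : M2) :
  linear d -> linear d' -> linear h0 -> (forall y, d' (d y) = 0) ->
  in_seq_mul ws (d' u) ->
  in_seq_mul ws (d' (u - d x - h0 (d' u))) /\
  forall v, in_seq_mul ws (u - d x - h0 (d' u) - d v) -> in_seq_mul ws (u - d (x + v)).
Proof.
move=> ld ld' l0 dd du; split.
  rewrite (linB (u - d x) _ ld') (linB u _ ld') dd subr0.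
  by apply: in_seq_mulB => //; apply: (in_seq_mul_lin ld'); apply: (in_seq_mul_lin l0).
move=> v Hv; rewrite (linD x v ld) opprD addrA.
have -> : u - d x - d v = (u - d x - h0 (d' u) - d v) + h0 (d' u).
  by rewrite [RHS]addrAC subrK.
by apply: in_seq_mulD => //; apply: (in_seq_mul_lin l0).
Qed.

(** * Exactness over the field implies that maximal minors kill homology *)

Section MinorHomotopy.
Variables (K : fieldType) (A : comNzRingType) (c : {rmorphism K -> A}) (g : nat).
Variables (n0 n1 n2 : nat) (P' : {set 'I_g} -> 'M[K]_(n0, n1)) (P : {set 'I_g} -> 'M[K]_(n1, n2)).
Notation F n := {ffun {set 'I_g} -> 'cV[K]_n}.
Hypothesis dd0 : forall x : F n2, dF P' (dF P x) = 0.
Hypothesis dexact : forall x : F n1, dF P' x = 0 -> exists y : F n2, x = dF P y.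

(** An exact sequence of finite-dimensional spaces is contractible: generalized inverses of the two
    maps, with D D^-1 D = D, give the homotopy. *)
Lemma field_homotopy : exists (h1 : {linear F n1 -> F n2}) (h0 : {linear F n0 -> F n1}),
  forall x, dF P (h1 x) + h0 (dF P' x) = x.
Proof.
pose D := linfun (dF P : {linear F n2 -> F n1}).
pose D' := linfun (dF P' : {linear F n1 -> F n0}).
have sD (n n' : nat) (E : 'Hom(F n, F n')) y : E ((E^-1)%VF (E y)) = E y.
  by apply: limg_lfunVK; rewrite memv_img ?memvf.
exists ((D^-1)%VF \o (\1 - (D'^-1 \o D'))%VF), (D'^-1)%VF => x.
have DE y : D y = dF P y by rewrite lfunE.
have D'E y : D' y = dF P' y by rewrite lfunE.
rewrite /= add_lfunE opp_lfunE id_lfunE comp_lfunE -D'E -DE.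
set y := x - _; have [z yz] : exists z, y = dF P z.
  by apply: dexact; rewrite -D'E /y linearB /= sD subrr.
by rewrite {1}yz -DE sD DE -yz /y subrK.
Qed.

Lemma PP_eq0 U : PP P' P U = 0.
Proof. by apply: dF0_eq0 => x; rewrite -dF_dF. Qed.

Variables (f : nat) (psi : 'M[A]_(f, g)) (ws : seq A).
Notation X := {ffun {set 'I_f} -> A^o}.
Notation J := (@iotam A f g A^o psi).
Notation Jt := (itot psi).

Lemma dP_tot_dP x : dP c Jt P' (dP c Jt P x) = 0.
Proof.
have := @dP_dP K A c g _ (fun j => Jt j : {linear _ -> _}) n0 n1 n2 P' P x (itotC psi) (itot_sqr psi).
move=> ->; apply/ffunP=> b; rewrite !ffunE big1 // => L _; rewrite big1 // => a _.
by rewrite PP_eq0 mxE rmorph0 scale0r.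
Qed.

Lemma itot_linfam : linfam Jt.
Proof. by move=> j; apply: linearP. Qed.
Lemma iotam_linfam : linfam J.
Proof. by move=> j; apply: linearP. Qed.

Notation Xt := {ffun {set 'I_g} -> X}.
Definition fflt n r (x : {ffun 'I_n -> Xt}) := forall a, flt r (x a).

Lemma flt_sum r (I : finType) (F : I -> Xt) (p : pred I) :
  (forall i, p i -> flt r (F i)) -> flt r (\sum_(i | p i) F i).
Proof. by move=> H; elim/big_ind: _ => //; [apply: flt0|apply: fltD]. Qed.

Lemma fflt_dP_diff n n' (Q : {set 'I_g} -> 'M[K]_(n', n)) r (x : {ffun 'I_n -> Xt}) :
  fflt r.+1 x -> fflt r (dP c Jt Q x - dP c (@iota A g X) Q x).
Proof.
move=> H b; rewrite [X in flt r X]ffunE [dP _ _ _ _ b]ffunE [X in _ + X]ffunE [dP _ (@iota A g X) _ _ b]ffunE.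
rewrite -sumrB; apply: flt_sum => L _; rewrite -sumrB; apply: flt_sum => a _.
rewrite -scalerBr; apply: fltZ; exact: (flt_comps psi L (H a)).2.
Qed.

Lemma fflt_actk n n' (h : F n -> F n') r (x : {ffun 'I_n -> Xt}) : fflt r x -> fflt r (actk c h x).
Proof.
move=> H b S D rD; rewrite [actk _ _ _ b]ffunE ffunE sum_ffunE big1 // => a _.
rewrite sum_ffunE big1 // => S' _; rewrite ffunE (H a S' D rD) scaler0 //.
Qed.

Lemma ffltD n r (x y : {ffun 'I_n -> Xt}) : fflt r x -> fflt r y -> fflt r (x + y).
Proof. by move=> H1 H2 a; rewrite ffunE; apply: fltD. Qed.

(** Induction on the filtration in F. The contracting homotopy of the identity complex corrects a
    cycle of the split complex up to an error lying one step lower. *)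
Lemma tot_exact r (u : {ffun 'I_n1 -> Xt}) : fflt r u -> in_seq_mul ws (dP c Jt P' u) ->
  exists v, in_seq_mul ws (u - dP c Jt P v).
Proof.
have [h1 [h0 Hh]] := field_homotopy.
elim: r u => [|r IH] u fu du.
  exists 0; rewrite (lin0 (dP_lin c P itot_linfam)) subr0.
  have -> : u = 0 by apply/ffunP=> a; apply/ffunP=> S; apply/ffunP=> D; rewrite fu // !ffunE.
  exact: in_seq_mul0.
pose d0 := dP c (@iota A g X) P; pose d0' := dP c (@iota A g X) P'.
have E0 : d0 (actk c h1 u) + actk c h0 (d0' u) = u.
  rewrite /d0 /d0' -!actk_dF !actk_comp actkD -[RHS](@actk_id K A c g X n1 u).
  by apply: actk_ext => x; apply: Hh.
(* The error after one correction. By [E0] it would vanish with the differentials of the identity,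
   so only the differences of the differentials remain, and they lower the filtration. *)
pose u' := u - dP c Jt P (actk c h1 u) - actk c h0 (dP c Jt P' u).
have fu' : fflt r u'.
  have E1 : actk c h0 (dP c Jt P' u - d0' u) = actk c h0 (dP c Jt P' u) - actk c h0 (d0' u).
    exact: (linB (dP c Jt P' u) (d0' u) (actk_lin c h0)).
  have : fflt r ((dP c Jt P (actk c h1 u) - d0 (actk c h1 u)) + actk c h0 (dP c Jt P' u - d0' u)).
    apply: ffltD; last by apply: fflt_actk; apply: fflt_dP_diff.
    by apply: fflt_dP_diff; apply: fflt_actk.
  rewrite E1 /u' -[X in _ -> fflt r (X - _ - _)]E0.
  move: (d0 _) (actk c h0 (d0' u)) (dP c Jt P _) (actk c h0 _) => a b d e H i.
  have -> : (a + b - d - e) i = -1 *: (d - a + (e - b)) i.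
    rewrite !ffunE scaleN1r !opprD !opprK [- d i + a i]addrC -!addrA; congr (_ + _).
    by rewrite addrC -addrA; congr (_ + _); rewrite addrC.
  by apply: fltZ; exact: H.
have ldP := dP_lin c P itot_linfam; have ldP' := dP_lin c P' itot_linfam.
have la1 := actk_lin c (Y := X) h1; have la0 := actk_lin c (Y := X) h0.
have [du' Hu'] := @homotopy_step _ ws _ _ _ _ _ _ u (actk c h1 u) ldP ldP' la0 dP_tot_dP du.
have [v Hv] := IH _ fu' du'; exists (actk c h1 u + v); exact: Hu'.
Qed.

(** Include u in the split complex, write it there as a boundary modulo ws, and collapse: inclusion
    followed by collapse is, up to sign, multiplication by the minor of L. *)
Lemma minor_homotopy (L : {set 'I_f}) (u : {ffun 'I_n1 -> X}) : #|L| = g ->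
  in_seq_mul ws (dP c J P' u) ->
  exists v, in_seq_mul ws (minorS psi g L setT *: u - dP c J P v).
Proof.
move=> cL du.
(* No subset of the f rows has f+1 elements, so the whole module lies in this step of the
   filtration. *)
have [||v Hv] := @tot_exact f.+1 (fmap (@incl A f g) u).
- move=> a S D h; rewrite !ffunE; case: eqP => _; last by rewrite ffunE.
  by have := max_card (mem D); rewrite card_ord leqNgt h.
- rewrite -(dP_nat c P' u (@incl_linear A f g) (incl_itot psi)).
  by apply: in_seq_mul_lin => //; apply: fmap_lin; apply: incl_linear.
pose s : A := contract_sign A L L; exists (s *: fmap (collapse psi L) v).
rewrite (linZ s (fmap (collapse psi L) v) (dP_lin c P iotam_linfam)).
have lc := fmap_lin (n := n1) (@collapse_linear A f g psi L).
rewrite -(dP_nat c P v (collapse_linear psi L) (collapse_itot psi L)).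
have -> : minorS psi g L setT *: u = s *: fmap (collapse psi L) (fmap (@incl A f g) u).
  apply/ffunP=> a; rewrite !ffunE collapse_incl // scalerA mulrA.
  by rewrite /s /contract_sign -expr2 sqrr_sign mul1r.
rewrite -scalerBr; apply: in_seq_mulZ.
have := in_seq_mul_lin lc Hv.
by rewrite (linB (fmap (@incl A f g) u) (dP c Jt P v) lc).
Qed.

End MinorHomotopy.

Section CharZero.
Variable K : fieldType.
Hypothesis charK : [pchar K] =i pred0.

Lemma natr_eq0_char0 n : (n%:R == 0 :> K) = (n == 0)%N.
Proof. by move: n; apply/pcharf0P. Qed.

Lemma intr_eq0_char0 (m : int) : (m%:~R == 0 :> K) = (m == 0).
Proof.
case: m => n; first by rewrite -[LHS]/(n%:R == 0 :> K) natr_eq0_char0.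
by rewrite NegzE rmorphN /= !oppr_eq0 -[LHS]/(n.+1%:R == 0 :> K) natr_eq0_char0.
Qed.

Lemma intr_inj_char0 (m n : int) : m%:~R = n%:~R :> K -> m = n.
Proof.
move=> /eqP; rewrite -subr_eq0 -rmorphB /= intr_eq0_char0 subr_eq0 => /eqP //.
Qed.
End CharZero.

(** * Weights, the dominance order and Casimir values *)

Section WeightOrder.
Variable g : nat.
Implicit Types k : {ffun 'I_g -> int}.

Definition psum k (r : nat) : int := \sum_(a < g | (a < r)%N) k a.
Definition wle k k' := (forall r, psum k r <= psum k' r) /\ psum k g = psum k' g.
Definition wdom k := forall a b : 'I_g, (a < b)%N -> k b <= k a.
(** The scalar by which the Casimir operator acts on a highest weight vector of weight k. *)
Definition wcas k : int := \sum_a k a ^+ 2 + \sum_(a : 'I_g) \sum_(b : 'I_g | (a < b)%N) (k a - k b).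
Definition wroot k (a b : 'I_g) : {ffun 'I_g -> int} :=
  [ffun c : 'I_g => k c + (c == a)%:R - (c == b)%:R].
(** A height that strictly increases under every raising operator; it makes raising processes
    stop. *)
Definition wht k : int := \sum_(a < g) (g%:Z - a%:Z) * k a.

Lemma wle_refl k : wle k k. Proof. by []. Qed.
Lemma wle_trans k k' k'' : wle k k' -> wle k' k'' -> wle k k''.
Proof. by move=> [h1 e1] [h2 e2]; split=> [r|]; [apply: le_trans (h1 r) (h2 r)|rewrite e1]. Qed.

Lemma psum_wroot k (a b : 'I_g) r :
  psum (wroot k a b) r = psum k r + (a < r)%N%:R - (b < r)%N%:R.
Proof.
rewrite /psum (eq_bigr (fun c => k c + (c == a)%:R - (c == b)%:R)); last by move=> c _; rewrite ffunE.
rewrite big_split sumrN big_split /=; congr (_ + _ - _).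
  case: (ltnP a r) => ar.
    by rewrite (bigD1 a) //= eqxx big1 ?addr0 // => i /andP[_ /negbTE ->].
  by rewrite big1 // => i ir; case: eqP => // E; rewrite -E leqNgt ir in ar.
case: (ltnP b r) => ar.
  by rewrite (bigD1 b) //= eqxx big1 ?addr0 // => i /andP[_ /negbTE ->].
by rewrite big1 // => i ir; case: eqP => // E; rewrite -E leqNgt ir in ar.
Qed.

Lemma wle_wroot k (a b : 'I_g) : (a < b)%N -> wle k (wroot k a b).
Proof.
move=> ab; split=> [r|]; rewrite psum_wroot ?ltn_ord ?addrK //.
by case: (ltnP b r) => br; [rewrite (ltn_trans ab br)|case: (a < r)%N]; rewrite ?addrK ?subr0 ?lerDl ?addr0.
Qed.

Lemma wht_wroot k (a b : 'I_g) : wht (wroot k a b) = wht k + (b%:Z - a%:Z).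
Proof.
rewrite /wht (eq_bigr (fun c : 'I_g => (g%:Z - c%:Z) * k c + ((g%:Z - c%:Z) * (c == a)%:R - (g%:Z - c%:Z) * (c == b)%:R))).
  rewrite big_split sumrB /=; congr (_ + _).
  rewrite (bigD1 a) //= eqxx mulr1 big1 ?addr0 => [|i /negbTE ->]; last by rewrite mulr0.
  rewrite (bigD1 b) //= eqxx mulr1 big1 ?addr0 => [|i /negbTE ->]; last by rewrite mulr0.
  lia.
by move=> c _; rewrite ffunE; ring.
Qed.

Lemma wcasE k : wcas k = \sum_(a < g) (k a + (g%:Z - 1 - 2 * a%:Z)) * k a.
Proof.
rewrite /wcas [RHS](eq_bigr (fun a => k a ^+ 2 + (g%:Z - 1 - 2 * a%:Z) * k a)); last first.
  by move=> a _; rewrite mulrDl.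
rewrite big_split /=; congr (_ + _).
under eq_bigr => a _ do rewrite sumrB.
rewrite sumrB [X in _ - X](exchange_big_dep xpredT) //= -sumrB; apply: eq_bigr => a _.
have c1 : #|[pred b : 'I_g | (b < a)%N]| = a.
  rewrite -sum1_card (eq_bigl (fun k' : 'I_g => (k' < a)%N)) //.
  by rewrite (big_ord_narrow (ltnW (ltn_ord a))) sum1_card card_ord.
have c2 : (#|[pred b : 'I_g | (a < b)%N]| + a.+1 = g)%N.
  have := cardC [pred b : 'I_g | (a < b)%N]; rewrite card_ord => E; rewrite -[RHS]E; congr (_ + _)%N.
  symmetry.
  have -> : #|[predC [pred b : 'I_g | (a < b)%N]]| = #|[pred b : 'I_g | (b < a.+1)%N]|.
    by apply: eq_card => b; rewrite !inE -leqNgt.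
  rewrite -sum1_card (eq_bigl (fun k' : 'I_g => (k' < a.+1)%N)) //.
  by rewrite (big_ord_narrow (ltn_ord a)) sum1_card card_ord.
have S1 (p : pred 'I_g) : \sum_(b | p b) k a = #|[pred b | p b]|%:Z * k a.
  by rewrite [RHS]mulrC -[#|_|%:Z]natz mulr_natr -sumr_const; apply: eq_bigl.
rewrite !S1 c1 -mulrBl; congr (_ * _); lia.
Qed.

End WeightOrder.

(** Abel summation: the sum becomes a sum of products of nonnegative partial sums with the positive
    gaps of y, so it vanishes only if all partial sums do. *)
Lemma abel_pos (n : nat) (d y : nat -> int) :
  (forall r, (r <= n)%N -> 0 <= \sum_(0 <= a < r) d a) -> \sum_(0 <= a < n) d a = 0 ->
  (forall a, (a.+1 < n)%N -> y a.+1 < y a) ->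
  0 <= \sum_(0 <= a < n) d a * y a /\
  (\sum_(0 <= a < n) d a * y a = 0 -> forall r, (r <= n)%N -> \sum_(0 <= a < r) d a = 0).
Proof.
move=> dpos dtot ydec.
pose D r := \sum_(0 <= a < r) d a.
have Habel m : \sum_(0 <= a < m.+1) d a * y a = D m.+1 * y m + \sum_(0 <= r < m) D r.+1 * (y r - y r.+1).
  elim: m => [|m IH]; first by rewrite big_nat1 big_geq // addr0 /D big_nat1.
  rewrite big_nat_recr //= IH [in RHS]big_nat_recr //= /D [in RHS](@big_nat_recr _ _ _ m.+1) //=; ring.
case: n dpos dtot ydec => [|n] dpos dtot ydec.
  by rewrite !big_geq //; split=> // _ r; rewrite leqn0 => /eqP->; rewrite big_geq.
rewrite Habel -/(D n.+1) in dtot *; rewrite dtot mul0r add0r.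
have tpos r : (r < n)%N -> 0 <= D r.+1 * (y r - y r.+1).
  by move=> rn; apply: mulr_ge0; [apply: dpos; apply: ltnW | rewrite subr_ge0; apply: ltW; apply: ydec].
rewrite big_mkord; split; first by apply: sumr_ge0 => r _; apply: tpos.
move=> /eqP; rewrite psumr_eq0 => [/allP H r|r _]; last exact: tpos.
case: r => [|r]; first by rewrite big_geq.
rewrite leq_eqVlt => /orP[/eqP[->]|]; first by rewrite -[LHS]/(D n.+1).
rewrite ltnS => rn; have := H (Ordinal rn) (mem_index_enum _); rewrite mulf_eq0 => /orP[/eqP //|].
by rewrite subr_eq0 gt_eqF // ydec.
Qed.

Section WeightStrict.
Variable g : nat.
Implicit Types k : {ffun 'I_g -> int}.

(** The difference of the two Casimir values is a sum of (k'_r - k_r) times a strictly decreasing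
    factor, so equality would force equal partial sums by [abel_pos], whereas the root a, b
    separates them just after a. *)
Lemma wcas_lt k k' (a b : 'I_g) : wdom k -> wdom k' -> (a < b)%N -> wle (wroot k a b) k' ->
  wcas k != wcas k'.
Proof.
move=> dk dk' ab [hle heq]; apply/eqP => E.
pose nf (h : {ffun 'I_g -> int}) (r : nat) : int := odflt 0 (omap h (insub r)).
have nfE h (i : 'I_g) : nf h i = h i by rewrite /nf valK.
have psE h r : (r <= g)%N -> psum h r = \sum_(0 <= i < r) nf h i.
  move=> rg; rewrite /psum big_mkord (big_ord_narrow rg); apply: eq_bigr => i _.
  by rewrite -nfE.
(* The factorization behind [wcasE]: the shift by -2r makes the second factor strictly decreasing
   for dominant weights. *)
pose d r := nf k' r - nf k r; pose y (r : nat) := nf k' r + nf k r + (g%:Z - 1 - 2 * r%:Z).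
have D r : (r <= g)%N -> \sum_(0 <= i < r) d i = psum k' r - psum k r.
  by move=> rg; rewrite sumrB !psE.
have hle' := wle_trans (wle_wroot k ab) (conj hle heq).
have tot : \sum_(0 <= i < g) d i = 0 by rewrite D // (hle'.2) subrr.
have [||_ H] := @abel_pos g d y _ tot.
- by move=> r rg; rewrite D // subr_ge0 hle'.1.
- move=> r rg; rewrite /y.
  have r1 : (r < g)%N by apply: ltnW.
  rewrite -[r.+1]/(val (Ordinal rg)) -[r in X in _ < X]/(val (Ordinal r1)) !nfE /=.
  have := dk (Ordinal r1) (Ordinal rg) (ltnSn _); have := dk' (Ordinal r1) (Ordinal rg) (ltnSn _).
  lia.
have /H/(_ a.+1 (ltn_ord a)) : \sum_(0 <= i < g) d i * y i = 0.
  transitivity (wcas k' - wcas k); last by rewrite E subrr.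
  rewrite !wcasE -sumrB big_mkord; apply: eq_bigr => i _; rewrite /d /y !nfE; ring.
rewrite D ?ltn_ord //; have := hle a.+1; rewrite psum_wroot ltnSn ltnS leqNgt ab /=; lia.
Qed.
End WeightStrict.

Section Subspaces.
Variables (K : fieldType) (F : lmodType K).
Definition subspace (B : F -> Prop) := B 0 /\ forall a x y, B x -> B y -> B (a *: x + y).

Variable B : F -> Prop.
Hypothesis sB : subspace B.
Lemma sub0 : B 0. Proof. exact: sB.1. Qed.
Lemma subD x y : B x -> B y -> B (x + y).
Proof. by move=> hx hy; rewrite -[x]scale1r; apply: sB.2. Qed.
Lemma subZ a x : B x -> B (a *: x).
Proof. by move=> hx; rewrite -[_ *: _]addr0; apply: sB.2 => //; apply: sub0. Qed.
Lemma subN x : B x -> B (- x).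
Proof. by rewrite -scaleN1r; apply: subZ. Qed.
Lemma subB x y : B x -> B y -> B (x - y).
Proof. by move=> hx hy; apply: subD => //; apply: subN. Qed.
Lemma sub_sum (I : Type) (r : seq I) (p : pred I) (G : I -> F) :
  (forall i, p i -> B (G i)) -> B (\sum_(i <- r | p i) G i).
Proof. by move=> H; elim/big_ind: _ => //; [apply: sub0 | move=> x y; apply: subD]. Qed.
Lemma subZ_inv a x : a != 0 -> B (a *: x) -> B x.
Proof. by move=> a0 h; rewrite -[x](scalerK a0); apply: subZ. Qed.
End Subspaces.

(** * Highest weight theory for modules over gl_g *)

Section GlModule.
Variables (K : fieldType) (g : nat) (F : vectType K) (E : 'I_g -> 'I_g -> F -> F).
Hypothesis charK : [pchar K] =i pred0.
Notation wt := {ffun 'I_g -> int}.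
Implicit Types (k : wt) (x y z : F).

Definition wv k x := forall a, E a a x = (k a)%:~R *: x.
Definition weight_spanned_in (p : wt -> Prop) := exists r (bs : 'I_r -> F) (ws : 'I_r -> wt),
  (forall i, wv (ws i) (bs i) /\ p (ws i)) /\
  forall x, exists c : 'I_r -> K, x = \sum_i c i *: bs i.
Definition weight_spanned := weight_spanned_in (fun=> True).
Definition gl_action := (forall a b, linear (E a b)) /\ forall a b c d x,
  E a b (E c d x) = E c d (E a b x) + ((b == c)%:R *: E a d x - (d == a)%:R *: E c b x).
Definition gl_stable (B : F -> Prop) := subspace B /\ forall a b x, B x -> B (E a b x).
Definition raised (B : F -> Prop) x := forall a b : 'I_g, (a < b)%N -> B (E a b x).
Definition zeroP x := x = 0.

Hypothesis Egl : gl_action.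

Let Elin a b : linear (E a b). Proof. exact: Egl.1. Qed.

Lemma wv_sub k : subspace (wv k).
Proof.
split=> [a|c x y hx hy a]; first by rewrite (lin0 (Elin a a)) scaler0.
by rewrite Elin hx hy scalerDr !scalerA mulrC.
Qed.

Lemma zero_gl_stable : gl_stable zeroP.
Proof.
split; last by move=> a b x ->; apply: lin0.
by split=> // a x y -> ->; rewrite scaler0 addr0.
Qed.

(** Applying E_aa minus the eigenvalue of one weight removes that component and multiplies another
    one by a nonzero scalar, for an a where the two weights differ; induction on the number of
    weights does the rest. *)
Lemma wv_comp (B : F -> Prop) (ks : seq wt) (xs : wt -> F) :
  subspace B -> (forall a x, B x -> B (E a a x)) -> uniq ks ->
  (forall k, k \in ks -> wv k (xs k)) -> B (\sum_(k <- ks) xs k) ->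
  forall k, k \in ks -> B (xs k).
Proof.
move=> sB hB; elim: ks xs => [|k0 ks IH] xs //= /andP[k0ks uks] hxs Bs.
have sub1 k1 : k1 \in ks -> B (xs k1).
  move=> k1ks; have [a na] : exists a, k1 a != k0 a.
    apply: contrapT => H; move/negP: k0ks; apply; suff -> : k0 = k1 by [].
    apply/ffunP=> a; apply/eqP; rewrite eq_sym; apply: contrapT => h; apply: H; exists a.
    exact/negP.
  have : B ((k1 a - k0 a)%:~R *: xs k1).
    apply: (IH (fun k => (k a - k0 a)%:~R *: xs k)) => // [k kks|].
      by apply: (subZ (wv_sub k)); apply: hxs; rewrite inE kks orbT.
    have : B (E a a (\sum_(k <- k0 :: ks) xs k) - (k0 a)%:~R *: \sum_(k <- k0 :: ks) xs k).
      by apply: (subB sB); [apply: hB|apply: (subZ sB)].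
    rewrite !big_cons (linD _ _ (Elin a a)) scalerDr hxs ?inE ?eqxx // opprD addrACA subrr add0r.
    rewrite (lin_sum _ _ _ (Elin a a)) scaler_sumr -sumrB.
    rewrite (eq_big_seq (fun k => (k a - k0 a)%:~R *: xs k)) // => k kks.
    by rewrite hxs ?inE ?kks ?orbT // rmorphB scalerBl.
  by apply: (subZ_inv sB); rewrite intr_eq0_char0 // subr_eq0.
move=> k; rewrite inE => /orP[/eqP->|]; last exact: sub1.
have -> : xs k0 = \sum_(k <- k0 :: ks) xs k - \sum_(k <- ks) xs k by rewrite big_cons addrK.
apply: (subB sB) => //; rewrite big_seq; exact: (sub_sum sB).
Qed.

Lemma wt_finite p : weight_spanned_in p -> exists2 ws : seq wt, (forall k, k \in ws -> p k) &
  forall x, exists2 ks, uniq ks /\ {subset ks <= ws} &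
  exists2 xs : wt -> F, forall k, wv k (xs k) & x = \sum_(k <- ks) xs k.
Proof.
move=> [r [bs [ws [Hw Hs]]]]; exists (codom ws) => [k /codomP[i ->]|x]; first exact: (Hw i).2.
have [c ->] := Hs x; exists (undup (codom ws)).
  by split; [apply: undup_uniq|move=> k; rewrite mem_undup].
exists (fun k => \sum_(i | ws i == k) c i *: bs i).
  by move=> k; apply: (sub_sum (wv_sub k)) => i /eqP <-; apply: (subZ (wv_sub _)); exact: (Hw i).1.
rewrite (exchange_big_dep xpredT) //=; apply: eq_bigr => i _.
rewrite -big_filter (_ : [seq _ <- _ | _] = [:: ws i]) ?big_seq1 //.
rewrite (eq_filter (a2 := pred1 (ws i))) => [|k /=]; last by rewrite eq_sym.
by rewrite filter_pred1_uniq ?undup_uniq // mem_undup codom_f.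
Qed.

Lemma wt_bounded_in p : weight_spanned_in p ->
  exists2 ws : seq wt, (forall k, k \in ws -> p k) & forall k x, wv k x -> x <> 0 -> k \in ws.
Proof.
move=> /wt_finite[ws Hp H]; exists ws => // k x kx x0.
have [ks [uks sks] [xs Hxs xE]] := H x; case: (boolP (k \in ks)) => [/sks //|knks]; exfalso; apply: x0.
have := @wv_comp zeroP (k :: ks) (fun k' => if k' == k then - x else xs k') zero_gl_stable.1.
move=> /(_ (fun a => zero_gl_stable.2 a a)); rewrite /= knks => /(_ uks) h.
have : zeroP (if k == k then - x else xs k).
  apply: h; last by rewrite inE eqxx.
    move=> k' _; case: eqP => [->|_ //]; exact: (subN (wv_sub k)).
  rewrite big_cons eqxx big_seq (eq_bigr xs) => [|k' k'ks]; last first.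
    by case: eqP => // E'; rewrite -E' k'ks in knks.
  by rewrite -big_seq -xE /zeroP addNr.
by rewrite eqxx /zeroP => /eqP; rewrite oppr_eq0 => /eqP.
Qed.

Lemma wv_in p k x : weight_spanned_in p -> wv k x -> x <> 0 -> p k.
Proof. by move=> /wt_bounded_in[ws Hp H] kx x0; apply: Hp; apply: H x0. Qed.

Hypothesis Ews : weight_spanned.

Lemma wt_bounded : exists ws : seq wt, forall k x, wv k x -> x <> 0 -> k \in ws.
Proof. by have [ws _ H] := wt_bounded_in Ews; exists ws. Qed.

Lemma wv_split (B Z : F -> Prop) z : subspace B -> subspace Z -> (forall a x, Z x -> Z (E a a x)) ->
  Z z -> ~ B z -> exists k y, [/\ wv k y, Z y & ~ B y].
Proof.
move=> sB sZ hZ Zz nBz; have [ws _ /(_ z) [ks [uks _] [xs Hxs xE]]] := wt_finite Ews.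
have [k [kks nB]] : exists k, k \in ks /\ ~ B (xs k).
  apply: contrapT => H; apply: nBz; rewrite xE big_seq; apply: (sub_sum sB) => k kks.
  by apply: contrapT => h; apply: H; exists k.
exists k, (xs k); split => //; apply: (wv_comp sZ hZ uks) => //.
by rewrite -xE.
Qed.

Lemma wv_root k a b x : wv k x -> wv (wroot k a b) (E a b x).
Proof.
move=> kx c; rewrite Egl.2 kx (linZ _ _ (Elin a b)) ffunE rmorphB rmorphD /= scalerBl scalerDl addrA.
rewrite !rmorph_nat [b == c]eq_sym; congr (_ + _ - _).
  by case: eqP => [->|_]; rewrite ?scale0r.
by case: eqP => [->|_]; rewrite ?scale0r.
Qed.

(** Only finitely many weights occur, so the height [wht] is bounded and raising a vector outside B
    must stop at one that all raising operators send into B. *)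
Lemma raising_ind (Q : wt -> F -> Prop) (B : F -> Prop) : B 0 ->
  (forall k x (a b : 'I_g), (a < b)%N -> Q k x -> ~ B (E a b x) -> Q (wroot k a b) (E a b x)) ->
  (forall k x, Q k x -> wv k x /\ ~ B x) ->
  forall k x, Q k x -> exists k' x', [/\ Q k' x', wle k k' & raised B x'].
Proof.
move=> B0 Qr Qw; have [ws Hws] := wt_bounded.
have [M HM] : exists M : int, forall k, k \in ws -> wht k <= M.
  elim: ws {Hws} => [|k0 ws [M HM]]; first by exists 0.
  exists (Num.max (wht k0) M) => k; rewrite inE le_max => /orP[/eqP->|/HM->]; rewrite ?lexx ?orbT //.
move=> k x; have [m] := ubnP `|M - wht k|%N; elim: m k x => // m IH k x km Qkx.
have [kx nB] := Qw _ _ Qkx.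
have wM k' x' : Q k' x' -> wht k' <= M.
  move=> /Qw[k'x nB']; apply: HM; apply: (Hws k' x') => // x0; apply: nB'; by rewrite x0.
case: (EM (raised B x)) => [r|nr]; first by exists k, x; split=> //; apply: wle_refl.
have [a [b [ab nBE]]] : exists a b : 'I_g, (a < b)%N /\ ~ B (E a b x).
  apply: contrapT => H; apply: nr => a b ab; apply: contrapT => h; apply: H; by exists a, b.
have Q' := Qr _ _ _ _ ab Qkx nBE.
have [|k' [x' [Qk' kk' rx']]] := IH _ _ _ Q'.
  have := wM _ _ Q'; have := wM _ _ Qkx; rewrite wht_wroot; lia.
by exists k', x'; split=> //; apply: wle_trans kk'; apply: wle_wroot.
Qed.

Lemma hw_mod (B Z : F -> Prop) z : gl_stable B -> gl_stable Z -> Z z -> ~ B z ->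
  exists k y, [/\ wv k y, Z y, ~ B y & raised B y].
Proof.
move=> [sB hB] [sZ hZ] Zz nBz.
have [k [y [ky Zy nBy]]] := wv_split sB sZ (fun a => hZ a a) Zz nBz.
have Qr : forall k x (a b : 'I_g), (a < b)%N -> [/\ wv k x, Z x & ~ B x] -> ~ B (E a b x) ->
    [/\ wv (wroot k a b) (E a b x), Z (E a b x) & ~ B (E a b x)].
  by move=> k1 x a b ab [h1 h2 h3] h4; split=> //; [apply: wv_root|apply: hZ].
have Qw : forall k x, [/\ wv k x, Z x & ~ B x] -> wv k x /\ ~ B x by move=> k1 x [].
have [k' [y' [[k'y Zy' nB'] _ r]]] := raising_ind (sub0 sB) Qr Qw (And3 ky Zy nBy).
by exists k', y'.
Qed.

Lemma hw_above (B : F -> Prop) k y : gl_stable B -> wv k y -> y <> 0 -> B y ->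
  exists k' y', [/\ wv k' y', B y', y' <> 0, raised zeroP y' & wle k k'].
Proof.
move=> [sB hB] ky y0 By.
have Qr : forall k x (a b : 'I_g), (a < b)%N -> [/\ wv k x, B x & x <> 0] -> ~ zeroP (E a b x) ->
    [/\ wv (wroot k a b) (E a b x), B (E a b x) & E a b x <> 0].
  by move=> k1 x a b ab [h1 h2 h3] h4; split=> //; [apply: wv_root|apply: hB].
have Qw : forall k x, [/\ wv k x, B x & x <> 0] -> wv k x /\ ~ zeroP x by move=> k1 x [].
have [k' [y' [[k'y By' y0'] kk' r]]] := @raising_ind _ zeroP erefl Qr Qw _ _ (And3 ky By y0).
by exists k', y'.
Qed.

(** The sl_2 argument. If k_a < k_b, the scalars relating successive powers of E_ba on z never
    vanish, so all these powers stay outside B, although only finitely many weights occur. *)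
Lemma hw_dom (B : F -> Prop) k z : gl_stable B -> wv k z -> ~ B z -> raised B z -> wdom k.
Proof.
move=> [sB hB] kz nB r a b ab; rewrite leNgt; apply/negP => kab.
have ba : (b == a) = false by apply/eqP => h; rewrite h ltnn in ab.
pose fz n := iter n (E b a) z; have fzS n : fz n.+1 = E b a (fz n) by [].
have wf n : exists kn, wv kn (fz n) /\ forall c, kn c = k c + n%:Z * ((c == b)%:R - (c == a)%:R).
  elim: n => [|n [kn [h1 h2]]]; first by exists k; split=> // c; rewrite mul0r addr0.
  exists (wroot kn b a); split; first exact: wv_root.
  by move=> c; rewrite ffunE h2 intS; ring.
have eH n : E a a (fz n) - E b b (fz n) = (k a - k b - n%:Z * 2)%:~R *: fz n.
  have [kn [h1 h2]] := wf n; rewrite !h1 -scalerBl -rmorphB !h2 !eqxx [a == b]eq_sym ba.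
  congr (_%:~R *: _); rewrite /=; lia.
(* The sl_2 relation e f^(n+1) z = (n+1)(h - n) f^n z modulo B, with h = k_a - k_b. *)
have ef n : B (E a b (fz n.+1) - (n.+1%:Z * (k a - k b - n%:Z))%:~R *: fz n).
  elim: n => [|n IH].
    rewrite /= Egl.2 !eqxx !scale1r (eH 0%N) /= mul1r !mul0r !subr0 addrK; apply: hB; exact: r.
  rewrite (fzS n.+1) Egl.2 !eqxx !scale1r (eH n.+1).
  rewrite -addrA -scalerBl -rmorphB.
  have -> : E b a (E a b (fz n.+1)) = E b a (E a b (fz n.+1) - (n.+1%:Z * (k a - k b - n%:Z))%:~R *: fz n)
     + (n.+1%:Z * (k a - k b - n%:Z))%:~R *: fz n.+1.
    by rewrite (linB _ _ (Elin b a)) (linZ _ _ (Elin b a)) subrK.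
  rewrite -addrA -scalerDl -rmorphD (_ : _ + _ = 0); last by lia.
  by rewrite scale0r addr0; apply: hB.
have nBf n : ~ B (fz n).
  elim: n => // n IH Bn; apply: IH.
  have h1 := ef n; have h2 := hB a b _ Bn.
  have h3 : B ((n.+1%:Z * (k a - k b - n%:Z))%:~R *: fz n).
    have := subB sB h2 h1; by rewrite opprB addrC subrK.
  apply: (subZ_inv sB _ h3); rewrite intr_eq0_char0 // mulf_eq0 negb_or; apply/andP; split; lia.
(* The b-coordinate of the weight of f^n z grows with n, so a bound M on these coordinates is
   exceeded. *)
have [ws Hws] := wt_bounded.
have [M HM] : exists M : int, forall k, k \in ws -> k b <= M.
  elim: ws {Hws} => [|k0 ws [M HM]]; first by exists 0.
  exists (Num.max (k0 b) M) => k1; rewrite inE le_max => /orP[/eqP->|/HM->]; rewrite ?lexx ?orbT //.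
have [kn [h1 h2]] := wf (`|M - k b|%N.+1).
have := HM kn (Hws _ _ h1 _); rewrite h2 eqxx ba => H.
have fz0 : fz `|M - k b|%N.+1 <> 0 by move=> z0; apply: (nBf `|M - k b|%N.+1); rewrite z0; apply: sub0.
have := H fz0; rewrite /=; lia.
Qed.

Definition casimir x := \sum_a \sum_b E a b (E b a x).

Lemma casimir_lin : linear casimir.
Proof.
move=> c x y; rewrite /casimir scaler_sumr -big_split; apply: eq_bigr => a _.
by rewrite scaler_sumr -big_split; apply: eq_bigr => b _; rewrite !Elin.
Qed.

Lemma casimir_comm c d x : E c d (casimir x) = casimir (E c d x).
Proof.
rewrite /casimir (lin_sum _ _ _ (Elin c d)).
apply/eqP; rewrite -subr_eq0 -sumrB.
transitivity (\sum_a \sum_b ((((d == a)%:R *: E c b (E b a x) - (b == c)%:R *: E a d (E b a x)) +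
   ((d == b)%:R *: E a b (E c a x) - (a == c)%:R *: E a b (E b d x)))) == 0).
  congr (_ == 0); apply: eq_bigr => a _; rewrite (lin_sum _ _ _ (Elin c d)) -sumrB.
  apply: eq_bigr => b _; rewrite Egl.2 (Egl.2 c d b a x) (linD _ _ (Elin a b)) (linB _ _ (Elin a b)).
  rewrite !(linZ _ _ (Elin a b)).
  by set M := E a b (E b a (E c d x)); rewrite [LHS]addrAC [M + _]addrC addrK addrC.
under eq_bigr => a _ do rewrite big_split /= !sumrB.
rewrite big_split /= !sumrB.
have S1 (G : 'I_g -> F) (e : 'I_g) : \sum_i (e == i)%:R *: G i = G e.
  by rewrite (bigD1 e) //= eqxx scale1r big1 ?addr0 // => i; rewrite eq_sym => /negbTE ->; rewrite scale0r.
have S2 (G : 'I_g -> F) (e : 'I_g) : \sum_i (i == e)%:R *: G i = G e.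
  by rewrite -(S1 G e); apply: eq_bigr => i _; rewrite eq_sym.
rewrite exchange_big /=.
under eq_bigr => b _ do rewrite (S1 (fun a => E c b (E b a x)) d).
under [X in _ - X + _]eq_bigr => a _ do rewrite (S2 (fun b => E a d (E b a x)) c).
under [X in _ + (X - _)]eq_bigr => a _ do rewrite (S1 (fun b => E a b (E c a x)) d).
rewrite [X in _ + (_ - X)]exchange_big /=.
under [X in _ + (_ - X)]eq_bigr => b _ do rewrite (S2 (fun a => E a b (E b d x)) c).
by rewrite addrA subrK subrr eqxx.
Qed.

Lemma casimir_hw (B : F -> Prop) k z : gl_stable B -> wv k z -> raised B z ->
  B (casimir z - (wcas k)%:~R *: z).
Proof.
move=> [sB hB] kz r.
have -> : (wcas k)%:~R *: z = \sum_a \sum_b ((a == b)%:R * (k a)%:~R ^+ 2 +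
    (a < b)%N%:R * ((k a)%:~R - (k b)%:~R)) *: z.
  rewrite /wcas rmorphD !rmorph_sum scalerDl !scaler_suml -big_split; apply: eq_bigr => a _.
  under [RHS]eq_bigr => b _ do rewrite scalerDl.
  rewrite [RHS]big_split /=; congr (_ + _).
    rewrite (bigD1 a) //= eqxx mul1r big1 ?addr0 ?rmorphXn // => b.
    by rewrite eq_sym => /negbTE ->; rewrite mul0r scale0r.
  rewrite rmorph_sum scaler_suml big_mkcond; apply: eq_bigr => b _.
  by case: ifP => _; rewrite ?mul1r ?rmorphB // mul0r scale0r.
rewrite /casimir -sumrB; apply: (sub_sum sB) => a _; rewrite -sumrB; apply: (sub_sum sB) => b _.
case: (ltngtP a b) => [ab|ba|/val_inj ->].
- have ab' : (a == b) = false by apply/eqP => h; rewrite h ltnn in ab.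
  rewrite ab' mul0r add0r mul1r Egl.2 !eqxx !scale1r -addrA !kz -scalerBl subrr addr0.
  by apply: hB; apply: r.
- have ab' : (a == b) = false by apply/eqP => h; rewrite h ltnn in ba.
  by rewrite ab' !mul0r addr0 scale0r subr0; apply: hB; apply: r.
- rewrite eqxx mul1r mul0r addr0 kz (linZ _ _ (Elin b b)) kz scalerA -expr2 subrr.
  exact: sub0.
Qed.

(** The iterates of z are linearly dependent in finite dimension; the first one with a nonzero
    coefficient is a combination of the later ones. This replaces the Fitting decomposition of N. *)
Lemma power_dep (N : F -> F) z : exists m d (c : 'I_d -> K),
  iter m N z = \sum_(i < d) c i *: iter (m + i.+1) N z.
Proof.
set n := (\dim (fullv : {vspace F})).+1.
pose X : n.-tuple F := [tuple iter i N z | i < n].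
have : ~~ free X.
  apply/negP => fX; have := dimvS (subvf <<X>>%VS).
  by rewrite (eqP fX) size_tuple /n ltnn.
rewrite freeNE => /existsP[i] h.
have /coord_span H : X`_i \in <<[tuple of drop i.+1 X]>>%VS by [].
exists i, (n - i.+1)%N, (fun j => coord [tuple of drop i.+1 X] j X`_i).
have XE (j : nat) : (j < n)%N -> X`_j = iter j N z.
  by move=> jn; rewrite -[j]/(val (Ordinal jn)) -tnth_nth tnth_mktuple.
rewrite -XE //; apply: (eq_trans H); apply: eq_bigr => j _; congr (_ *: _).
have -> : [tuple of drop i.+1 X]`_j = X`_(i.+1 + j) by rewrite -nth_drop.
rewrite XE ?addSnnS //; have := ltn_ord j; have := ltn_ord i; lia.
Qed.

(** A form of complete reducibility: a highest weight vector modulo a submodule lifts. Subtracting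
    an element of B makes z a generalized eigenvector of the Casimir operator, and raising it would
    create a highest weight vector with a different Casimir value in the same generalized
    eigenspace. *)
Lemma hw_lift (B : F -> Prop) k z : gl_stable B -> wv k z -> ~ B z -> raised B z ->
  exists y, [/\ wv k y, raised zeroP y & B (z - y)].
Proof.
move=> gB kz nB r; have [sB hB] := gB.
have dk := hw_dom gB kz nB r.
pose N x := casimir x - (wcas k)%:~R *: x.
have lN : linear N.
  by move=> c x y; rewrite /N casimir_lin scalerDr scalerA [_ * c]mulrC -scalerA opprD addrACA -scalerBr.
have NE a b x : E a b (N x) = N (E a b x).
  by rewrite /N (linB _ _ (Elin a b)) (linZ _ _ (Elin a b)) casimir_comm.
have NiE m a b x : E a b (iter m N x) = iter m N (E a b x).
  by elim: m => //= m <-; rewrite NE.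
have lNi m : linear (iter m N) by elim: m => // m IH c x y; rewrite !iterS IH lN.
have NB x : B x -> B (N x).
  move=> Bx; apply: (subB sB); last exact: (subZ sB).
  by apply: (sub_sum sB) => a _; apply: (sub_sum sB) => b _; apply: (hB); apply: (hB).
have NiB m : B (iter m.+1 N z).
  elim: m => [|m IH]; first exact: casimir_hw.
  by rewrite iterS; apply: NB.
have Niw m : wv k (iter m N z).
  by move=> a; rewrite NiE kz (linZ _ _ (lNi m)).
have [m [d [c Hc]]] := power_dep N z.
pose b := \sum_(i < d) c i *: iter i.+1 N z.
have Bb : B b by apply: (sub_sum sB) => i _; apply: (subZ sB); apply: NiB.
have wb : wv k b by apply: (sub_sum (wv_sub k)) => i _; apply: (subZ (wv_sub k)); apply: Niw.
have Nb : iter m N (z - b) = 0.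
  rewrite (linB _ _ (lNi m)) Hc (lin_sum _ _ _ (lNi m)) -sumrB big1 // => i _.
  by rewrite (linZ _ _ (lNi m)) -iterD subrr.
exists (z - b); split; first exact: (subB (wv_sub k)).
  2: by rewrite opprB addrC subrK.
move=> a a' aa; apply: contrapT => n0.
(* If the raised vector were nonzero, this submodule would contain a highest weight vector above k,
   on which N is a nonzero scalar by [wcas_lt] and yet nilpotent. *)
pose B0 x := B x /\ iter m N x = 0.
have gB0 : gl_stable B0.
  split; last by move=> a1 b1 x [h1 h2]; split; [apply: hB|rewrite -NiE h2 (lin0 (Elin a1 b1))].
  split; first by split; [apply: sub0|apply: (lin0 (lNi m))].
  move=> t x y [h1 h2] [h3 h4]; split; first exact: sB.2.
  by rewrite lNi h2 h4 scaler0 addr0.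
have B0y : B0 (E a a' (z - b)).
  split; last by rewrite -NiE Nb (lin0 (Elin a a')).
  by rewrite (linB _ _ (Elin a a')); apply: (subB sB); [apply: r|apply: hB].
have [k' [y [k'y [By Ny] y0 ry kk']]] := hw_above gB0 (wv_root a a' (subB (wv_sub k) kz wb)) n0 B0y.
have dk' : wdom k' by apply: (@hw_dom zeroP k' y zero_gl_stable).
have := wcas_lt dk dk' aa kk'; apply/negP/negPn.
have cE : casimir y = (wcas k')%:~R *: y.
  have := casimir_hw zero_gl_stable k'y ry; rewrite /zeroP => /eqP; rewrite subr_eq0 => /eqP //.
have NyE j : iter j N y = ((wcas k')%:~R - (wcas k)%:~R) ^+ j *: y.
  elim: j => [|j IH]; first by rewrite expr0 scale1r.
  by rewrite iterS IH (linZ _ _ lN) /N cE -scalerBl scalerA -exprSr.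
move: Ny; rewrite NyE => /eqP; rewrite scaler_eq0 => /orP[|/eqP //].
by rewrite expf_eq0 -rmorphB intr_eq0_char0 // subr_eq0 eq_sym => /andP[].
Qed.

Definition lowered (Q : F -> Prop) := subspace Q /\
  forall (a b : 'I_g) x, (a < b)%N -> Q x -> Q (E b a x).

(** Modulo B, lowering operators alone generate the submodule spanned by a highest weight vector:
    raising operators can be commuted to the right until they hit it. *)
Lemma lowered_gl_stable (B : F -> Prop) k y : gl_stable B -> wv k y -> raised B y ->
  gl_stable (fun u => forall Q, lowered Q -> Q y -> (forall x, B x -> Q x) -> Q u).
Proof.
move=> [sB hB] ky r; set Low := (fun u => _).
have sL : subspace Low.
  split=> [Q [sQ _] _ _|c x z hx hz Q lQ Qy QB]; first exact: sub0.
  by apply: lQ.1.2; [apply: hx|apply: hz].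
have LE (a b : 'I_g) u : (a < b)%N -> Low u -> Low (E b a u).
  by move=> ab hu Q lQ Qy QB; apply: lQ.2 => //; apply: hu.
have Ly : Low y by move=> Q _ Qy _.
have LB u : B u -> Low u by move=> Bu Q _ _; apply.
split=> // a b x Lx.
suff [_] : Low x /\ forall a b, Low (E a b x) by apply.
apply: (Lx (fun u => Low u /\ forall a b, Low (E a b u))) => [||u Bu].
- split; first split=> [|c u w [h1 h2] [h3 h4]].
  + by split=> [|a1 b1]; rewrite ?(lin0 (Elin a1 b1)); apply: sub0.
  + by split=> [|a1 b1]; rewrite ?Elin; apply: sL.2.
  move=> c d u cd [Lu Lu']; split; first exact: LE.
  move=> a1 b1; rewrite Egl.2; apply: (subD sL); first exact: LE.
  by apply: (subB sL); apply: (subZ sL).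
- split=> // a1 b1; case: (ltngtP a1 b1) => [ab|ba|/val_inj ->].
  + by apply: LB; apply: r.
  + exact: LE.
  + by rewrite ky; apply: (subZ sL).
- by split=> [|a1 b1]; apply: LB => //; apply: hB.
Qed.

(** A highest weight vector of the dual, in functional form: it vanishes on everything that has been
    lowered. Such functionals pull back along equivariant maps, and so certify the existence of
    highest weight vectors. *)
Definition colowest k (phi : F -> K) := (forall c x y, phi (c *: x + y) = c * phi x + phi y) /\
  (forall (a b : 'I_g) x, (a < b)%N -> phi (E b a x) = 0) /\
  (forall a x, phi (E a a x) = (k a)%:~R * phi x).

Lemma colowest_wt k phi k' x : colowest k phi -> wv k' x -> phi x != 0 -> k' = k.
Proof.
move=> [ph1 [_ ph2]] kx px; apply/ffunP=> a.
have ph0 : phi 0 = 0 by have := ph1 (-1) 0 0; rewrite scaler0 addr0 mulN1r addNr.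
apply: (@intr_inj_char0 K charK); have := ph2 a x; rewrite kx.
by have := ph1 (k' a)%:~R x 0; rewrite addr0 ph0 addr0 => -> /(mulIf px).
Qed.

(** Take a highest weight vector y modulo B, the largest submodule in the kernel of phi. If phi(y)
    were 0, phi would vanish on the submodule generated by y, which then would lie in B. A lift of y
    by [hw_lift] has the same value under phi. *)
Lemma colowest_hw k phi z : colowest k phi -> phi z != 0 ->
  exists y, [/\ wv k y, raised zeroP y & phi y != 0].
Proof.
move=> cphi pz; have [ph1 [ph2 ph3]] := cphi.
have ph0 : phi 0 = 0 by have := ph1 (-1) 0 0; rewrite scaler0 addr0 mulN1r addNr.
pose B y := forall w : seq ('I_g * 'I_g), phi (foldr (fun p => E p.1 p.2) y w) = 0.
have fl w : linear (fun y => foldr (fun p => E p.1 p.2) y w).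
  by elim: w => //= p w IH c x y; rewrite IH Elin.
have gB : gl_stable B.
  split; last by move=> a b x Bx w; have := Bx (rcons w (a, b)); rewrite foldr_rcons.
  split=> [w|c x y Bx By w]; first by rewrite (lin0 (fl w)).
  by rewrite fl ph1 Bx By mulr0 addr0.
have gT : gl_stable (fun=> True) by [].
have nB : ~ B z by move=> /(_ [::]) /= /eqP; rewrite (negbTE pz).
have [k' [y [k'y _ nBy r]]] := hw_mod gB gT I nB.
have py : phi y != 0.
  apply/eqP => py; apply: nBy => w.
  have gL := lowered_gl_stable gB k'y r.
  have phL u : (forall Q, lowered Q -> Q y -> (forall x, B x -> Q x) -> Q u) -> phi u = 0.
    move=> H; apply: (H (fun u => phi u = 0)) => // [|x /(_ [::])//].
    split; last by move=> a b x ab _; apply: ph2.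
    by split=> // c x t hx ht; rewrite ph1 hx ht mulr0 addr0.
  apply: phL; elim: w => [|p w IH] /=; first by move=> Q _.
  exact: gL.2.
have E' := colowest_wt cphi k'y py; rewrite E' in k'y.
have [y' [ky' ry' By']] := hw_lift gB k'y nBy r.
exists y'; split=> //; have := By' [::] => /= h.
have : phi y = phi (1 *: (y - y') + y') by rewrite scale1r subrK.
by rewrite ph1 h mulr0 add0r => <-.
Qed.

End GlModule.

Section WeightSpan.
Variables (K : fieldType) (g : nat) (F : vectType K) (E : 'I_g -> 'I_g -> F -> F).
Notation wt := {ffun 'I_g -> int}.

Definition wtsum (p : wt -> Prop) (u : F) := exists r (ks : 'I_r -> wt) (xs : 'I_r -> F),
  (forall i, wv E (ks i) (xs i) /\ p (ks i)) /\ u = \sum_i xs i.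

Hypothesis Egl : gl_action E.

Lemma wtsum1 (p : wt -> Prop) k x : wv E k x -> p k -> wtsum p x.
Proof. by move=> kx pk; exists 1%N, (fun=> k), (fun=> x); rewrite big_ord1. Qed.

Lemma wtsum_sub p : subspace (wtsum p).
Proof.
split=> [|c x y [r [ks [xs [H ->]]]] [r' [ks' [xs' [H' ->]]]]].
  by exists 0%N, (fun=> 0), (fun=> 0); rewrite big_ord0; split=> // -[].
exists (r + r')%N, (fun i => match split i with inl j => ks j | inr j => ks' j end),
   (fun i => match split i with inl j => c *: xs j | inr j => xs' j end); split.
  move=> i; case: (split i) => j; last exact: H'.
  by split; [apply: (subZ (wv_sub Egl _)); exact: (H j).1 | exact: (H j).2].
rewrite big_split_ord scaler_sumr; congr (_ + _); apply: eq_bigr => j _.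
  by rewrite (unsplitK (inl j)).
by rewrite (unsplitK (inr j)).
Qed.

Lemma wtsum_spanned p : (forall u, wtsum p u) -> weight_spanned_in E p.
Proof.
move=> H; pose b := vbasis (fullv : {vspace F}).
have [r Hr] := choice (fun i : 'I_(\dim (fullv : {vspace F})) => H b`_i).
have {}Hr (i : 'I_(\dim (fullv : {vspace F}))) : exists q : ('I_(r i) -> wt) * ('I_(r i) -> F),
   (forall j, wv E (q.1 j) (q.2 j) /\ p (q.1 j)) /\ b`_i = \sum_j q.2 j.
  by have [ks [xs h]] := Hr i; exists (ks, xs).
have {}Hr : forall i : 'I_(\dim (fullv : {vspace F})), {q : ('I_(r i) -> wt) * ('I_(r i) -> F) |
   (forall j, wv E (q.1 j) (q.2 j) /\ p (q.1 j)) /\ b`_i = \sum_j q.2 j}.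
  by move=> i; apply: cid.
pose T := {i : 'I_(\dim (fullv : {vspace F})) & 'I_(r i)}.
pose fk (t : T) := (sval (Hr (tag t))).1 (tagged t).
pose fx (t : T) := (sval (Hr (tag t))).2 (tagged t).
exists #|{: T}|, (fun i => fx (enum_val i)), (fun i => fk (enum_val i)); split.
  by move=> i; apply: (svalP (Hr (tag (enum_val i)))).1.
move=> x; exists (fun i => coord b (tag (enum_val i)) x).
rewrite -(big_enum_val (fun t : T => coord b (tag t) x *: fx t)) /=.
have := sig_big_dep (op := +%R) (idx := 0) xpredT (fun i (j : 'I_(r i)) => true)
  (fun i j => coord b i x *: (sval (Hr i)).2 j) => /= <-.
rewrite {1}(coord_vbasis (memvf x)); apply: eq_bigr => i _.
by rewrite -scaler_sumr -(svalP (Hr i)).2.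
Qed.
End WeightSpan.

(** * Irreducible highest weight modules given by matrices *)

Section HWModule.
Variables (K : fieldType) (g : nat).
Hypothesis charK : [pchar K] =i pred0.
Notation wt := {ffun 'I_g -> int}.

Section One.
Variables (n : nat) (e : 'I_g -> 'I_g -> 'M[K]_n) (lam : wt) (v : 'cV[K]_n).
Definition mact : 'I_g -> 'I_g -> 'cV[K]_n -> 'cV[K]_n := fun a b u => e a b *m u.

Definition glmx := forall a b c d,
  e a b *m e c d = e c d *m e a b + ((b == c)%:R *: e a d - (d == a)%:R *: e c b).

(** Irreducibility is stated as: a nonzero vector of a submodule forces the submodule to be
    everything. *)
Definition hwm := [/\ glmx, v <> 0, wv mact lam v, raised mact (@zeroP _ _) v
  & forall B, gl_stable mact B -> forall u, B u -> u <> 0 -> forall w, B w].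

Hypothesis H : hwm.

Lemma mact_gl : gl_action mact.
Proof.
have [br _ _ _ _] := H; split; first by move=> a b c x y; rewrite /mact mulmxDr scalemxAr.
by move=> a b c d x; rewrite /mact !mulmxA br mulmxDl mulmxBl -!scalemxAl.
Qed.

Lemma hw_gen Q : lowered mact Q -> Q v -> forall u, Q u.
Proof.
have [_ v0 kv rv irr] := H; move=> lQ Qv u.
have gL := lowered_gl_stable mact_gl (zero_gl_stable mact_gl) kv rv.
by apply: (irr _ gL v) => // x ->; apply: sub0 lQ.1.
Qed.

Lemma wle_anti (k k' : wt) : wle k k' -> wle k' k -> k = k'.
Proof.
move=> [h1 _] [h2 _]; have ps r : psum k r = psum k' r by apply/eqP; rewrite eq_le h1 h2.
apply/ffunP=> a; have S (h : wt) : psum h a.+1 = psum h a + h a.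
  rewrite /psum (bigID (fun b : 'I_g => (b < a)%N)) /=; congr (_ + _).
    by apply: eq_bigl => b; rewrite ltnS; case: (ltngtP b a).
  by rewrite (big_pred1 a) // => b /=; rewrite ltnS -leqNgt -(inj_eq val_inj) eqn_leq.
by have := S k; rewrite (ps a) (ps a.+1) (S k') => /addrI.
Qed.

Definition wlt (k : wt) := wle k lam /\ k <> lam.

Lemma wlt_lower k (a b : 'I_g) : (a < b)%N -> wle k lam -> wlt (wroot k b a).
Proof.
move=> ab kl; have h : wle (wroot k b a) k.
  have := wle_wroot (wroot k b a) ab; suff -> : wroot (wroot k b a) a b = k by [].
  by apply/ffunP=> c; rewrite !ffunE; ring.
split; first exact: wle_trans kl.
move=> E; move: h; rewrite E => lk; have := wle_anti lk kl => /esym Ek.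
have := congr1 (fun h : wt => h a) E; rewrite Ek ffunE eqxx.
have -> : (a == b) = false by apply/eqP => h; rewrite h ltnn in ab.
by rewrite addr0 => /eqP; rewrite -subr_eq0 addrAC subrr add0r.
Qed.

(** The set of vectors of this form contains v and is stable under lowering, and v generates the
    module by lowering operators alone. *)
Lemma V_decomp u : exists c, wtsum mact wlt (u - c *: v).
Proof.
have [_ v0 kv rv irr] := H.
have sW := wtsum_sub mact_gl wlt.
apply: (hw_gen (Q := fun u => exists c, wtsum mact wlt (u - c *: v))); last first.
  by exists 1; rewrite scale1r subrr; apply: sub0 sW.
have lE := mact_gl.1.
split=> [|a b x ab [c [r [ks [xs [Hx xE]]]]]].
  split; first by exists 0; rewrite scale0r subr0; apply: sub0 sW.
  move=> a x y [c hc] [c' hc']; exists (a * c + c').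
  have -> : a *: x + y - (a * c + c') *: v = a *: (x - c *: v) + (y - c' *: v).
    by rewrite scalerBr scalerA scalerDl opprD addrACA.
  exact: sW.2.
exists 0; rewrite scale0r subr0 -(subrK (c *: v) x) (linD _ _ (lE b a)) xE (lin_sum _ _ _ (lE b a)).
rewrite (linZ _ _ (lE b a)); apply: (subD sW).
  apply: (sub_sum sW) => i _; apply: (wtsum1 (wv_root mact_gl b a (Hx i).1)).
  exact: wlt_lower ab (Hx i).2.1.
apply: (subZ sW); apply: (wtsum1 (wv_root mact_gl b a kv)).
by apply: wlt_lower ab _; apply: wle_refl.
Qed.

Lemma V_spanned : weight_spanned_in mact (fun k => wle k lam).
Proof.
have [_ v0 kv rv irr] := H.
apply: (wtsum_spanned) => u; have sW := wtsum_sub mact_gl (fun k => wle k lam).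
have [c [r [ks [xs [Hx E]]]]] := V_decomp u; rewrite -(subrK (c *: v) u) E.
apply: (subD sW); last by apply: (subZ sW); apply: (wtsum1 kv); apply: wle_refl.
by apply: (sub_sum sW) => i _; apply: (wtsum1 (Hx i).1); exact: (Hx i).2.1.
Qed.

Lemma V_ws : weight_spanned mact.
Proof.
have [r [bs [ws [h1 h2]]]] := V_spanned; exists r, bs, ws; split=> // i.
by split=> //; exact: (h1 i).1.
Qed.

Lemma V_wle k u : wv mact k u -> u <> 0 -> wle k lam.
Proof. exact: (wv_in charK mact_gl V_spanned). Qed.

Lemma wtsum_nolam u : wtsum mact wlt u -> wv mact lam u -> u = 0.
Proof.
move=> [r [ks [xs [Hx uE]]]] ku.
pose kk := undup (codom ks).
have u2 : u = \sum_(k <- kk) \sum_(i | ks i == k) xs i.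
  rewrite uE (exchange_big_dep xpredT) //=; apply: eq_bigr => i _.
  rewrite -big_filter (_ : [seq _ <- _ | _] = [:: ks i]) ?big_seq1 //.
  rewrite (eq_filter (a2 := pred1 (ks i))) => [|k /=]; last by rewrite eq_sym.
  by rewrite filter_pred1_uniq ?undup_uniq // mem_undup codom_f.
have nl : lam \notin kk.
  by rewrite mem_undup; apply/negP => /codomP[i Ei]; apply: (Hx i).2.2.
pose f k := if k == lam then - u else \sum_(i | ks i == k) xs i.
have := @wv_comp _ _ _ _ charK mact_gl (@zeroP _ _) (lam :: kk) f (zero_gl_stable mact_gl).1.
move=> /(_ (fun a => (zero_gl_stable mact_gl).2 a a)); rewrite /= nl undup_uniq => /(_ isT) h.
have : zeroP (f lam).
  apply: h; last by rewrite inE eqxx.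
    move=> k _; rewrite /f; case: eqP => [->|_]; first exact: (subN (wv_sub mact_gl _)).
    by apply: (sub_sum (wv_sub mact_gl k)) => i /eqP <-; exact: (Hx i).1.
  rewrite big_cons {1}/f eqxx big_seq (eq_bigr (fun k => \sum_(i | ks i == k) xs i)) => [|k kk'].
    by rewrite -big_seq -u2 /zeroP addNr.
  by rewrite /f; case: eqP => // E; rewrite -E kk' in nl.
by rewrite /f eqxx /zeroP => /eqP; rewrite oppr_eq0 => /eqP.
Qed.

Lemma V_lam u : wv mact lam u -> exists c, u = c *: v.
Proof.
have [_ v0 kv rv irr] := H; move=> ku; have [c hc] := V_decomp u; exists c.
apply/eqP; rewrite -subr_eq0; apply/eqP; apply: wtsum_nolam => //.
by apply: (subB (wv_sub mact_gl lam)) => //; apply: (subZ (wv_sub mact_gl lam)).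
Qed.

(** xi is the coefficient of v in the decomposition of the module into the line of v and the lower
    weights; it is well defined since a multiple of v that is a sum of lower weight vectors
    vanishes. *)
Lemma xi_exists : exists xi : 'rV[K]_n, [/\ (xi *m v) 0 0 = 1,
  forall (a b : 'I_g), (a < b)%N -> xi *m e b a = 0
  & forall a, xi *m e a a = (lam a)%:~R *: xi].
Proof.
have [_ v0 kv rv irr] := H; have sW := wtsum_sub mact_gl wlt.
have uniq_c c : wtsum mact wlt (c *: v) -> c = 0.
  move=> h; have := wtsum_nolam h (subZ (wv_sub mact_gl lam) c kv) => /eqP.
  by rewrite scaler_eq0 => /orP[/eqP //|/eqP].
pose c u := sval (cid (V_decomp u)).
have cP u : wtsum mact wlt (u - c u *: v) by exact: (svalP (cid (V_decomp u))).
have cE u d : wtsum mact wlt (u - d *: v) -> c u = d.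
  move=> h; apply/eqP; rewrite -subr_eq0; apply/eqP; apply: uniq_c.
  have -> : (c u - d) *: v = (u - d *: v) - (u - c u *: v).
    by rewrite opprB [RHS]addrC addrA subrK scalerBl.
  have h2 := subB sW h (cP u); exact: h2.
have lc a x y : c (a *: x + y) = a * c x + c y.
  apply: cE; have -> : a *: x + y - (a * c x + c y) *: v = a *: (x - c x *: v) + (y - c y *: v).
    by rewrite scalerBr scalerA scalerDl opprD addrACA.
  by apply: sW.2; apply: cP.
pose xi : 'rV[K]_n := \row_i c (delta_mx i 0).
have c0 : c 0 = 0 by have := lc (-1) 0 0; rewrite scaler0 addr0 mulN1r addNr.
have xiE u : (xi *m u) 0 0 = c u.
  rewrite mxE {2}(matrix_sum_delta u).
  have cs (I : finType) (G : I -> 'cV[K]_n) : c (\sum_i G i) = \sum_i c (G i).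
    by apply: (big_morph c) => // x y; have := lc 1 x y; rewrite scale1r mul1r.
  rewrite cs; apply: eq_bigr => i _; rewrite big_ord1 mxE mulrC.
  by have := lc (u i 0) (delta_mx i 0) 0; rewrite !addr0 c0 addr0.
have xi_low u : wtsum mact wlt u -> c u = 0.
  by move=> h; apply: cE; rewrite scale0r subr0.
have xi0 (X : 'M[K]_n) (d : K) : (forall u, c (X *m u) = d * c u) -> xi *m X = d *: xi.
  move=> h; apply/matrixP=> i j; rewrite ord1.
  have -> : (xi *m X) 0 j = (xi *m (X *m (delta_mx j 0 : 'cV[K]_n))) 0 0.
    by rewrite mulmxA -colE [RHS]mxE.
  by rewrite xiE h !mxE.
exists xi; split.
- by rewrite xiE; apply: cE; rewrite scale1r subrr; apply: sub0.
- move=> a b ab; rewrite (xi0 _ 0) ?scale0r // => u; rewrite mul0r; apply: xi_low.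
  have [r [ks [xs [Hx E]]]] := cP u; have lE := mact_gl.1 b a.
  rewrite -[e b a *m u]/(mact b a u) -(subrK (c u *: v) u) (linD _ _ lE) E (lin_sum _ _ _ lE).
  rewrite (linZ _ _ lE); apply: (subD sW).
    apply: (sub_sum sW) => i _; apply: (wtsum1 (wv_root mact_gl b a (Hx i).1)).
    exact: wlt_lower ab (Hx i).2.1.
  apply: (subZ sW); apply: (wtsum1 (wv_root mact_gl b a kv)).
  by apply: wlt_lower ab _; apply: wle_refl.
- move=> a; apply: xi0 => u; apply: cE.
  have [r [ks [xs [Hx E]]]] := cP u; have lE := mact_gl.1 a a.
  rewrite mulrC -scalerA -kv -(linZ _ _ lE) -[e a a *m u]/(mact a a u) -(linB _ _ lE) E (lin_sum _ _ _ lE).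
  apply: (sub_sum sW) => i _; rewrite (Hx i).1; apply: (subZ sW).
  by apply: (wtsum1 (Hx i).1); exact: (Hx i).2.
Qed.

Variable xi : 'rV[K]_n.
Definition is_xi := [/\ (xi *m v) 0 0 = 1,
  forall (a b : 'I_g), (a < b)%N -> xi *m e b a = 0
  & forall a, xi *m e a a = (lam a)%:~R *: xi].
Hypothesis Hxi : is_xi.

(** A nonzero subspace stable under the upper triangular part contains a highest weight vector.
    Irreducibility forces its weight to be lam, so it is a multiple of v, on which xi does not
    vanish. *)
Lemma xi_nondeg (R : 'cV[K]_n -> Prop) : subspace R ->
  (forall (a b : 'I_g) x, (a <= b)%N -> R x -> R (e a b *m x)) ->
  (forall x, R x -> xi *m x = 0) -> forall u, R u -> u = 0.
Proof.
have [_ v0 kv rv irr] := H; have [xv _ _] := Hxi.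
move=> sR hR R0 u Ru; apply: contrapT => u0.
have [k [y [ky Ry y0]]] : exists k y, [/\ wv mact k y, R y & y <> 0].
  apply: (wv_split charK mact_gl V_ws (B := @zeroP _ _) _ sR _ Ru u0).
    exact: (zero_gl_stable mact_gl).1.
  by move=> a x Rx; apply: hR.
pose Qm k x := [/\ wv mact k x, R x & x <> 0].
have Qr k1 x (a b : 'I_g) : (a < b)%N -> Qm k1 x -> ~ zeroP (mact a b x) ->
    Qm (wroot k1 a b) (mact a b x).
  move=> ab [h1 h2 h3] h4; split=> //; first exact: (wv_root mact_gl a b h1).
  by apply: hR => //; apply: ltnW.
have Qw k1 x : Qm k1 x -> wv mact k1 x /\ ~ zeroP x by move=> [].
have [k' [y' [[k'y Ry' y0'] kk' r]]] :=
  @raising_ind _ _ _ _ charK mact_gl V_ws Qm (@zeroP _ _) erefl Qr Qw _ _ (And3 ky Ry y0).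
have gL := lowered_gl_stable mact_gl (zero_gl_stable mact_gl) k'y r.
have Lv : forall Q, lowered mact Q -> Q y' -> (forall x, zeroP x -> Q x) -> Q v.
  by apply: (irr _ gL y').
have lk : weight_spanned_in mact (fun k => wle k k') .
  apply: wtsum_spanned => w; have sW := wtsum_sub mact_gl (fun k => wle k k').
  have gLw : forall Q, lowered mact Q -> Q y' -> (forall x, zeroP x -> Q x) -> Q w.
    by apply: (irr _ gL y').
  apply: gLw; last by move=> x ->; apply: sub0.
    split=> // a b x ab [r0 [ks [xs [Hx ->]]]]; rewrite (lin_sum _ _ _ (mact_gl.1 b a)).
    apply: (sub_sum sW) => i _; apply: (wtsum1 (wv_root mact_gl _ _ (Hx i).1)).
    apply: wle_trans (Hx i).2; have := wle_wroot (wroot (ks i) b a) ab.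
    suff -> : wroot (wroot (ks i) b a) a b = ks i by [].
    by apply/ffunP=> c; rewrite !ffunE; ring.
  by apply: (wtsum1 k'y); apply: wle_refl.
have Ek : k' = lam.
  by apply: wle_anti; [apply: V_wle k'y y0'|apply: (wv_in charK mact_gl lk kv v0)].
rewrite Ek in k'y; have [c yE] := V_lam k'y.
have := R0 _ Ry'; rewrite yE -scalemxAr => /(congr1 (fun M : 'M_1 => M 0 0)); rewrite !mxE.
rewrite mxE in xv; rewrite xv mulr1 => c0; apply: y0'; by rewrite yE c0 scale0r.
Qed.

End One.
End HWModule.

(** * Highest weight vectors in an exterior algebra tensored with an irreducible module *)

Section Fock.
Variables (K : fieldType) (g : nat).
Hypothesis charK : [pchar K] =i pred0.
Notation wt := {ffun 'I_g -> int}.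
Notation F n := {ffun {set 'I_g} -> 'cV[K]_n}.

Definition pw n n' (B : 'M[K]_(n', n)) (x : F n) : F n' := [ffun I => B *m x I].

Lemma pw_lin n n' (B : 'M[K]_(n', n)) : linear (pw B).
Proof. by move=> a x y; apply/ffunP=> I; rewrite !ffunE mulmxDr scalemxAr. Qed.

Lemma iota_pw n n' (B : 'M[K]_(n', n)) a x : iota a (pw B x) = pw B (iota a x).
Proof. by apply/ffunP=> I; rewrite !ffunE; case: ifP => _; rewrite ?mulmx0 // scalemxAr. Qed.
Lemma eps_pw n n' (B : 'M[K]_(n', n)) a x : eps a (pw B x) = pw B (eps a x).
Proof. by apply/ffunP=> I; rewrite !ffunE; case: ifP => _; rewrite ?mulmx0 // ?ffunE scalemxAr. Qed.
Lemma pw_comp n n' n'' (B : 'M[K]_(n', n)) (B' : 'M[K]_(n'', n')) x : pw B' (pw B x) = pw (B' *m B) x.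
Proof. by apply/ffunP=> I; rewrite !ffunE mulmxA. Qed.
Lemma pwD n n' (B B' : 'M[K]_(n', n)) x : pw (B + B') x = pw B x + pw B' x.
Proof. by apply/ffunP=> I; rewrite !ffunE mulmxDl. Qed.
Lemma pwZ n n' (B : 'M[K]_(n', n)) c x : pw (c *: B) x = c *: pw B x.
Proof. by apply/ffunP=> I; rewrite !ffunE scalemxAl. Qed.

Lemma eps_iota_diag (X : lmodType K) a (x : {ffun {set 'I_g} -> X}) I :
  eps a (iota a x) I = (a \in I)%:R *: x I.
Proof.
rewrite ffunE; case: ifP => aI; last by rewrite scale0r.
by rewrite ffunE !inE eqxx /= setD1K // sgD1_eq scalerA sgK scale1r.
Qed.

Lemma eps_iota_br (X : lmodType K) a b c d (x : {ffun {set 'I_g} -> X}) :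
  eps b (iota a (eps d (iota c x))) = eps d (iota c (eps b (iota a x))) +
   ((d == a)%:R *: eps b (iota c x) - (b == c)%:R *: eps d (iota a x)).
Proof.
rewrite iota_eps (iota_eps c b) !linearB !linearZ /= [c == b]eq_sym [a == d]eq_sym.
have -> : eps b (eps d (iota a (iota c x))) = eps d (eps b (iota c (iota a x))).
  by rewrite iotaC !linearN /= epsC opprK.
by rewrite scalerN [RHS]addrC [RHS]addrA subrK.
Qed.

Definition wsub (k : wt) (I : {set 'I_g}) : wt := [ffun a => k a - (a \in I)%:R].

Section OneModule.
Variables (n : nat) (e : 'I_g -> 'I_g -> 'M[K]_n).

(** The exterior factor carries the dual of the standard representation: E_ab acts on it by -eps_b
    iota_a, so e_I has weight -1_I, whence [wsub]. *)
Definition Fa a b (x : F n) : F n := pw (e a b) x - eps b (iota a x).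

Lemma Fa_at a b x I : Fa a b x I = e a b *m x I - eps b (iota a x) I.
Proof. by rewrite [LHS]ffunE [pw _ _ _]ffunE [X in _ + X = _]ffunE. Qed.

Lemma Fa_at0 a b x : Fa a b x set0 = e a b *m x set0.
Proof. by rewrite Fa_at [eps _ _ _]ffunE inE subr0. Qed.

Lemma Fa_diag a x I : Fa a a x I = e a a *m x I - (a \in I)%:R *: x I.
Proof. by rewrite Fa_at eps_iota_diag. Qed.

Lemma Fa_lin a b : linear (Fa a b).
Proof.
move=> c x y; have h : eps b (iota a (c *: x + y)) = c *: eps b (iota a x) + eps b (iota a y) by rewrite !linearP.
by rewrite /Fa pw_lin h scalerBr opprD addrACA.
Qed.

Lemma Fa_iota a b c x : Fa a b (iota c x) = iota c (Fa a b x) + (b == c)%:R *: iota a x.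
Proof.
rewrite /Fa linearB /= iota_pw iota_eps [c == b]eq_sym.
by rewrite [iota a (iota c x)]iotaC [eps b (- _)]linearN opprK opprB addrA subrK.
Qed.

Lemma Fa_gl : glmx e -> gl_action Fa.
Proof.
move=> br; split; first exact: Fa_lin.
move=> a b c d x; rewrite /Fa (linB _ _ (pw_lin (e a b))) (linB _ _ (pw_lin (e c d))) !pw_comp.
rewrite !linearB /= !iota_pw !eps_pw eps_iota_br br pwD.
have -> : pw ((b == c)%:R *: e a d - (d == a)%:R *: e c b) x =
  (b == c)%:R *: pw (e a d) x - (d == a)%:R *: pw (e c b) x.
  by rewrite -!pwZ; apply/ffunP=> I; rewrite !ffunE mulmxBl.
move: (pw (e a b) (eps d _)) (pw (e c d) (eps b _)) (pw (_ *m _) x) => p q r.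
move: (eps d (iota c (eps b _))) => s.
move: (eps b (iota c x)) (eps d (iota a x)) (pw (e a d) x) (pw (e c b) x) => z w t u.
by rewrite !opprK !addrA [LHS](ACl (1*5*4*6*2*8*3*7)%AC).
Qed.

Lemma wv_ebas k I u : wv (mact e) k u -> wv Fa (wsub k I) (ebas I u).
Proof.
move=> ku a; apply/ffunP=> S; rewrite Fa_diag !ffunE -scalemxAr; have:= ku a; rewrite /mact => ->.
case: eqP => [->|_]; rewrite ?scale0r ?scaler0 ?subr0 ?scale1r // -scalerBl.
by rewrite rmorphB /= rmorph_nat.
Qed.

Lemma ebas_sum (x : F n) : x = \sum_I ebas I (x I).
Proof.
apply/ffunP=> S; rewrite sum_ffunE (bigD1 S) //= ffunE eqxx scale1r big1 ?addr0 // => I /negPf IS.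
by rewrite ffunE eq_sym IS scale0r.
Qed.

Lemma ebas_lin I : linear (@ebas K g n I).
Proof. by move=> a x y; apply/ffunP=> S; rewrite !ffunE scalerDr !scalerA mulrC. Qed.

Lemma eps_ebas (a : 'I_g) I (u : 'cV[K]_n) : exists c I', eps a (ebas I u) = c *: ebas I' u.
Proof.
case aI: (a \in I); [exists 0, I | exists (sg K a I), (a |: I)]; apply/ffunP=> S; rewrite !ffunE; case: ifP => aS.
- by case: eqP => [h|]; rewrite ?scale0r ?scaler0 //; move: aI; rewrite -h !inE eqxx.
- by rewrite scale0r.
- case: eqP => [h|h]; case: eqP => h' //; rewrite ?scale0r ?scaler0 //.
  + by rewrite h' sgU1_eq.
  + by case: h'; rewrite -h setD1K.
  + by case: h; rewrite h' setU1K // aI.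
by case: eqP => [h|]; rewrite ?scale0r ?scaler0 //; move: aS; rewrite h !inE eqxx.
Qed.

Lemma iota_ebas (a : 'I_g) I (u : 'cV[K]_n) : exists c I', iota a (ebas I u) = c *: ebas I' u.
Proof.
case aI: (a \in I); [exists (sg K a I), (I :\ a)|exists 0, I]; apply/ffunP=> S; rewrite !ffunE; case: ifP => aS.
- by case: eqP => [h|]; rewrite ?scale0r ?scaler0 //; move: aS; rewrite h !inE eqxx.
- case: eqP => [h|h]; case: eqP => h' //; rewrite ?scale0r ?scaler0 //.
  + by rewrite h' sgD1_eq.
  + by case: h'; rewrite -h setU1K // aS.
  + by case: h; rewrite h' setD1K.
- by rewrite scale0r.
by case: eqP => [h|]; rewrite ?scale0r ?scaler0 //; move: aI; rewrite -h !inE eqxx.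
Qed.

End OneModule.

Section HW.
Variables (n : nat) (e : 'I_g -> 'I_g -> 'M[K]_n) (lam : wt) (v : 'cV[K]_n) (xi : 'rV[K]_n).
Hypotheses (H : hwm e lam v) (Hxi : is_xi e lam v xi).
Notation E := (Fa e).

Lemma FE_gl : gl_action E. Proof. by apply: Fa_gl; case: H. Qed.

Lemma F_spanned : weight_spanned_in E (fun k => exists I k', wle k' lam /\ k = wsub k' I).
Proof.
apply: wtsum_spanned => x; rewrite (ebas_sum x).
have sW := wtsum_sub FE_gl (fun k => exists I k', wle k' lam /\ k = wsub k' I).
apply: sub_sum => // I _; have [r [bs [ws [h1 h2]]]] := V_spanned H.
have [c ->] := h2 (x I); rewrite (lin_sum _ _ _ (ebas_lin I)).
apply: sub_sum => // i _; rewrite (linZ _ _ (ebas_lin I)); apply: (subZ sW).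
apply: wtsum1 (wv_ebas I (h1 i).1) _; exists I, (ws i); split=> //; exact: (h1 i).2.
Qed.

Lemma F_ws : weight_spanned E.
Proof. by have [r [bs [ws [h1 h2]]]] := F_spanned; exists r, bs, ws; split=> // i; split=> //; case: (h1 i). Qed.

Definition hwv k (x : F n) := [/\ wv E k x, raised E (@zeroP _ _) x & x <> 0].

(** The coordinates of a highest weight vector span a subspace stable under the upper triangular
    operators, so by [xi_nondeg] xi cannot vanish on all of them. *)
Lemma xi_ne k x : hwv k x -> exists J, (xi *m x J) 0 0 != 0.
Proof.
case=> kx rx x0; apply: contrapT => h; apply: x0.
have xx J : (xi *m x J) 0 0 = 0.
  by apply/eqP; apply: contrapT => /negP h'; apply: h; exists J.
have xx' J : xi *m x J = 0 by apply/matrixP=> i j; rewrite !ord1 xx mxE.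
(* The equations E_ab x = 0 express e_ab x_I through another coordinate of x, and the weight
   equations do the same for a = b; this is the stability of R. *)
pose R u := exists c : {set 'I_g} -> K, u = \sum_I c I *: x I.
have sR : subspace R.
  split; first by exists (fun=> 0); rewrite big1 // => I _; rewrite scale0r.
  move=> a y z [c ->] [c' ->]; exists (fun I => a * c I + c' I).
  by rewrite scaler_sumr -big_split; apply: eq_bigr => I _; rewrite /= scalerDl scalerA.
have Rx I c : R (c *: x I).
  exists (fun I' => if I' == I then c else 0); rewrite (bigD1 I) //= eqxx big1 ?addr0 //.
  by move=> J /negPf ->; rewrite scale0r.
have Rs (a b : 'I_g) y : (a <= b)%N -> R y -> R (e a b *m y).
  move=> ab [c ->]; rewrite mulmx_sumr; apply: sub_sum => // I _; rewrite -scalemxAr; apply: (subZ sR).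
  move: ab; rewrite leq_eqVlt => /orP[/eqP ab|ab].
    have <- : a = b by apply: val_inj.
    move: (kx a) => /ffunP /(_ I); rewrite Fa_diag [RHS]ffunE => /eqP; rewrite subr_eq -scalerDl => /eqP ->.
    exact: Rx.
  move: (rx a b ab) => /ffunP /(_ I); rewrite Fa_at [RHS]ffunE => /eqP; rewrite subr_eq0 => /eqP ->.
  rewrite ffunE; case: ifP => _; last by exists (fun=> 0); rewrite big1 // => J _; rewrite scale0r.
  rewrite ffunE; case: ifP => _; last by rewrite scalerA; apply: Rx.
  by rewrite scaler0; exists (fun=> 0); rewrite big1 // => J _; rewrite scale0r.
have R0 y : R y -> xi *m y = 0.
  by case=> c ->; rewrite mulmx_sumr big1 // => I _; rewrite -scalemxAr xx' scaler0.
apply/ffunP=> I; rewrite ffunE -[LHS]scale1r; exact: (xi_nondeg charK H Hxi sR Rs R0 (Rx I 1)).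
Qed.

(** Apply xi to the J-coordinate of the weight equation: xi has weight lam and e_J contributes
    -1_J. *)
Lemma hw_at k x J : wv E k x -> (xi *m x J) 0 0 != 0 -> k = wsub lam J.
Proof.
move=> kx h; apply/ffunP=> a; rewrite ffunE; apply: (intr_inj_char0 charK).
move: (kx a) => /ffunP /(_ J); rewrite Fa_diag [RHS]ffunE => /(congr1 (mulmx xi)) /matrixP /(_ 0 0).
case: Hxi => _ _ /(_ a) xa; rewrite mulmxBr mulmxA xa -!scalemxAr -scalemxAl -scalerBl.
set w := xi *m x J in h *; rewrite [X in X = _ -> _]mxE [X in _ = X -> _]mxE.
by move/(mulIf h) => <-; rewrite rmorphB /= rmorph_nat.
Qed.

Lemma hw_type k x : hwv k x -> exists J, (xi *m x J) 0 0 != 0 /\ k = wsub lam J.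
Proof. by move=> h; have [J hJ] := xi_ne h; exists J; split=> //; apply: hw_at hJ; case: h. Qed.

Lemma wsub_inj k I J : wsub k I = wsub k J -> I = J.
Proof.
move=> /ffunP h; apply/setP=> a; move: (h a); rewrite !ffunE => /addrI /oppr_inj.
by case: (a \in I); case: (a \in J).
Qed.

Lemma hw_typeJ J x : hwv (wsub lam J) x -> (xi *m x J) 0 0 != 0.
Proof. by move=> h; have [J' [h1 /wsub_inj ->]] := hw_type h. Qed.

(** The multiplicity-free part of the Pieri rule: subtract the multiple of x for which xi vanishes
    at the coordinate J attached to the weight; what remains would be a highest weight vector
    contradicting [hw_typeJ]. *)
Lemma hw_unique k x y : hwv k x -> wv E k y -> raised E (@zeroP _ _) y -> exists c, y = c *: x.
Proof.
move=> hx ky ry; have [J [hJ kE]] := hw_type hx; case: (hx) => kx rx x0.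
exists ((xi *m y J) 0 0 / (xi *m x J) 0 0); set c := _ / _.
apply/eqP; rewrite -subr_eq0; apply/eqP; apply: contrapT => z0.
have hz : hwv k (y - c *: x).
  split=> // [|a b ab]; first by apply: (subB (wv_sub FE_gl k)) => //; apply: (subZ (wv_sub FE_gl k)).
  rewrite /zeroP (linB _ _ (Fa_lin e a b)) (linZ _ _ (Fa_lin e a b)) ry // rx //.
  by rewrite scaler0 subr0.
have:= hz; rewrite kE => /hw_typeJ; rewrite !ffunE mulmxBr -scalemxAr /c.
set w := xi *m x J in hJ *; set w' := xi *m y J.
by rewrite [X in X != 0]mxE [X in _ + X]mxE [X in _ - X]mxE mulfVK // subrr eqxx.
Qed.

Lemma iota_hw k x (a : 'I_g) : wv E k x -> raised E (@zeroP _ _) x -> (forall b : 'I_g, (b < a)%N -> iota b x = 0) ->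
  wv E [ffun c => k c + (c == a)%:R] (iota a x) /\ raised E (@zeroP _ _) (iota a x).
Proof.
move=> kx rx ax; split=> [c|b c bc].
  rewrite Fa_iota kx linearZ /= ffunE rmorphD /= scalerDl.
  by case: eqP => [->|_]; rewrite ?scale0r.
rewrite /zeroP Fa_iota rx // linear0 add0r; case: eqP => [cE|_]; rewrite ?scale0r // scale1r ax //.
by rewrite -cE.
Qed.

(** Contraction by the least index of J preserves highest weight vectors because contractions by
    smaller indices vanish. It is nonzero, since otherwise the coordinate at J would vanish. *)
Lemma hw_min J x (i : 'I_g) : hwv (wsub lam J) x -> i \in J -> (forall j : 'I_g, j \in J -> (i <= j)%N) ->
  hwv (wsub lam (J :\ i)) (iota i x).
Proof.
move=> hx iJ imin; case: (hx) => kx rx x0.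
(* For a below all of J, the contraction would be a highest weight vector whose weight exceeds lam
   at a, which no weight lam - 1_J' does. *)
have az : forall m (a : 'I_g), (a < m)%N -> (a < i)%N -> iota a x = 0.
  elim=> // m IH a am ai.
  have [|h1 h2] := @iota_hw _ x a kx rx.
    by move=> b ba; apply: IH; [apply: leq_trans ba _| apply: ltn_trans ba ai].
  apply: contrapT => h3; have [J' [_]] := hw_type (And3 h1 h2 h3).
  move/ffunP/(_ a); rewrite !ffunE eqxx; have aJ : a \notin J by apply/negP=> /imin; rewrite leqNgt ai.
  rewrite (negPf aJ) subr0 => /addrI; case: (a \in J') => //.
have [|h1 h2] := @iota_hw _ x i kx rx; first by move=> b bi; apply: (az b.+1).
have <- : [ffun c => wsub lam J c + (c == i)%:R] = wsub lam (J :\ i).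
  apply/ffunP=> c; rewrite !ffunE !inE; case: eqP => [->|_] /=; last by rewrite addr0.
  by rewrite iJ subrK subr0.
split=> // /ffunP /(_ (J :\ i)); rewrite !ffunE !inE eqxx /= setD1K // => h.
move: (hw_typeJ hx); have -> : x J = 0.
  by rewrite -[x J]scale1r -(sgK _ i (J :\ i)) -scalerA h scaler0.
by rewrite mulmx0 mxE eqxx.
Qed.

(** Removing the elements of J below r one at a time, from the least, keeps any property stable
    under contractions, in particular that of being a cycle. *)
Lemma hw_cut (T : F n -> Prop) J x r : (forall a y, T y -> T (iota a y)) -> hwv (wsub lam J) x -> T x ->
  exists2 y, hwv (wsub lam [set j in J | (r <= j)%N]) y & T y.
Proof.
move=> Ti; move: {2}(#|[set j in J | (j < r)%N]|) (leqnn #|[set j in J | (j < r)%N]|) => m.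
elim: m J x => [|m IH] J x Jm hx Tx.
  exists x => //; suff -> : [set j in J | (r <= j)%N] = J by [].
  apply/setP=> j; rewrite inE; case jJ: (j \in J) => //=; rewrite leqNgt; apply/negP=> jr.
  by move: Jm; rewrite leqn0 cards_eq0 => /eqP /setP /(_ j); rewrite !inE jJ jr.
have [J0|[j0 j0J]] := set_0Vmem [set j in J | (j < r)%N].
  by apply: (IH _ x) => //; rewrite J0 cards0.
move: j0J; rewrite inE => /andP[j0J j0r].
pose i := [arg min_(i < j0 in J) i].
have [iJ imin] : i \in J /\ forall j : 'I_g, j \in J -> (i <= j)%N.
  by rewrite /i; case: arg_minnP.
have ir : (i < r)%N by apply: leq_ltn_trans j0r; apply: imin.
have [] := IH (J :\ i) (iota i x) _ (hw_min hx iJ imin) (Ti _ _ Tx).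
  have -> : [set j in J :\ i | (j < r)%N] = [set j in J | (j < r)%N] :\ i.
    by apply/setP=> j; rewrite !inE andbA.
  by move: Jm; rewrite (cardsD1 i [set j in J | _]) !inE iJ ir.
move=> y hy Ty; exists y => //; move: hy; congr (hwv (wsub lam _) y).
by apply/setP=> j; rewrite !inE; case: eqP => //= ->; rewrite leqNgt ir andbF.
Qed.

Lemma hwv_dom k x : hwv k x -> wdom k.
Proof. by case=> kx rx x0; apply: (hw_dom charK FE_gl F_ws (zero_gl_stable FE_gl) kx). Qed.

(** A functional that vanishes on lowered vectors and on all e_I tensored with v vanishes
    everywhere, because lowering operators generate the module from v. *)
Lemma colow_nz k (phi : F n -> K) x : colowest E k phi -> phi x != 0 -> exists I, phi (ebas I v) != 0.
Proof.
case=> plin [plow pwt] px; apply: contrapT => h; move/eqP: px; apply.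
have p0 I : phi (ebas I v) = 0 by apply/eqP; apply: contrapT => /negP h'; apply: h; exists I.
have p00 : phi 0 = 0 by have:= plin (-1) 0 0; rewrite scaler0 addr0 mulN1r addNr.
have pZ c y : phi (c *: y) = c * phi y by rewrite -[c *: y]addr0 plin p00 addr0.
have pD y z : phi (y + z) = phi y + phi z by rewrite -[y]scale1r plin mul1r scale1r.
have Q u : forall I, phi (ebas I u) = 0.
  apply: (hw_gen H (Q := fun u => forall I, phi (ebas I u) = 0)) => //; split; first split.
  - by move=> I; rewrite (lin0 (ebas_lin I)).
  - by move=> a y z hy hz I; rewrite (ebas_lin I) plin hy hz mulr0 addr0.
  move=> a b y ab hy I; have:= plow a b (ebas I y) ab.
  have -> : Fa e b a (ebas I y) = ebas I (mact e b a y) - eps a (iota b (ebas I y)).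
    by congr (_ - _); apply/ffunP=> S; rewrite !ffunE -scalemxAr.
  have [c [I' ->]] := iota_ebas b I y; have [c' [I'' hh]] := eps_ebas a I' y.
  by rewrite linearZ /= hh scalerA -scaleNr pD pZ hy mulr0 addr0.
rewrite (ebas_sum x); elim/big_rec: _ => // I y _ IH; by rewrite pD Q add0r.
Qed.

Lemma xi0_colow : colowest E lam (fun x => (xi *m x set0) 0 0).
Proof.
case: Hxi => _ h1 h2; split=> [c x y|].
  by rewrite !ffunE mulmxDr -scalemxAr !mxE.
split=> [a b x ab|a x]; rewrite Fa_at0 mulmxA; first by rewrite h1 // mul0mx mxE.
by rewrite h2 -scalemxAl mxE.
Qed.
End HW.
End Fock.

(** * Equivariant Pieri coefficients *)

Section Equivariant.
Variables (K : fieldType) (g : nat).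
Hypothesis charK : [pchar K] =i pred0.
Notation wt := {ffun 'I_g -> int}.
Notation F n := {ffun {set 'I_g} -> 'cV[K]_n}.

Lemma iotaS_iota (X : lmodType K) L (c : 'I_g) (x : {ffun {set 'I_g} -> X}) :
  iotaS L (iota c x) = (-1) ^+ #|L| *: iota c (iotaS L x).
Proof.
elim/set_min_ind: L x => [|a L aL IH] x; first by rewrite !iotaS0 cards0 scale1r.
have nL : a \notin L by apply/negP=> /aL; rewrite ltnn.
have h y : iotaS (a |: L) y = iota a (iotaS L y).
  rewrite iota_iotaS // /sg; have -> : [set j in L | (j < a)%N] = set0; last by rewrite cards0 scale1r.
  apply/setP=> j; rewrite !inE; case jL: (j \in L) => //=; by apply/negbTE; rewrite -leqNgt ltnW // aL.
by rewrite !h IH linearZ /= iotaC cardsU1 nL exprS mulN1r scalerN scaleNr.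
Qed.

Section Linearity.
Variables (n n' : nat) (P : {set 'I_g} -> 'M[K]_(n', n)).
Lemma dF_lin : linear (dF P). Proof. exact: linearP. Qed.
Lemma dF0 : dF P 0 = 0. Proof. exact: lin0 dF_lin. Qed.
Lemma dFB x y : dF P (x - y) = dF P x - dF P y. Proof. exact: linB dF_lin. Qed.
Lemma dFZ a x : dF P (a *: x) = a *: dF P x. Proof. exact: linZ dF_lin. Qed.
End Linearity.

Section Two.
Variables (n : nat) (e : 'I_g -> 'I_g -> 'M[K]_n) (lam : wt) (v : 'cV[K]_n) (xi : 'rV[K]_n).
Hypotheses (H : hwm e lam v) (Hxi : is_xi e lam v xi).
Variables (n' : nat) (e' : 'I_g -> 'I_g -> 'M[K]_n') (lam' : wt) (v' : 'cV[K]_n') (xi' : 'rV[K]_n').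
Hypotheses (H' : hwm e' lam' v') (Hxi' : is_xi e' lam' v' xi').

Definition equi (P : {set 'I_g} -> 'M[K]_(n', n)) := forall a b x, dF P (Fa e a b x) = Fa e' a b (dF P x).

Variables (P : {set 'I_g} -> 'M[K]_(n', n)) (N : nat).
Hypotheses (eP : equi P) (supp : forall L : {set 'I_g}, #|L| != N -> P L = 0).

(** All index sets L in the support of P have N elements, so one contraction passes the differential
    with the single sign (-1)^N. *)
Lemma dF_iota c x : dF P (iota c x) = (-1) ^+ N *: iota c (dF P x).
Proof.
apply/ffunP=> S; rewrite !ffunE.
have h L : P L *m iotaS L (iota c x) S = (-1) ^+ N *: (P L *m iota c (iotaS L x) S).
  have [<-|LN] := eqVneq #|L| N; first by rewrite iotaS_iota [in LHS]ffunE scalemxAr.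
  by rewrite supp // !mul0mx scaler0.
under eq_bigr => L _ do rewrite h ffunE.
case: ifP => cS; first by rewrite big1 ?scaler0 // => L _; rewrite mulmx0 scaler0.
rewrite 2!scaler_sumr; apply: eq_bigr => L _.
by rewrite -scalemxAr.
Qed.

Lemma dF_at0 x : dF P x set0 = \sum_(L : {set 'I_g}) contract_sign K L L *: (P L *m x L).
Proof. by rewrite ffunE; apply: eq_bigr => L _; rewrite iotaS_at0 scalemxAr. Qed.

Lemma csign_ne0 (L I : {set 'I_g}) : contract_sign K L I != 0.
Proof. exact: csignN0. Qed.

Lemma dF_ebas0 L u : dF P (ebas L u) set0 = contract_sign K L L *: (P L *m u).
Proof.
rewrite dF_at0 (bigD1 L) //= ffunE eqxx scale1r big1 ?addr0 // => I /negPf IL.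
by rewrite ffunE IL scale0r mulmx0 scaler0.
Qed.

Lemma P_weight k L u : wv (mact e) k u -> wv (mact e') (wsub k L) (P L *m u).
Proof.
move=> ku a; apply: (scalerI (csign_ne0 L L)); rewrite /mact scalemxAr -dF_ebas0 -Fa_at0 -eP.
by rewrite (wv_ebas L ku a) dFZ ffunE dF_ebas0 !scalerA mulrC.
Qed.

(** The values at the empty set of the image form a submodule of the target, so xi' detects P. The
    resulting functional on the source is colowest, hence nonzero on some e_L tensored with v, and
    comparing weights gives lam' = lam - 1_L. *)
Lemma xiP_ne0 L0 : P L0 != 0 -> exists L, (xi' *m (P L *m v)) 0 0 != 0 /\ lam' = wsub lam L.
Proof.
move=> P0.
have [x hx] : exists x, (xi' *m dF P x set0) 0 0 != 0.
  apply: contrapT => h; move/eqP: P0; apply; move: L0; apply: dF0_eq0 => x.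
  have hh y : dF P y set0 = 0.
    pose R u := exists y, u = dF P y set0.
    have sR : subspace R.
      split; first by exists 0; rewrite linear0 ffunE.
      by move=> a y1 y2 [z1 ->] [z2 ->]; exists (a *: z1 + z2); rewrite dF_lin !ffunE.
    apply: (xi_nondeg charK H' Hxi' sR); last by exists y.
      by move=> a b w _ [z ->]; exists (Fa e a b z); rewrite eP Fa_at0.
    move=> w [z ->]; apply/matrixP=> i j; rewrite !ord1 [RHS]mxE; apply/eqP; apply: contrapT => /negP hz.
    by apply: h; exists z.
  have P0 L : P L = 0.
    apply/matrixP=> i j; have := hh (ebas L (delta_mx j 0)); rewrite dF_ebas0 => /eqP.
    by rewrite scaler_eq0 (negPf (csign_ne0 L L)) /= -colE => /eqP /matrixP /(_ i 0); rewrite !mxE.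
  by apply/ffunP=> S; rewrite !ffunE big1 // => L _; rewrite P0 mul0mx.
have col : colowest (Fa e) lam' (fun x => (xi' *m dF P x set0) 0 0).
  have [h1 [h2 h3]] := xi0_colow Hxi'; split; last split.
  - by move=> c y z; rewrite dF_lin /= h1.
  - by move=> a b y ab; rewrite eP; apply: h2.
  by move=> a y; rewrite eP; apply: h3.
have [L hL] := colow_nz H col hx; exists L; move: hL; rewrite dF_ebas0 -scalemxAr.
set w := xi' *m _; rewrite [X in X != 0]mxE mulf_eq0 (negPf (csign_ne0 L L)) /= => hL; split=> //.
have [_ _ kv _ _] := H.
have [_ [_ h3]] := xi0_colow Hxi'.
have hw := P_weight L kv.
apply/ffunP=> a; apply: (intr_inj_char0 charK); apply: (mulIf hL).
have := h3 a (ebas set0 (P L *m v)); rewrite Fa_at0 /ebas ffunE eqxx scale1r.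
by have := hw a; rewrite /mact => ->; rewrite -scalemxAr -/w [X in X = _]mxE => ->.
Qed.

Variable B : {set 'I_g}.
Hypothesis lamB : lam' = wsub lam B.

Lemma xiPB_ne0 L0 : P L0 != 0 -> (xi' *m (P B *m v)) 0 0 != 0.
Proof. by case/xiP_ne0 => L [h hL]; move: h; congr (_ != 0); rewrite lamB in hL; rewrite (wsub_inj hL). Qed.

Lemma PB_v L0 : P L0 != 0 -> exists2 c, c != 0 & P B *m v = c *: v'.
Proof.
move=> P0; have [_ _ kv _ _] := H; have := P_weight B kv; rewrite -lamB => /(V_lam charK H') [c hc].
exists c => //; apply/eqP=> c0; have := xiPB_ne0 P0; by rewrite hc c0 scale0r mulmx0 mxE eqxx.
Qed.

Hypothesis cB : #|B| = N.

Lemma card_mem (p : pred 'I_g) (L : {set 'I_g}) : \sum_(a < g | p a) (a \in L)%:R = #|[set a in L | p a]|%:Z :> int.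
Proof.
rewrite -sum1_card (big_morph Posz PoszD (erefl (Posz 0))).
rewrite [RHS](eq_bigl (fun a => p a && (a \in L))) => [|a]; last by rewrite inE andbC.
by rewrite big_mkcondr; apply: eq_bigr => a _; case: (a \in L).
Qed.

(** The image of a vector of weight lam under P_L has weight lam - 1_L, which is at most lam - 1_B
    in the dominance order. The partial sum up to r then forces L to have at least as many elements
    below r as B has. *)
Lemma P_other u (M : {set 'I_g}) (r : nat) (L : {set 'I_g}) : wv (mact e) lam u ->
  (forall b : 'I_g, b \in B -> (b < r)%N) -> (forall b : 'I_g, b \in M -> (r <= b)%N) ->
  L \subset B :|: M -> P L *m u != 0 -> L = B.
Proof.
move=> ku Br rM LBM Pu.
have cL : #|L| = N by apply/eqP; apply: contraNT Pu => /supp ->; rewrite mul0mx.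
have [h _] : wle (wsub lam L) lam' by apply: (V_wle charK H' (P_weight L ku)); apply/eqP.
have := h r; rewrite lamB /psum; under eq_bigr do rewrite ffunE; under [X in _ <= X]eq_bigr do rewrite ffunE.
rewrite !sumrB lerD2l lerN2 !card_mem lez_nat.
have -> : [set a in B | (a < r)%N] = B.
  by apply/setP=> a; rewrite inE; case aB: (a \in B) => //=; rewrite Br.
move=> BL; have LB : [set a in L | (a < r)%N] \subset B.
  apply/subsetP=> a; rewrite inE => /andP[/(subsetP LBM)]; rewrite inE => /orP[//|/rM].
  by rewrite leqNgt => /negPf ->.
have e1 : [set a in L | (a < r)%N] = B by apply/eqP; rewrite eqEcard LB BL.
apply/esym/eqP; rewrite eqEcard cB cL leqnn andbT -e1.
by apply/subsetP=> a; rewrite inE => /andP[].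
Qed.

(** If B lies below M, the differential sends e_{B + M} tensored with v to a nonzero multiple of e_M
    tensored with v', because by [P_other] only the coefficient P_B contributes. A colowest
    functional that is nonzero on the latter therefore pulls back. *)
Lemma step_colow L0 k phi (M : {set 'I_g}) (r : nat) : P L0 != 0 ->
  (forall b : 'I_g, b \in B -> (b < r)%N) -> (forall b : 'I_g, b \in M -> (r <= b)%N) ->
  colowest (Fa e') k phi -> phi (ebas M v') != 0 ->
  colowest (Fa e) k (fun x => phi (dF P x)) /\ phi (dF P (ebas (B :|: M) v)) != 0.
Proof.
move=> P0 Br rM [h1 [h2 h3]] pM; split.
  split; last split.
  - by move=> c y z; rewrite dF_lin /= h1.
  - by move=> a b y ab; rewrite eP; apply: h2.
  by move=> a y; rewrite eP; apply: h3.
have [c c0 hc] := PB_v P0.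
have dBM : [disjoint B & M].
  by apply/pred0P=> a /=; apply/negbTE/negP=> /andP[/Br aB /rM]; rewrite leqNgt aB.
have -> : dF P (ebas (B :|: M) v) = (contract_sign K B (B :|: M) * c) *: ebas M v'.
  have [_ _ kv _ _] := H.
  apply/ffunP=> S; rewrite [LHS]ffunE (bigD1 B) //= [X in _ + X]big1 ?addr0 => [|L LB].
    rewrite [iotaS _ _ _]ffunE [RHS]ffunE [ebas M _ _]ffunE; case: ifPn => dBS; last first.
      case: eqP dBS => [->|_]; first by rewrite dBM.
      by rewrite mulmx0 scale0r scaler0.
    rewrite ffunE; have -> : (B :|: S == B :|: M) = (S == M).
      apply/eqP/eqP=> [|-> //]; move/setP=> hh; apply/setP=> a; have := hh a; rewrite !inE.
      case aB: (a \in B) => //= _.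
      by rewrite (disjointFr dBS aB) (disjointFr dBM aB).
    case: eqP => [->|_]; last by rewrite !scale0r scaler0 mulmx0 scaler0.
    by rewrite !scale1r -scalemxAr hc scalerA.
  rewrite ffunE; case: ifPn => dLS; last by rewrite mulmx0.
  rewrite ffunE; case: eqP => [hh|_]; last by rewrite scale0r scaler0 mulmx0.
  rewrite scale1r -scalemxAr; have -> : P L *m v = 0; last by rewrite scaler0.
  apply/eqP; apply: contraNT LB => Pv; apply/eqP; apply: (P_other (u := v) (M := M) (r := r)) => //.
  by rewrite -hh subsetUl.
have p0 : phi 0 = 0 by have:= h1 (-1) 0 0; rewrite scaler0 addr0 mulN1r addNr.
by rewrite -[_ *: ebas M v']addr0 h1 p0 addr0 !mulf_neq0 ?csign_ne0.
Qed.

Lemma dF_ker_stable : gl_stable (Fa e) (fun x => dF P x = 0).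
Proof.
split; first split; first exact: dF0.
  by move=> a x y hx hy; rewrite dF_lin /= hx hy scaler0 addr0.
move=> a b x hx; rewrite eP hx; exact: (lin0 (Fa_lin e' a b)).
Qed.

Lemma dF_im_stable : gl_stable (Fa e') (fun y => exists x, y = dF P x).
Proof.
split; first split; first by exists 0; rewrite dF0.
  by move=> a x y [x' ->] [y' ->]; exists (a *: x' + y'); rewrite dF_lin.
by move=> a b x [y ->]; exists (Fa e a b y); rewrite eP.
Qed.

Lemma dF_hw k x : wv (Fa e) k x -> raised (Fa e) (@zeroP _ _) x ->
  wv (Fa e') k (dF P x) /\ raised (Fa e') (@zeroP _ _) (dF P x).
Proof.
move=> kx rx; split=> [a|a b ab]; first by rewrite -eP kx dFZ.
by rewrite /zeroP -eP rx // dF0.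
Qed.
End Two.

(** Uniqueness of the Pieri map: choose c so that xi' of the value at v of the B-coefficient of P2 -
    c P1 vanishes; by [xiPB_ne0] the difference is then 0. *)
Lemma equi_unique n (e : 'I_g -> 'I_g -> 'M[K]_n) lam v n' (e' : 'I_g -> 'I_g -> 'M[K]_n') lam' v' xi'
  (P1 P2 : {set 'I_g} -> 'M[K]_(n', n)) L0 B :
  hwm e lam v -> hwm e' lam' v' -> is_xi e' lam' v' xi' -> lam' = wsub lam B ->
  equi e e' P1 -> equi e e' P2 -> P1 L0 != 0 -> exists c, forall L, P2 L = c *: P1 L.
Proof.
move=> H H' Hxi' lamB e1 e2 P0; have h1 := xiPB_ne0 H H' Hxi' e1 lamB P0.
have [c cE] : exists c, c = (xi' *m (P2 B *m v)) 0 0 / (xi' *m (P1 B *m v)) 0 0 by eexists.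
exists c => L.
pose P3 L := P2 L - c *: P1 L.
have d3 x : dF P3 x = dF P2 x - c *: dF P1 x.
  apply/ffunP=> S; rewrite !ffunE scaler_sumr -sumrB; apply: eq_bigr => L' _.
  by rewrite mulmxBl scalemxAl.
have e3 : equi e e' P3.
  move=> a b x; rewrite !d3 e1 e2 (linB _ _ (Fa_lin e' a b)) (linZ _ _ (Fa_lin e' a b)) //.
apply/eqP; rewrite -subr_eq0; apply: contrapT => /negP P30.
have := xiPB_ne0 H H' Hxi' e3 lamB (L0 := L) P30; rewrite /P3 mulmxBl mulmxBr -scalemxAl -scalemxAr.
set w := xi' *m (P2 B *m v) in cE *; set w' := xi' *m (P1 B *m v) in cE h1 *.
by rewrite [X in X != 0]mxE [X in _ + X]mxE [X in _ - X]mxE cE mulfVK // subrr eqxx.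
Qed.
End Equivariant.

(** * Combinatorics of the weights p(nu;k) *)

Section PWeight.
Implicit Types (nu lam : seq int) (k : int).

Lemma dominantP n lam : dominant n lam ->
  size lam = n /\ forall i j, (i <= j)%N -> (j < n)%N -> lam`_j <= lam`_i.
Proof.
case/andP=> /eqP sz so; split=> // i j ij jn.
apply: (@sorted_leq_nth _ (fun x y : int => y <= x) _ _ 0 lam so i j) => //; rewrite ?inE ?sz //.
- by move=> x y z h1 h2; apply: le_trans h2 h1.
- exact: leq_ltn_trans ij jn.
Qed.

Lemma mkdominant n lam : size lam = n -> (forall i, (i.+1 < n)%N -> lam`_(i.+1) <= lam`_i) -> dominant n lam.
Proof. by move=> sz h; apply/andP; split; [apply/eqP | apply/(sortedP 0) => i; rewrite sz => /h]. Qed.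

Lemma nu_prime_lt n nu k j : dominant n nu -> (j < n)%N -> (j < nu_prime nu k)%N = (k <= nu`_j).
Proof.
case/andP=> /eqP <- {n}; elim: nu j => //= x nu IH j so jn.
rewrite /nu_prime /=; have tr : transitive (fun x y : int => y <= x) by move=> y z t h1 h2; apply: le_trans h2 h1.
case: (leP k x) => kx /=.
  case: j jn => [|j] jn /=; first by rewrite kx.
  by rewrite add1n ltnS IH // (path_sorted so).
have := order_path_min tr so => /allP all_le.
have c0 : count (>= k) nu = 0%N.
  apply/eqP; rewrite -leqn0 leqNgt -has_count; apply/negP=> /hasP[y yn ky].
  by have := le_lt_trans (le_trans ky (all_le _ yn)) kx; rewrite ltxx.
rewrite c0 ltn0; case: j jn => [|j] jn /=; first by rewrite leNgt kx.
apply/esym/negbTE; rewrite -ltNge; apply: le_lt_trans kx; apply: all_le; exact: mem_nth.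
Qed.

Lemma nu_prime_le n nu k : dominant n nu -> (nu_prime nu k <= n)%N.
Proof. by case/andP=> /eqP <- _; apply: count_size. Qed.

Lemma size_p_weight nu k : size (p_weight nu k) = (size nu).+1.
Proof. by rewrite size_cat /= size_map addnS -size_cat cat_take_drop. Qed.

Lemma nth_p_weight n nu k j : dominant n nu -> (j < n.+1)%N ->
  (p_weight nu k)`_j = if (j < nu_prime nu k)%N then nu`_j else if j == nu_prime nu k then k else nu`_(j.-1) + 1.
Proof.
move=> dn jn; have le := nu_prime_le k dn; case/andP: (dn) => /eqP sz _.
rewrite /p_weight nth_cat size_takel ?sz //; case: ltnP => ij; first by rewrite nth_take.
case: eqP => [->|/eqP ne]; first by rewrite subnn.
have lt : (nu_prime nu k < j)%N by rewrite ltn_neqAle eq_sym ne.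
have -> : (j - nu_prime nu k)%N = (j.-1 - nu_prime nu k).+1 by lia.
rewrite /= (nth_map 0) ?size_drop ?sz ?nth_drop; last by lia.
by congr (nu`_ _ + 1); lia.
Qed.

Lemma nu_prime_mono nu k : (nu_prime nu k <= nu_prime nu (k - 1))%N.
Proof. by apply: sub_count => x /=; lia. Qed.

Variable g : nat.
Hypothesis g0 : (0 < g)%N.

(** The positions of the block k^N in p(nu;k), which are those lowered by 1 in passing to
    p(nu;k-1). *)
Definition Bset nu k : {set 'I_g} := [set c : 'I_g | (nu_prime nu k <= c)%N && (c <= nu_prime nu (k - 1))%N].

Lemma nth_p_weightg nu k j : dominant g.-1 nu -> (j < g)%N ->
  (p_weight nu k)`_j = if (j < nu_prime nu k)%N then nu`_j else if j == nu_prime nu k then k else nu`_(j.-1) + 1.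
Proof. by move=> dn jg; apply: nth_p_weight dn _; rewrite prednK. Qed.

Lemma p_weight_dominant nu k : dominant g.-1 nu -> dominant g (p_weight nu k).
Proof.
move=> dn; case: (dominantP dn) => sz mono; apply: mkdominant; first by rewrite size_p_weight sz prednK.
move=> i ig; rewrite !nth_p_weightg //; last by lia.
have h j : (j < g.-1)%N -> (j < nu_prime nu k)%N = (k <= nu`_j) by move=> ?; apply: nu_prime_lt dn _.
case: ltnP => h1; case: ltnP => h2; try lia.
- by apply: mono => //; have := nu_prime_le k dn; lia.
- by case: eqP => h3; [have := h i; have := nu_prime_le k dn; lia | lia].
- case: eqP => h3; case: eqP => h4; try lia.
    by rewrite /=; move: (h i); move: (nu`_i) => x; lia.
  by have := mono i.-1 i; rewrite /=; lia.
Qed.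

Lemma nth_p_step nu k j : dominant g.-1 nu -> (j < g)%N -> (p_weight nu (k - 1))`_j =
  (p_weight nu k)`_j - ((nu_prime nu k <= j)%N && (j <= nu_prime nu (k - 1))%N)%:R.
Proof.
move=> dn jg; rewrite !nth_p_weightg //.
have h j' : (j' < g.-1)%N -> (j' < nu_prime nu k)%N = (k <= nu`_j') by move=> ?; apply: nu_prime_lt dn _.
have h' j' : (j' < g.-1)%N -> (j' < nu_prime nu (k - 1))%N = (k - 1 <= nu`_j') by move=> ?; apply: nu_prime_lt dn _.
have := nu_prime_mono nu k; have := nu_prime_le k dn; have := nu_prime_le (k - 1) dn.
have := h j; have := h j.-1; have := h' j; have := h' j.-1.
move: (nu_prime nu k) (nu_prime nu (k-1)) (nu`_j) (nu`_j.-1) => i i1 x y.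
case: (ltnP j i); case: (ltnP j i1); case: (ltngtP j i); case: (ltngtP j i1); try lia.
all: case: ltngtP; lia.
Qed.

Lemma card_ord_lt r : (r <= g)%N -> #|[set c : 'I_g | (c < r)%N]| = r.
Proof.
move=> rg; rewrite -sum1_card (eq_bigl (fun c : 'I_g => (c < r)%N)) => [|c]; last by rewrite inE.
by rewrite -(big_ord_widen g (fun=> 1%N) rg) sum1_card card_ord.
Qed.

Lemma card_Bset nu k : dominant g.-1 nu -> #|Bset nu k| = N_step nu k.
Proof.
move=> dn; have h1 := nu_prime_le (k - 1) dn; have h2 := nu_prime_mono nu k.
have -> : Bset nu k = [set c : 'I_g | (c < (nu_prime nu (k - 1)).+1)%N] :\: [set c : 'I_g | (c < nu_prime nu k)%N].
  by apply/setP=> c; rewrite !inE ltnS -leqNgt.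
rewrite cardsD (setIidPr _) ?card_ord_lt /N_step; try lia.
by apply/subsetP=> c; rewrite !inE; lia.
Qed.

Definition swt lam : {ffun 'I_g -> int} := [ffun a : 'I_g => lam`_a].

Lemma swt_step nu k : dominant g.-1 nu -> swt (p_weight nu (k - 1)) = wsub (swt (p_weight nu k)) (Bset nu k).
Proof. by move=> dn; apply/ffunP=> c; rewrite !ffunE nth_p_step // inE. Qed.

(** Any dominant weight and any position a arise from some nu and k: delete the entry at a, lower
    the later entries by 1, and take k to be the deleted entry. The block then starts at a and
    contains the later entries equal to that at a. *)
Lemma p_weight_cover lam (a : 'I_g) : dominant g lam -> exists nu k,
  [/\ dominant g.-1 nu, p_weight nu k = lam, nu_prime nu k = a :> nat
  & forall c : 'I_g, (c \in Bset nu k) = (a <= c)%N && (lam`_c == lam`_a)].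
Proof.
move=> dl; case: (dominantP dl) => sz mono.
pose nu := take a lam ++ [seq x - 1 | x <- drop a.+1 lam]; exists nu, lam`_a.
have ag := ltn_ord a.
have snu : size nu = g.-1 by rewrite size_cat size_takel ?size_map ?size_drop ?sz; lia.
have nuE j : (j < g.-1)%N -> nu`_j = if (j < a)%N then lam`_j else lam`_(j.+1) - 1.
  move=> jg; rewrite nth_cat size_takel; last by rewrite sz ltnW.
  case: ltnP => ja; first by rewrite nth_take.
  rewrite (nth_map 0) ?size_drop ?sz ?nth_drop; last by lia.
  by congr (lam`_ _ - 1); lia.
have dn : dominant g.-1 nu.
  apply: mkdominant => // i ig; rewrite !nuE //; last by lia.
  have m1 : lam`_i.+1 <= lam`_i by apply: mono => //; lia.
  have m2 : lam`_i.+2 <= lam`_i.+1 by apply: mono => //; lia.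
  case: ltnP => h1; case: ltnP => h2; [exact: m1 | lia | | by rewrite lerD2r].
  by rewrite lerBlDr; apply: le_trans m2 _; apply: le_trans m1 _; rewrite lerDl.
have nup : nu_prime nu lam`_a = a.
  have le := nu_prime_le lam`_a dn.
  have h j : (j < g.-1)%N -> (j < nu_prime nu lam`_a)%N = (j < a)%N.
    move=> jg; rewrite (nu_prime_lt _ dn jg) nuE //; case: ltnP => ja.
      by apply: mono => //; apply: ltnW.
    by apply/negbTE; rewrite -ltNge; have := mono a j.+1; lia.
  apply/eqP; rewrite eqn_leq; apply/andP; split; rewrite leqNgt; apply/negP=> hh.
    by have := h a; rewrite ltnn hh; lia.
  by have := h (nu_prime nu lam`_a); rewrite ltnn hh; lia.
split=> //.
  rewrite /p_weight nup /nu take_size_cat ?size_takel ?sz 1?ltnW //.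
  rewrite drop_size_cat ?size_takel ?sz 1?ltnW // -map_comp (eq_map (g := id)) ?map_id => [|x /=]; last by rewrite subrK.
  by rewrite -drop_nth ?sz // cat_take_drop.
move=> c; rewrite inE nup; case: (leqP a c) => //= ac.
have [->|ne] := eqVneq (c : nat) (a : nat).
  by rewrite eqxx -[X in (X <= _)%N]nup nu_prime_mono.
have cg := ltn_ord c.
have -> : (c <= nu_prime nu (lam`_a - 1))%N = (c.-1 < nu_prime nu (lam`_a - 1))%N by lia.
rewrite (nu_prime_lt _ dn) ?nuE; try lia.
have lt : (a < c)%N by rewrite ltn_neqAle eq_sym ne.
have c0 : (0 < c)%N by apply: leq_ltn_trans lt.
by rewrite -ltnS prednK // ltnS leqNgt lt /= lerD2r eq_le (mono a c).
Qed.
End PWeight.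

(** * Exactness of the complex for the identity of G *)

Section PieriComplex.
Variables (K : fieldType) (g : nat).
Hypothesis charK : [pchar K] =i pred0.
Hypothesis g0 : (0 < g)%N.
Variables (Vd : seq int -> nat) (ee : forall l, 'I_g -> 'I_g -> 'M[K]_(Vd l)) (vv : forall l, 'cV[K]_(Vd l)).
Variable xx : forall l, 'rV[K]_(Vd l).
Hypothesis HH : forall l, dominant g l -> hwm (@ee l) (swt g l) (vv l).
Hypothesis HX : forall l, dominant g l -> is_xi (@ee l) (swt g l) (vv l) (xx l).
Variable PP : forall nu k, {set 'I_g} -> 'M[K]_(Vd (p_weight nu (k - 1)), Vd (p_weight nu k)).
Hypothesis Pe : forall nu k, dominant g.-1 nu ->
  equi (@ee (p_weight nu k)) (@ee (p_weight nu (k - 1))) (@PP nu k).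
Hypothesis Ps : forall nu k (L : {set 'I_g}), dominant g.-1 nu -> #|L| != N_step nu k -> PP nu k L = 0.
Hypothesis P0 : forall nu k, dominant g.-1 nu -> exists L, PP nu k L != 0.

Notation d nu k := (dF (@PP nu k)).

(** Dominance of lam - 1_M forces M to contain the whole block of equal entries that starts at its
    least element a; a later entry of the block left unlowered would exceed the entry at a. *)
Lemma block_split lam (M : {set 'I_g}) (a : 'I_g) nu k : dominant g lam -> p_weight nu k = lam -> dominant g.-1 nu ->
  wdom (wsub (swt g lam) M) -> a \in M -> (forall j : 'I_g, j \in M -> (a <= j)%N) -> nu_prime nu k = a :> nat ->
  let B := Bset g nu k in
  [/\ B :|: (M :\: B) = M, forall b : 'I_g, b \in B -> (b < (nu_prime nu (k - 1)).+1)%N &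
      forall b : 'I_g, b \in M :\: B -> ((nu_prime nu (k - 1)).+1 <= b)%N].
Proof.
move=> dl lE dn wd aM amin nupa B.
have BM : B \subset M.
  apply/subsetP=> c; rewrite inE nupa => /andP[ac cB]; have [<-|ne] := eqVneq a c; first by [].
  have lt : (a < c)%N by rewrite ltn_neqAle ac andbT; apply: contraNneq ne => h; apply/eqP/val_inj.
  have := wd a c lt; rewrite !ffunE aM -lE !(nth_p_weightg g0) //; rewrite nupa ltnn eqxx ltnNge ac /=.
  have -> : (c == a :> nat) = false by apply/negbTE; rewrite neq_ltn lt orbT.
  case: (c \in M) => //; have c0 : (0 < c)%N by apply: leq_ltn_trans lt.
  have h : (c.-1 < nu_prime nu (k - 1))%N by rewrite prednK.
  have cg := ltn_ord c.
  move: h; rewrite (nu_prime_lt _ dn); last by lia.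
  by rewrite (_ : false%:R = 0 :> int) // subr0; move: (nu`_ _) => x; lia.
split=> [|b|b].
- by apply/setP=> c; rewrite !inE; have := subsetP BM c; rewrite /B inE; case: (_ && _) => //= ->.
- by rewrite inE => /andP[].
by rewrite !inE nupa => /andP[h1 h2]; move: h1; rewrite amin //= -ltnNge.
Qed.

Lemma set_minP (M : {set 'I_g}) : M != set0 -> exists a : 'I_g, a \in M /\ forall j : 'I_g, j \in M -> (a <= j)%N.
Proof.
case/set0Pn => a0 a0M; exists [arg min_(i < a0 in M) i]; by case: arg_minnP.
Qed.

Lemma wdom_sub_block lam (M : {set 'I_g}) nu k : dominant g.-1 nu -> p_weight nu k = lam ->
  Bset g nu k :|: (M :\: Bset g nu k) = M ->
  wsub (swt g (p_weight nu (k - 1))) (M :\: Bset g nu k) = wsub (swt g lam) M.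
Proof.
move=> dn lE BM; rewrite (swt_step g0) // lE; apply/ffunP=> c; rewrite !ffunE.
rewrite -[in RHS]BM [in RHS]inE [in X in _ - X]inE -addrA -opprD; congr (_ - _).
by rewrite [c \in M :\: _]inE; case: (c \in Bset g nu k); rewrite /= ?addr0 ?add0r.
Qed.

(** The existence part of the Pieri rule, obtained from the differentials themselves. Present lam as
    p(nu;k) with block B starting at the least element of M; the differential takes M to the smaller
    set M \ B, where the functional exists by induction, and [step_colow] pulls it back. *)
Lemma colow_exists m lam (M : {set 'I_g}) : (#|M| <= m)%N -> dominant g lam -> wdom (wsub (swt g lam) M) ->
  exists k phi, colowest (Fa (@ee lam)) k phi /\ phi (ebas M (vv lam)) != 0.
Proof.
elim: m lam M => [|m IH] lam M cM dl wd.
  have -> : M = set0 by apply/eqP; rewrite -cards_eq0 -leqn0.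
  exists (swt g lam), (fun x : {ffun {set 'I_g} -> 'cV[K]_(Vd lam)} => (xx lam *m x set0) 0 0); split; first exact: xi0_colow (HX dl).
  by rewrite /ebas ffunE eqxx scale1r; case: (HX dl) => -> _ _; apply: oner_neq0.
have [M0|M0] := eqVneq M set0; first by apply: IH => //; rewrite M0 cards0.
have [a [aM amin]] := set_minP M0.
have [nu [k [dn lE nupa _]]] := p_weight_cover g0 a dl.
have [BM Br rM] := block_split dl lE dn wd aM amin nupa.
have wM := wdom_sub_block dn lE BM.
subst lam.
have [] := IH (p_weight nu (k - 1)) (M :\: Bset g nu k).
- rewrite -ltnS; apply: leq_trans cM; apply: proper_card; rewrite properE subsetDl /=; apply/subsetPn; exists a => //.
  by rewrite !inE nupa leqnn -[X in (X <= _)%N]nupa nu_prime_mono.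
- exact: (p_weight_dominant g0).
- by rewrite wM.
move=> k' [phi [col pM]]; have [L0 PL0] := P0 k dn.
have := @step_colow K g charK _ _ _ _ (HH (p_weight_dominant g0 k dn)) _ _ _ _ _
  (HH (p_weight_dominant g0 (k - 1) dn)) (HX (p_weight_dominant g0 (k - 1) dn)) (@PP nu k) _ (@Pe nu k dn)
  (fun L => @Ps nu k L dn) (Bset g nu k) (swt_step g0 k dn) (card_Bset g0 k dn) L0 k' phi _ _ PL0 Br rM col pM.
by rewrite BM => -[h1 h2]; exists k', (fun x => phi (d nu k x)).
Qed.

(** If d x = 0, then [hw_cut] makes the first position a of the block the least element of J while
    keeping a cycle. But [step_colow] provides a highest weight vector of the same weight with
    nonzero image, and by uniqueness it is a multiple of the cycle. *)
Lemma d_hw_ne0 nu k J x (a : 'I_g) : dominant g.-1 nu -> hwv (@ee (p_weight nu k)) (wsub (swt g (p_weight nu k)) J) x ->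
  a \in J -> nu_prime nu k = a :> nat -> d nu k x <> 0.
Proof.
move=> dn hx aJ nupa dx0.
have dl := p_weight_dominant g0 k dn; have dl' := p_weight_dominant g0 (k - 1) dn.
have Hh := HH dl; have Hx := HX dl.
have [|x1 hx1 dx1] := hw_cut charK Hh Hx (T := fun y => d nu k y = 0) a _ hx dx0.
  move=> b y hy; rewrite (dF_iota (fun L => @Ps nu k L dn)) hy (lin0 (@linearP _ _ _ _ (iota b))); exact: scaler0.
set J1 := [set j in J | (a <= j)%N] in hx1.
have aJ1 : a \in J1 by rewrite inE aJ leqnn.
have wd : wdom (wsub (swt g (p_weight nu k)) J1) := hwv_dom charK Hh hx1.
have [BM Br rM] := block_split dl (erefl _) dn wd aJ1 (fun j => ltac:(rewrite inE => /andP[_ h]; exact h)) nupa.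
have wM := wdom_sub_block dn (erefl _) BM.
have [k' [phi [col pM]]] : exists k' phi, colowest (Fa (@ee (p_weight nu (k - 1)))) k' phi /\
    phi (ebas (J1 :\: Bset g nu k) (vv (p_weight nu (k - 1)))) != 0.
  by apply: colow_exists (leqnn _) dl' _; rewrite wM.
have [L0 PL0] := P0 k dn.
have := @step_colow K g charK _ _ _ _ Hh _ _ _ _ _
  (HH dl') (HX dl') (@PP nu k) _ (@Pe nu k dn)
  (fun L => @Ps nu k L dn) (Bset g nu k) (swt_step g0 k dn) (card_Bset g0 k dn) L0 k' phi _ _ PL0 Br rM col pM.
rewrite BM => -[h1 h2].
have Egl := FE_gl Hh.
have [_ _ kv _ _] := Hh.
have k'E := colowest_wt charK h1 (wv_ebas J1 kv) h2.
have [y [ky ry py]] := colowest_hw charK Egl (F_ws Hh) h1 h2.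
have [c yE] := hw_unique charK Hh Hx hx1 (eq_ind_r (fun w => wv _ w y) ky k'E) ry.
move: py; rewrite yE dFZ dx1 scaler0.
case: col => h _; have := h (-1) 0 0; rewrite scaler0 addr0 mulN1r addNr => ->.
by rewrite eqxx.
Qed.

(** A nonzero composite would be nonzero on some highest weight vector. Its weight lowers p(nu;k) by
    at most 1 in each coordinate, while seen from the target the coordinate common to both blocks is
    lowered at least twice. *)
Lemma d_d nu k x : dominant g.-1 nu -> d nu (k - 1) (d nu k x) = 0.
Proof.
move=> dn; apply: contrapT => hx.
have dl := p_weight_dominant g0 k dn; have dl1 := p_weight_dominant g0 (k - 1) dn.
have dl2 := p_weight_dominant g0 (k - 1 - 1) dn.
have Hh := HH dl; have Egl := FE_gl Hh; have Ews := F_ws Hh.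
have sB : gl_stable (Fa (@ee (p_weight nu k))) (fun y => d nu (k - 1) (d nu k y) = 0).
  split; first split.
  - by rewrite !dF0.
  - by move=> b y z hy hz; rewrite !dF_lin hy hz scaler0 addr0.
  by move=> a b y hy; rewrite (@Pe nu k dn) (@Pe nu (k - 1) dn) hy; exact: (lin0 (Fa_lin _ a b)).
have sZ : gl_stable (Fa (@ee (p_weight nu k))) (fun=> True) by [].
have [w [y [ky _ nBy ry]]] := hw_mod charK Egl Ews sB sZ I hx.
have [y' [ky' ry' Byy]] := hw_lift charK Egl Ews sB ky nBy ry.
have nB : ~ (d nu (k - 1) (d nu k y') = 0).
  by move=> h; apply: nBy; move: Byy; rewrite !dFB h subr0.
have y0 : y' <> 0 by move=> h; apply: nB; rewrite h !dF0.
have [k1 r1] := dF_hw (@Pe nu k dn) ky' ry'; have [k2 r2] := dF_hw (@Pe nu (k - 1) dn) k1 r1.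
have [J [_ wE]] := hw_type charK Hh (HX dl) (And3 ky' ry' y0).
have [J2 [_ wE2]] := hw_type charK (HH dl2) (HX dl2) (And3 k2 r2 nB).
(* The last position of one block is the first position of the next one. *)
have mg : (nu_prime nu (k - 1) < g)%N by have := nu_prime_le (k - 1) dn; lia.
move: wE2; rewrite wE (swt_step g0 (k - 1) dn) (swt_step g0 k dn) => /ffunP /(_ (Ordinal mg)).
have q1 : Ordinal mg \in Bset g nu k by rewrite inE /= leqnn nu_prime_mono.
have q2 : Ordinal mg \in Bset g nu (k - 1) by rewrite inE /= leqnn nu_prime_mono.
rewrite !ffunE q1 q2; case: (_ \in J); case: (_ \in J2); lia.
Qed.

(** Test on a highest weight cycle of type J. If J contains the first position of the next block,
    [d_hw_ne0] contradicts its being a cycle. Otherwise J is disjoint from the current block B, the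
    weight also occurs in the source with type B + J, and the image of that vector is nonzero, hence
    spans the same line. *)
Lemma d_exact nu k x : dominant g.-1 nu -> d nu (k - 1) x = 0 -> exists y, x = d nu k y.
Proof.
move=> dn dx; apply: contrapT => nx.
have dl := p_weight_dominant g0 k dn; have dl1 := p_weight_dominant g0 (k - 1) dn.
have dl2 := p_weight_dominant g0 (k - 1 - 1) dn.
have Hh := HH dl; have Hh1 := HH dl1; have Egl := FE_gl Hh1; have Ews := F_ws Hh1.
have sB := dF_im_stable (@Pe nu k dn); have sZ := dF_ker_stable (@Pe nu (k - 1) dn).
have [w [y [ky Zy nBy ry]]] := hw_mod charK Egl Ews sB sZ dx nx.
have [y' [ky' ry' Byy]] := hw_lift charK Egl Ews sB ky nBy ry.
have nB : ~ (exists z, y' = d nu k z).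
  by move=> h; apply: nBy; rewrite -[y](subrK y'); apply: (subD sB.1).
have Zy' : d nu (k - 1) y' = 0.
  have -> : y' = y - (y - y') by rewrite subKr.
  by case: Byy => z ->; rewrite dFB Zy d_d // subr0.
have y0 : y' <> 0 by move=> h; apply: nB; exists 0; rewrite h dF0.
have hw := And3 ky' ry' y0.
have [J [_ wE]] := hw_type charK Hh1 (HX dl1) hw; subst w.
have mg : (nu_prime nu (k - 1) < g)%N by have := nu_prime_le (k - 1) dn; lia.
have [aJ|aJ] := boolP (Ordinal mg \in J); first by apply: (d_hw_ne0 dn hw aJ _ Zy').
have wd := hwv_dom charK Hh1 hw.
(* An element of the block in J would be lowered while the last position of the block is not,
   against dominance. *)
have dJ (c : 'I_g) : c \in Bset g nu k -> c \notin J.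
  move=> cB; apply/negP=> cJ; have ne : c != Ordinal mg by apply: contraTneq cJ => ->.
  move: cB; rewrite inE => /andP[c1 c2].
  have lt : (c < Ordinal mg)%N by rewrite ltn_neqAle c2 andbT.
  have := wd _ _ lt; rewrite !ffunE cJ (negPf aJ) !(nth_p_weightg g0) //= ltnn eqxx.
  move: (lt) => /= ->.
  have cg : (c < g.-1)%N by move: lt => /=; lia.
  by rewrite subr0 lerD2r => h; move: c1; rewrite leqNgt (nu_prime_lt k dn cg) h.
have wJ : wsub (swt g (p_weight nu (k - 1))) J = wsub (swt g (p_weight nu k)) (Bset g nu k :|: J).
  rewrite (swt_step g0) //; apply/ffunP=> c; rewrite !ffunE [in RHS]in_setU -addrA -opprD; congr (_ - _).
  by case cB: (c \in Bset g nu k); rewrite ?add0r //= (negPf (dJ _ cB)) addr0.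
have [k' [phi [col pM]]] : exists k' phi, colowest (Fa (@ee (p_weight nu k))) k' phi /\
    phi (ebas (Bset g nu k :|: J) (vv (p_weight nu k))) != 0.
  by apply: colow_exists (leqnn _) dl _; rewrite -wJ.
have [_ _ kv _ _] := Hh.
have k'E := colowest_wt charK col (wv_ebas (Bset g nu k :|: J) kv) pM.
have [z [kz rz pz]] := colowest_hw charK (FE_gl Hh) (F_ws Hh) col pM.
have p0 : phi 0 = 0 by case: col => h _; have := h (-1) 0 0; rewrite scaler0 addr0 mulN1r addNr.
have z0 : z <> 0 by move=> h; move: pz; rewrite h p0 eqxx.
rewrite -k'E in kz.
have ag : (nu_prime nu k < g)%N by have := nu_prime_le k dn; lia.
have aB : Ordinal ag \in Bset g nu k :|: J by rewrite !inE /= leqnn nu_prime_mono.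
have dz0 := d_hw_ne0 dn (And3 kz rz z0) aB (erefl _).
have [k1 r1] := dF_hw (@Pe nu k dn) kz rz; rewrite -wJ in k1.
have [c yE] := hw_unique charK Hh1 (HX dl1) (And3 k1 r1 dz0) ky' ry'.
by apply: nB; exists (c *: z); rewrite dFZ.
Qed.
End PieriComplex.

Lemma mpoly_ring_ind (n : nat) (R : comNzRingType) (P : {mpoly R[n]} -> Prop) :
  (forall c, P c%:MP) -> (forall i, P 'X_i) -> (forall p q, P p -> P q -> P (p + q)) ->
  (forall p q, P p -> P q -> P (p * q)) -> forall p, P p.
Proof.
move=> Pc Px Pa Pm p; rewrite (mpolyE p); elim/big_ind: _ => //; first by rewrite -mpolyC0.
move=> m _; rewrite -mul_mpolyC; apply: (Pm) => //; rewrite mpolyXE_id.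
elim/big_ind: _ => [|x y|i _]; [by rewrite -mpolyC1 | exact: Pm |].
by elim: (m i) => [|k IH]; rewrite ?expr0 -?mpolyC1 // exprS; apply: (Pm).
Qed.

(** * Differentiating rational representations of GL_g *)

Section Curves.
Variables (K : fieldType) (N : nat).
Hypothesis charK : [pchar K] =i pred0.

Lemma poly_eq0_inf (p : {poly K}) : (forall s, p.[s] = 0) -> p = 0.
Proof.
move=> h; apply/eqP; apply: contraT => p0.
pose rs := [seq i%:R : K | i <- seq.iota 0 (size p)].
have u : uniq rs.
  rewrite map_inj_in_uniq ?iota_uniq // => i j _ _ hij.
  have := @intr_inj_char0 K charK i%:Z j%:Z; rewrite -!pmulrn => /(_ hij) [] //.
have : all (root p) rs by apply/allP=> x _; apply/rootP.
by move/(max_poly_roots p0)/(_ u); rewrite size_map size_iota ltnn.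
Qed.

(** A group identity holds only at invertible matrices; along a line these are the points where the
    determinant polynomial d does not vanish, and that suffices over an infinite field. *)
Lemma poly_eq_away (d p q : {poly K}) : d != 0 -> (forall s, d.[s] != 0 -> p.[s] = q.[s]) -> p = q.
Proof.
move=> d0 h; apply/eqP; rewrite -subr_eq0; have : d * (p - q) = 0.
  apply: poly_eq0_inf => s; rewrite hornerM hornerD hornerN.
  by have [->|/h ->] := eqVneq d.[s] 0; rewrite ?mul0r // subrr mulr0.
by move/eqP; rewrite mulf_eq0 (negPf d0).
Qed.

Lemma mmap_horner (h : 'I_N -> {poly K}) p s : (mmap (@polyC K) h p).[s] = p.@[fun t => (h t).[s]].
Proof.
elim/mpoly_ring_ind: p => [c|i|p q hp hq|p q hp hq].
- by rewrite mmapC mevalC hornerC.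
- by rewrite mmapX mmap1U mevalXU.
- by rewrite raddfD /= hornerD hp hq mevalD.
- by rewrite rmorphM /= hornerM hp hq mevalM.
Qed.

Lemma mderivXU (i j : 'I_N) : ('X_i : {mpoly K[N]})^`M(j) = (i == j)%:R.
Proof.
rewrite mderivX mnm1E; case: eqP => [->|_]; last by rewrite scale0r.
by rewrite scale1r; have -> : (U_(j) - U_(j))%MM = 0%MM; [apply/mnmP=> t; rewrite mnmBE subnn mnm0E | rewrite mpolyX0].
Qed.

Lemma mmap_deriv (h : 'I_N -> {poly K}) p :
  (mmap (@polyC K) h p)^`() = \sum_t mmap (@polyC K) h p^`M(t) * (h t)^`().
Proof.
elim/mpoly_ring_ind: p => [c|i|p q hp hq|p q hp hq].
- by rewrite mmapC derivC big1 // => t _; rewrite mderivC raddf0 mul0r.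
- rewrite mmapX mmap1U (bigD1 i) //= big1 ?addr0 => [|t ti]; rewrite mderivXU.
    by rewrite eqxx rmorph1 mul1r.
  by rewrite eq_sym (negPf ti) rmorph0 mul0r.
- by rewrite raddfD /= derivD hp hq -big_split; apply: eq_bigr => t _; rewrite mderivD raddfD mulrDl.
- rewrite rmorphM /= derivM hp hq mulr_suml mulr_sumr -big_split; apply: eq_bigr => t _ /=.
  by rewrite mderivM rmorphD !rmorphM /= mulrDl mulrAC mulrA.
Qed.
End Curves.

Section GLtogl.
Variables (K : fieldType) (g : nat).
Hypothesis charK : [pchar K] =i pred0.

Definition line (x Y : 'M[K]_g) : 'M[{poly K}]_g := \matrix_(i, j) ((x i j)%:P + (Y i j) *: 'X).

Lemma line_at x Y s i j : (line x Y i j).[s] = (x + s *: Y) i j.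
Proof. by rewrite !mxE !hornerE mulrC. Qed.

Lemma det_line x Y s : (\det (line x Y)).[s] = \det (x + s *: Y).
Proof.
rewrite -[LHS]/(horner_eval s _) -det_map_mx; congr (\det _).
by apply/matrixP=> i j; rewrite mxE -line_at.
Qed.

Lemma det_line_neq0 Y : \det (line 1%:M Y) != 0.
Proof. by apply/eqP=> /(congr1 (horner^~ 0)); rewrite det_line scale0r addr0 det1 horner0 => /eqP; rewrite oner_eq0. Qed.

Section OneRep.
Variable V : GLrep K g.
Local Notation n := (gl_dim V).

Definition rat_exp : nat := projT1 (cid (gl_rational V)).
Definition rat_num : 'I_n -> 'I_n -> {mpoly K[g * g]} := projT1 (cid (projT2 (cid (gl_rational V)))).

Definition Qm (x : 'M[K]_g) : 'M[K]_n := \matrix_(i, j) (rat_num i j).@[fun t => mxvec x 0 t].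
(** The differential at x, in the direction Z, of the polynomial numerators [Qm] of the
    representation. *)
Definition Qd (x Z : 'M[K]_g) : 'M[K]_n :=
  \matrix_(i, j) \sum_t (rat_num i j)^`M(t).@[fun t => mxvec x 0 t] * mxvec Z 0 t.

Lemma glE x : x \in unitmx -> gl_mx V x = (\det x ^- rat_exp) *: Qm x.
Proof.
move=> ux; apply/matrixP=> i j; rewrite !mxE mulrC.
exact: (projT2 (cid (projT2 (cid (gl_rational V)))) x ux i j).
Qed.

Lemma QmE x : x \in unitmx -> Qm x = \det x ^+ rat_exp *: gl_mx V x.
Proof. by move=> ux; rewrite glE // scalerA divff ?scale1r // expf_neq0 // -unitfE -unitmxE. Qed.

Lemma Qm1 : Qm 1%:M = 1%:M.
Proof. by rewrite QmE ?unitmx1 // det1 expr1n scale1r gl_mx1. Qed.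

Lemma QmM x y : x \in unitmx -> y \in unitmx -> Qm (x *m y) = Qm x *m Qm y.
Proof.
move=> ux uy; rewrite !QmE ?unitmx_mul ?ux // gl_mxM // det_mulmx exprMn.
by rewrite -scalemxAl -scalemxAr scalerA.
Qed.

Lemma Qd_lin x : linear (Qd x).
Proof.
move=> c Y Z; apply/matrixP=> i j; rewrite !mxE mulr_sumr -big_split; apply: eq_bigr => t _ /=.
by rewrite linearP /= !mxE mulrDr mulrCA.
Qed.

Definition Qp x Y i j : {poly K} := mmap (@polyC K) (fun t => mxvec (line x Y) 0 t) (rat_num i j).

Lemma mxvec_line x Y t s : (mxvec (line x Y) 0 t).[s] = mxvec (x + s *: Y) 0 t.
Proof. by case/mxvec_indexP: t => i j; rewrite !mxvecE line_at. Qed.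

Lemma Qp_at x Y i j s : (Qp x Y i j).[s] = Qm (x + s *: Y) i j.
Proof. by rewrite mmap_horner mxE; apply: meval_eq => t; rewrite mxvec_line. Qed.

Lemma Qp_deriv x Y i j s : (Qp x Y i j)^`().[s] = Qd (x + s *: Y) Y i j.
Proof.
rewrite mmap_deriv mxE horner_sum; apply: eq_bigr => t _.
rewrite hornerM mmap_horner; congr (_ * _).
  by apply: meval_eq => u; rewrite mxvec_line.
by case/mxvec_indexP: t => a b; rewrite !mxvecE mxE derivD derivC derivZ derivX !hornerE.
Qed.

(** Differentiate Qm((1 + sZ)x) = Qm(1 + sZ) Qm(x) at s = 0. *)
Lemma Qd_mull x Z : x \in unitmx -> Qd x (Z *m x) = Qd 1%:M Z *m Qm x.
Proof.
move=> ux; apply/matrixP=> i j.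
have h : Qp x (Z *m x) i j = \sum_k Qp 1%:M Z i k * (Qm x k j)%:P.
  apply: (poly_eq_away charK (det_line_neq0 Z)) => s; rewrite det_line => ds.
  rewrite Qp_at -[x in x + _]mul1mx scalemxAl -mulmxDl QmM // ?unitmxE ?unitfE // [LHS]mxE.
  rewrite horner_sum; apply: eq_bigr => k _.
  by rewrite hornerM Qp_at hornerC.
have := congr1 (fun p => p^`().[0]) h; rewrite Qp_deriv scale0r addr0 => ->.
rewrite raddf_sum /= horner_sum [RHS]mxE; apply: eq_bigr => k _.
by rewrite derivM derivC mulr0 addr0 hornerM hornerC Qp_deriv scale0r addr0.
Qed.

Lemma Qd_mulr x Z : x \in unitmx -> Qd x (x *m Z) = Qm x *m Qd 1%:M Z.
Proof.
move=> ux; apply/matrixP=> i j.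
have h : Qp x (x *m Z) i j = \sum_k (Qm x i k)%:P * Qp 1%:M Z k j.
  apply: (poly_eq_away charK (det_line_neq0 Z)) => s; rewrite det_line => ds.
  rewrite Qp_at -[x in x + _]mulmx1 scalemxAr -mulmxDr QmM // ?unitmxE ?unitfE // [LHS]mxE.
  rewrite horner_sum; apply: eq_bigr => k _.
  by rewrite hornerM Qp_at hornerC.
have := congr1 (fun p => p^`().[0]) h; rewrite Qp_deriv scale0r addr0 => ->.
rewrite raddf_sum /= horner_sum [RHS]mxE; apply: eq_bigr => k _.
by rewrite derivM derivC mul0r add0r hornerM hornerC Qp_deriv scale0r addr0.
Qed.

Lemma Qd_conj x Y Y' : x \in unitmx -> x *m Y = Y' *m x -> Qm x *m Qd 1%:M Y = Qd 1%:M Y' *m Qm x.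
Proof. by move=> ux h; rewrite -Qd_mulr // h Qd_mull. Qed.

(** The bracket relation is the derivative at s = 0 of the intertwining relation [Qd_conj] along x =
    1 + sE. *)
Lemma Qd_bracket E C : Qd 1%:M E *m Qd 1%:M C + Qd 1%:M (C *m E) = Qd 1%:M C *m Qd 1%:M E + Qd 1%:M (E *m C).
Proof.
apply/matrixP=> i j.
have h : \sum_k Qp 1%:M E i k * ((Qd 1%:M C k j)%:P + Qd 1%:M (C *m E) k j *: 'X) =
         \sum_k ((Qd 1%:M C i k)%:P + Qd 1%:M (E *m C) i k *: 'X) * Qp 1%:M E k j.
  apply: (poly_eq_away charK (det_line_neq0 E)) => s; rewrite det_line => ds.
  have ux : (1%:M + s *: E) \in unitmx by rewrite unitmxE unitfE.
  (* Taking Y = Cx and Y' = xC makes the relation xY = Y'x hold without inverting x, and keeps both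
     sides polynomial in s. *)
  have := Qd_conj (Y := C *m (1%:M + s *: E)) (Y' := (1%:M + s *: E) *m C) ux; rewrite mulmxA => /(_ erefl).
  rewrite mulmxDr mulmxDl mulmx1 mul1mx -scalemxAl -scalemxAr.
  rewrite (linD _ _ (Qd_lin _)) (linD _ _ (Qd_lin _)) !(linZ _ _ (Qd_lin _)) => /matrixP /(_ i j).
  rewrite [LHS]mxE [X in _ = X -> _]mxE => hh.
  rewrite !horner_sum.
  refine (etrans (etrans _ hh) _).
    by apply: eq_bigr => k _; rewrite hornerM Qp_at !hornerE !mxE [_ * s]mulrC.
  by apply: eq_bigr => k _; rewrite hornerM Qp_at !hornerE !mxE [_ * s]mulrC.
have := congr1 (fun p => p^`().[0]) h; rewrite !raddf_sum /= !horner_sum => hh; rewrite [LHS]mxE [RHS]mxE ![(_ *m _) i j]mxE.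
have Q0 k l : (Qp 1%:M E k l).[0] = (k == l)%:R by rewrite Qp_at scale0r addr0 Qm1 mxE.
have Q1 k l : (Qp 1%:M E k l)^`().[0] = Qd 1%:M E k l by rewrite Qp_deriv scale0r addr0.
refine (esym (etrans (etrans _ (esym hh)) _)); last first.
- rewrite [LHS](eq_bigr (fun k => Qd 1%:M E i k * Qd 1%:M C k j + (i == k)%:R * Qd 1%:M (C *m E) k j)); last first.
    move=> k _; rewrite derivM derivD derivC add0r derivZ derivX alg_polyC hornerD !hornerM.
    by rewrite Q0 Q1 !hornerE.
  rewrite big_split /= [X in _ + X](bigD1 i) //= eqxx mul1r [X in _ + (_ + X)]big1 ?addr0 //.
  by move=> k; rewrite eq_sym => /negPf ->; rewrite mul0r.
rewrite [RHS](eq_bigr (fun k => Qd 1%:M C i k * Qd 1%:M E k j + (k == j)%:R * Qd 1%:M (E *m C) i k)); last first.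
  move=> k _; rewrite derivM derivD derivC add0r derivZ derivX alg_polyC hornerD !hornerM.
  by rewrite Q0 Q1 !hornerE [RHS]addrC mulrC.
rewrite big_split /= [X in _ = _ + X](bigD1 j) //= eqxx mul1r [X in _ = _ + (_ + X)]big1 ?addr0 //.
by move=> k /negPf ->; rewrite mul0r.
Qed.

(** The derivative of the representation at 1 along E_ab; the scalar comes from differentiating the
    denominator, a power of the determinant. *)
Definition gle (a b : 'I_g) : 'M[K]_n := Qd 1%:M (delta_mx a b) - ((a == b)%:R * rat_exp%:R)%:M.

Lemma gle_gl : glmx gle.
Proof.
move=> a b c d; rewrite /gle; set r := rat_exp%:R.
have := Qd_bracket (delta_mx a b) (delta_mx c d); rewrite !mul_delta_mx_cond.
rewrite -!scaler_nat !(linZ _ _ (Qd_lin _)) [a == d]eq_sym.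
set X := Qd _ (delta_mx a b); set Y := Qd _ (delta_mx c d); set Z := Qd _ (delta_mx c b); set W := Qd _ (delta_mx a d).
move=> h; have h' : X *m Y = Y *m X + ((b == c)%:R *: W - (d == a)%:R *: Z) by rewrite addrA -h addrK.
have cm (A B : 'M[K]_n) al be : (A - al%:M) *m (B - be%:M) = A *m B - (be *: A + al *: B - (al * be)%:M).
  have h1 : al%:M *m (B - be%:M) = al *: B - (al * be)%:M by rewrite mul_scalar_mx scalerBr scale_scalar_mx.
  by rewrite mulmxBl h1 mulmxBr mul_mx_scalar !opprB opprD -!addrA; congr (_ + _); rewrite addrCA.
rewrite !cm h' !scalerBr.
have -> : (b == c)%:R *: ((d == a)%:R * r)%:M = (d == a)%:R *: ((c == b)%:R * r)%:M :> 'M[K]_n.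
  by rewrite !scale_scalar_mx !mulrA [c == b]eq_sym [X in (X * r)%:M]mulrC.
have e3 (A B k : 'M[K]_n) : A - k - (B - k) = A - B by rewrite opprB addrA subrK.
by rewrite e3 [_ *: X + _]addrC [(a == b)%:R * r * _]mulrC addrAC.
Qed.
End OneRep.
End GLtogl.

Lemma subspace_vspace (K : fieldType) (V : vectType K) (B : V -> Prop) : subspace B ->
  exists U : {vspace V}, forall x, B x <-> x \in U.
Proof.
move=> sB; pose P d := `[< exists U : {vspace V}, (forall x, x \in U -> B x) /\ \dim U = d >].
have ex : exists d, P d.
  by exists 0%N; apply/asboolP; exists 0%VS; rewrite dimv0; split=> // x; rewrite memv0 => /eqP ->; apply: sub0.
have ub d : P d -> (d <= \dim {: V})%N by move/asboolP=> [U [_ <-]]; apply/dimvS/subvf.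
case: (ex_maxnP ex ub) => d /asboolP [U [UB dU]] dmax; exists U => x; split=> [Bx|]; last exact: UB.
have h : P (\dim (U + <[x]>)%VS).
  apply/asboolP; exists (U + <[x]>)%VS; split=> // y /memv_addP[u uU [w /vlineP[c ->] ->]].
  by apply: (subD sB); [apply: UB | apply: (subZ sB)].
have := dmax _ h; rewrite -dU => le.
have -> : U = (U + <[x]>)%VS by apply/eqP; rewrite eqEdim addvSl.
by apply: (subvP (addvSr U <[x]>)); apply: memv_line.
Qed.

Section RepToModule.
Variables (K : fieldType) (g : nat).
Hypothesis charK : [pchar K] =i pred0.

Lemma det_elem (a b : 'I_g) (s : K) : \det (1%:M + s *: delta_mx a b) = 1 + s *+ (a == b).
Proof.
have e i j : (1%:M + s *: delta_mx a b : 'M[K]_g) i j = (i == j)%:R + s * ((i == a) && (j == b))%:R.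
  by rewrite !mxE.
have pr : \prod_(i < g) (1%:M + s *: delta_mx a b : 'M[K]_g) i i = 1 + s *+ (a == b).
  rewrite (bigD1 a) //= big1 ?mulr1 => [|i ia]; rewrite e eqxx.
    by rewrite /= mulr_natr.
  by rewrite (negPf ia) /= mulr0 addr0.
have [ab|ba] := leqP a b.
  rewrite -det_tr det_trig; first by rewrite -pr; apply: eq_bigr => i _; rewrite mxE.
  apply/is_trig_mxP => i j ij; rewrite mxE e.
  have -> : (j == i) = false by apply/eqP=> h; rewrite h ltnn in ij.
  have -> : (j == a) && (i == b) = false.
    by apply/negbTE/negP=> /andP[/eqP ja /eqP ib]; move: ij; rewrite ja ib ltnNge ab.
  by rewrite mulr0 addr0.
rewrite det_trig //; apply/is_trig_mxP => i j ij; rewrite e.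
have -> : (i == j) = false by apply/eqP=> h; rewrite h ltnn in ij.
have -> : (i == a) && (j == b) = false.
  by apply/negbTE/negP=> /andP[/eqP ja /eqP ib]; move: ij; rewrite ja ib ltnNge ltnW.
by rewrite mulr0 addr0.
Qed.

Section OneRep.
Variable V : GLrep K g.
Local Notation n := (gl_dim V).
Local Notation D := (Qd V 1%:M).

Definition Qv Y (u : 'cV[K]_n) i : {poly K} := \sum_j Qp 1%:M Y i j * (u j 0)%:P.

Lemma Qv_at Y u i s : (Qv Y u i).[s] = (Qm V (1%:M + s *: Y) *m u) i 0.
Proof. by rewrite horner_sum mxE; apply: eq_bigr => j _; rewrite hornerM hornerC Qp_at. Qed.

Lemma Qv_deriv Y u i s : (Qv Y u i)^`().[s] = (Qd V (1%:M + s *: Y) Y *m u) i 0.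
Proof.
rewrite raddf_sum horner_sum mxE; apply: eq_bigr => j _ /=.
by rewrite derivM derivC mulr0 addr0 hornerM hornerC Qp_deriv.
Qed.

Lemma gle_raised v : (forall x, upper_unitriangular x -> gl_mx V x *m v = v) -> raised (mact (gle V)) (@zeroP _ _) v.
Proof.
move=> h a b ab; have ne : (a == b) = false by apply/eqP=> h'; rewrite h' ltnn in ab.
rewrite /zeroP /mact /gle ne mul0r raddf0 subr0; apply/matrixP=> i j; rewrite ord1 {j}.
have hQ : Qv (delta_mx a b) v i = (v i 0)%:P.
  apply: (poly_eq_away charK (oner_neq0 _)) => s _; rewrite Qv_at hornerC.
  have ds : \det (1%:M + s *: delta_mx a b) = 1 by rewrite det_elem ne mulr0n addr0.
  rewrite QmE ?unitmxE ?ds ?unitr1 // expr1n scale1r h // => k l lk; rewrite !mxE.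
  have -> : (k == a) && (l == b) = false.
    by apply/negbTE/negP=> /andP[/eqP ja /eqP ib]; move: lk; rewrite ja ib leqNgt ab.
  by rewrite mulr0 addr0.
have := congr1 (fun p => p^`().[0]) hQ; rewrite derivC horner0 Qv_deriv scale0r addr0 => ->.
by rewrite mxE.
Qed.

Lemma gle_weight v lam :
  (forall t : 'rV[K]_g, (forall i, t 0 i != 0) ->
        gl_mx V (diag_mx t) *m v = (\prod_(i < g) t 0 i ^ lam`_i) *: v) -> wv (mact (gle V)) (swt g lam) v.
Proof.
move=> h a; apply/matrixP=> i j; rewrite ord1 {j}.
have [m1 [m2 lamE]] : exists m1 m2 : nat, lam`_a = m2%:Z - m1%:Z.
  case: (lam`_a) => k; [exists 0%N, k | exists k.+1, 0%N]; by rewrite ?subr0 ?sub0r ?NegzE.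
pose r := rat_exp V.
(* The torus acts on v through (1+s)^(m2-m1) along the a-th diagonal direction; multiplying by the
   negative part of the exponent and by the denominator leaves a polynomial identity. *)
have hQ : (1 + 'X) ^+ m1 * Qv (delta_mx a a) v i = (1 + 'X) ^+ (r + m2) * (v i 0)%:P.
  apply: (poly_eq_away (d := 1 + 'X) charK) => [|s].
    by rewrite addrC -[1]opprK -polyCN monic_neq0 // monicXsubC.
  move=> ds0; have ds : 1 + s != 0 by move: ds0; rewrite !hornerE.
  rewrite !hornerM !horner_exp hornerC Qv_at hornerD hornerC hornerX.
  have dE : \det (1%:M + s *: delta_mx a a) = 1 + s by rewrite det_elem eqxx.
  rewrite QmE ?unitmxE ?dE ?unitfE // -/r.
  pose t : 'rV[K]_g := \row_i (1 + s *+ (i == a)).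
  have -> : 1%:M + s *: delta_mx a a = diag_mx t.
    apply/matrixP=> k l; rewrite !mxE; case: (eqVneq k l) => [<-|kl]; rewrite ?mulr1n ?mulr0n.
      by case: (k == a); rewrite ?mulr1 ?mulr0 ?mulr1n ?mulr0n.
    have -> : (k == a) && (l == a) = false by apply/negbTE/negP=> /andP[/eqP ka /eqP la]; rewrite ka la eqxx in kl.
    by rewrite mulr0 addr0.
  rewrite -scalemxAl h => [|k]; last by rewrite mxE; case: (k == a); rewrite ?mulr1n ?mulr0n ?addr0 ?oner_eq0.
  rewrite (bigD1 a) //= big1 ?mulr1 => [|k /negPf ka]; last by rewrite mxE ka mulr0n addr0 exp1rz.
  rewrite !mxE eqxx mulr1n lamE expfzDr // -!exprnP exprD.
  have yy : (1 + s) ^+ m1 * (1 + s) ^ (- m1%:Z) = 1 by rewrite exprnP -expfzDr // subrr expr0z.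
  move: ((1 + s) ^ _) ((1 + s) ^+ m1) ((1 + s) ^+ r) ((1 + s) ^+ m2) yy => z p q w yz.
  by rewrite mulrCA -!mulrA; congr (q * _); rewrite mulrCA; congr (w * _); rewrite mulrA yz mul1r.
have dX : ('X + 1 : {poly K})^`() = 1 by rewrite derivD derivX derivC addr0.
have dX1 m : ((1 + 'X : {poly K}) ^+ m)^`().[0] = m%:R.
  by rewrite addrC deriv_exp dX mul1r hornerMn horner_exp !hornerE expr1n.
have dX0 m : ((1 + 'X : {poly K}) ^+ m).[0] = 1 by rewrite horner_exp !hornerE expr1n.
have := congr1 (fun p => p^`().[0]) hQ; rewrite !derivM !hornerD !hornerM !dX1 !dX0 derivC hornerC horner0 Qv_deriv Qv_at.
rewrite !scale0r !addr0 Qm1 mul1mx !mul1r addr0 => hh.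
rewrite /mact /gle eqxx mul1r mulmxBl mul_scalar_mx [LHS]mxE [X in _ + X]mxE [X in _ - X]mxE [RHS]mxE ffunE lamE rmorphB /= -!pmulrn.
rewrite mulrBl; apply/eqP; rewrite subr_eq; apply/eqP.
by rewrite addrAC -mulrDl -natrD addnC -hh addrAC subrr add0r.
Qed.

Lemma D_delta (B : 'cV[K]_n -> Prop) : gl_stable (mact (gle V)) B -> forall Y u, B u -> B (D Y *m u).
Proof.
case=> sB Bs Y u Bu; rewrite (matrix_sum_delta Y) (lin_sum _ _ _ (Qd_lin V _)) mulmx_suml.
apply: (sub_sum sB) => a _; rewrite (lin_sum _ _ _ (Qd_lin V _)) mulmx_suml; apply: (sub_sum sB) => b _.
rewrite (linZ _ _ (Qd_lin V _)) -scalemxAl; apply: (subZ sB).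
have -> : D (delta_mx a b) = gle V a b + ((a == b)%:R * (rat_exp V)%:R)%:M by rewrite subrK.
by rewrite mulmxDl mul_scalar_mx; apply: (subD sB); [apply: Bs | apply: (subZ sB)].
Qed.

(** The curve s -> Qm(1 + sY)u satisfies a linear differential equation whose coefficients act
    through the Lie algebra. In characteristic zero its Taylor coefficients are determined
    recursively and stay in B; the value at s = 1 is their sum. *)
Lemma gl_stable_group (B : 'cV[K]_n -> Prop) : gl_stable (mact (gle V)) B -> forall x u, B u -> B (Qm V x *m u).
Proof.
move=> HB x u Bu; have sB := HB.1; pose Y := x - 1%:M.
pose de := \det (line 1%:M Y).
pose M : 'M[{poly K}]_g := map_mx polyC Y *m \adj (line 1%:M Y).
pose dq (i j : 'I_n) t : K := (rat_num i j)^`M(t).@[fun t => mxvec (1%:M : 'M[K]_g) 0 t].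
have idt i : de * (Qv Y u i)^`() = \sum_j (\sum_t (dq i j t)%:P * mxvec M 0 t) * Qv Y u j.
  apply: (poly_eq_away charK (det_line_neq0 Y)) => s ds; rewrite [LHS]hornerM Qv_deriv [RHS]horner_sum [de.[s]]det_line.
  rewrite det_line in ds; set y := 1%:M + s *: Y in ds *.
  have uy : y \in unitmx by rewrite unitmxE unitfE.
  have -> : Qd V y Y = Qd V y ((Y *m invmx y) *m y) by rewrite mulmxKV.
  rewrite (Qd_mull charK) // -mulmxA.
  have yy : \det y *: (Y *m invmx y) = Y *m \adj y.
    by rewrite /invmx uy -scalemxAr scalerA divff ?scale1r.
  transitivity ((D (Y *m \adj y) *m (Qm V y *m u)) i 0).
    by rewrite -yy (linZ _ _ (Qd_lin V _)) -scalemxAl [RHS]mxE.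
  rewrite mxE; apply: eq_bigr => j _; rewrite hornerM Qv_at -/y; congr (_ * _).
  rewrite mxE horner_sum; apply: eq_bigr => t _; rewrite hornerM hornerC; congr (_ * _).
  have -> : Y *m \adj y = map_mx (horner_eval s) M.
    rewrite map_mxM map_mx_adj; congr (_ *m \adj _); apply/matrixP=> k l; rewrite !mxE.
      by rewrite -[RHS]/((_)%:P.[s]) hornerC.
    by rewrite -[RHS]/((_ + _).[s]) !hornerE mulrC.
  by case/mxvec_indexP: t => k l; rewrite !mxvecE mxE.
pose w m : 'cV[K]_n := \col_i (Qv Y u i)`_m.
pose Mc m : 'M[K]_g := \matrix_(k, l) (M k l)`_m.
have de0 : de`_0 = 1 by rewrite -horner_coef0 det_line scale0r addr0 det1.
(* The equation is cleared of denominators by the determinant de, whose constant term is 1; hence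
   the coefficient of index m+1 occurs with the invertible factor m+1. *)
have rec m : \sum_(k < m.+1) (de`_k * (m - k).+1%:R) *: w (m - k).+1 = \sum_(k < m.+1) D (Mc k) *m w (m - k)%N.
  apply/matrixP=> i j; rewrite ord1 {j} !summxE; have := congr1 (fun p : {poly K} => p`_m) (idt i).
  rewrite coefM coef_sum => hh.
  transitivity (\sum_(k < m.+1) de`_k * (Qv Y u i)^`()`_(m - k)).
    apply: eq_bigr => k _; rewrite [LHS]mxE [w _ _ _]mxE coef_deriv -[X in _ = _ * X]mulr_natr -mulrA.
    by congr (_ * _); exact: mulrC.
  rewrite hh; under [RHS]eq_bigr => k _ do rewrite mxE.
  rewrite exchange_big; apply: eq_bigr => j _; rewrite coefM; apply: eq_bigr => k _ /=.
  rewrite [w _ _ _]mxE; congr (_ * _); rewrite coef_sum mxE; apply: eq_bigr => t _.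
  by rewrite coefCM; congr (_ * _); case/mxvec_indexP: t => k' l; rewrite !mxvecE [RHS]mxE.
have Bw : forall m, B (w m).
  move=> m; elim/ltn_ind: m => -[_|m IH].
    have -> : w 0%N = u; last by [].
    by apply/matrixP=> i j; rewrite ord1 mxE -horner_coef0 Qv_at scale0r addr0 Qm1 mul1mx.
  have := rec m; rewrite big_ord_recl de0 mul1r subn0 => hh.
  have n0 : m.+1%:R != 0 :> K by rewrite (natr_eq0_char0 charK).
  apply: (subZ_inv sB n0); rewrite -[_ *: _](addrK (\sum_(i < m) (de`_(lift ord0 i) * (m - lift ord0 i).+1%:R) *: w (m - lift ord0 i).+1)) hh.
  apply: (subB sB); apply: (sub_sum sB) => k _.
    by apply: (D_delta HB); apply: IH; rewrite ltnS leq_subr.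
  by apply: (subZ sB); apply: (IH); rewrite ltnS /= /bump leq0n; have := ltn_ord k; lia.
have -> : Qm V x *m u = \sum_(m < \max_i size (Qv Y u i)) w m.
  apply/matrixP=> i j; rewrite ord1 summxE; have -> : x = 1%:M + 1 *: Y by rewrite scale1r addrC subrK.
  rewrite -Qv_at (horner_coef_wide (n := \max_i size (Qv Y u i))).
    by apply: eq_bigr => m _; rewrite expr1n mulr1 mxE.
  exact: (leq_bigmax i).
exact: (sub_sum sB).
Qed.

Lemma is_Schur_hwm lam : is_Schur lam V -> exists v, hwm (gle V) (swt g lam) v.
Proof.
case=> -[n0 irr] [v [v0 hr hw]]; exists v; split.
- exact: gle_gl.
- by apply/eqP.
- exact: gle_weight.
- exact: gle_raised.
move=> B HB u Bu u0 w; have [U BU] := subspace_vspace HB.1.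
case: (irr U) => [x ux y yU|U0|UF].
- have By : B y by apply/BU.
  apply/BU; rewrite glE // -scalemxAl; apply: (subZ HB.1); exact: gl_stable_group.
- by case: u0; apply/eqP; rewrite -memv0 -U0; apply/BU.
by apply/BU; rewrite UF memvf.
Qed.

(** The longest Weyl group element; it exchanges raising and lowering operators, which is used for
    dual modules. *)
Definition rev_mx : 'M[K]_g := \matrix_(i, j) (j == rev_ord i)%:R.

Lemma rev_mxK : rev_mx *m rev_mx = 1%:M.
Proof.
apply/matrixP=> i j; rewrite mxE (bigD1 (rev_ord i)) //= !mxE eqxx mul1r rev_ordK big1 ?addr0 1?eq_sym // => k /negPf ki.
by rewrite mxE ki mul0r.
Qed.

Lemma gle_rev : exists W W' : 'M[K]_n, [/\ W *m W' = 1%:M, W' *m W = 1%:M &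
  forall a b, W *m gle V a b = gle V (rev_ord a) (rev_ord b) *m W].
Proof.
have ur : rev_mx \in unitmx by case/mulmx1_unit: rev_mxK.
have QQ : Qm V rev_mx *m Qm V rev_mx = 1%:M by rewrite -QmM // rev_mxK Qm1.
exists (Qm V rev_mx), (Qm V rev_mx); split=> // a b; rewrite /gle (inj_eq rev_ord_inj) mulmxBr mulmxBl mul_mx_scalar mul_scalar_mx.
congr (_ - _); apply: Qd_conj => //; apply/matrixP=> i j; rewrite !mxE.
rewrite (bigD1 a) //= [RHS](bigD1 (rev_ord b)) //= !mxE !eqxx /= [X in _ + X]big1 ?addr0 => [|k /negPf ka].
  rewrite big1 ?addr0 => [|k /negPf kb]; last by rewrite !mxE kb andbF mul0r.
  rewrite rev_ordK andbT; congr (_%:R * _).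
by rewrite -(inj_eq rev_ord_inj) rev_ordK eq_sym.
by rewrite !mxE ka mulr0.
Qed.
End OneRep.
End RepToModule.

(** * Infinitesimal equivariance of Pieri maps *)

Section PieriEquivariance.
Variables (K : fieldType) (g : nat).
Hypothesis charK : [pchar K] =i pred0.

Lemma iotaS_min (X : lmodType K) (a : 'I_g) (L : {set 'I_g}) (y : {ffun {set 'I_g} -> X}) :
  (forall j : 'I_g, j \in L -> (a < j)%N) -> iotaS (a |: L) y = iota a (iotaS L y).
Proof.
move=> aL; have nL : a \notin L by apply/negP=> /aL; rewrite ltnn.
rewrite iota_iotaS // /sg; have -> : [set j in L | (j < a)%N] = set0; last by rewrite cards0 scale1r.
by apply/setP=> j; rewrite !inE; case jL: (j \in L) => //=; apply/negbTE; rewrite -leqNgt ltnW // aL.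
Qed.

Lemma eps_iota_iota (X : lmodType K) (a b c : 'I_g) (y : {ffun {set 'I_g} -> X}) :
  iota c (eps b (iota a y)) = (c == b)%:R *: iota a y + eps b (iota a (iota c y)).
Proof. by rewrite iota_eps [iota c (iota a y)]iotaC [eps b (- _)]linearN opprK. Qed.

Lemma iotaS_eps_iota (X : lmodType K) (a b : 'I_g) (L : {set 'I_g}) (y : {ffun {set 'I_g} -> X}) : b \notin L ->
  iotaS L (eps b (iota a y)) = eps b (iota a (iotaS L y)).
Proof.
elim/set_min_ind: L => [|c L cL IH]; first by rewrite !iotaS0.
rewrite !inE negb_or => /andP[bc bL]; rewrite !iotaS_min // IH // eps_iota_iota eq_sym (negPf bc).
by rewrite scale0r add0r.
Qed.

(** Only the contraction of index b is modified by the elementary matrix, and it occurs at most once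
    in L, so the product is affine in s; its slope is the commutator with eps_b iota_a. *)
Lemma comps_elem (X : lmodType K) (a b : 'I_g) (s : K) (L : {set 'I_g}) (y : {ffun {set 'I_g} -> X}) :
  comps (iotam (1%:M + s *: delta_mx a b)) L y =
  iotaS L y + s *: (iotaS L (eps b (iota a y)) - eps b (iota a (iotaS L y))).
Proof.
have J c z : iotam (1%:M + s *: delta_mx a b) c z = iota c z + (s * (c == b)%:R) *: iota a z.
  rewrite /iotam (bigD1 c) //= !mxE eqxx.
  have [->|ac] := eqVneq c a.
    rewrite big1 ?addr0 => [|i ia]; first by rewrite /= scalerDl scale1r.
    by rewrite !mxE (negPf ia) /= mulr0 addr0 scale0r.
  rewrite /= mulr0 addr0 scale1r (bigD1 a) 1?eq_sym //= !mxE eqxx eq_sym (negPf ac) /= add0r big1 => [|i /andP[ic ia]].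
    by rewrite addr0 [b == c]eq_sym.
  by rewrite !mxE (negPf ic) (negPf ia) /= mulr0 addr0 scale0r.
elim/set_min_ind: L => [|c L cL IH]; first by rewrite comps0 !iotaS0 subrr scaler0 addr0.
rewrite compsU1 // IH J !iotaS_min // linearD linearZ /=.
have -> : (s * (c == b)%:R) *: iota a (iotaS L y + s *: (iotaS L (eps b (iota a y)) - eps b (iota a (iotaS L y)))) =
   (s * (c == b)%:R) *: iota a (iotaS L y).
  case: eqP => [cb|_]; last by rewrite mulr0 !scale0r.
  by rewrite iotaS_eps_iota ?subrr ?scaler0 ?addr0 //; apply/negP=> /cL; rewrite cb ltnn.
rewrite -addrA -scalerA -scalerDr linearB /=; congr (_ + _ *: _).
by rewrite eps_iota_iota opprD -addrA addrAC -addrA addKr addrC.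
Qed.

Section One.
Variables (V V' : GLrep K g) (N : nat) (P : ext_tensor_map N V V').
Hypothesis hP : is_Pieri P.

Definition pext (L : {set 'I_g}) : 'M[K]_(gl_dim V', gl_dim V) :=
  if insub L is Some L1 then P L1 else 0.

Lemma pext_supp (L : {set 'I_g}) : #|L| != N -> pext L = 0.
Proof. by move=> LN; rewrite /pext insubF //; apply/negbTE. Qed.

Lemma pext_val (L : ext g N) : pext (val L) = P L.
Proof. by rewrite /pext valK. Qed.

Lemma pext_neq0 : exists L, pext L != 0.
Proof. by case: hP => -[L PL] _; exists (val L); rewrite pext_val. Qed.

Lemma sum_ext (Z : zmodType) (F : {set 'I_g} -> Z) :
  \sum_(L : {set 'I_g} | #|L| == N) F L = \sum_(L : ext g N) F (val L).
Proof.
case: (pickP (fun L : {set 'I_g} => #|L| == N)) => [L0 hL0|no]; last first.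
  rewrite !big1 // => [L _|L]; last by rewrite no.
  by have := no (val L); rewrite (valP L).
rewrite (reindex_onto val (insubd (Sub L0 hL0 : ext g N))) /= => [|L hL]; last by rewrite insubdK.
by apply: eq_bigl => L; rewrite (valP L) valKd eqxx.
Qed.

Lemma sum_pext (Z : zmodType) (F : {set 'I_g} -> Z) : (forall L : {set 'I_g}, #|L| != N -> F L = 0) ->
  \sum_(L : {set 'I_g}) F L = \sum_(L : ext g N) F (val L).
Proof.
by move=> F0; rewrite -sum_ext (bigID (fun L : {set 'I_g} => #|L| == N)) /= [X in _ + X]big1 ?addr0.
Qed.

Lemma pext_group x y : x \in unitmx ->
  dF pext (pw (gl_mx V x) y) = pw (gl_mx V' x) [ffun S => \sum_L pext L *m comps (iotam x) L y S].
Proof.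
move=> ux; apply/ffunP=> S; rewrite !ffunE.
rewrite !sum_pext => [|L LN|L LN]; try by rewrite pext_supp // mul0mx.
transitivity (\sum_(L : ext g N) \sum_(L' : ext g N)
   minor x L L' *: (gl_mx V' x *m (P L' *m iotaS (val L) y S))).
  apply: eq_bigr => L _; have -> : iotaS (val L) (pw (gl_mx V x) y) S = gl_mx V x *m iotaS (val L) y S.
    by rewrite /pw iotaS_mul ffunE.
  rewrite mulmxA pext_val (hP.2 _ ux L) mulmx_suml; apply: eq_bigr => L' _.
  by rewrite -scalemxAl mulmxA.
rewrite exchange_big mulmx_sumr; apply: eq_bigr => L' _; rewrite pext_val (comps_iotam x y (eqP (valP L'))).
rewrite sum_ext sum_ffunE !mulmx_sumr; apply: eq_bigr => L _.
by rewrite [in RHS]ffunE -!scalemxAr /minorS !valK.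
Qed.

(** The derivative at s = 0 of the group equivariance [pext_group] along 1 + s E_ab. *)
Lemma pext_equi : equi (gle V) (gle V') pext.
Proof.
move=> a b y; pose E : 'M[K]_g := delta_mx a b.
pose X (n : nat) (z : {ffun {set 'I_g} -> 'cV[K]_n}) := eps b (iota a z).
pose u := dF pext y; pose w := dF pext (X _ y) - X _ (dF pext y).
have hs s : [ffun S => \sum_L pext L *m comps (iotam (1%:M + s *: E)) L y S] = u + s *: w.
  apply/ffunP=> S; rewrite ffunE.
  under eq_bigr => L _ do rewrite comps_elem ffunE mulmxDr.
  rewrite big_split /= ffunE [u S]ffunE; congr (_ + _).
  transitivity (s *: (\sum_L pext L *m iotaS L (X _ y) S - \sum_L pext L *m X _ (iotaS L y) S)).
    rewrite -sumrB scaler_sumr; apply: eq_bigr => L _; rewrite [X in _ *m X]ffunE -scalemxAr; congr (_ *: _).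
    by rewrite ffunE [in LHS]mulmxDr; congr (_ + _); rewrite ffunE mulmxN.
  rewrite [RHS]ffunE; congr (_ *: _); rewrite /w [RHS]ffunE [dF _ _ _]ffunE [X in _ = _ + X]ffunE; congr (_ - _).
  rewrite /X [RHS]ffunE; case: ifP => bS; last first.
    by rewrite big1 // => L _; rewrite ffunE bS mulmx0.
  rewrite [in RHS]ffunE; case: ifP => aS.
    by rewrite scaler0 big1 // => L _; rewrite ffunE bS ffunE aS scaler0 mulmx0.
  rewrite ffunE !scaler_sumr; apply: eq_bigr => L _.
  by rewrite ffunE bS ffunE aS !scalemxAr.
have key S : gle V' a b *m u S + w S = dF pext (pw (gle V a b) y) S.
  apply/matrixP=> i j; rewrite ord1 {j}.
  pose de : {poly K} := 1 + 'X *+ (a == b).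
  have dE s : de.[s] = \det (1%:M + s *: E) by rewrite det_elem // hornerD hornerC hornerMn hornerX.
  have de0 : de != 0.
    by apply/eqP=> /(congr1 (horner^~ 0)); rewrite dE scale0r addr0 det1 horner0 => /eqP; rewrite oner_eq0.
  (* Both sides are multiplied by powers of the determinant to clear the denominators of the two
     representations; the derivatives at 0 of these powers are the scalar corrections in [gle]. *)
  have hp : de ^+ rat_exp V * \sum_j Qp (V := V') 1%:M E i j * ((u S j 0)%:P + (w S j 0) *: 'X) =
            de ^+ rat_exp V' * \sum_L \sum_j (pext L i j)%:P * Qv E (iotaS L y S) j.
    apply: (poly_eq_away charK de0) => s ds; rewrite dE in ds.
    have ux : 1%:M + s *: E \in unitmx by rewrite unitmxE unitfE.
    rewrite !hornerM !horner_exp dE.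
    have := pext_group y ux; rewrite hs => /ffunP /(_ S); rewrite [RHS]ffunE [LHS]ffunE => /matrixP /(_ i 0).
    set x := 1%:M + s *: E in ds ux *.
    rewrite !(glE) //.
    have -> : (\sum_j Qp (V := V') 1%:M E i j * ((u S j 0)%:P + w S j 0 *: 'X)).[s] = (Qm V' x *m (u + s *: w) S) i 0.
      rewrite horner_sum mxE; apply: eq_bigr => j _; rewrite hornerM Qp_at !ffunE !mxE !hornerE.
      by rewrite [s * _]mulrC.
    have -> : (\sum_L \sum_j (pext L i j)%:P * Qv E (iotaS L y S) j).[s] = (\sum_L pext L *m (Qm V x *m iotaS L y S)) i 0.
      rewrite horner_sum summxE; apply: eq_bigr => L _; rewrite horner_sum mxE; apply: eq_bigr => j _.
      by rewrite hornerM hornerC Qv_at.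
    under eq_bigr => L _ do rewrite /pw iotaS_mul ffunE -scalemxAl -scalemxAr.
    rewrite -scaler_sumr [in RHS]ffunE -scalemxAl => hh.
    have dr : \det x ^+ rat_exp V != 0 by rewrite expf_neq0.
    have dr' : \det x ^+ rat_exp V' != 0 by rewrite expf_neq0.
    move: hh; rewrite [X in X = _ -> _]mxE [X in _ = X -> _]mxE.
    move/(congr1 (fun t => \det x ^+ rat_exp V' * (\det x ^+ rat_exp V * t))).
    rewrite mulVKf // [X in _ = X -> _]mulrCA mulVKf // => hh; rewrite hh; congr (_ * (_ *m _) _ _).
    by rewrite ffunE.
  have de00 : de.[0] = 1 by rewrite dE scale0r addr0 det1.
  have de1 r : (de ^+ r)^`().[0] = (a == b)%:R * r%:R.
    rewrite deriv_exp derivD derivC add0r derivMn derivX hornerMn hornerM horner_exp de00 expr1n mulr1.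
    by rewrite hornerMn hornerC mulr_natr.
  have := congr1 (fun p => p^`().[0]) hp; rewrite !derivM !hornerD !hornerM !horner_exp de00 !expr1n !de1 !mul1r.
  have -> : (\sum_j Qp (V := V') 1%:M E i j * ((u S j 0)%:P + w S j 0 *: 'X)).[0] = u S i 0.
    rewrite horner_sum (bigD1 i) //= big1 ?addr0 => [|j /negPf ji].
      by rewrite hornerM Qp_at scale0r addr0 Qm1 mxE eqxx mul1r !hornerE.
    by rewrite hornerM Qp_at scale0r addr0 Qm1 mxE eq_sym ji mul0r.
  have -> : (\sum_j Qp (V := V') 1%:M E i j * ((u S j 0)%:P + w S j 0 *: 'X))^`().[0] =
     (Qd V' 1%:M E *m u S) i 0 + w S i 0.
    rewrite raddf_sum horner_sum /= mxE; under eq_bigr => j _ do rewrite derivM derivD derivC add0r derivZ derivX hornerD !hornerM.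
    rewrite big_split; congr (_ + _) => /=.
      by apply: eq_bigr => j _; rewrite Qp_deriv scale0r addr0 !hornerE.
    rewrite (bigD1 i) //= big1 ?addr0 => [|j /negPf ji].
      by rewrite Qp_at scale0r addr0 Qm1 mxE eqxx mul1r !hornerE.
    by rewrite Qp_at scale0r addr0 Qm1 mxE eq_sym ji mul0r.
  have -> : (\sum_L \sum_j (pext L i j)%:P * Qv E (iotaS L y S) j).[0] = u S i 0.
    rewrite horner_sum /u ffunE summxE; apply: eq_bigr => L _; rewrite horner_sum mxE; apply: eq_bigr => j _.
    by rewrite hornerM hornerC Qv_at scale0r addr0 Qm1 mul1mx.
  have -> : (\sum_L \sum_j (pext L i j)%:P * Qv E (iotaS L y S) j)^`().[0] = (\sum_L pext L *m (Qd V 1%:M E *m iotaS L y S)) i 0.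
    rewrite raddf_sum horner_sum summxE; apply: eq_bigr => L _; rewrite raddf_sum horner_sum mxE; apply: eq_bigr => j _ /=.
    by rewrite derivM derivC mul0r add0r hornerM hornerC Qv_deriv scale0r addr0.
  move=> hh.
  have -> : dF pext (pw (gle V a b) y) S = \sum_L pext L *m (Qd V 1%:M E *m iotaS L y S) - ((a == b)%:R * (rat_exp V)%:R) *: u S.
    rewrite /u !ffunE scaler_sumr -sumrB; apply: eq_bigr => L _; rewrite /pw iotaS_mul ffunE /gle mulmxBl mul_scalar_mx.
    by rewrite mulmxBr scalemxAr.
  rewrite /gle mulmxBl mul_scalar_mx.
  have e1 (A B C : 'cV[K]_(gl_dim V')) c : (A - c *: B + C) i 0 = A i 0 - c * B i 0 + C i 0 by rewrite !mxE.
  have e2 (A B : 'cV[K]_(gl_dim V')) c : (A - c *: B) i 0 = A i 0 - c * B i 0 by rewrite !mxE.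
  have e3 (c c' p q r : K) : c' + (p + q) = c + r -> p - c + q = r - c'.
    by move=> h; apply/eqP; rewrite addrAC subr_eq addrAC [r + c]addrC -h addrAC subrr add0r.
  by rewrite e1 e2 -/E; apply: e3.
apply/ffunP=> S; rewrite Fa_at /Fa dFB [LHS]ffunE -key /w -/u; set p := gle V' a b *m u S.
have s1 : (dF pext (X _ y) - X _ u) S = dF pext (X _ y) S - X _ u S by rewrite ffunE [X in _ + X]ffunE.
have s2 : (- dF pext (eps b (iota a y))) S = - dF pext (X _ y) S by rewrite ffunE.
by rewrite s1 s2 -/(X _ u) -addrA addrAC subrr add0r.
Qed.

End One.
End PieriEquivariance.

(** * Acyclicity from regular sequences that kill homology *)

Section Acyclicity.
Variable A : comNzRingType.
Implicit Types (ws rest : seq A).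

(** The first half of [regular_seq], without properness; this half passes freely to projective
    modules and localizations. *)
Definition wreg ws (M : lmodType A) := forall i, (i < size ws)%N -> forall y : M,
  in_seq_mul (take i ws) (ws`_i *: y) -> in_seq_mul (take i ws) y.

Lemma in_seq_mul_nil (M : lmodType A) (x : M) : in_seq_mul [::] x <-> x = 0.
Proof.
split=> [[z ->]|->]; first by rewrite big_ord0.
by exists (fun=> 0); rewrite big_ord0.
Qed.

Lemma in_seq_mulE ws (M : lmodType A) (x : M) :
  in_seq_mul ws x <-> exists z : nat -> M, x = \sum_(i < size ws) ws`_i *: z i.
Proof.
split=> [[z ->]|[z ->]]; last by exists (fun i => z i).
exists (fun i => if insub i is Some j then z j else 0); apply: eq_bigr => i _.
by rewrite valK.
Qed.

Lemma in_seq_mul_rcons ws w (M : lmodType A) (x : M) :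
  in_seq_mul (rcons ws w) x <-> exists y, in_seq_mul ws (x - w *: y).
Proof.
have e (z : nat -> M) : \sum_(i < size (rcons ws w)) (rcons ws w)`_i *: z i =
    \sum_(i < size ws) ws`_i *: z i + w *: z (size ws).
  rewrite size_rcons big_ord_recr /= nth_rcons ltnn eqxx; congr (_ + _).
  by apply: eq_bigr => i _; rewrite nth_rcons ltn_ord.
split=> [/in_seq_mulE [z ->]|[y /in_seq_mulE [z zE]]].
  by exists (z (size ws)); apply/in_seq_mulE; exists z; rewrite e addrK.
apply/in_seq_mulE; pose z' i := if i == size ws then y else z i.
exists z'; rewrite e {2}/z' eqxx.
apply/eqP; rewrite -subr_eq zE; apply/eqP; apply: eq_bigr => i _.
by rewrite /z' (ltn_eqF (ltn_ord i)).
Qed.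

Lemma wreg_next ws w rest (M : lmodType A) (y : M) : wreg (ws ++ w :: rest) M ->
  in_seq_mul ws (w *: y) -> in_seq_mul ws y.
Proof.
move=> /(_ (size ws)); rewrite size_cat /= -addSnnS leq_addr take_size_cat // nth_cat ltnn subnn /=.
by move=> /(_ isT y).
Qed.

Variables (T : nat -> lmodType A) (d : forall i, {linear T i.+1 -> T i}).
Hypothesis dd : forall i x, d i (d i.+1 x) = 0.

(** Annihilation of homology at positive positions is required modulo every sequence ws at once, so
    that it survives each step of dividing by a further element. *)
Definition kills w := forall ws i (x : T i.+1), in_seq_mul ws (d i x) ->
  exists y, in_seq_mul ws (w *: x - d i.+1 y).

Definition exact_mod ws j := forall i (x : T i.+1), (j <= i)%N -> in_seq_mul ws (d i x) ->
  exists y, in_seq_mul ws (x - d i.+1 y).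

Let dlin i : linear (d i). Proof. exact: linearP. Qed.

(** The long exact sequence for division by a nonzerodivisor w: a cycle modulo w yields a relation
    one position lower, so exactness is lost at one position only. *)
Lemma exact_mod_rcons ws w rest j : (forall i, wreg (ws ++ w :: rest) (T i)) -> exact_mod ws j ->
  exact_mod (rcons ws w) j.+1.
Proof.
move=> wr ex [//|i] x ji /in_seq_mul_rcons [y h].
have h1 : in_seq_mul ws (w *: d i y).
  have := in_seq_mul_lin (@dlin i) h; rewrite (linB _ _ (@dlin i)) dd sub0r (linZ _ _ (@dlin i)) => /in_seq_mulN.
  by rewrite opprK.
have [z hz] := ex _ _ ji (wreg_next (wr i) h1).
have [] := ex i.+1 (x - w *: z) (leqW ji).
  rewrite (linB _ _ (@dlin _)) (linZ _ _ (@dlin _)).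
  have -> : d i.+1 x - w *: d i.+1 z = (d i.+1 x - w *: y) + w *: (y - d i.+1 z).
    by rewrite scalerBr addrA subrK.
  by apply: in_seq_mulD => //; apply: in_seq_mulZ.
move=> t ht; exists t; apply/in_seq_mul_rcons; exists z.
by rewrite addrAC.
Qed.

(** If w u = d v modulo ws, then v is a cycle modulo (ws, w). An element of [rest] kills its class,
    and by induction, one position higher, v = d v1 + w z; then w (u - d z) = 0 and w cancels. The
    induction ends where the complex does. *)
Lemma regular_mod_boundary rest ws j w u v :
  (forall i, wreg (ws ++ w :: rest) (T i)) -> (forall i (x : T i), (j + size rest < i)%N -> x = 0) ->
  exact_mod ws j -> (forall w', w' \in rest -> kills w') ->
  in_seq_mul ws (w *: u - d j v) -> exists v', in_seq_mul ws (u - d j v').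
Proof.
elim: rest ws j w u v => [|w' rest IH] ws j w u v wr Tz ex kl h.
  have v0 : v = 0 by apply: Tz; rewrite addn0.
  exists 0; rewrite linear0 subr0; apply: (wreg_next (wr j)).
  by move: h; rewrite v0 linear0 subr0.
have [v1] : exists v1, in_seq_mul (rcons ws w) (v - d j.+1 v1).
  have dv : in_seq_mul (rcons ws w) (d j v).
    apply/in_seq_mul_rcons; exists u; rewrite -opprB; exact: in_seq_mulN.
  have [y hy] := kl w' (mem_head _ _) _ _ _ dv.
  apply: (IH _ _ w' _ y) => //.
  - by move=> i; rewrite cat_rcons.
  - by move=> i x; rewrite addSnnS; apply: Tz.
  - exact: exact_mod_rcons wr ex.
  by move=> w'' w''r; apply: kl; rewrite inE w''r orbT.
move/in_seq_mul_rcons => [z hz]; exists z; apply: (wreg_next (wr j)).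
have -> : w *: (u - d j z) = (w *: u - d j v) + d j (v - d j.+1 v1 - w *: z).
  by rewrite !(linB _ _ (@dlin j)) dd subr0 (linZ _ _ (@dlin j)) scalerBr addrA subrK.
by apply: in_seq_mulD => //; apply: in_seq_mul_lin (@dlin j) hz.
Qed.

(* A sequence killing the homology forces exactness once it is longer than the remaining part of the complex. *)
Lemma acyclic_mod ws ds : (forall i, wreg (ws ++ ds) (T i)) -> (forall i (x : T i), (size ds < i)%N -> x = 0) ->
  (forall w, w \in ds -> kills w) -> exact_mod ws 0.
Proof.
move=> wr Tz kl; have h m : forall j, (size ds <= j + m)%N -> exact_mod ws j.
  elim: m => [|m IH] j jm.
    move=> i x ji _; exists 0; rewrite linear0 subr0; have -> : x = 0 by apply: Tz; rewrite ltnS (leq_trans _ ji) // -[j]addn0.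
    exact: in_seq_mul0.
  have ex : exact_mod ws j.+1 by apply: IH; rewrite addSnnS.
  clear IH; move=> i x; rewrite leq_eqVlt => /orP[/eqP ji|]; last exact: ex.
  rewrite -{}ji in x * => dx.
  case: ds wr Tz kl jm => [|w ds] wr Tz kl jm.
    exists 0; rewrite linear0 subr0; have -> : x = 0 by apply: Tz.
    exact: in_seq_mul0.
  have [y hy] := kl w (mem_head _ _) _ _ _ dx.
  apply: (regular_mod_boundary (rest := ds) (w := w) (v := y)) => //.
    by move=> i' x' h; apply: Tz => /=; apply: leq_ltn_trans h; rewrite addSn ltnS leq_addl.
  by move=> w' w'd; apply: kl; rewrite inE w'd orbT.
by apply: (h (size ds)).
Qed.

(** The killing sequence ds makes the complex exact modulo ws, and q, placed in front of ds, then
    acts without torsion on the cokernel. *)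
Lemma regular_on_coker ws q ds : (forall i, wreg (ws ++ q :: ds) (T i)) -> (forall i, wreg (ws ++ ds) (T i)) ->
  (forall i (x : T i), (size ds < i)%N -> x = 0) -> (forall w, w \in ds -> kills w) ->
  forall u v, in_seq_mul ws (q *: u - d 0 v) -> exists v', in_seq_mul ws (u - d 0 v').
Proof.
move=> wr wr' Tz kl u v h; apply: (regular_mod_boundary (rest := ds) (w := q) (v := v)) => //.
exact: acyclic_mod wr' Tz kl.
Qed.
End Acyclicity.

Section Transport.
Variable A : comNzRingType.

Lemma in_seq_mem (ws : seq A) (M : lmodType A) a (x : M) : a \in ws -> in_seq_mul ws (a *: x).
Proof.
move=> aw; apply/in_seq_mulE; exists (fun i => if i == index a ws then x else 0).
have ia : (index a ws < size ws)%N by rewrite index_mem.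
rewrite (bigD1 (Ordinal ia)) //= eqxx nth_index // big1 ?addr0 // => i.
by rewrite -val_eqE /= => /negPf ->; rewrite scaler0.
Qed.

Lemma in_seq_mul_mono (ws ws' : seq A) (M : lmodType A) (x : M) : {subset ws <= ws'} ->
  in_seq_mul ws x -> in_seq_mul ws' x.
Proof.
move=> sub [z ->]; elim/big_ind: _ => [|y y'|i _]; [exact: in_seq_mul0 | exact: in_seq_mulD|].
by apply: in_seq_mem; apply: sub; apply: mem_nth.
Qed.

Lemma in_seq_ffun (ws : seq A) (J : finType) (M : lmodType A) (x : {ffun J -> M}) :
  in_seq_mul ws x <-> forall j, in_seq_mul ws (x j).
Proof.
split=> [[z ->] j|h].
  by exists (fun i => z i j); rewrite sum_ffunE; apply: eq_bigr => i _; rewrite ffunE.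
have [z hz] : exists z : J -> 'I_(size ws) -> M, forall j, x j = \sum_(i < size ws) ws`_i *: z j i.
  have H j : exists z : 'I_(size ws) -> M, x j = \sum_(i < size ws) ws`_i *: z i by case: (h j) => z hz; exists z.
  by have [z hz] := boolp.choice H; exists z.
exists (fun i => [ffun j => z j i]); apply/ffunP=> j; rewrite hz sum_ffunE.
by apply: eq_bigr => i _; rewrite !ffunE.
Qed.

Lemma wreg_ffun (ws : seq A) (J : finType) (M : lmodType A) : wreg ws M -> wreg ws {ffun J -> M}.
Proof.
move=> wr i iw y /in_seq_ffun h; apply/in_seq_ffun => j; apply: wr => //.
by move: (h j); rewrite ffunE.
Qed.

Lemma in_seq_morph (B : comNzRingType) (be : {rmorphism A -> B}) (be' : B -> A) ws (x : A^o) :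
  cancel be be' -> cancel be' be ->
  in_seq_mul [seq be a | a <- ws] (be x : B^o) <-> in_seq_mul ws x.
Proof.
move=> k1 k2; split=> /in_seq_mulE [z hz]; apply/in_seq_mulE.
  exists (fun i => be' (z i)); apply: (can_inj k1); rewrite hz rmorph_sum size_map.
  apply: eq_bigr => i _; rewrite (nth_map 0) // rmorphM /= k2 //.
exists (fun i => be (z i)); rewrite hz rmorph_sum size_map; apply: eq_bigr => i _.
by rewrite rmorphM /= (nth_map 0).
Qed.

Lemma wreg_morph (be : {rmorphism A -> A}) (be' : A -> A) ws :
  cancel be be' -> cancel be' be -> wreg [seq be a | a <- ws] A^o -> wreg ws A^o.
Proof.
move=> k1 k2 wr i iw y h; apply/(in_seq_morph _ _ k1 k2); rewrite map_take; apply: wr.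
  by rewrite size_map.
rewrite -map_take (nth_map 0) //.
by have /(in_seq_morph _ _ k1 k2) := h; rewrite rmorphM.
Qed.

End Transport.

(** * Regular sequences detected by leading monomials *)

Section LeadingMonomials.
Variables (K : fieldType) (N : nat) (w : 'I_N -> nat).
Notation A := {mpoly K[N]}.

Definition wd (m : 'X_{1..N}) : nat := (\sum_t w t * m t)%N.
Definition wlow d (p : A) := forall m, m \in msupp p -> (wd m < d)%N.
Definition wdle d (p : A) := forall m, m \in msupp p -> (wd m <= d)%N.
(** m dominates strictly for the weighted degree, with coefficient 1; no tie-breaking order is
    involved. *)
Definition lead m (p : A) := wlow (wd m) (p - 'X_[m]).

Lemma wdD m m' : wd (m + m')%MM = (wd m + wd m')%N.
Proof. by rewrite /wd -big_split; apply: eq_bigr => t _; rewrite mnmDE mulnDr. Qed.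
Lemma wd0 : wd 0%MM = 0%N.
Proof. by rewrite /wd big1 // => t _; rewrite mnm0E muln0. Qed.
Lemma wdU t : wd U_(t)%MM = w t.
Proof.
rewrite /wd (bigD1 t) //= mnm1E eqxx muln1 big1 ?addn0 // => i /negPf it.
by rewrite mnm1E eq_sym it muln0.
Qed.
Lemma wdMn m k : wd (m *+ k)%MM = (wd m * k)%N.
Proof. by rewrite /wd big_distrl; apply: eq_bigr => t _; rewrite mulmnE /= mulnA. Qed.

Lemma wlow_le d p : wlow d p -> wdle d p. Proof. by move=> h m /h /ltnW. Qed.
Lemma wlow0 d : wlow d 0. Proof. by move=> m; rewrite msupp0. Qed.
Lemma wlow_mono d d' p : (d <= d')%N -> wlow d p -> wlow d' p.
Proof. by move=> dd h m /h h1; apply: leq_trans h1 dd. Qed.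
Lemma wdle_mono d d' p : (d <= d')%N -> wdle d p -> wdle d' p.
Proof. by move=> dd h m /h h1; apply: leq_trans h1 dd. Qed.
Lemma wdle_low d p : wdle d p -> wlow d.+1 p. Proof. by move=> h m /h; rewrite ltnS. Qed.
Lemma wlowD d p q : wlow d p -> wlow d q -> wlow d (p + q).
Proof. by move=> hp hq m /msuppD_le; rewrite mem_cat => /orP[/hp|/hq]. Qed.
Lemma wdleD d p q : wdle d p -> wdle d q -> wdle d (p + q).
Proof. by move=> hp hq m /msuppD_le; rewrite mem_cat => /orP[/hp|/hq]. Qed.
Lemma wlowZ d c p : wlow d p -> wlow d (c *: p). Proof. by move=> hp m /msuppZ_le /hp. Qed.
Lemma wdleX m : wdle (wd m) 'X_[m]. Proof. by move=> m'; rewrite msuppX inE => /eqP ->. Qed.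
Lemma wdleC c : wdle 0 c%:MP. Proof. by move=> m; rewrite msuppC; case: ifP => // _; rewrite inE => /eqP ->; rewrite wd0. Qed.
Lemma wdleM d d' p q : wdle d p -> wdle d' q -> wdle (d + d') (p * q).
Proof. by move=> hp hq m /msuppM_le /allpairsP[[a b] [/= /hp ha /hq hb ->]]; rewrite wdD leq_add. Qed.
Lemma wlowM d d' p q : wlow d p -> wdle d' q -> wlow (d + d') (p * q).
Proof. by move=> hp hq m /msuppM_le /allpairsP[[a b] [/= /hp ha /hq hb ->]]; rewrite wdD -addSn leq_add. Qed.
Lemma wlow_sum d (I : Type) (r : seq I) (P : pred I) (G : I -> A) :
  (forall i, P i -> wlow d (G i)) -> wlow d (\sum_(i <- r | P i) G i).
Proof. by move=> h; elim/big_ind: _ => //; [exact: wlow0 | exact: wlowD]. Qed.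

Lemma lead_le m p : lead m p -> wdle (wd m) p.
Proof. by move=> h; rewrite -[p](subrK 'X_[m]); apply: wdleD; [apply: wlow_le | apply: wdleX]. Qed.
Lemma leadX m : lead m 'X_[m]. Proof. by rewrite /lead subrr; apply: wlow0. Qed.
Lemma leadM m m' p q : lead m p -> lead m' q -> lead (m + m') (p * q).
Proof.
move=> hp hq; rewrite /lead wdD mpolyXD.
have -> : p * q - 'X_[m] * 'X_[m'] = (p - 'X_[m]) * q + (q - 'X_[m']) * 'X_[m].
  by rewrite [(q - _) * _]mulrC mulrBl mulrBr addrA subrK.
apply: wlowD; first by apply: wlowM => //; apply: lead_le.
by rewrite addnC; apply: wlowM => //; apply: wdleX.
Qed.
Lemma lead_exp m p k : lead m p -> lead (m *+ k) (p ^+ k).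
Proof.
move=> hp; elim: k => [|k IH]; first by rewrite mulm0n expr0 -mpolyX0; apply: leadX.
by rewrite mulmS exprS; apply: leadM.
Qed.

Variables (F : 'I_N -> A) (G : 'I_N -> nat).
Hypothesis G0 : forall t, (0 < G t)%N.
Hypothesis leadF : forall t, lead (U_(t) *+ G t) (F t).

(** Each exponent of X_t is divided by G_t and the quotient is taken as a power of F_t. These
    elements have the same leading monomials as the monomials, so [Th] is a K-linear bijection
    carrying multiplication by X_t^{G_t} to multiplication by F_t. *)
Definition Bm (m : 'X_{1..N}) : A := \prod_t ('X_t ^+ (m t %% G t) * F t ^+ (m t %/ G t)).
Definition Th (p : A) : A := \sum_(m <- msupp p) p@_m *: Bm m.

Lemma lead_Bm m : lead m (Bm m).
Proof.
rewrite {1}[m]multinomUE_id /Bm; elim/big_ind2: _ => [|a p b q|t _].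
- by rewrite -mpolyX0; apply: leadX.
- exact: leadM.
have -> : (U_(t) *+ m t)%MM = (U_(t) *+ (m t %% G t) + (U_(t) *+ G t) *+ (m t %/ G t))%MM.
  by apply/mnmP=> i; rewrite mnmDE !mulmnE -mulnA -mulnDr addnC [(G t * _)%N]mulnC -divn_eq.
by apply: leadM; apply: lead_exp => //; apply: leadX.
Qed.

Lemma Th_wE (k : nat) p : (msize p <= k)%N -> Th p = \sum_(m : 'X_{1..N < k}) p@_m *: Bm m.
Proof.
move=> lt_pk; pose I : subFinType _ := 'X_{1..N < k}.
rewrite /Th (ssrcomplements.big_mksub I) //=; first last.
  by move=> x /msize_mdeg_lt /leq_trans; apply.
  by rewrite msupp_uniq.
by rewrite big_rmcond //= => i; move/memN_msupp_eq0 ->; rewrite scale0r.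
Qed.

Lemma Th_lin : linear Th.
Proof.
move=> a p q; pose k := maxn (msize (a *: p + q)) (maxn (msize p) (msize q)).
rewrite !(@Th_wE k) /k ?leq_maxl ?leq_max ?leqnn ?orbT // scaler_sumr -big_split; apply: eq_bigr => m _ /=.
by rewrite mcoeffD mcoeffZ scalerDl scalerA.
Qed.

Lemma ThX m : Th 'X_[m] = Bm m.
Proof. by rewrite /Th msuppX big_seq1 mcoeffX eqxx scale1r. Qed.

Lemma Bm_mul t m : F t * Bm m = Bm (U_(t) *+ G t + m)%MM.
Proof.
rewrite /Bm (bigD1 t) //= [RHS](bigD1 t) //= mnmDE mulmnE mnm1E eqxx mul1n modnDl divnDl ?dvdnn // divnn G0 add1n exprS.
rewrite !mulrA [F t * _]mulrC; congr (_ * _); apply: eq_bigr => i /negPf it.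
by rewrite mnmDE mulmnE mnm1E eq_sym it.
Qed.

Lemma Th_mul t p : Th ('X_[U_(t) *+ G t] * p) = F t * Th p.
Proof.
rewrite {1}[p]mpolyE mulr_sumr (lin_sum _ _ _ Th_lin) [in RHS]/Th mulr_sumr; apply: eq_bigr => m _.
by rewrite -scalerAr (linZ _ _ Th_lin) -mpolyXD ThX -scalerAr Bm_mul.
Qed.

Lemma Th_surj p : exists q, Th q = p.
Proof.
have h d : forall p, wlow d p -> exists q, Th q = p.
  elim: d => [|d IH] {}p hp.
    exists 0; rewrite (lin0 Th_lin); apply/esym/mpolyP=> m; rewrite mcoeff0; apply/eqP.
    by rewrite mcoeff_eq0; apply/negP=> /hp.
  have [|q hq] := IH (p - Th p); last by exists (p + q); rewrite (linD _ _ Th_lin) hq addrC subrK.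
  rewrite {1}[p]mpolyE /Th -sumrB big_seq; apply: wlow_sum => m mp; rewrite -scalerBr; apply: wlowZ.
  rewrite -opprB -scaleN1r; apply: wlowZ; have hl : wlow (wd m) (Bm m - 'X_[m]) := @lead_Bm m.
  by apply: wlow_mono hl; rewrite -ltnS; apply: hp.
apply: (h (\max_(m <- msupp p) wd m).+1) => m mp; rewrite ltnS; exact: leq_bigmax_seq.
Qed.

Lemma Th_inj p : Th p = 0 -> p = 0.
Proof.
move=> Tp; apply/mpolyP=> m0; rewrite mcoeff0; apply/eqP; rewrite mcoeff_eq0; apply/negP=> m0p.
have [m mp mmax] : exists2 m, m \in msupp p & forall m', m' \in msupp p -> (wd m' <= wd m)%N.
  have ex : exists d, has (fun m => wd m == d) (msupp p) by exists (wd m0); apply/hasP; exists m0.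
  have ub d : has (fun m => wd m == d) (msupp p) -> (d <= \max_(m <- msupp p) wd m)%N.
    by case/hasP=> m mp /eqP <-; apply: leq_bigmax_seq.
  case: (ex_maxnP ex ub) => d /hasP[m mp /eqP <-] dmax; exists m => // m' m'p.
  by apply: dmax; apply/hasP; exists m'.
have := congr1 (mcoeff m) Tp; rewrite mcoeff0 /Th raddf_sum (bigD1_seq m) ?msupp_uniq //= big_seq_cond big1 => [|m' /andP[m'p ne]].
  rewrite addr0 mcoeffZ -[Bm m](subrK 'X_[m]) mcoeffD mcoeffX eqxx.
  have -> : (Bm m - 'X_[m])@_m = 0.
    by apply/eqP; rewrite mcoeff_eq0; apply/negP=> /(@lead_Bm m); rewrite ltnn.
  by rewrite add0r mulr1 => /eqP; rewrite mcoeff_eq0 mp.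
rewrite mcoeffZ -[Bm m'](subrK 'X_[m']) mcoeffD mcoeffX (negPf ne) addr0.
have -> : (Bm m' - 'X_[m'])@_m = 0; last by rewrite mulr0.
by apply/eqP; rewrite mcoeff_eq0; apply/negP=> /(@lead_Bm m'); rewrite ltnNge mmax.
Qed.

Local Notation Fs s := [seq F t | t <- s].
Local Notation Xs s := [seq 'X_[U_(t) *+ G t] : A | t <- s].

Lemma in_seq_Th s (q : A) : in_seq_mul (Fs s) (Th q : A^o) <-> in_seq_mul (Xs s) (q : A^o).
Proof.
have nF i : (i < size s)%N -> exists t, (Fs s)`_i = F t /\ (Xs s)`_i = 'X_[U_(t) *+ G t].
  move=> si; case: s si => // t0 s' si; exists (nth t0 (t0 :: s') i).
  by rewrite !(nth_map t0).
split=> /in_seq_mulE [z hz]; apply/in_seq_mulE; last first.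
  exists (fun i => Th (z i)); rewrite hz (lin_sum _ _ _ Th_lin) !size_map; apply: eq_bigr => i _.
  by have [t [-> ->]] := nF i (ltn_ord i); apply: Th_mul.
have [y hy] : exists y : nat -> A, forall i, Th (y i) = z i by have [y hy] := boolp.choice (fun i => Th_surj (z i)); exists y.
exists y; apply/eqP; rewrite -subr_eq0; apply/eqP; apply: Th_inj.
rewrite (linB _ _ Th_lin) (lin_sum _ _ _ Th_lin) [X in X - _]hz !size_map -sumrB big1 // => i _.
have [t [-> ->]] := nF i (ltn_ord i).
by apply/eqP; rewrite subr_eq0 -hy; apply/eqP/esym; apply: Th_mul.
Qed.

Lemma mcoeff_mulX k (z : A) m : ('X_[k] * z)@_m = if (k <= m)%MM then z@_(m - k) else 0.
Proof.
case: ifP => km; first by rewrite -{1}[m](submK km) addmC mulrC mcoeffMX.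
apply/eqP; rewrite mcoeff_eq0; apply/negP=> /msuppM_le /allpairsP[[a b] [/= ha hb mE]].
by move: ha km; rewrite msuppX inE => /eqP ak; rewrite mE -ak lem_addr.
Qed.

Lemma in_seq_X (s : seq 'I_N) (p : A) : in_seq_mul (Xs s) (p : A^o) <->
  forall m, m \in msupp p -> has (fun t => G t <= m t)%N s.
Proof.
split=> [[z ->] m|h].
  apply: contraTT => hs; rewrite -mcoeff_eq0 raddf_sum big1 //= => i _.
  have is_ : (i < size s)%N by rewrite -[size s](size_map (fun t => 'X_[U_(t) *+ G t] : A)).
  case: s hs z i is_ => // t0 s hs z i is_; rewrite (nth_map t0) // [_ *: _]/(_ * _) mcoeff_mulX.
  case: ifP => // /mnm_lepP /(_ (nth t0 (t0 :: s) i)); rewrite mulmnE mnm1E eqxx mul1n => hG.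
  by case/negP: hs; apply/hasP; exists (nth t0 (t0 :: s) i) => //; apply: mem_nth.
rewrite [p]mpolyE big_seq; elim/big_ind: _ => [|x y|m mp]; [exact: in_seq_mul0 | exact: in_seq_mulD|].
have /hasP[t ts hG] := h m mp; rewrite -mul_mpolyC; apply: (@in_seq_mulZ _ _ A^o).
have le : (U_(t) *+ G t <= m)%MM.
  by apply/mnm_lepP=> i; rewrite mulmnE mnm1E; case: eqP => [<-|]; rewrite ?mul1n ?mul0n.
rewrite -[m](submK le) addmC mpolyXD; apply: (@in_seq_mem _ _ A^o); apply/mapP; by exists t.
Qed.

(** Through [Th] the question becomes one about powers of distinct variables, where membership in
    the ideal is read off the exponents. *)
Lemma wreg_lead s : uniq s -> wreg (Fs s) A^o.
Proof.
move=> us i; rewrite size_map => si y; have [q <-] := Th_surj y; rewrite -map_take.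
case: s us si => // t0 s us si; rewrite (nth_map t0) //; set t := nth t0 _ i.
have -> : F t *: (Th q : A^o) = Th ('X_[U_(t) *+ G t] * q) by rewrite Th_mul.
move=> /in_seq_Th /in_seq_X h; apply/in_seq_Th/in_seq_X => m mq.
have /hasP[t' t's hG] : has (fun t' => G t' <= (U_(t) *+ G t + m)%MM t')%N (take i (t0 :: s)).
  apply: h; rewrite mcoeff_msupp mcoeff_mulX lem_addr ?lemm_addr // addmC addmK; by rewrite -mcoeff_msupp.
apply/hasP; exists t' => //; move: hG; rewrite mnmDE mulmnE mnm1E; case: eqP => [tt'|]; last by rewrite mul0n.
move: us t's; rewrite -[X in uniq X](cat_take_drop i) (drop_nth t0) // cat_uniq /= => /and3P[_ /norP[nt _] _].
by rewrite -tt' (negPf nt).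
Qed.

Lemma one_notin_lead s : ~ in_seq_mul (Fs s) (1 : A^o).
Proof.
have -> : (1 : A^o) = Th 1.
  rewrite -mpolyX0 ThX /Bm big1 ?mpolyX0 // => t _; by rewrite mnm0E mod0n div0n !expr0 mulr1.
move=> /in_seq_Th /in_seq_X /(_ 0%MM); rewrite -mpolyX0 msuppX inE eqxx => /(_ isT) /hasP[t _].
by rewrite mnm0E leqNgt G0.
Qed.
End LeadingMonomials.

(** * The e+1 minors on consecutive rows and a complementary set of coordinates *)

Section Coordinates.
Variables (K : fieldType) (e g : nat).
Hypothesis g0 : (0 < g)%N.
Notation f := (e + g)%N.
Notation N := (f * g)%N.
Notation A := {mpoly K[N]}.

Definition col0 : 'I_g := Ordinal g0.
Definition subrow (i : 'I_f) (j : nat) : 'I_f := Ordinal (leq_ltn_trans (leq_subr j i) (ltn_ord i)).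
Definition X2 (i : 'I_f) (j : 'I_g) : A := 'X_(mxvec_index i j).

(* The change of coordinates X_ij |-> X_ij + X_(i-j)0 moves the leading terms of the minors to powers of
   the variables of the first column. *)
Definition shear1 (s : A) (i : 'I_f) (j : 'I_g) : A :=
  X2 i j + if (0 < j <= i)%N && (i - j <= e)%N then s * X2 (subrow i j) col0 else 0.
Local Notation shear s := (mmap (@mpolyC N K) (fun t => mxvec (\matrix_(i < f, j < g) shear1 s i j) 0 t)).

Lemma shearX s i j : shear s (X2 i j) = shear1 s i j.
Proof. by rewrite /X2 mmapX mmap1U mxvecE mxE. Qed.

Lemma shear_cancel s s' : shear s s' = s' -> s + s' = 0 -> cancel (shear s') (shear s).
Proof.
move=> ss ss0; elim/mpoly_ring_ind => [c|t|p q hp hq|p q hp hq]; rewrite ?rmorphD ?rmorphM /= ?hp ?hq //.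
  by rewrite !mmapC.
case/mxvec_indexP: t => i j; rewrite -/(X2 i j) shearX /shear1 rmorphD /= shearX /shear1.
case: ifP => [h|_]; last by rewrite rmorph0 !addr0.
by rewrite rmorphM /= ss shearX /shear1 /= addr0 -addrA -mulrDl ss0 mul0r addr0.
Qed.

Lemma shear1K : cancel (shear 1) (shear (-1)) /\ cancel (shear (-1)) (shear 1).
Proof.
by split; apply: shear_cancel; rewrite ?rmorphN ?rmorph1 ?addNr ?subrr.
Qed.

(** Large enough that Cw - x^2 exceeds 1, the weight of the other variables, for every index
    difference x up to f. *)
Definition Cw : nat := (f ^ 2 + 2)%N.
Fact zrow_lt (k : 'I_e.+1) : (k < f)%N. Proof. by have := ltn_ord k; lia. Qed.
Definition zrow (k : 'I_e.+1) : 'I_f := Ordinal (zrow_lt k).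
Definition zvar (k : 'I_e.+1) : 'I_N := mxvec_index (zrow k) col0.
(** The special variables are those of the first column in rows 0, ..., e. The weight of the k-th
    one is concave in k, which singles out the diagonal term of the minor. *)
Definition wvar (t : 'I_N) : nat :=
  mxvec (\matrix_(i < f, j < g) (if (j == col0) && (i <= e)%N then Cw - i ^ 2 else 1)%N) 0 t.

Lemma wvarE i j : wvar (mxvec_index i j) = (if (j == col0) && (i <= e)%N then Cw - i ^ 2 else 1)%N.
Proof. by rewrite /wvar mxvecE mxE. Qed.

Lemma wvar_z k : wvar (zvar k) = (Cw - k ^ 2)%N.
Proof. by rewrite wvarE eqxx /= -ltnS ltn_ord. Qed.

Lemma Cw_gt (x : nat) : (x <= f)%N -> (1 < Cw - x ^ 2)%N.
Proof. by move=> h; have h2 : (x ^ 2 <= f ^ 2)%N by [rewrite leq_exp2r]; rewrite /Cw; lia. Qed.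

Definition is_z (t : 'I_N) := [exists k, t == zvar k].

Lemma zvar_inj : injective zvar.
Proof.
move=> k k' h; have : mxvec (\matrix_(i < f, j < g) (i : nat)) 0 (zvar k) = mxvec (\matrix_(i < f, j < g) (i : nat)) 0 (zvar k').
  by rewrite h.
by rewrite !mxvecE !mxE /= => /val_inj.
Qed.

Lemma wvar_nz t : ~~ is_z t -> wvar t = 1%N.
Proof.
case/mxvec_indexP: t => i j nz; rewrite wvarE; case: ifP => // /andP[/eqP jE ie].
case/negP: nz; apply/existsP; exists (Ordinal (ie : (i < e.+1)%N)); apply/eqP; rewrite jE.
by congr mxvec_index; apply: val_inj.
Qed.

Fact drow_lt (k : 'I_e.+1) (a : 'I_g) : (k + a < f)%N.
Proof. by have := ltn_ord k; have := ltn_ord a; lia. Qed.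
Definition drow k a : 'I_f := Ordinal (drow_lt k a).
(** The maximal minor on the rows k, ..., k+g-1. After the shear every entry of its diagonal
    contains the variable of row k and first column. *)
Definition delta (k : 'I_e.+1) : A := \det (rowsub (drow k) (psi K f g : 'M[A]_(f, g))).

Definition dentry k (a b : 'I_g) : A := shear1 1 (drow k a) b.

Lemma shear_delta k : shear 1 (delta k) = \det (\matrix_(a, b) dentry k a b).
Proof.
rewrite /delta -det_map_mx; congr (\det _); apply/matrixP=> a b; rewrite !mxE.
exact: shearX.
Qed.

Lemma lead_low m (p q : A) : lead wvar m p -> wlow wvar (wd wvar m) q -> lead wvar m (p + q).
Proof. by move=> hp hq; rewrite /lead addrAC; apply: wlowD. Qed.

Lemma dentry_diag k a : lead wvar U_(zvar k) (dentry k a a).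
Proof.
rewrite /dentry /shear1 addnK /=.
have ke : (k <= e)%N by rewrite -ltnS.
case: (posnP a) => [a0|a_gt0].
  rewrite addr0; have -> : X2 (drow k a) a = 'X_[U_(zvar k)].
    rewrite /X2 /zvar; congr 'X_(mxvec_index _ _); apply: val_inj => //=; by rewrite a0 addn0.
  exact: leadX.
rewrite leq_addl ke /= mul1r addrC; apply: lead_low.
  have -> : X2 (subrow (drow k a) a) col0 = 'X_[U_(zvar k)]; last exact: leadX.
  by rewrite /X2 /zvar; congr 'X_(mxvec_index _ _); apply: val_inj; rewrite /= addnK.
apply: wlow_mono (wdle_low (@wdleX _ _ _ _)); rewrite !wdU wvar_z wvarE.
have -> : (a == col0) = false by apply/eqP=> h; move: a_gt0; rewrite h.
by apply: Cw_gt; lia.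
Qed.

Definition dist (k : 'I_e.+1) (a b : 'I_g) : nat := `|(k + a)%N%:Z - b%:Z|%N.

Lemma dist_le k a b : (dist k a b <= f)%N.
Proof. by rewrite /dist; have := ltn_ord k; have := ltn_ord a; have := ltn_ord b; lia. Qed.

Lemma dentry_le k a b : wdle wvar (Cw - dist k a b ^ 2) (dentry k a b).
Proof.
have h1 := Cw_gt (dist_le k a b).
have hX i j : wdle wvar (wvar (mxvec_index i j)) (X2 i j) by rewrite -wdU; apply: wdleX.
rewrite /dentry /shear1; apply: wdleD.
  apply: wdle_mono (hX _ _); rewrite wvarE; case: ifP => [/andP[/eqP -> _] /=|_]; last by apply: ltnW.
  by rewrite /dist subr0.
case: ifP => [/andP[/andP[b0 ba] le] /=|_]; last by move=> m; rewrite msupp0.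
rewrite mul1r; apply: wdle_mono (hX _ _); rewrite wvarE eqxx le /= /dist.
by move: ba => /= ba; rewrite subzn // absz_nat.
Qed.

(** Expanding the squares, the linear term cancels because s is a permutation, and the sum of (a -
    s(a))^2 that remains is positive unless s = 1. *)
Lemma sum_dist k (s : {perm 'I_g}) : s != 1%g -> (\sum_a (Cw - dist k a (s a) ^ 2) < (Cw - k ^ 2) * g)%N.
Proof.
move=> s1; rewrite -ltz_nat (big_morph Posz PoszD (erefl (Posz 0))).
have kf : (k <= f)%N by have := ltn_ord k; lia.
have cE (x : nat) : (x <= f)%N -> (Cw - x ^ 2)%N%:Z = Cw%:Z - x%:Z ^+ 2.
  by move=> xf; rewrite -subzn ?PoszM // ltnW // -subn_gt0 (leq_trans _ (Cw_gt xf)).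
under eq_bigr => a _ do rewrite cE ?dist_le // /dist abszE real_normK ?num_real //.
rewrite PoszM cE // sumrB sumr_const card_ord -mulr_natr natz mulrBl ltrD2l ltrN2.
have sE (a : 'I_g) : ((k + a)%N%:Z - (s a)%:Z) ^+ 2 = k%:Z ^+ 2 + (2 * k%:Z * (a%:Z - (s a)%:Z) + (a%:Z - (s a)%:Z) ^+ 2).
  by rewrite PoszD; ring.
under eq_bigr => a _ do rewrite sE.
rewrite big_split /= sumr_const card_ord -[_ *+ g]mulr_natr natz ltrDl big_split /= -mulr_sumr sumrB.
have -> : \sum_(a < g) (s a)%:Z = \sum_(a < g) a%:Z by rewrite [RHS](reindex_inj (@perm_inj _ s)).
rewrite subrr mulr0 add0r.
have [a sa] : exists a, s a != a.
  apply/existsP; apply: contraNT s1; rewrite negb_exists => /forallP h; apply/eqP/permP => a.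
  by rewrite perm1; apply/eqP; move: (h a); rewrite negbK.
rewrite (bigD1 a) //=; apply: ltr_pwDl; last by apply: sumr_ge0 => b _; apply: sqr_ge0.
by rewrite lt0r sqr_ge0 andbT sqrf_eq0 subr_eq0; apply: contraNneq sa => -[h]; apply/eqP/val_inj.
Qed.

(** The entry (a, b) has weighted degree at most Cw - (k+a-b)^2, so by [sum_dist] every permutation
    other than the identity contributes strictly less than the diagonal. *)
Lemma lead_delta k : lead wvar (U_(zvar k) *+ g)%MM (shear 1 (delta k)).
Proof.
rewrite shear_delta /determinant (bigD1 1%g) //=; apply: lead_low.
  rewrite odd_perm1 expr0 mul1r.
  have -> : (U_(zvar k) *+ g)%MM = (\sum_(a < g) U_(zvar k))%MM.
    by apply/mnmP=> t; rewrite mnm_sumE mulmnE sum_nat_const card_ord mulnC.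
  elim/big_ind2: _ => [|a p b q|a _].
  - by rewrite -mpolyX0; apply: leadX.
  - exact: leadM.
  by rewrite perm1 mxE; apply: dentry_diag.
apply: wlow_sum => s s1; rewrite mulr_sign.
have h : wlow wvar (wd wvar (U_(zvar k) *+ g)%MM) (\prod_(i < g) (\matrix_(a, b) dentry k a b) i (s i)).
  rewrite wdMn wdU wvar_z; apply: wlow_mono (sum_dist k s1) _; apply: wdle_low.
  elim/big_ind2: _ => [|a p b q|a _].
  - by rewrite -mpolyC1; apply: wdleC.
  - exact: wdleM.
  by rewrite mxE; apply: dentry_le.
by case: ifP => // _; rewrite -scaleN1r; apply: wlowZ.
Qed.

Section Regular.
Variable p : 'I_N -> {poly K}.
Hypotheses (pm : forall t, p t \is monic) (ps : forall t, (1 < size (p t))%N).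

(** Monic polynomials in single coordinates: [qpol] in the sheared system, where its leading
    monomial is visible, [qvar] in the original one, where it is to lie in a given maximal ideal. *)
Definition qpol t : A := (map_poly (@mpolyC N K) (p t)).['X_t].
Definition uvar t : A := shear (-1) 'X_t.
Definition qvar t : A := (map_poly (@mpolyC N K) (p t)).[uvar t].

Lemma shear_qvar t : shear 1 (qvar t) = qpol t.
Proof.
rewrite /qvar /qpol -horner_map /= -map_poly_comp (eq_map_poly (g := @mpolyC N K)) => [|c /=]; last by rewrite mmapC.
by congr (_.[_]); rewrite /uvar; exact: (shear1K.2).
Qed.

Lemma lead_qpol t : ~~ is_z t -> lead wvar (U_(t) *+ (size (p t)).-1) (qpol t).
Proof.
move=> nz; rewrite /qpol horner_coef size_map_poly_id0; last by rewrite (eqP (pm t)) mpolyC1 oner_eq0.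
have := ps t; case sE: (size (p t)) => [//|d] _ /=; rewrite big_ord_recr /= coef_map /=.
have -> : (p t)`_d = 1 by have := eqP (pm t); rewrite lead_coefE sE.
rewrite mpolyC1 mul1r addrC; apply: lead_low.
  by apply: lead_exp; apply: leadX.
apply: wlow_sum => i _; rewrite coef_map /= mul_mpolyC; apply: wlowZ; rewrite wdMn wdU wvar_nz // mul1n.
have := @wdleX K _ wvar (U_(t) *+ i); rewrite mpolyXn wdMn wdU wvar_nz // mul1n => h.
by apply: wlow_mono (ltn_ord i) (wdle_low h).
Qed.

Definition zidx (t : 'I_N) : 'I_e.+1 := odflt ord0 [pick k | t == zvar k].
Lemma zidxK k : zidx (zvar k) = k.
Proof.
rewrite /zidx; case: pickP => [k' /eqP /zvar_inj //|/(_ k)]; by rewrite eqxx.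
Qed.
Definition Fv t : A := if is_z t then shear 1 (delta (zidx t)) else qpol t.
Definition Gv t : nat := if is_z t then g else (size (p t)).-1.

Lemma Gv0 t : (0 < Gv t)%N.
Proof. by rewrite /Gv; case: ifP => // _; have := ps t; lia. Qed.

Lemma lead_Fv t : lead wvar (U_(t) *+ Gv t) (Fv t).
Proof.
rewrite /Fv /Gv; case: ifP => [/existsP[k /eqP ->]|nz]; first by rewrite zidxK; apply: lead_delta.
by apply: lead_qpol; rewrite nz.
Qed.

Definition deltas : seq A := [seq delta k | k <- enum 'I_e.+1].

Lemma coord_map s : all (predC is_z) s ->
  [seq shear 1 a | a <- [seq qvar t | t <- s] ++ deltas] = [seq Fv t | t <- s ++ [seq zvar k | k <- enum 'I_e.+1]].
Proof.
move=> /allP hs; rewrite !map_cat -!map_comp; congr (_ ++ _).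
  by apply/eq_in_map => t /hs /= nz; rewrite shear_qvar /Fv (negPf nz).
apply: eq_map => k /=; rewrite /Fv zidxK; have -> // : is_z (zvar k).
by apply/existsP; exists k.
Qed.

(** The shear carries the two groups of elements to elements whose leading monomials are powers of
    distinct variables: the special ones for the minors, the others for the monic polynomials. *)
Lemma coord_regular s : uniq s -> all (predC is_z) s -> wreg ([seq qvar t | t <- s] ++ deltas) A^o.
Proof.
move=> us hs; apply: (wreg_morph shear1K.1 shear1K.2); rewrite coord_map //.
apply: (wreg_lead Gv0 lead_Fv); rewrite cat_uniq us (map_inj_uniq zvar_inj) enum_uniq andbT /=.
apply/hasPn => t /mapP[k _ ->]; apply/negP=> /(allP hs) /=.
by rewrite negb_exists => /forallP /(_ k); rewrite eqxx.
Qed.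

Lemma deltas_proper : ~ in_seq_mul deltas (1 : A^o).
Proof.
move/(in_seq_morph _ _ shear1K.1 shear1K.2); rewrite rmorph1 (coord_map (s := [::])) //.
exact: (one_notin_lead Gv0 lead_Fv).
Qed.
End Regular.

Lemma card_nz : #|[pred t | ~~ is_z t]| = (f * g - e.+1)%N.
Proof.
have -> : #|[pred t | ~~ is_z t]| = #|[predC is_z]| by apply: eq_card.
have h1 : #|is_z| = e.+1; last first.
  by apply: (canRL (addKn e.+1)); rewrite -h1 cardC card_ord.
rewrite -[RHS]card_ord -(card_image zvar_inj); apply: eq_card => t.
by apply/existsP/imageP => [[k /eqP ->]|[k _ ->]]; exists k.
Qed.
End Coordinates.

(** * Zariski's lemma *)

Section PredIdeals.
Variable R : comNzRingType.

(** Bundling the predicate with its closure proof lets an ideal built inside a proof carry the ideal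
    structure. *)
Record pideal := PIdeal { pid_pred : {pred R}; pid_closed : idealr_closed pid_pred }.
HB.instance Definition _ (I : pideal) := isIdealr.Build R (pid_pred I) (pid_closed I).

Record primeideal := PrimeIdeal { prid_pred : {pred R}; prid_closed : idealr_closed prid_pred;
  prid_prime : prime_idealr_closed prid_pred }.
HB.instance Definition _ (I : primeideal) := isIdealr.Build R (prid_pred I) (prid_closed I).
HB.instance Definition _ (I : primeideal) := isPrimeIdealrClosed.Build R (prid_pred I) (@prid_prime I).

Lemma maximal_inv (m : idealr R) x : is_maximal m -> x \notin m -> exists y, 1 - x * y \in m.
Proof.
move=> mm xm; apply: contrapT => h.
pose J : {pred R} := fun z => `[< exists y, z - x * y \in m >].
have Jc : idealr_closed J.
  split.
  - by apply/asboolP; exists 0; rewrite mulr0 subr0 rpred0.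
  - by apply/negP=> /asboolP.
  move=> a u v /asboolP[y hy] /asboolP[z hz]; apply/asboolP; exists (a * y + z).
  have -> : a * u + v - x * (a * y + z) = a * (u - x * y) + (v - x * z).
    by rewrite mulrDr mulrBr opprD mulrCA addrACA.
  by apply: rpredD => //; apply: idealMr.
have := mm (pid_pred (PIdeal Jc) : idealr R) => /(_ _ x) hx; move/negP: xm; apply; apply: hx.
  by move=> z zm; apply/asboolP; exists 0; rewrite mulr0 subr0.
by apply/asboolP; exists 1; rewrite mulr1 subrr rpred0.
Qed.
End PredIdeals.

Section IntegralSubring.
Variable L : fieldType.

Record subr := SubR { sr_pred : {pred L}; sr_closed : subring_closed sr_pred }.
HB.instance Definition _ (S : subr) := GRing.isSubringClosed.Build L (sr_pred S) (sr_closed S).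

Section Elt.
Variable S : subr.
Record elt := Elt { elt_val : L; _ : elt_val \in sr_pred S }.
HB.instance Definition _ := [isSub for elt_val].
HB.instance Definition _ := [Choice of elt by <:].
HB.instance Definition _ := [SubChoice_isSubComNzRing of elt by <:].
End Elt.

Definition sint (S : subr) (u : L) := exists p : {poly L}, [/\ p \is monic, p \is a polyOver (sr_pred S) & root p u].

Lemma sintP S u : sint S u <-> integralOver (\val : elt S -> L) u.
Proof.
split=> [[p [pm pS pu]]|[p pm pu]].
  pose q := map_poly (insubd (0 : elt S)) p.
  have qE : map_poly (\val : elt S -> L) q = p.
    apply/polyP=> i; rewrite coef_map /= coef_map_id0; last by apply: val_inj; rewrite val_insubd rpred0.
    by rewrite val_insubd; have /polyOverP -> := pS.
  exists q; rewrite ?qE //; apply/eqP/val_inj; rewrite lead_coefE.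
  have sq : size q = size p by rewrite -[in RHS]qE size_map_inj_poly // ?rmorph0 //; apply: val_inj.
  rewrite sq -[LHS](coef_map (\val : {rmorphism elt S -> L})) /= -/(map_poly _ _) qE -lead_coefE.
  exact: (eqP pm).
exists (map_poly (\val : elt S -> L) p); split=> //; first exact: monic_map.
by apply/polyOverP=> i; rewrite coef_map /=; apply: valP.
Qed.

Lemma sint_add S u v : sint S u -> sint S v -> sint S (u + v).
Proof. by move=> /sintP hu /sintP hv; apply/sintP; apply: integral_add. Qed.
Lemma sint_mul S u v : sint S u -> sint S v -> sint S (u * v).
Proof. by move=> /sintP hu /sintP hv; apply/sintP; apply: integral_mul. Qed.
Lemma sint_id S u : u \in sr_pred S -> sint S u.
Proof.
move=> uS; exists ('X - u%:P); split; rewrite ?monicXsubC ?root_XsubC //.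
by rewrite polyOverXsubC.
Qed.
Lemma sint_exp S u k : sint S u -> sint S (u ^+ k).
Proof.
move=> hu; elim: k => [|k IH]; first by rewrite expr0; apply: sint_id; rewrite rpred1.
by rewrite exprS; apply: sint_mul.
Qed.
Lemma sint_sum S (I : Type) (r : seq I) (P : pred I) (F : I -> L) :
  (forall i, P i -> sint S (F i)) -> sint S (\sum_(i <- r | P i) F i).
Proof.
by move=> h; elim/big_ind: _ => //; [apply: sint_id; rewrite rpred0 | exact: sint_add].
Qed.
Lemma sint_root S (p : {poly L}) u : p \is monic -> (forall i, sint S p`_i) -> root p u -> sint S u.
Proof.
move=> pm pc pu; apply/sintP; apply: (integral_root_monic pm pu).
by apply/integral_poly => i; apply/sintP.
Qed.

(* If p(u) = 0 then c u is integral, c being the leading coefficient of p. *)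
Lemma scale_root (p : {poly L}) u (c : L) : p \is monic -> root p u ->
  root (\poly_(i < size p) (if i == (size p).-1 then 1 else p`_i * c ^+ ((size p).-1 - i))) (c * u).
Proof.
move=> pm pu; have sp : (0 < size p)%N by rewrite size_poly_gt0 monic_neq0.
apply/rootP; rewrite horner_poly; have := rootP pu; rewrite horner_coef => /(congr1 ( *%R (c ^+ (size p).-1))).
rewrite mulr0 mulr_sumr => h; rewrite -[RHS]h; apply: eq_bigr => i _; case: eqP => [->|ne].
  by rewrite mul1r exprMn; have := eqP pm; rewrite lead_coefE => ->; rewrite mul1r.
have le : (i <= (size p).-1)%N by have := ltn_ord i; lia.
rewrite exprMn (_ : c ^+ (size p).-1 = c ^+ ((size p).-1 - i) * c ^+ i); last by rewrite -exprD subnK.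
by rewrite -!mulrA mulrCA; congr (_ * _); rewrite mulrCA.
Qed.

Definition adj_pred (S : subr) (x : L) : {pred L} := fun u => `[< exists2 p : {poly L}, p \is a polyOver (sr_pred S) & u = p.[x] >].
Lemma adj_closed S x : subring_closed (adj_pred S x).
Proof.
split.
- by apply/asboolP; exists 1; rewrite ?rpred1 ?hornerC.
- by move=> u v /asboolP[p hp ->] /asboolP[q hq ->]; apply/asboolP; exists (p - q); rewrite ?rpredB ?hornerE.
by move=> u v /asboolP[p hp ->] /asboolP[q hq ->]; apply/asboolP; exists (p * q); rewrite ?rpredM ?hornerM.
Qed.
Definition adj S x := SubR (adj_closed S x).

Lemma adj_sub S x : {subset sr_pred S <= sr_pred (adj S x)}.
Proof. by move=> u uS; apply/asboolP; exists u%:P; rewrite ?polyOverC ?hornerC. Qed.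
Lemma adj_gen S x : x \in sr_pred (adj S x).
Proof. by apply/asboolP; exists 'X; rewrite ?polyOverX ?hornerX. Qed.

Lemma pred_sub_S n i : (i < n)%N -> i <> n.-1 -> (n.-1 - i)%N = (n.-2 - i).+1.
Proof. by lia. Qed.

(* A finitely generated ring extension that is a field is integral after inverting one element. *)
Lemma field_integral (xs : seq L) : forall S, (forall u, u \in sr_pred (foldl adj S xs)) ->
  exists a, [/\ a \in sr_pred S, a != 0 & forall u, exists k, sint S (a ^+ k * u)].
Proof.
elim: xs => [|x xs IH] S /= hL.
  exists 1; split; rewrite ?rpred1 ?oner_neq0 // => u; exists 0%N; rewrite expr0 mul1r.
  exact: sint_id.
have [a1 [a1S a10 a1i]] := IH _ hL.
have /asboolP[q qS a1E] := a1S.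
case: (pselect (exists p : {poly L}, [/\ p \is a polyOver (sr_pred S), p != 0 & p.[x] = 0])) => [[p [pS p0 px]]|tr]; last first.
  (* The case where x is transcendental over S is impossible: integrality of the inverse of 1 + x
     a1, after inverting a1, would make the nonconstant polynomial 1 + Xq divide a power of q, to
     which it is coprime. *)
  pose b := 1 + x * a1; pose B := 1 + 'X * q.
  have q0 : q != 0 by apply: contraNneq a10 => q0; rewrite a1E q0 horner0.
  have tr0 (r : {poly L}) : r \is a polyOver (sr_pred S) -> r.[x] = 0 -> r = 0.
    by move=> rS rx; apply/eqP; apply: contrapT => /negP r0; apply: tr; exists r.
  have BS : B \is a polyOver (sr_pred S) by rewrite rpredD ?rpred1 // rpredM // polyOverX.
  have sB : (1 < size B)%N.
    rewrite /B addrC size_polyDl ?size_poly1; first by rewrite mulrC size_mulX // ltnS size_poly_gt0.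
    by rewrite mulrC size_mulX // ltnS size_poly_gt0.
  have bE : b = B.[x] by rewrite /b /B !hornerE a1E.
  have b0 : b != 0.
    by apply/eqP=> b0; move: sB; rewrite (tr0 B) ?size_poly0 // -bE.
  have [k [r [rm rS rr]]] := a1i b^-1.
  set m := (size r).-1.
  have sr : size r = m.+1 by rewrite /m prednK // size_poly_gt0 monic_neq0.
  have [s sS sE] : exists2 s : {poly L}, s \is a polyOver (sr_pred S) & a1 ^+ (k * m) = b * s.[x].
    have : \sum_(i < m) r`_i * a1 ^+ (k * i) * b ^+ (m - i.+1) \in sr_pred (adj S x).
      apply: rpred_sum => i _; rewrite !rpredM ?rpredX //.
        by have /polyOverP -> := rS.
      rewrite bE; apply/asboolP; by exists B.
    case/asboolP=> s sS sE; exists (- s); first by rewrite rpredN.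
    rewrite hornerN mulrN -sE mulr_sumr; apply/eqP; rewrite -addr_eq0; apply/eqP.
    have := rootP rr; rewrite horner_coef sr big_ord_recr /= => /(congr1 ( *%R (b ^+ m))); rewrite mulr0 => h.
    rewrite -[RHS]h mulrDr addrC; congr (_ + _).
      rewrite mulr_sumr; apply: eq_bigr => i _; rewrite exprMn -exprM.
      rewrite [in RHS](_ : b ^+ m = b * b ^+ (m - i.+1) * b ^+ i); last by rewrite -exprS -exprD subnSK // subnK // ltnW.
      rewrite exprVn; move: (b ^+ (m - i.+1)) (a1 ^+ (k * i)) (r`_i) => y z t.
      rewrite -!mulrA; congr (_ * _); rewrite [RHS]mulrA [RHS]mulrC -!mulrA; congr (_ * (_ * _)).
      by rewrite [y * _]mulrC mulrA mulVf ?mul1r // expf_neq0.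
    have := eqP rm; rewrite lead_coefE -/m => ->; rewrite mul1r exprMn -exprM mulrCA exprVn mulfV ?mulr1 //.
    by rewrite expf_neq0.
  have qB : q ^+ (k * m) = B * s.
    apply/eqP; rewrite -subr_eq0; apply/eqP; apply: tr0; first by rewrite rpredB ?rpredX ?rpredM.
    by rewrite hornerD hornerN hornerM horner_exp -a1E sE -bE subrr.
  have cBq : coprimep B (q ^+ (k * m)).
    apply: coprimep_expr; apply/Bezout_coprimepP; exists (1, - 'X).
    by rewrite /B /= mul1r mulNr addrK eqpxx.
  have hB : B %| q ^+ (k * m) by rewrite qB dvdp_mulIl.
  have : size B == 1%N by rewrite -(eqp_size (dvdp_gcd_idl hB)).
  by rewrite eqn_leq leqNgt sB.
(* x is algebraic over S *)
have p1 : (1 < size p)%N.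
  rewrite ltnNge; apply/negP=> sp; move: px p0; rewrite [p]size1_polyC // hornerC => ->.
  by rewrite eqxx.
set c := lead_coef p; have c0 : c != 0 by rewrite lead_coef_eq0.
have cS : c \in sr_pred S by have /polyOverP := pS; apply.
have pm' : c^-1 *: p \is monic by rewrite monicE lead_coefZ mulVf.
have sZ : size (c^-1 *: p) = size p by rewrite size_scale ?invr_eq0.
have icx : sint S (c * x).
  eexists; split; last by apply: (scale_root (p := c^-1 *: p)) => //; rewrite rootE hornerZ px mulr0.
    rewrite monicE lead_coefE sZ size_poly_eq ?sZ; last by rewrite eqxx oner_neq0.
    by rewrite coef_poly eqxx prednK ?leqnn // ltnW.
  apply/polyOverP=> i; rewrite coef_poly sZ; case: ifP => [ip|_]; last by rewrite rpred0.
  case: eqP => [_|ne]; first by rewrite rpred1.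
  rewrite (pred_sub_S ip ne).
  rewrite coefZ exprS mulrACA mulVf // mul1r rpredM ?rpredX //.
  by have /polyOverP -> := pS.
have int_adj u : u \in sr_pred (adj S x) -> exists k, forall k', (k <= k')%N -> sint S (c ^+ k' * u).
  case/asboolP=> s sS ->; exists (size s) => k kk; rewrite horner_coef mulr_sumr; apply: sint_sum => i _.
  have ik : (i <= k)%N by apply: leq_trans kk; apply: ltnW.
  rewrite mulrCA -{1}(subnK ik) exprD -mulrA -exprMn; apply: sint_mul; first by apply: sint_id; have /polyOverP -> := sS.
  by apply: sint_mul; [apply: sint_id; rewrite rpredX | apply: sint_exp].
have [D hD] := int_adj _ a1S; set y := c ^+ D * a1.
have y0 : y != 0 by rewrite mulf_neq0 // expf_neq0.
(* The lowest nonzero coefficient of an integral equation of y is a nonzero element of S divisible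
   by y, hence by a1, in S[x]; inverting it inverts a1. *)
have [c0' [c0S c00 [h hS c0E]]] : exists c0', [/\ c0' \in sr_pred S, c0' != 0 & exists2 h, h \in sr_pred (adj S x) & c0' = a1 * h].
  have yA : y \in sr_pred (adj S x) by rewrite rpredM ?rpredX // adj_sub.
  have [r [rm rS rr]] := hD D (leqnn _); rewrite -/y in rr.
  have r0 := monic_neq0 rm.
  have [d hd] : exists d, r`_d != 0 /\ forall i, (i < d)%N -> r`_i = 0.
    have ex : exists d, r`_d != 0 by exists (size r).-1; rewrite -lead_coefE lead_coef_eq0.
    case: (ex_minnP ex) => d hd dmin; exists d; split=> // i id; apply/eqP; apply: contraTT id => /dmin.
    by rewrite -leqNgt.
  exists r`_d; case: hd => hd hd'; split=> //; first by have /polyOverP -> := rS.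
  have rE : r`_d = - \sum_(i < size r) (if (d < i)%N then r`_i * y ^+ (i - d) else 0).
    apply/eqP; rewrite -addr_eq0; apply/eqP; apply: (@mulfI _ (y ^+ d)); first by rewrite expf_neq0.
    rewrite mulr0 -[RHS](rootP rr) horner_coef mulrDr mulr_sumr.
    have dr : (d < size r)%N by rewrite ltnNge; apply: contraNN hd => /(nth_default 0) ->.
    rewrite (bigD1 (Ordinal dr)) //= ltnn mulr0 add0r [RHS](bigD1 (Ordinal dr)) //= mulrC; congr (_ + _).
    apply: eq_bigr => i; rewrite -val_eqE /= => ne; case: ltnP => di.
      by rewrite mulrCA -exprD subnKC // ltnW.
    by rewrite mulr0 hd' ?mul0r // ltn_neqAle ne.
  exists (- (c ^+ D * \sum_(i < size r) (if (d < i)%N then r`_i * y ^+ (i - d).-1 else 0))).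
    rewrite rpredN; apply: rpredM; first by apply: rpredX; apply: adj_sub.
    apply: rpred_sum => i _; case: ifP => _; last by rewrite rpred0.
    by apply: rpredM; [apply: adj_sub; have /polyOverP := rS; apply | exact: rpredX].
  rewrite rE mulrN mulrA [a1 * _]mulrC -/y; congr (- _); rewrite mulr_sumr; apply: eq_bigr => i _.
  case: ifP => di; last by rewrite mulr0.
  by rewrite mulrCA -exprS prednK // subn_gt0.
exists (c * c0'); split; rewrite ?rpredM ?mulf_neq0 // => u.
have [k iu] := a1i u.
have [r [rm rS rr]] : sint (adj S x) (c0' ^+ k * u).
  rewrite c0E exprMn mulrAC mulrC; apply: sint_mul => //; apply: sint_id; by rewrite rpredX.
have [D' hD'] : exists D', forall i, sint S (c ^+ D' * r`_i).
  have [kk hk] := boolp.choice (fun i => int_adj r`_i ltac:(by have /polyOverP -> := rS)).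
  exists (\max_(i < size r) kk i) => i; case: (ltnP i (size r)) => ir; last first.
    by rewrite nth_default // mulr0; apply: sint_id; rewrite rpred0.
  by apply: hk; apply: (leq_bigmax (Ordinal ir)).
have iv : sint S (c ^+ D' * (c0' ^+ k * u)).
  have sr : (0 < size r)%N by rewrite size_poly_gt0 monic_neq0.
  apply: (sint_root _ _ (scale_root (c ^+ D') rm rr)).
    rewrite monicE lead_coefE size_poly_eq; last by rewrite eqxx oner_neq0.
    by rewrite coef_poly eqxx prednK ?leqnn.
  move=> i; rewrite coef_poly; case: ifP => [ip|_]; last by apply: sint_id; rewrite rpred0.
  case: eqP => [_|ne]; first by apply: sint_id; rewrite rpred1.
  rewrite (pred_sub_S ip ne).
  rewrite exprS mulrA [r`_i * _]mulrC; apply: sint_mul => //; by apply: sint_id; apply: rpredX; apply: rpredX.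
exists (k + D')%N.
have -> : (c * c0') ^+ (k + D') * u = (c ^+ k * c0' ^+ D') * (c ^+ D' * (c0' ^+ k * u)).
  rewrite exprMn !exprD; move: (c ^+ k) (c ^+ D') (c0' ^+ k) (c0' ^+ D') => p1' p2 p3 p4.
  by rewrite -!mulrA; congr (_ * _); rewrite [RHS]mulrCA; congr (_ * _); exact: mulrCA.
by apply: sint_mul => //; apply: sint_id; rewrite rpredM ?rpredX.
Qed.
End IntegralSubring.

Section Zariski.
Local Open Scope quotient_scope.
Variables (K : fieldType) (N : nat).
Notation A := {mpoly K[N]}.

(** The residue field is generated over the image of K by finitely many elements. [field_integral]
    makes it integral after inverting one nonzero element of that image, which is already a unit
    there. *)
Lemma maximal_algebraic (m : idealr A) : is_maximal m -> forall u : A,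
  exists p : {poly K}, [/\ p \is monic, (1 < size p)%N & (map_poly (@mpolyC N K) p).[u] \in m].
Proof.
move=> mm u.
pose Q : comNzRingType := {ideal_quot m}.
have piE (a b : A) : (\pi_Q a = \pi_Q b) <-> (a - b \in m).
  by rewrite (Quotient.idealrBE m); split=> [->|/eqP].
have Qinv (x : Q) : x <> 0 -> exists y, y * x = 1.
  move=> x0; pose a := repr x; have xE : x = \pi_Q a by rewrite reprK.
  have am : a \notin m.
    by apply/negP=> am; apply: x0; rewrite xE; have <- : \pi_Q 0 = 0 :> Q := rmorph0 _; apply/piE; rewrite subr0.
  have [b hb] := maximal_inv mm am; exists (\pi_Q b); rewrite xE.
  rewrite -[LHS]rmorphM -[RHS](rmorph1 (\pi_Q)); apply/piE.
  by rewrite -opprB rpredN mulrC.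
pose inv (x : Q) : Q := if pselect (x <> 0) is left h then projT1 (cid (Qinv x h)) else 0.
have mV x : x != 0 -> inv x * x = 1.
  by move=> /eqP x0; rewrite /inv; case: pselect => // h; case: (cid _).
have i0 : inv 0 = 0 by rewrite /inv; case: pselect => // h; case: (h erefl).
pose L : fieldType := HB.pack Q (GRing.ComNzRing_isField.Build Q mV i0).
pose pr (a : A) : L := \pi_Q a.
have prD a b : pr (a + b) = pr a + pr b by exact: (rmorphD (\pi_Q)).
have prB a b : pr (a - b) = pr a - pr b by exact: (rmorphB (\pi_Q)).
have prM a b : pr (a * b) = pr a * pr b by exact: (rmorphM (\pi_Q)).
have pr1 : pr 1 = 1 by exact: (rmorph1 (\pi_Q)).
have pr0 : pr 0 = 0 by exact: (rmorph0 (\pi_Q)).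
pose S0 : {pred L} := fun y => `[< exists c : K, y = pr c%:MP >].
have S0c : subring_closed S0.
  split.
  - by apply/asboolP; exists 1; rewrite mpolyC1.
  - by move=> x y /asboolP[a ->] /asboolP[b ->]; apply/asboolP; exists (a - b); rewrite mpolyCB prB.
  by move=> x y /asboolP[a ->] /asboolP[b ->]; apply/asboolP; exists (a * b); rewrite mpolyCM prM.
pose S := SubR S0c.
pose xs : seq L := [seq pr 'X_i | i <- enum 'I_N].
have sub (T : subr L) ys : {subset sr_pred T <= sr_pred (foldl (@adj L) T ys)}.
  elim: ys T => [|y ys IH] T z zT //=; apply: (IH); exact: adj_sub.
have gen : forall ys (T : subr L) y, y \in ys -> y \in sr_pred (foldl (@adj L) T ys).
  elim=> [|y ys IH] T z //=; rewrite inE => /orP[/eqP ->|zy]; last exact: IH.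
  by apply: sub; apply: adj_gen.
have full (y : L) : y \in sr_pred (foldl (@adj L) S xs).
  rewrite -[y](reprK (y : Q)) -/(pr (repr (y : Q))); elim/mpoly_ring_ind: (repr _) => [c|i|p q hp hq|p q hp hq].
  - by apply: sub; apply/asboolP; exists c.
  - by apply: gen; apply/mapP; exists i; rewrite ?mem_enum.
  - by rewrite prD rpredD.
  by rewrite prM rpredM.
have [a [/asboolP[ca aE] a0 ha]] := field_integral full.
have [k [p [pm pS pu]]] : exists k, sint S (a ^+ k * pr u) := ha (pr u).
have ca0 : ca != 0 by apply: contraNneq a0 => c0; rewrite aE c0 mpolyC0 pr0.
have aV : pr (ca^-1)%:MP * a = 1 by rewrite aE -prM -mpolyCM mulVf // mpolyC1.
have [q [qm qS qu]] : sint S (pr u).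
  have -> : pr u = (pr (ca^-1)%:MP) ^+ k * (a ^+ k * pr u) by rewrite mulrA -exprMn aV expr1n mul1r.
  apply: sint_mul; last by exists p.
  by apply: sint_id; rewrite rpredX //; apply/asboolP; exists ca^-1.
have hq i : exists x : K, q`_i = pr x%:MP by apply/asboolP; have /polyOverP := qS; apply.
have [c hc] := boolp.choice hq.
pose r := \poly_(i < size q) (if i == (size q).-1 then 1 else c i).
have sq : (0 < size q)%N by rewrite size_poly_gt0 monic_neq0.
have sr : size r = size q by rewrite size_poly_eq // eqxx oner_neq0.
have rm : r \is monic.
  by rewrite monicE lead_coefE sr coef_poly eqxx prednK ?leqnn.
have ru : (map_poly (@mpolyC N K) r).[u] \in m.
  rewrite -[X in X \in m]subr0; apply/piE; rewrite -/(pr _) -/(pr 0) pr0 -[RHS](rootP qu).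
  rewrite horner_coef size_map_poly_id0; last by rewrite (eqP rm) mpolyC1 oner_neq0.
  rewrite sr horner_coef.
  have prs (F : nat -> A) n : pr (\sum_(i < n) F i) = \sum_(i < n) pr (F i).
    by elim: n => [|n IH]; rewrite ?big_ord0 ?pr0 // !big_ord_recr prD IH.
  have prX x n : pr (x ^+ n) = pr x ^+ n.
    by elim: n => [|n IH]; rewrite ?expr0 ?pr1 // !exprS prM IH.
  rewrite (prs (fun i => (map_poly (@mpolyC N K) r)`_i * u ^+ i)); apply: eq_bigr => i _; rewrite prM prX coef_map /= coef_poly ltn_ord; congr (_ * _).
  case: eqP => [->|_]; last by rewrite hc.
  by rewrite mpolyC1 pr1; have := eqP qm; rewrite lead_coefE => ->.
exists r; split=> //; rewrite ltnNge; apply/negP=> sr1.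
move: ru; rewrite [r]size1_polyC // map_polyC hornerC.
have -> : r`_0 = 1 by have := eqP rm; rewrite lead_coefE; case: (size r) sr1 => [|[|]].
by rewrite /= mpolyC1 (idealr1 m).
Qed.
End Zariski.

(** * Algebraic dependence by counting monomials *)

Section ExponentLists.
Fixpoint elists (n s : nat) : seq (seq nat) :=
  if n is n'.+1 then [seq i :: l | i <- seq.iota 0 s, l <- elists n' s] else [:: [::]].
Lemma size_elists n s : size (elists n s) = (s ^ n)%N.
Proof. by elim: n => [|n IH] //=; rewrite size_allpairs size_iota IH expnS. Qed.

Lemma elists_uniq n s : uniq (elists n s).
Proof.
elim: n => [|n IH] //=; apply: allpairs_uniq; rewrite ?iota_uniq //.
by move=> [i l] [i' l'] _ _ /= [-> ->].
Qed.
End ExponentLists.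

Section AlgebraicDependence.
Variables (K : fieldType) (N : nat).
Notation A := {mpoly K[N]}.

Fixpoint emon (x : nat -> A) (l : seq nat) : A :=
  if l is i :: l' then x 0%N ^+ i * emon (fun j => x j.+1) l' else 1.


Lemma emon_ext n s (x y : nat -> A) l : (forall j, (j < n)%N -> x j = y j) -> l \in elists n s -> emon x l = emon y l.
Proof.
elim: n x y l => [|n IH] x y l h /=; first by rewrite inE => /eqP ->.
case/allpairsP=> -[i l'] [/= _ hl ->] /=; rewrite h //; congr (_ * _).
by apply: IH hl => j jn; apply: h.
Qed.

(* A chain of primes with x j in q (j+1) but not in q j makes the x j algebraically independent: the coefficient
   of the least exponent of x 0 lies in q 1. *)
Lemma chain_independent (q : nat -> A -> Prop) n (x : nat -> A) s (c : seq nat -> K) :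
  (forall j a b, q j a -> q j b -> q j (a + b)) -> (forall j a b, q j b -> q j (a * b)) ->
  (forall j a b, (j < n)%N -> q j (a * b) -> q j a \/ q j b) ->
  (forall j, (j < n)%N -> ~ q j (x j)) -> (forall j, (j < n)%N -> q j.+1 (x j)) ->
  (forall j a, (j < n)%N -> q j a -> q j.+1 a) -> ~ q n 1 ->
  q 0%N (\sum_(l <- elists n s) (c l)%:MP * emon x l) -> forall l, l \in elists n s -> c l = 0.
Proof.
elim: n q x c => [|n IH] q x c qD qM qP xn xq qS q1 /= h l.
  rewrite inE => /eqP ->; move: h; rewrite big_seq1 mulr1 => h; apply/eqP; apply: contrapT => /negP c0.
  by apply: q1; have := qM _ (c [::])^-1%:MP _ h; rewrite -mpolyCM mulVf // mpolyC1.
pose T i := \sum_(l <- elists n s) (c (i :: l))%:MP * emon (fun j => x j.+1) l.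
have hT : q 0%N (\sum_(i <- seq.iota 0 s) x 0%N ^+ i * T i).
  move: h; congr (q 0%N _); rewrite big_allpairs_dep; apply: eq_bigr => i _.
  by rewrite mulr_sumr; apply: eq_bigr => l' _ /=; rewrite mulrCA.
have step i : (i < s)%N -> (forall i', (i' < i)%N -> forall l', l' \in elists n s -> c (i' :: l') = 0) ->
    forall l', l' \in elists n s -> c (i :: l') = 0.
  move=> is_ hi; apply: (IH (fun j => q j.+1) (fun j => x j.+1) (fun l' => c (i :: l'))).
  - by move=> j; apply: qD.
  - by move=> j; apply: qM.
  - by move=> j a b jn; apply: qP.
  - by move=> j jn; apply: xn.
  - by move=> j jn; apply: xq.
  - by move=> j a jn; apply: qS.
  - by [].
  rewrite -/(T i).
  pose U := \sum_(i.+1 <= k < s) x 0%N ^+ (k - i.+1) * T k.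
  have e1 : \sum_(k <- seq.iota 0 s) x 0%N ^+ k * T k = x 0%N ^+ i * (T i + x 0%N * U).
    have -> : seq.iota 0 s = index_iota 0 s by rewrite /index_iota subn0.
    rewrite (big_cat_nat _ _ (n := i)) //= ?(ltnW is_) // big_nat big1 ?add0r => [|k /andP[_ ki]].
      rewrite big_ltn // mulrDr; congr (_ + _); rewrite /U !mulr_sumr big_nat [RHS]big_nat.
      apply: eq_bigr => k /andP[ik _]; rewrite !mulrA -exprSr -exprD subnKC //.
    by rewrite /T big_seq big1 ?mulr0 // => l' l'e; rewrite hi // mpolyC0 mul0r.
  have qx k a : q 0%N (x 0%N ^+ k * a) -> q 0%N a.
    elim: k => [|k IHk]; first by rewrite mul1r.
    rewrite exprS -mulrA => hh; have [h0|h0] := qP 0%N _ _ isT hh; last exact: IHk.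
    by case: (xn 0%N isT).
  have h1 : q 1%N (T i + x 0%N * U) by apply: qS => //; apply: (qx i); rewrite -e1.
  have h2 : q 1%N (x 0%N * U) by rewrite mulrC; apply: qM; apply: xq.
  have -> : T i = (T i + x 0%N * U) + (-1) * (x 0%N * U) by rewrite mulN1r addrK.
  by apply: qD => //; apply: qM.
case/allpairsP=> -[i l'] [/= is_ hl ->]; move: is_; rewrite mem_iota add0n /=.
move: i l' hl; apply: ltn_ind => i IHi l' hl is_; apply: step => // i' i'i l'' hl''.
by apply: IHi => //; apply: ltn_trans is_.
Qed.

Variables (w : 'I_N -> nat) (F : 'I_N -> A) (G : 'I_N -> nat) (zs : {pred 'I_N}).
Hypotheses (w0 : forall t, (0 < w t)%N) (G0 : forall t, (0 < G t)%N).
Hypothesis leadF : forall t, lead w (U_(t) *+ G t) (F t).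

Lemma Th_surj_low d p : wlow w d p -> exists2 q, wlow w d q & Th F G q = p.
Proof.
elim: d p => [|d IH] p hp.
  exists 0; first exact: wlow0.
  rewrite (lin0 (Th_lin F G)); apply/esym/mpolyP=> m; rewrite mcoeff0; apply/eqP.
  by rewrite mcoeff_eq0; apply/negP=> /hp.
have [|q hq qE] := IH (p - Th F G p); last first.
  exists (p + q); first by apply: wlowD => //; apply: wlow_mono hq.
  by rewrite (linD _ _ (Th_lin F G)) qE addrC subrK.
rewrite {1}[p]mpolyE /Th -sumrB big_seq; apply: wlow_sum => m mp; rewrite -scalerBr; apply: wlowZ.
rewrite -opprB -scaleN1r; apply: wlowZ.
have hl : wlow w (wd w m) (Bm F G m - 'X_[m]) := @lead_Bm K N w F G leadF m.
by apply: wlow_mono hl; rewrite -ltnS; apply: hp.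
Qed.

(** Exponents of a normal form modulo the F_t for t in zs: below G_t for these t, and at most the
    weighted degree W for the other ones. *)
Definition boxdim (W : nat) (t : 'I_N) : nat := if t \in zs then G t else W.+1.
Notation box W := {dffun forall t : 'I_N, 'I_(boxdim W t)}.
Definition boxmon W (b : box W) : 'X_{1..N} := [multinom (b t : nat) | t < N].

Lemma wd_ge (m : 'X_{1..N}) (t : 'I_N) : (m t <= wd w m)%N.
Proof. by rewrite /wd (bigD1 t) //=; apply: leq_trans (leq_addr _ _); apply: leq_pmull. Qed.

(** Expand p in the basis [Bm]; a basis element whose exponent at some t in zs reaches G_t is a
    multiple of F_t, and the others are indexed by the box. *)
Lemma box_span s W (p : A) : (forall t, t \in s = (t \in zs)) -> wdle w W p ->
  exists c : box W -> K, in_seq_mul [seq F t | t <- s] (p - \sum_b c b *: Bm F G (boxmon b) : A^o).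
Proof.
move=> hs /wdle_low /Th_surj_low [q hq <-].
pose Sp (p : A) := exists c : box W -> K, in_seq_mul [seq F t | t <- s] (p - \sum_b c b *: Bm F G (boxmon b) : A^o).
have SpD x y : Sp x -> Sp y -> Sp (x + y).
  move=> [c hc] [c' hc']; exists (fun b => c b + c' b).
  have -> : x + y - \sum_b (c b + c' b) *: Bm F G (boxmon b) =
     (x - \sum_b c b *: Bm F G (boxmon b)) + (y - \sum_b c' b *: Bm F G (boxmon b)).
    by under eq_bigr => b _ do rewrite scalerDl; rewrite big_split /= opprD addrACA.
  exact: (@in_seq_mulD _ _ A^o).
have Sp0 x : in_seq_mul [seq F t | t <- s] (x : A^o) -> Sp x.
  by exists (fun=> 0); rewrite big1 ?subr0 // => b _; rewrite scale0r.
rewrite /Th big_seq; apply: (@big_ind _ Sp) => [||m mq]; [by apply: Sp0; apply: (@in_seq_mul0 _ _ A^o) | exact: SpD|].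
have [/existsP[t /andP[tz tG]]|hb] := boolP [exists t, (t \in zs) && (G t <= m t)%N].
  have le : (U_(t) *+ G t <= m)%MM.
    by apply/mnm_lepP=> i; rewrite mulmnE mnm1E; case: eqP => [<-|]; rewrite ?mul1n ?mul0n.
  apply: Sp0; rewrite -[m in Bm _ _ m](submK le) addmC -(Bm_mul F G0) -mul_mpolyC; apply: (@in_seq_mulZ _ _ A^o).
  by apply: (@in_seq_mem _ _ A^o); apply/mapP; exists t; rewrite ?hs.
have bt t : (m t < boxdim W t)%N.
  rewrite /boxdim; case: ifP => tz.
    by rewrite ltnNge; apply/negP=> h; move/negP: hb; apply; apply/existsP; exists t; rewrite tz.
  by rewrite ltnS; apply: leq_trans (wd_ge m t) _; rewrite -ltnS; apply: hq.
pose b0 : box W := [ffun t => Ordinal (bt t)].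
have b0E : boxmon b0 = m by apply/mnmP=> t; rewrite mnmE ffunE.
exists (fun b => if b == b0 then q@_m else 0).
rewrite (bigD1 b0) //= eqxx b0E big1 ?addr0 => [|b /negPf ->]; last by rewrite scale0r.
by rewrite subrr; apply: (@in_seq_mul0 _ _ A^o).
Qed.

Lemma card_box W : #|{: box W}| = (\prod_t boxdim W t)%N.
Proof. by rewrite card_dep_ffun foldrE big_map big_enum; apply: eq_bigr => t _; rewrite card_ord. Qed.

Lemma wdle_exp d (p : A) k : wdle w d p -> wdle w (d * k) (p ^+ k).
Proof.
move=> h; elim: k => [|k IH]; first by rewrite expr0 -mpolyC1 muln0; apply: wdleC.
by rewrite exprS mulnS; apply: wdleM.
Qed.

Lemma wdle_emon n s W x l : (forall j, wdle w W (x j)) -> l \in elists n s -> wdle w (n * (s * W)) (emon x l).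
Proof.
elim: n x l => [|n IH] x l hx /=; first by rewrite inE => /eqP -> /=; rewrite -mpolyC1; apply: wdleC.
case/allpairsP=> -[i l'] [/= is_ hl ->] /=; rewrite mulSn; apply: wdleM; last exact: IH.
apply: (wdle_mono _ (wdle_exp (k:=i) (hx 0%N))); rewrite mulnC leq_mul2r; apply/orP; right.
by move: is_; rewrite mem_iota add0n => /ltnW.
Qed.

(** With exponents below k there are k^(d+1) monomials in d+1 elements, whereas modulo the F_t they
    lie in a space whose dimension grows like k^d. *)
Lemma dependent_mod s d (x : nat -> A) : (forall t, t \in s = (t \in zs)) -> #|[predC zs]| = d ->
  exists k (c : seq nat -> K), in_seq_mul [seq F t | t <- s] (\sum_(l <- elists d.+1 k) (c l)%:MP * emon x l : A^o) /\
    exists2 l, l \in elists d.+1 k & c l != 0.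
Proof.
move=> hs hd; pose W := \max_(j < d.+1) \max_(m <- msupp (x j)) wd w m.
pose x' j := if (j < d.+1)%N then x j else 0.
have hx j : wdle w W (x' j).
  rewrite /x'; case: ltnP => jd m; last by rewrite msupp0.
  move=> mx; apply: leq_trans (leq_bigmax (Ordinal jd)); exact: leq_bigmax_seq.
(* The monomials have weighted degree at most W' = (d+1)kW, and W'+1 is at most k C0; the choice of
   k makes gz (k C0)^d smaller than k^(d+1). *)
pose C0 := (d.+1 * W).+1; pose gz := (\prod_(t in zs) G t)%N.
pose k := (gz * C0 ^ d).+1; pose W' := (d.+1 * (k * W))%N.
have kc : (#|{: box W'}| < k ^ d.+1)%N.
  rewrite card_box (bigID (fun t => t \in zs)) /=.
  rewrite (eq_bigr G) => [|t tz]; last by rewrite /boxdim tz.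
  rewrite [X in (_ * X)%N](eq_bigr (fun=> W'.+1)) => [|t tz]; last by rewrite /boxdim (negPf tz).
  rewrite prod_nat_const -/gz.
  have -> : #|[predC zs]| = d by [].
  have le : (W'.+1 <= k * C0)%N by rewrite /W' /C0; nia.
  have expm a b n : (a <= b -> a ^ n <= b ^ n)%N by move=> ab; elim: n => // n IH; rewrite !expnS leq_mul.
  have le2 : (W'.+1 ^ d <= k ^ d * C0 ^ d)%N by rewrite -expnMn; apply: expm.
  apply: leq_ltn_trans (leq_mul (leqnn gz) le2) _.
  by rewrite mulnCA expnSr ltn_pmul2l ?expn_gt0 // /k.
have xE l : l \in elists d.+1 k -> emon x l = emon x' l.
  by apply: emon_ext => j jd; rewrite /x' jd.
have H l : exists c : box W' -> K, l \in elists d.+1 k ->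
    in_seq_mul [seq F t | t <- s] (emon x l - \sum_b c b *: Bm F G (boxmon b) : A^o).
  have [le|nle] := boolP (l \in elists d.+1 k); last by exists (fun=> 0).
  have [c hc] := box_span hs (wdle_emon hx le); exists c => _; rewrite xE //.
have [C hC] := boolp.choice H.
set El := elists d.+1 k in H hC xE *.
have sE : size El = (k ^ d.+1)%N := size_elists _ _.
pose M : 'M[K]_(size El, #|{: box W'}|) := \matrix_(i, b) C (nth [::] El i) (enum_val b).
have : kermx M != 0.
  rewrite kermx_eq0 /row_free neq_ltn; apply/orP; left; apply: leq_ltn_trans (rank_leq_col M) _.
  by rewrite [X in (_ < X)%N]sE.
case/rowV0Pn => u /sub_kermxP uM u0.
pose c l := oapp (fun j : 'I_(size El) => u 0 j) 0 (insub (index l El)).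
have cE (i : 'I_(size El)) : c (nth [::] El i) = u 0 i.
  by rewrite /c index_uniq ?elists_uniq // valK.
exists k, c; split; last first.
  have [i ui] : exists i, u 0 i != 0.
    apply/existsP; apply: contraNT u0; rewrite negb_exists => /forallP h; apply/eqP/rowP => i.
    by rewrite mxE; apply/eqP; rewrite -[_ == _]negbK; apply: h.
  by exists (nth [::] El i); rewrite ?mem_nth // cE.
have -> : \sum_(l <- El) (c l)%:MP * emon x l =
    \sum_(i < size El) u 0 i *: (emon x (nth [::] El i) - \sum_b C (nth [::] El i) b *: Bm F G (boxmon b)).
  rewrite (big_nth [::]) big_mkord.
  under [RHS]eq_bigr => i _ do rewrite scalerBr.
  rewrite sumrB [X in _ - X](_ : _ = 0) ?subr0.
    by apply: eq_bigr => i _; rewrite cE mul_mpolyC.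
  under eq_bigr => i _ do rewrite scaler_sumr.
  rewrite exchange_big big1 // => b _; under eq_bigr => i _ do rewrite scalerA.
  rewrite -scaler_suml; have -> : \sum_(i < size El) u 0 i * C (nth [::] El i) b = (u *m M) 0 (enum_rank b).
    by rewrite mxE; apply: eq_bigr => i _; rewrite mxE enum_rankK.
  by rewrite uM mxE scale0r.
elim/big_ind: _ => [|y z|i _]; [exact: (@in_seq_mul0 _ _ A^o) | exact: (@in_seq_mulD _ _ A^o)|].
rewrite -mul_mpolyC; apply: (@in_seq_mulZ _ _ A^o); apply: hC; exact: mem_nth.
Qed.
End AlgebraicDependence.

(** * Chains of primes from regular sequences *)

Section PrimeExistence.
Variable R : comNzRingType.

Definition idealp (I : R -> Prop) := I 0 /\ forall a u v, I u -> I v -> I (a * u + v).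

Lemma idealpD I u v : idealp I -> I u -> I v -> I (u + v).
Proof. by move=> [_ h] Iu Iv; rewrite -[u]mul1r; apply: h. Qed.
Lemma idealpM I a u : idealp I -> I u -> I (a * u).
Proof. by move=> [h0 h] Iu; rewrite -[_ * _]addr0; apply: h. Qed.

(** An ideal containing J and maximal among those disjoint from the multiplicative set T is prime;
    it exists by Zorn's lemma. *)
Lemma prime_avoiding (J T : R -> Prop) : idealp J -> T 1 -> (forall a b, T a -> T b -> T (a * b)) ->
  (forall a, J a -> T a -> False) ->
  exists p : prime_idealr R, (forall a, J a -> a \in p) /\ forall a, a \in p -> T a -> False.
Proof.
move=> HJ T1 TM JT.
pose good (I : R -> Prop) := [/\ idealp I, forall a, J a -> I a & forall a, I a -> T a -> False].
pose X := {I : R -> Prop | good I}.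
pose le (I I' : X) := `[< forall a, sval I a -> sval I' a >].
have gJ : good J by [].
have [P hP] : exists P : X, forall I, le P I -> le I P.
  apply: (@classical_sets.ZL_preorder X (exist _ J gJ) le).
  - by move=> I; apply/asboolP.
  - by move=> I1 I2 I3 /asboolP h1 /asboolP h2; apply/asboolP => a /h1 /h2.
  move=> Ch tot; case: (pselect (exists I, Ch I)) => [[I0 hI0]|no]; last first.
    by exists (exist _ J gJ) => I hI; case: no; exists I.
  pose U a := exists2 I : X, Ch I & sval I a.
  have gU : good U.
    split.
    - split; first by exists I0 => //; case: (svalP I0) => -[].
      move=> a u v [I1 c1 h1] [I2 c2 h2].
      have [/asboolP l12|/asboolP l21] := tot _ _ c1 c2.
        exists I2 => //; case: (svalP I2) => -[_ h] _ _; apply: h => //; exact: l12.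
      exists I1 => //; case: (svalP I1) => -[_ h] _ _; apply: h => //; exact: l21.
    - by move=> a Ja; exists I0 => //; case: (svalP I0) => _ h _; apply: h.
    by move=> a [I c1 h1]; case: (svalP I) => _ _; apply.
  by exists (exist _ U gU) => I cI; apply/asboolP => a Ia; exists I.
case: P hP => P gP hmax; have [HP JP PT] := gP; have [HP0 HPl] := HP.
have big (I : R -> Prop) : idealp I -> (forall a, P a -> I a) -> (forall a, I a -> T a -> False) -> forall a, I a -> P a.
  move=> HI PI IT a Ia; have gI : good I by split=> // b /JP /PI.
  by have /asboolP := hmax (exist _ I gI) (introT (asboolP _) PI); apply.
pose S : {pred R} := fun a => `[< P a >].
have Sc : idealr_closed S.
  split; first by apply/asboolP; exact: HP0.
  - by apply/negP=> /asboolP P1; apply: (PT 1).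
  move=> a u v /asboolP Pu /asboolP Pv; apply/asboolP; exact: HPl.
have Sp : prime_idealr_closed S.
  have ext u : u \notin S -> exists t s p, [/\ T t, P p & t = p + s * u].
    move=> /asboolPn nPu; apply: contrapT => no; apply: nPu.
    apply: (big (fun a => exists p s, P p /\ a = p + s * u)).
    - split; first by exists 0, 0; rewrite mul0r addr0; split=> //; exact: HP0.
      move=> a x y [p [s [hp ->]]] [p' [s' [hp' ->]]]; exists (a * p + p'), (a * s + s'); split.
        exact: HPl.
      by rewrite mulrDr mulrDl mulrA addrACA.
    - by move=> a Pa; exists a, 0; rewrite mul0r addr0.
    - by move=> a [p [s [hp ->]]] Ta; apply: no; exists (p + s * u), s, p.
    by exists 0, 1; rewrite mul1r add0r; split=> //; exact: HP0.
  move=> u v uvS; apply: contraT; rewrite negb_or => /andP[/ext [t [s [p [Tt Pp tE]]]] /ext [t' [s' [p' [Tt' Pp' tE']]]]].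
  suff: False by [].
  apply: (PT (t * t')); last exact: TM.
  have -> : t * t' = (p' + s' * v) * p + (s * u * p' + s * s' * (u * v)).
    rewrite tE tE' mulrDl [p * _]mulrC; congr (_ + _); rewrite mulrDr; congr (_ + _).
    by rewrite mulrACA.
  apply: (idealpD HP); first exact: (idealpM _ HP).
  by apply: (idealpD HP); apply: (idealpM _ HP) => //; apply/asboolP.
exists (prid_pred (PrimeIdeal Sc Sp) : prime_idealr R); split=> a; first by move=> Ja; apply/asboolP; apply: JP.
by move=> /asboolP Pa; apply: PT.
Qed.

Section Chain.
Variables (M : lmodType R) (xs : seq R).
Hypothesis reg : regular_seq xs M.

(** The annihilator of M modulo the first i terms of the sequence. *)
Definition annq i (s : R) := forall y : M, in_seq_mul (take i xs) (s *: y).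

Lemma annq_ideal i : idealp (annq i).
Proof.
split=> [y|a u v hu hv y]; first by rewrite scale0r; apply: in_seq_mul0.
by rewrite scalerDl -scalerA; apply: in_seq_mulD => //; apply: in_seq_mulZ.
Qed.

Lemma annq_mono i s : annq i s -> annq i.+1 s.
Proof.
move=> h y; apply: in_seq_mul_mono (h y) => a; case: (ltnP i (size xs)) => hi.
  by rewrite (take_nth 0) // mem_rcons inE => ->; rewrite orbT.
by rewrite !take_oversize // ltnW.
Qed.

(** Take for T the products of an element outside p with a power of x_i. Regularity cancels the
    power, so T misses the annihilator of the i-th quotient, and a prime avoiding T lies in p and
    does not contain x_i. *)
Lemma annq_step i (p : prime_idealr R) : (i < size xs)%N -> (forall s, annq i.+1 s -> s \in p) ->
  exists p' : prime_idealr R, [/\ forall s, annq i s -> s \in p', {subset p' <= p}, xs`_i \in p & xs`_i \notin p'].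
Proof.
move=> ix hp.
have xp : xs`_i \in p.
  by apply: hp => y; apply: in_seq_mem; rewrite (take_nth 0) // mem_rcons inE eqxx.
pose T (t : R) := exists s k, s \notin p /\ t = s * xs`_i ^+ k.
have [|||p' [h1 h2]] := @prime_avoiding (annq i) T (annq_ideal i).
- by exists 1, 0%N; rewrite expr0 mulr1; split=> //; rewrite (idealr1 p).
- move=> a b [s [k [sp ->]]] [s' [k' [s'p ->]]]; exists (s * s'), (k + k')%N; split.
    by rewrite (prime_idealrM p) negb_or sp.
  by rewrite exprD mulrACA.
- move=> a ha [s [k [sp aE]]]; move/negP: sp; apply; apply: hp; apply: annq_mono => y.
  elim: k a aE ha => [|k IH] a aE ha; first by have := ha y; rewrite aE expr0 mulr1.
  apply: (IH (s * xs`_i ^+ k)) => // z; apply: (reg.1 _ ix).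
  by rewrite scalerA mulrCA -exprS -aE.
exists p'; split=> //.
  move=> s sp'; apply: contrapT => /negP nsp; apply: (h2 _ sp'); exists s, 0%N.
  by rewrite expr0 mulr1.
apply/negP=> xp'; apply: (h2 _ xp'); exists 1, 1%N; rewrite mul1r expr1; split=> //.
by rewrite (idealr1 p).
Qed.

Lemma regular_prime_chain : exists p, @prime_chain R (annihilator M) (size xs) p.
Proof.
(* The chain is built downwards from a prime above the annihilator of the last quotient, which is
   proper because the sequence is. *)
have h j : (j <= size xs)%N -> exists p : 'I_j.+1 -> prime_idealr R,
    (forall s, annq (size xs - j) s -> s \in p ord0) /\
    forall i i' : 'I_j.+1, (i < i')%N -> {subset p i <= p i'} /\ exists2 x, x \in p i' & x \notin p i.
  elim: j => [_|j IH jx].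
    have [|||p [h1 _]] := @prime_avoiding (annq (size xs)) (fun t => t = 1) (annq_ideal _) => //.
    - by move=> a b -> ->; rewrite mulr1.
    - move=> a ha a1; case: reg => _ [y ny]; apply: ny; have := ha y; rewrite a1 scale1r.
      by rewrite take_oversize.
    exists (fun=> p); split; first by rewrite subn0.
    by move=> i i'; rewrite !ord1.
  have [p [p1 p2]] := IH (ltnW jx).
  have e : (size xs - j = (size xs - j.+1).+1)%N by lia.
  rewrite e in p1; have [|p' [q1 q2 q3 q4]] := annq_step _ p1; first by lia.
  exists (fun i => if unlift ord0 i is Some i0 then p i0 else p'); split; first by rewrite unlift_none.
  move=> i i'; case: (unliftP ord0 i') => [k' ->|->]; last by [].
  case: (unliftP ord0 i) => [k ->|->]; first by rewrite !lift0 ltnS; apply: p2.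
  move=> _; split.
    move=> x /q2; case: (posnP k') => [k0|k0]; first by have -> : k' = ord0 by apply: val_inj.
    by have [sub _] := p2 ord0 k' k0; apply: sub.
  exists xs`_(size xs - j.+1) => //; case: (posnP k') => [k0|k0]; first by have -> : k' = ord0 by apply: val_inj.
  by have [sub _] := p2 ord0 k' k0; apply: sub.
have [p [p1 p2]] := h _ (leqnn _); exists p; split=> // i x hx.
have hx0 : x \in p ord0 by apply: p1 => y; rewrite hx; apply: in_seq_mul0.
case: (posnP i) => [i0|i0]; first by have -> : i = ord0 by apply: val_inj.
by have [sub _] := p2 ord0 i i0; apply: sub.
Qed.
End Chain.
End PrimeExistence.

(** * The dimension bound for ideals containing the minors *)

Section ChainBound.
Variables (K : fieldType) (e g : nat).
Hypothesis g0 : (0 < g)%N.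
Notation f := (e + g)%N.
Notation N := (f * g)%N.
Notation A := {mpoly K[N]}.

(** Elements separating consecutive primes of the chain are algebraically independent modulo the
    first prime ([chain_independent]), but any fg - e of them are dependent modulo the e+1 minors
    ([dependent_mod], after the shear). The q are predicates, so that primes of a localization can
    be pulled back without being repackaged. *)
Lemma chain_bound (q : nat -> A -> Prop) n (x : nat -> A) :
  (forall j a b, q j a -> q j b -> q j (a + b)) -> (forall j a b, q j b -> q j (a * b)) ->
  (forall j a b, (j < n)%N -> q j (a * b) -> q j a \/ q j b) ->
  (forall j, (j < n)%N -> ~ q j (x j)) -> (forall j, (j < n)%N -> q j.+1 (x j)) ->
  (forall j a, (j < n)%N -> q j a -> q j.+1 a) -> (forall j, (j <= n)%N -> ~ q j 1) ->
  (forall k, q 0%N (delta K g0 k)) -> (n <= f * g - e.+1)%N.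
Proof.
move=> qD qM qP xn xq qS q1 qd; rewrite leqNgt; apply/negP=> dn; set d := (f * g - e.+1)%N in dn.
pose p (t : 'I_N) : {poly K} := 'X.
have pm t : p t \is monic by rewrite monicX.
have ps t : (1 < size (p t))%N by rewrite size_polyX.
pose zs := [pred t : 'I_N | is_z g0 t]; pose s := [seq zvar g0 k | k <- enum 'I_e.+1].
have hs t : t \in s = (t \in zs).
  rewrite inE; apply/mapP/existsP => [[k _ ->]|[k /eqP ->]]; first by exists k.
  by exists k; rewrite ?mem_enum.
have hd : #|[predC zs]| = d by rewrite /d -(card_nz e g0); apply: eq_card => t; rewrite !inE.
have [c1 c2] := shear1K K e g0.
have w0 (t : 'I_N) : (0 < wvar g0 t)%N.
  case: (boolP (is_z g0 t)) => [/existsP[k /eqP ->]|/wvar_nz ->] //.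
  by rewrite wvar_z; apply: ltnW; apply: (Cw_gt g0); have := ltn_ord k; lia.
set sh := (X in cancel X _) in c1; set sh' := (X in cancel X _) in c2.
have [k [c [hc [l ll cl]]]] := dependent_mod w0 (Gv0 g0 ps) (@lead_Fv K e g g0 p pm ps) (fun j => sh (x j)) hs hd.
move/eqP: cl; apply; apply: (chain_independent (q := q) (n := d.+1) (x := x) (s := k)) ll => //.
- by move=> j a b jd; apply: qP; apply: leq_trans dn.
- by move=> j jd; apply: xn; apply: leq_trans dn.
- by move=> j jd; apply: xq; apply: leq_trans dn.
- by move=> j a jd; apply: qS; apply: leq_trans dn.
- exact: q1.
have E : [seq Fv g0 p t | t <- s] = [seq sh a | a <- deltas K e g0].
  by have := @coord_map K e g g0 p [::] isT; rewrite /= => ->.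
have emE l' : emon (fun j => sh (x j)) l' = sh (emon x l').
  elim: l' x {xn xq hc} => [|i l' IH] x /=; first by rewrite -mpolyC1 /sh mmapC.
  by rewrite /sh rmorphM rmorphXn /= -/sh IH.
have SE : \sum_(l0 <- elists d.+1 k) (c l0)%:MP * emon (fun j => sh (x j)) l0 =
   sh (\sum_(l0 <- elists d.+1 k) (c l0)%:MP * emon x l0).
  rewrite /sh rmorph_sum; apply: eq_bigr => l0 _; rewrite rmorphM /= -/sh emE; congr (_ * _).
  by rewrite /sh mmapC.
move: hc; rewrite E SE => /(in_seq_morph _ _ c1 c2) [z ->].
have q00 : q 0%N 0 by rewrite -(mul0r (delta K (e:=e) g0 ord0)); apply: qM.
elim/big_ind: _ => [|a b|i _]; [exact: q00 | exact: qD|].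
rewrite [_ *: _]mulrC; apply: qM; have /mapP[k' _ ->] : (deltas K e g0)`_i \in deltas K e g0 by apply: mem_nth.
exact: qd.
Qed.
End ChainBound.

(** * Projective resolutions and the annihilator *)

Section Projectives.
Variable A : comNzRingType.

Definition lin_of (U V : lmodType A) (h : U -> V) (H : linear h) : {linear U -> V} :=
  HB.pack h (GRing.isLinear.Build A U V *:%R h H).

(** Projectivity applied to the corestriction of p to the kernel of k, realised as [cycles k]. *)
Lemma proj_lift (Q U V W : lmodType A) (p : {linear U -> V}) (k : {linear V -> W}) (h : {linear Q -> V}) :
  projective Q -> (forall v, k v = 0 -> exists u, p u = v) -> (forall u, k (p u) = 0) -> (forall x, k (h x) = 0) ->
  exists h' : {linear Q -> U}, forall x, p (h' x) = h x.
Proof.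
move=> PQ sp kp kh.
have cp u : p u \in Defs.cycle k by apply/eqP; exact: kp.
have ch x : h x \in Defs.cycle k by apply/eqP; exact: kh.
pose p' u : cycles k := Cycle (cp u); pose h0 x : cycles k := Cycle (ch x).
have lp : linear p' by move=> a u v; apply: val_inj; rewrite /= linearP.
have lh : linear h0 by move=> a u v; apply: val_inj; rewrite /= linearP.
have [|h' hh'] := PQ _ _ (lin_of lp) (lin_of lh).
  move=> [v kv]; have /eqP kv0 : k v == 0 by [].
  by have [u pu] := sp v kv0; exists u; apply: val_inj.
by exists h' => x; have /(congr1 val) := hh' x.
Qed.

Section FreeCover.
Import freeg.

Lemma freeg_in_seq ws (C : choiceType) (D : {freeg C / A}) :
  in_seq_mul ws D <-> forall x, in_seq_mul ws (coeff x D : A^o).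
Proof.
split=> [h x|h].
  by apply: (in_seq_mul_lin (h := fun D => coeff x D : A^o)) h => a u v; rewrite coeffD coeffZ.
rewrite -[D]freeg_sumE; elim/big_ind: _ => [|y z|x _]; [exact: in_seq_mul0 | exact: in_seq_mulD|].
apply: (in_seq_mul_lin (h := fun c : A^o => << (c : A) *g x >> : {freeg C / A})) (h x) => a u v.
apply/eqP/freeg_eqP => t; rewrite coeffD coeffZ !coeffU mulrDl; congr (_ + _).
by rewrite mulrA.
Qed.

(** A projective module is a retract of the free module on its own elements, where regularity is
    checked coefficientwise. *)
Lemma wreg_projective ws (Q : lmodType A) : projective Q -> wreg ws A^o -> wreg ws Q.
Proof.
move=> PQ wr; pose p (D : {freeg Q / A}) : Q := fglift id D.
have pB : {morph p : x y / x - y} := lift_is_additive _.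
have p0 : p 0 = 0 by rewrite -[in LHS](subrr 0) pB subrr.
have pD x y : p (x + y) = p x + p y by rewrite -[y in LHS]opprK pB -[- y]sub0r pB p0 sub0r opprK.
have psum s F : p (\sum_(x <- s) F x) = \sum_(x <- s) p (F x).
  by elim: s => [|x s IH]; rewrite ?big_nil // !big_cons pD IH.
have pZ a D : p (a *: D) = a *: p D.
  rewrite -[in RHS](freeg_sumE D) -/(fgscale a D) /fgscale !psum scaler_sumr.
  by apply: eq_bigr => x _; rewrite /p !liftU scalerA.
have lp : linear p by move=> a u v; rewrite -pZ pD.
have [|s hs] := PQ _ _ (lin_of lp) (lin_of (h := @id Q) (fun a u v => erefl)).
  by move=> v; exists << v >>; rewrite /= /p liftU scale1r.
move=> i iw y h; have <- : p (s y) = y := hs y; apply: (in_seq_mul_lin (h := p)) => //.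
apply/freeg_in_seq => x; apply: (wr) => //.
have : in_seq_mul (take i ws) (s (ws`_i *: y)) by apply: (in_seq_mul_lin (h := s)) h => a u v; rewrite linearP.
by rewrite linearZ => /freeg_in_seq/(_ x); rewrite coeffZ.
Qed.

End FreeCover.

Section NullHomotopy.
Variables (M : lmodType A) (P : proj_resolution M) (a : A).
Hypothesis aM : annihilator M a.

(** Multiplication by a lifts the zero map of M, so it is null-homotopic on the resolution; the
    homotopy is built one position at a time, recording only its effect on boundaries. *)
Let exists_homotopy i : exists h : {linear P i -> P i.+1}, forall x, pr_d P i (h (pr_d P i x)) = a *: pr_d P i x.
Proof.
have step j (h : {linear P j -> P j.+1}) : (forall x, pr_d P j (h (pr_d P j x)) = a *: pr_d P j x) ->
   exists h' : {linear P j.+1 -> P j.+2}, forall x, pr_d P j.+1 (h' x) = a *: x - h (pr_d P j x).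
  move=> hh; have lk : linear (fun x => a *: x - h (pr_d P j x)).
    by move=> b u v; rewrite (linearP (pr_d P j)) (linearP h) /= scalerDr scalerBr !scalerA mulrC opprD addrACA.
  have [|||h' H'] := proj_lift (p := pr_d P j.+1) (k := pr_d P j) (h := lin_of lk) (@pr_proj _ _ P j.+1).
  - by move=> v /pr_exact.
  - by move=> u; apply/pr_exact; exists u.
  - by move=> x; rewrite /= linearB linearZ /= hh subrr.
  by exists h'.
elim: i => [|i [h hh]].
  have la : linear (fun x : P 0 => a *: x) by move=> b u v; rewrite scalerDr !scalerA mulrC.
  have [|||h H] := proj_lift (p := pr_d P 0) (k := pr_aug P) (h := lin_of la) (@pr_proj _ _ P 0).
  - by move=> v /pr_exact0.
  - by move=> u; apply/pr_exact0; exists u.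
  - by move=> x; rewrite /= linearZ /= aM.
  by exists h => x; rewrite H.
have [h' H'] := step i h hh; exists h' => x; rewrite H'.
have -> : pr_d P i (pr_d P i.+1 x) = 0 by apply/pr_exact; exists x.
by rewrite linear0 subr0.
Qed.

Lemma kills_annihilator : kills (pr_d P) a.
Proof.
move=> ws i x h; have [u hu] := exists_homotopy i.
have lk : linear (fun x => a *: x - u (pr_d P i x)).
  by move=> b y z; rewrite (linearP (pr_d P i)) (linearP u) /= scalerDr scalerBr !scalerA mulrC opprD addrACA.
have [|||h' H'] := proj_lift (p := pr_d P i.+1) (k := pr_d P i) (h := lin_of lk) (@pr_proj _ _ P i.+1).
- by move=> v /pr_exact.
- by move=> y; apply/pr_exact; exists y.
- by move=> y; rewrite /= linearB linearZ /= hu subrr.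
exists (h' x); rewrite H' /= opprB addrCA subrr addr0.
by apply: (in_seq_mul_lin (h := u)) h => b y z; rewrite linearP.
Qed.
End NullHomotopy.

(* A regular sequence in the annihilator of a nonzero module is not longer than a projective resolution. *)
Lemma projdim_grade (M : lmodType A) (P : proj_resolution M) m xs :
  (forall i, (m < i)%N -> forall x : P i, x = 0) -> wreg xs A^o -> (forall a, a \in xs -> annihilator M a) ->
  (m < size xs)%N -> forall y : M, y = 0.
Proof.
case: xs => // w rest Pz wr ann mx y.
have dd i x : pr_d P i (pr_d P i.+1 x) = 0 by apply/pr_exact; exists x.
have ex : exact_mod (pr_d P) [::] 0.
  move=> i x _ /in_seq_mul_nil /pr_exact [z zE]; exists z; apply/in_seq_mul_nil.
  by rewrite zE subrr.
have [u <-] := pr_aug_surj P y.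
have : pr_aug P (w *: u) = 0 by rewrite linearZ /= ann // mem_head.
case/pr_exact0 => v vE.
have [||||v' /in_seq_mul_nil hv] := regular_mod_boundary (d := pr_d P) dd (rest := rest) (ws := [::]) (j := 0) (w := w) (u := u) (v := v) _ _ ex.
- by move=> i; apply: wreg_projective => //; apply: pr_proj.
- by move=> i x hi; apply: (Pz i); apply: leq_ltn_trans hi; rewrite add0n -ltnS.
- by move=> w' w'r; apply: kills_annihilator; apply: ann; rewrite inE w'r orbT.
- by apply/in_seq_mul_nil; rewrite vE subrr.
have -> : u = pr_d P 0 v' by apply/eqP; rewrite -subr_eq0 hv.
by apply/pr_exact0; exists v'.
Qed.
End Projectives.

Fact subSz (i : nat) : (i.+1)%:Z - 1 = i%:Z. Proof. by lia. Qed.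

(** * The complex t_nu in terms of the abstract differentials *)

Section RepresentationStar.
Variables (K : fieldType) (g : nat).
Hypotheses (charK : [pchar K] =i pred0) (g0 : (0 < g)%N).
Variable S : seq int -> GLrep K g.
Hypothesis hS : forall lambda, dominant g lambda -> is_Schur lambda (S lambda).
Variable P : Pieri_family S.
Arguments P : clear implicits.
Hypothesis hP : forall nu k, dominant g.-1 nu -> is_Pieri (P nu k).

Definition hw_vec l : 'cV[K]_(gl_dim (S l)) :=
  if pselect (exists v, hwm (gle (S l)) (swt g l) v) is left h then projT1 (cid h) else 0.

Lemma hw_vecP l : dominant g l -> hwm (gle (S l)) (swt g l) (hw_vec l).
Proof.
move=> dl; have h := is_Schur_hwm charK (hS dl).
by rewrite /hw_vec; case: pselect => // h'; case: (cid _).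
Qed.

Definition hw_form l : 'rV[K]_(gl_dim (S l)) :=
  if pselect (exists xi, is_xi (gle (S l)) (swt g l) (hw_vec l) xi) is left h then projT1 (cid h) else 0.

Lemma hw_formP l : dominant g l -> is_xi (gle (S l)) (swt g l) (hw_vec l) (hw_form l).
Proof.
move=> dl; have h := xi_exists charK (hw_vecP dl).
by rewrite /hw_form; case: pselect => // h'; case: (cid _).
Qed.

Definition Pi nu k := pext (P nu k).

Lemma Pi_equi nu k : dominant g.-1 nu -> equi (gle (S (p_weight nu k))) (gle (S (p_weight nu (k - 1)))) (Pi nu k).
Proof. by move=> dn; apply: pext_equi => //; apply: hP. Qed.

Lemma Pi_supp nu k (L : {set 'I_g}) : dominant g.-1 nu -> #|L| != N_step nu k -> Pi nu k L = 0.
Proof. by move=> _; apply: pext_supp. Qed.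

Lemma Pi_neq0 nu k : dominant g.-1 nu -> exists L, Pi nu k L != 0.
Proof. by move=> dn; apply: pext_neq0; apply: hP. Qed.

Lemma Pi_d_d nu k x : dominant g.-1 nu -> dF (Pi nu (k - 1)) (dF (Pi nu k) x) = 0.
Proof. move=> dn; have := (@d_d K g charK g0 _ (fun l => gle (S l)) hw_vec hw_form hw_vecP hw_formP Pi Pi_equi nu k x dn); exact. Qed.

Lemma Pi_d_exact nu k x : dominant g.-1 nu -> dF (Pi nu (k - 1)) x = 0 -> exists y, x = dF (Pi nu k) y.
Proof. move=> dn; have := (@d_exact K g charK g0 _ (fun l => gle (S l)) hw_vec hw_form hw_vecP hw_formP Pi Pi_equi Pi_supp Pi_neq0 nu k x dn); exact. Qed.

Section Transfer.
Variable f : nat.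
Notation A := (symA K f g).
Notation ps := (psi K f g : 'M[A]_(f, g)).
Notation X := {ffun {set 'I_f} -> A^o}.
Notation J := (@iotam A f g A^o ps).
Notation c := (@mpolyC (f * g) K : {rmorphism K -> A}).
Notation s nu k := 'I_(gl_dim (S (p_weight nu k))).
Notation T nu k := (t_obj f S nu k).

Definition dA nu k (u : {ffun s nu k -> X}) : {ffun s nu (k - 1) -> X} := dP c J (Pi nu k) u.

(** t_{nu;k} sits in the functions on all subsets as those supported on subsets of size N(nu;k);
    [res] is the projection. Working with all degrees at once avoids casts between index types. *)
Definition emb nu k (x : T nu k) : {ffun s nu k -> X} :=
  [ffun a => [ffun D : {set 'I_f} => if insub D is Some E then x (E : extz f (N_degree g nu k), a) else 0 : A^o]].
Definition res nu k (u : {ffun s nu k -> X}) : T nu k :=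
  [ffun z : extz f (N_degree g nu k) * s nu k => u z.2 (val z.1)].

Lemma embE nu k (x : T nu k) a D : emb x a D = if insub D is Some E then x (E : extz f (N_degree g nu k), a) else 0.
Proof. by rewrite !ffunE. Qed.

Lemma emb_lin nu k : linear (@emb nu k).
Proof.
move=> b x y; apply/ffunP=> a; apply/ffunP=> D; rewrite !ffunE; case: insub => [E|]; rewrite ?ffunE //.
by rewrite scaler0 addr0.
Qed.
Lemma res_lin nu k : linear (@res nu k).
Proof. by move=> b x y; apply/ffunP=> z; rewrite !ffunE. Qed.
Lemma embK nu k : cancel (@emb nu k) (@res nu k).
Proof. by move=> x; apply/ffunP=> -[E a]; rewrite !ffunE /= valK. Qed.

Lemma dP_expand (A0 : comNzRingType) (c0 : {rmorphism K -> A0}) (ps0 : 'M[A0]_(f, g)) nu k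
    (u : {ffun s nu k -> {ffun {set 'I_f} -> A0^o}}) b E : dP c0 (@iotam A0 f g A0^o ps0) (Pi nu k) u b E =
  \sum_(L : ext f (N_step nu k) | [disjoint val L & E]) contract_sign A0 (val L) (val L :|: E) *
    \sum_(L' : ext g (N_step nu k)) minor ps0 L L' * \sum_a c0 (P nu k L' b a) * u a (val L :|: E).
Proof.
rewrite ffunE (sum_pext (N := N_step nu k)) => [|L LN]; last first.
  by rewrite big1 // => a _; rewrite /Pi pext_supp // mxE rmorph0 scale0r.
rewrite sum_ffunE.
transitivity (\sum_(L' : ext g (N_step nu k)) \sum_(L : ext f (N_step nu k) | [disjoint val L & E])
   \sum_a c0 (P nu k L' b a) * (minor ps0 L L' * (contract_sign A0 (val L) (val L :|: E) * u a (val L :|: E)))).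
  apply: eq_bigr => L' _; rewrite sum_ffunE.
  rewrite [RHS]exchange_big; apply: eq_bigr => a _; rewrite /Pi pext_val ffunE (comps_iotam _ _ (eqP (valP L'))).
  rewrite sum_ext sum_ffunE scaler_sumr [RHS]big_mkcond; apply: eq_bigr => L _; rewrite !ffunE minorS_ext.
  by case: ifP => // _; rewrite !scaler0.
rewrite exchange_big; apply: eq_bigr => L _; rewrite mulr_sumr; apply: eq_bigr => L' _.
rewrite !mulr_sumr; apply: eq_bigr => a _.
by rewrite [RHS]mulrCA [LHS]mulrCA; congr (_ * _); rewrite mulrCA.
Qed.

Lemma dA_expand nu k (u : {ffun s nu k -> X}) b E : dA u b E =
  \sum_(L : ext f (N_step nu k) | [disjoint val L & E]) contract_sign A (val L) (val L :|: E) *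
    \sum_(L' : ext g (N_step nu k)) minor ps L L' * \sum_a c (P nu k L' b a) * u a (val L :|: E).
Proof. exact: dP_expand. Qed.

Lemma N_degree_step nu k : N_degree g nu k = N_degree g nu (k - 1) + N_step nu k.
Proof. by rewrite /N_degree /N_step; have := nu_prime_mono nu k; lia. Qed.

Lemma card_disjointU (L E : {set 'I_f}) : [disjoint L & E] -> #|L :|: E| = (#|L| + #|E|)%N.
Proof. by move=> d; rewrite cardsU (disjoint_setI0 d) cards0 subn0. Qed.

Lemma t_map_res nu k (u : {ffun s nu k -> X}) : t_map P (res u) = res (dA u).
Proof.
apply/ffunP=> -[E b]; rewrite [RHS]ffunE /= dA_expand ffunE.
under eq_bigr => D _ do under eq_bigr => L _ do rewrite ffunE.
rewrite (exchange_big_dep predT) //= [RHS]big_mkcond; apply: eq_bigr => L _.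
have LD (D : extz f (N_degree g nu k)) : (val L \subset val D) && (val D :\: val L == val E) =
    [disjoint val L & val E] && (val D == val L :|: val E).
  apply/andP/andP => [[h1 /eqP h2]|[h1 /eqP h2]].
    have hD : val D = val L :|: val E by rewrite -h2 setDE setUIr setUCr setIT; apply/esym/setUidPr.
    split; last by rewrite hD.
    by rewrite disjoint_sym -h2 disjoints_subset; apply/subsetP => i; rewrite !inE => /andP[].
  rewrite h2 subsetUl setDUl setDv set0U; split=> //; apply/eqP/setDidPl; by rewrite disjoint_sym.
rewrite (eq_bigl _ _ LD); case: (boolP [disjoint _ & _]) => dLE /=; last by rewrite big_pred0.
have cD : #|val L :|: val E|%:Z == N_degree g nu k.
  rewrite card_disjointU // PoszD (eqP (valP L)) (eqP (valP E)) (N_degree_step nu k) addrC //.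
rewrite (big_pred1 (Sub (val L :|: val E) cD : extz f (N_degree g nu k))) => [|D]; last by rewrite -val_eqE.
congr (_ * _); apply: eq_bigr => L' _; congr (_ * _); rewrite ffunE; apply: eq_bigr => a _.
by rewrite ffunE.
Qed.

(** N(nu;k-1) = N(nu;k) - N, so the differential respects the supports. *)
Lemma dA_emb nu k (x : T nu k) : dA (emb x) = emb (t_map P x).
Proof.
apply/ffunP=> b; apply/ffunP=> E; have -> : t_map P x = res (dA (emb x)) by rewrite -t_map_res embK.
rewrite embE.
case: insubP => [E' _ <-|hE]; first by rewrite [in RHS]/res [RHS]ffunE.
rewrite dA_expand big1 // => L dLE; rewrite big1 ?mulr0 // => L' _; rewrite big1 ?mulr0 // => a _.
rewrite !ffunE insubF ?mulr0 //; apply/negbTE; apply: contra hE.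
by rewrite card_disjointU // PoszD (eqP (valP L)) (N_degree_step nu k) addrC => /eqP/addIr ->.
Qed.

Variable nu : seq int.
Hypothesis dn : dominant g.-1 nu.

Lemma t_map_t_map k (x : T nu k) : t_map P (t_map P x) = 0.
Proof.
rewrite -[t_map P x]embK t_map_res -dA_emb /dA.
have -> : dP c J (Pi nu (k - 1)) (dP c J (Pi nu k) (emb x)) = 0.
  have := @dP_dP K A c g _ (fun j => J j : {linear _ -> _}) _ _ _ (Pi nu (k - 1)) (Pi nu k) (emb x)
    (@iotamC _ _ _ _ _) (@iotam_sqr _ _ _ _ _).
  move=> ->; apply/ffunP=> b; rewrite !ffunE big1 // => L _; rewrite big1 // => a _.
  by rewrite (PP_eq0 (fun x => @Pi_d_d nu k x dn)) mxE rmorph0 scale0r.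
by rewrite (lin0 (res_lin (nu := nu) (k := _))).
Qed.

(** [minor_homotopy] with the exactness over the field supplied by [Pi_d_exact], then projected to
    the relevant degree. *)
Lemma t_map_homotopy k ws (L : {set 'I_f}) (x : T nu (k - 1)) : #|L| = g -> in_seq_mul ws (t_map P x) ->
  exists y : T nu k, in_seq_mul ws (minorS ps g L setT *: x - t_map P y).
Proof.
move=> cL hx.
have h : in_seq_mul ws (dP c J (Pi nu (k - 1)) (emb x)).
  by rewrite -/(dA (emb x)) dA_emb; apply: in_seq_mul_lin hx; apply: emb_lin.
have [v hv] := minor_homotopy (fun x => @Pi_d_d nu k x dn) (fun x => @Pi_d_exact nu k x dn) cL h.
exists (res v).
have -> : minorS ps g L setT *: x - t_map P (res v) = res (minorS ps g L setT *: emb x - dA v).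
  by rewrite (linB _ _ (@res_lin _ _)) (linZ _ _ (@res_lin _ _)) embK t_map_res.
by apply: in_seq_mul_lin hv; apply: res_lin.
Qed.

(** A selection of rows with a repetition has determinant 0; an injective one differs by a
    permutation from the increasing enumeration of its image. The enumeration of all g columns may
    contribute a second sign. *)
Lemma det_rowsub_minorS (h : 'I_g -> 'I_f) : \det (rowsub h ps) = 0 \/
  exists2 L : {set 'I_f}, #|L| = g & \det (rowsub h ps) = minorS ps g L setT \/ \det (rowsub h ps) = - minorS ps g L setT.
Proof.
case: (boolP (injectiveb h)) => [/injectiveP ih|/injectivePn [a [a' aa' haa']]]; last first.
  left; apply: (@determinant_alternate _ _ _ a a' aa') => j; by rewrite !mxE haa'.
right; pose L := [set h a | a : 'I_g].
have cL : #|L| == g by rewrite card_imset // card_ord.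
have cT : #|[set: 'I_g]| == g by rewrite cardsT card_ord.
exists L; first exact/eqP.
pose I : ext f g := Sub L cL; pose I' : ext g g := Sub [set: 'I_g] cT.
have [si hsi] : exists si : 'I_g -> 'I_g, forall a, h a = ext_nth I (si a).
  have H a : exists i, h a = ext_nth I i by apply: ext_nth_surj; rewrite SubK imset_f.
  by have [si hsi] := boolp.choice H; exists si.
have isi : injective si by move=> a b ab; apply: ih; rewrite !hsi ab.
have -> : \det (rowsub h ps) = (-1) ^+ (perm isi) * \det (rowsub (ext_nth I) ps).
  rewrite -det_perm -det_mulmx -row_permE; congr (\det _); apply/matrixP=> a b.
  by rewrite !mxE permE hsi.
set tau := perm (@ext_nth_inj _ _ I').
have -> : minorS ps g L setT = \det (rowsub (ext_nth I) ps) * (-1) ^+ tau.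
  have -> : minorS ps g L setT = minor ps I I' by exact: (minorS_ext ps I I').
  rewrite /minor -odd_permV -det_perm -det_mulmx -col_permE; congr (\det _).
  by apply/matrixP=> a b; rewrite !mxE permE.
case: (perm isi : bool); case: (tau : bool); rewrite ?expr0 ?expr1 ?mulr1 ?mul1r ?mulN1r ?mulrN1 ?opprK; by [left | right].
Qed.

Lemma t_map_det_homotopy k ws (h : 'I_g -> 'I_f) (x : T nu (k - 1)) : in_seq_mul ws (t_map P x) ->
  exists y : T nu k, in_seq_mul ws (\det (rowsub h ps) *: x - t_map P y).
Proof.
move=> hx; have [->|[L cL [->|->]]] := det_rowsub_minorS h.
- by exists 0; rewrite scale0r linear0 subr0; apply: in_seq_mul0.
- exact: t_map_homotopy.
have [y hy] := t_map_homotopy cL hx; exists (- y); rewrite scaleNr linearN -opprD.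
by apply: in_seq_mulN.
Qed.

(* The differentials reindexed by propositional equality of the positions. *)
Definition tm k k' (H : k - 1 = k') : {linear T nu k -> T nu k'} :=
  match H in _ = k' return {linear T nu k -> T nu k'} with erefl => (@t_map K f g S P nu k : {linear T nu k -> T nu (k - 1)}) end.

Lemma tm_tm k k' k'' (H : k - 1 = k') (H' : k' - 1 = k'') x : tm H' (tm H x) = 0.
Proof. by case: _ / H H' => H'; case: _ / H'; apply: t_map_t_map. Qed.

Lemma tm_homotopy k k' k'' (H : k - 1 = k') (H' : k' - 1 = k'') ws (h : 'I_g -> 'I_f) (x : T nu k') :
  in_seq_mul ws (tm H' x) -> exists y, in_seq_mul ws (\det (rowsub h ps) *: x - tm H y).
Proof. by case: _ / H H' x => H' x; case: _ / H'; apply: t_map_det_homotopy. Qed.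

Definition Tn (i : nat) : lmodType A := T nu i%:Z.
Definition dn_ i : {linear Tn i.+1 -> Tn i} := tm (subSz i).

Lemma Tn_dd i x : dn_ i (dn_ i.+1 x) = 0. Proof. exact: tm_tm. Qed.
Lemma Tn_kills (h : 'I_g -> 'I_f) : kills dn_ (\det (rowsub h ps)).
Proof. by move=> ws i x hx; apply: tm_homotopy hx. Qed.

Lemma T_eq0 k : (N_degree g nu k < 0) || (f%:Z < N_degree g nu k) -> forall x : T nu k, x = 0.
Proof.
move=> hk x; apply/ffunP=> -[[E /= hE] a]; exfalso; move: hk; rewrite -(eqP hE).
have : (#|E| <= f)%N by rewrite -[X in (_ <= X)%N]card_ord max_card.
by move=> h /orP[//|]; rewrite ltz_nat ltnNge h.
Qed.

Lemma dn_0 : dn_ 0 =1 (@t_map K f g S P nu 1).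
Proof. by move=> x; rewrite /dn_ (eq_irrelevance (subSz 0) (erefl (0 : int))). Qed.
End Transfer.
End RepresentationStar.

Section FreeModules.
Local Open Scope quotient_scope.
Variable A : comNzRingType.

Lemma ffun_projective (I : finType) : projective ({ffun I -> A^o} : lmodType A).
Proof.
move=> U V p h sp; have H i : exists u, p u = h [ffun j => (j == i)%:R] by exact: sp.
have [u hu] := boolp.choice H.
pose k (x : {ffun I -> A^o}) := \sum_i (x i : A) *: u i.
have lk : linear k.
  move=> a x y; rewrite /k scaler_sumr -big_split; apply: eq_bigr => i _.
  by rewrite !ffunE scalerDl scalerA.
exists (lin_of lk) => x; rewrite /= /k linear_sum /=.
have {2}-> : x = \sum_i (x i : A) *: ([ffun j => (j == i)%:R] : {ffun I -> A^o}).
  apply/ffunP=> j; rewrite sum_ffunE (bigD1 j) //= !ffunE eqxx [_ *: _]mulr1 big1 ?addr0 // => i ij.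
  by rewrite !ffunE eq_sym (negPf ij) [_ *: _]mulr0.
by rewrite linear_sum; apply: eq_bigr => i _; rewrite !linearZ hu.
Qed.

Lemma ffun_finitely_generated (I : finType) : finitely_generated ({ffun I -> A^o} : lmodType A).
Proof.
exists #|I|, (fun i => [ffun j => (j == enum_val i)%:R]) => x; exists (fun i => x (enum_val i)).
apply/ffunP=> j; rewrite sum_ffunE (bigD1 (enum_rank j)) //= !ffunE enum_rankK eqxx [_ *: _]mulr1 big1 ?addr0 // => i ij.
rewrite !ffunE; have -> : j == enum_val i = false; last by rewrite [_ *: _]mulr0.
by apply: contraNF ij => /eqP ->; rewrite enum_valK.
Qed.

Section CokernelSeq.
Variables (T1 T0 M : lmodType A) (d : {linear T1 -> T0}) (p : {linear T0 -> M}).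
Hypotheses (ps : forall y, exists x, p x = y) (pk : forall x, p x = 0 <-> exists y, d y = x).

Lemma in_seq_coker ws u : in_seq_mul ws (p u) <-> exists v, in_seq_mul ws (u - d v).
Proof.
split=> [/in_seq_mulE [z hz]|[v hv]]; last first.
  have -> : p u = p (u - d v) by rewrite linearB (_ : p (d v) = 0) ?subr0 //; apply/pk; exists v.
  by apply: in_seq_mul_lin hv => a x y; rewrite linearP.
have [z' hz'] := boolp.choice ps.
have /pk [v hv] : p (u - \sum_(i < size ws) ws`_i *: z' (z i)) = 0.
  rewrite linearB linear_sum hz; apply/eqP; rewrite subr_eq0; apply/eqP; apply: eq_bigr => i _.
  by rewrite linearZ hz'.
exists v; rewrite hv subKr; apply/in_seq_mulE; by exists (fun i => z' (z i)).
Qed.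

Lemma coker_finitely_generated : finitely_generated T0 -> finitely_generated M.
Proof.
move=> [n [x hx]]; exists n, (fun i => p (x i)) => y; have [u <-] := ps y; have [a ->] := hx u; exists a.
by rewrite linear_sum; apply: eq_bigr => i _; rewrite linearZ.
Qed.
End CokernelSeq.
End FreeModules.

(** * t_nu as a free resolution of its zeroth homology *)

Section Resolution.
Local Open Scope quotient_scope.
Variables (K : fieldType) (e g : nat).
Hypotheses (charK : [pchar K] =i pred0) (g0 : (0 < g)%N).
Variable S : seq int -> GLrep K g.
Hypothesis hS : forall lambda, dominant g lambda -> is_Schur lambda (S lambda).
Variable P : Pieri_family S.
Arguments P : clear implicits.
Hypothesis hP : forall nu k, dominant g.-1 nu -> is_Pieri (P nu k).
Variable nu : seq int.
Hypothesis dnu : dominant g.-1 nu.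
Hypothesis nu_range : {in nu, forall x, - 1 <= x <= e%:Z + 1}.
Notation f := (e + g)%N.
Notation A := (symA K f g).
Notation T := (Tn S f nu).
Notation d := (dn_ P f nu).
Notation M := (t_H0 f P nu).

Lemma nu_prime_top : nu_prime nu (- 1) = g.-1.
Proof.
case/andP: dnu => /eqP <- _; rewrite /nu_prime; apply/eqP; rewrite -all_count; apply/allP => x /nu_range.
by case/andP.
Qed.

Lemma nu_prime_bot k : e%:Z + 1 < k -> nu_prime nu k = 0%N.
Proof.
move=> hk; apply/eqP; rewrite -leqn0 leqNgt -has_count; apply/hasPn => x /nu_range /andP[_ h].
by rewrite /= -ltNge; apply: le_lt_trans hk.
Qed.

(** Since all nu_i are at least -1, N(nu;-1) = -1 and the exterior power vanishes. *)
Lemma T_neg (x : t_obj f S nu (0 - 1)) : x = 0.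
Proof. apply: T_eq0; have -> : (0 - 1 : int) = - 1 by []; rewrite /N_degree nu_prime_top; have := g0; lia. Qed.

(** Since all nu_i are at most e+1, N(nu;k) = g-1+k for k > e+1, which exceeds f. *)
Lemma T_top i (x : T i) : (e.+1 < i)%N -> x = 0.
Proof. by move=> hi; apply: (T_eq0 (k := i%:Z)); rewrite /N_degree nu_prime_bot; lia. Qed.

Lemma in_cycle0 (x : T 0) : x \in Defs.cycle (@t_map K f g S P nu 0 : {linear _ -> _}).
Proof. by apply/eqP; apply: T_neg. Qed.

(** Every element of t_{nu;0} is a cycle because the next term is zero, so the zeroth homology is
    the cokernel of the first differential. *)
Definition to_H0 (x : T 0) : M := \pi_(M) (Cycle (in_cycle0 x)).

Lemma to_H0_linear : linear to_H0.
Proof.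
move=> a x y; have piD u v : \pi_(M) (u + v) = \pi_(M) u + \pi_(M) v by exact: raddfD.
have piZ u : a *: \pi_(M) u = \pi_(M) (a *: u) by exact: homology_scale_pi.
rewrite /to_H0 piZ -piD; congr (\pi_(M) _).
exact: val_inj.
Qed.
Definition augm : {linear T 0 -> M} := lin_of to_H0_linear.

Lemma augm_surj y : exists x, augm x = y.
Proof.
exists (val (repr y)); rewrite /= /to_H0 -[RHS]reprK; congr (\pi_(M) _); exact: val_inj.
Qed.

Lemma augm_eq0 x : augm x = 0 <-> exists y, d 0 y = x.
Proof.
have pi0 : \pi_(M) 0 = 0 :> M by exact: raddf0.
split=> [h|[y hy]].
  have : \pi_(M) (Cycle (in_cycle0 x)) == \pi_(M) 0 by rewrite pi0 -h.
  rewrite -Quotient.idealrBE subr0 => /asboolP [u hu]; exists u; by rewrite dn_0.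
rewrite /= /to_H0 -pi0; apply/eqP; rewrite -Quotient.idealrBE subr0; apply/asboolP; exists y.
by rewrite -hy dn_0.
Qed.

Let pX (t : 'I_(f * g)) : {poly K} := 'X.

Lemma wreg_deltas_free s (p : 'I_(f * g) -> {poly K}) i : (forall t, p t \is monic) -> (forall t, (1 < size (p t))%N) ->
  uniq s -> all (predC (is_z (e := e) g0)) s -> wreg ([seq qvar g0 p t | t <- s] ++ deltas K e g0) (T i).
Proof. by move=> pm ps us nz; apply: wreg_ffun; apply: coord_regular. Qed.

Lemma wreg_deltas : wreg (deltas K e g0) (symA K f g)^o.
Proof.
apply: (@coord_regular K e g g0 pX _ _ [::]) => // t; first by rewrite monicX.
by rewrite size_polyX.
Qed.

Lemma size_deltas : size (deltas K e g0) = e.+1.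
Proof. by rewrite size_map size_enum_ord. Qed.

Lemma deltas_kill w : w \in deltas K e g0 -> kills d w.
Proof. by case/mapP=> k _ ->; apply: Tn_kills. Qed.

(** The e+1 minors on consecutive rows form a regular sequence that kills homology, and the complex
    has length e+1; [acyclic_mod] applies with the empty sequence. *)
Lemma T_exact i x : d i x = 0 <-> exists y, d i.+1 y = x.
Proof.
split=> [h|[y <-]]; last by apply: Tn_dd.
have dd j y : d j (d j.+1 y) = 0 by exact: Tn_dd.
have ex : exact_mod d [::] 0.
  apply: (@acyclic_mod _ _ d dd [::] (deltas K e g0)) => [j|j y|w].
  - by apply: wreg_ffun; apply: wreg_deltas.
  - by rewrite size_deltas => hj; apply: T_top.
  exact: deltas_kill.
have [|y /in_seq_mul_nil hy] := ex i x isT; first exact/in_seq_mul_nil.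
by exists y; apply/eqP; rewrite eq_sym -subr_eq0 hy.
Qed.

Definition t_resolution : proj_resolution M :=
  ProjResolution (fun i => @ffun_projective _ _) augm_surj augm_eq0 T_exact.

Lemma t_H0_pdim_le : pdim_le M e.+1.
Proof. by exists t_resolution => i hi x; apply: T_top. Qed.

Lemma t_H0_fin : finitely_generated M.
Proof. exact: (coker_finitely_generated augm_surj (ffun_finitely_generated _ _)). Qed.

(** The homotopy at position 0: every element of t_{nu;0} is a cycle, so its product with a minor is
    a boundary. *)
Lemma annihilator_minor (h : 'I_g -> 'I_f) : annihilator M (\det (rowsub h (psi K f g : 'M[A]_(f, g)))).
Proof.
move=> y; have [u <-] := augm_surj y; rewrite -linearZ; apply/augm_eq0.
have hx : in_seq_mul [::] (@tm K g S P f nu 0 (0 - 1) erefl u) by apply/in_seq_mul_nil; apply: T_neg.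
have [v /in_seq_mul_nil hv] := tm_homotopy charK g0 hS hP dnu (subSz 0) h hx.
by exists v; apply/eqP; rewrite eq_sym -subr_eq0; apply/eqP.
Qed.

Lemma annihilator_minors_ideal a : minors_ideal a -> annihilator M a.
Proof.
move=> [c ->] y; rewrite scaler_suml big1 // => s _; rewrite -scalerA.
by rewrite annihilator_minor scaler0.
Qed.

(** The monic polynomials followed by the minors form a regular sequence, so [regular_on_coker] lets
    each polynomial act without torsion on the cokernel modulo the preceding ones. *)
Lemma wreg_t_H0 (p : 'I_(f * g) -> {poly K}) s : (forall t, p t \is monic) -> (forall t, (1 < size (p t))%N) ->
  uniq s -> all (predC (is_z (e := e) g0)) s -> wreg [seq qvar g0 p t | t <- s] M.
Proof.
move=> pm ps us nz i; rewrite size_map => si y; have [u <-] := augm_surj y; rewrite -linearZ.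
case: s us nz si => // t0 s' us nz si; set s := t0 :: s' in us nz si *.
have tk j : [seq qvar g0 p t | t <- take j s] = take j [seq qvar g0 p t | t <- s] by rewrite map_take.
rewrite -tk; move/(in_seq_coker augm_surj augm_eq0) => [v hv]; apply/(in_seq_coker augm_surj augm_eq0).
have E : [seq qvar g0 p t | t <- s]`_i = qvar g0 p (nth t0 s i) by rewrite (nth_map t0).
rewrite E in hv.
have dd j z : d j (d j.+1 z) = 0 by exact: Tn_dd.
apply: (@regular_on_coker _ _ d dd _ (qvar g0 p (nth t0 s i)) (deltas K e g0) _ _ _ _ _ _ hv).
- move=> j; have -> : [seq qvar g0 p t | t <- take i s] ++ qvar g0 p (nth t0 s i) :: deltas K e g0 =
    [seq qvar g0 p t | t <- take i.+1 s] ++ deltas K e g0.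
    by rewrite (take_nth t0) // map_rcons cat_rcons.
  by apply: wreg_deltas_free => //; [exact: take_uniq | by apply/allP => t /mem_take /(allP nz)].
- by move=> j; apply: wreg_deltas_free => //; [exact: take_uniq | by apply/allP => t /mem_take /(allP nz)].
- by move=> j x; rewrite size_deltas; apply: T_top.
exact: deltas_kill.
Qed.
End Resolution.

(** * Changes of basis, polynomial identities, residue fields and the determinant trick *)

Section AntiCommutingCombination.
Variables (R : comNzRingType) (f g : nat) (X : lmodType R) (J : 'I_f -> {linear X -> X}).
Hypothesis JC : forall a b x, J a (J b x) = - J b (J a x).
Hypothesis Jsqr : forall a x, J a (J a x) = 0.

Definition comb (x : 'M[R]_(f, g)) (j : 'I_g) (y : X) : X := \sum_i x i j *: J i y.

(** The argument of [comps_iotam] for an arbitrary anticommuting family; it describes the effect of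
    the action of GL_g on the contractions. *)
Lemma comps_comb (x : 'M[R]_(f, g)) m (L' : {set 'I_g}) y : #|L'| = m ->
  comps (comb x) L' y = \sum_(L : {set 'I_f} | #|L| == m) minorS x m L L' *: comps J L y.
Proof.
elim/set_min_ind: L' m => [|a L' aL' IH] m.
  rewrite cards0 => <-; rewrite comps0 (big_pred1 set0) ?minorS0 ?scale1r ?comps0 //.
  by move=> L /=; rewrite cards_eq0.
have aNL : a \notin L' by apply/negP => /aL'; rewrite ltnn.
rewrite cardsU1 aNL add1n; case: m => // m [cL'].
rewrite compsU1 // (IH m) //.
transitivity (\sum_(L1 : {set 'I_f} | #|L1| == m) \sum_(i | i \notin L1)
   (minorS x m L1 L' * x i a * sg R i L1) *: comps J (i |: L1) y).
  rewrite /comb (eq_bigr (fun i => \sum_(L1 : {set 'I_f} | #|L1| == m) (x i a * minorS x m L1 L') *: J i (comps J L1 y))).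
    rewrite exchange_big; apply: eq_bigr => L1 _.
    rewrite [RHS]big_mkcond /=; apply: eq_bigr => i _.
    rewrite (comps_cons JC Jsqr); case: ifP => iL; first by rewrite scaler0.
    by rewrite scalerA; congr (_ *: _); ring.
  by move=> i _; rewrite linear_sum scaler_sumr; apply: eq_bigr => L1 _; rewrite linearZ scalerA.
rewrite (exchange_big_dep xpredT) //=.
transitivity (\sum_i \sum_(L : {set 'I_f} | (#|L| == m.+1) && (i \in L))
   (sg R i L * x i a * minorS x m (L :\ i) L') *: comps J L y).
  apply: eq_bigr => i _.
  rewrite (reindex_onto (fun L => L :\ i) (fun L => i |: L)) /=; last first.
    by move=> L1 /andP[_ iL]; rewrite setU1K.
  apply: eq_big => [L|L /andP[_ /eqP E]].
    rewrite !inE eqxx andbT /=.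
    have [iL|iL] := boolP (i \in L).
      by rewrite setD1K // eqxx andbT (cardsD1 i L) iL eqSS andbT.
    rewrite andbF; apply/negbTE; apply: contra iL => /andP[_ /eqP <-].
    by rewrite setU11.
  by rewrite E sgD1_eq; congr (_ *: _); ring.
rewrite (exchange_big_dep (fun L : {set 'I_f} => #|L| == m.+1)) /=; last by move=> i L _ /andP[].
apply: eq_bigr => L /eqP cL; rewrite (minorS_laplace _ cL cL' aL') scaler_suml.
by rewrite cL eqxx.
Qed.
End AntiCommutingCombination.

Section PolynomialIdentities.
Variables (K : fieldType) (n : nat).
Hypothesis charK : [pchar K] =i pred0.
Notation A := {mpoly K[n]}.

Lemma meval_deriv_eq0 (p : A) j : (forall v, p.@[v] = 0) -> forall v, p^`M(j).@[v] = 0.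
Proof.
move=> p0 v; pose h t : {poly K} := (v t)%:P + (t == j)%:R *: 'X.
have hp0 : mmap (@polyC K) h p = 0 by apply: (poly_eq0_inf charK) => s; rewrite mmap_horner p0.
have := mmap_deriv h p; rewrite hp0 derivC => /(congr1 (horner^~ 0)); rewrite horner0 => /esym.
rewrite horner_sum (bigD1 j) //= big1 ?addr0 => [|t tj]; last first.
  by rewrite /h (negPf tj) scale0r addr0 derivC mulr0 horner0.
rewrite /h eqxx scale1r derivD derivC derivX add0r mulr1 mmap_horner => <-.
by apply: meval_eq => t; rewrite hornerD hornerC hornerZ hornerX mulr0 addr0.
Qed.

(** A function vanishing at all points has vanishing partial derivatives by restriction to lines,
    and in characteristic zero its coefficients are recovered from derivatives by induction on the
    degree. *)
Lemma mpoly_eq0_points (p : A) : (forall v, p.@[v] = 0) -> p = 0.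
Proof.
move=> p0; suff h d : forall q : A, (forall v, q.@[v] = 0) -> forall m, mdeg m = d -> q@_m = 0.
  by apply/mpolyP => m; rewrite mcoeff0; apply: (h _ p).
elim: d => [|d IH] q q0 m dm.
  have -> : m = 0%MM by apply/eqP; rewrite -mdeg_eq0 dm.
  have [h0|/memN_msupp_eq0 //] := boolP (0%MM \in msupp q).
  have := q0 (fun=> 0); rewrite mevalE (bigD1_seq 0%MM) ?msupp_uniq //= big1 ?mulr1 => [|i _]; last by rewrite mnm0E expr0.
  rewrite big1 ?addr0 // => m' m'0; have [i mi] : exists i, (0 < m' i)%N.
    apply/existsP; apply: contraNT m'0; rewrite negb_exists => /forallP h; apply/eqP/mnmP => i.
    by rewrite mnm0E; apply/eqP; rewrite -leqn0 leqNgt.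
  by rewrite (bigD1 i) //= expr0n -leqn0 leqNgt mi mul0r mulr0.
have [i mi] : exists i, (0 < m i)%N.
  apply/existsP; apply: contra_eqT dm; rewrite negb_exists => /forallP h.
  by rewrite mdegE big1 // => i _; apply/eqP; rewrite -leqn0 leqNgt.
have mE : m = (m - U_(i) + U_(i))%MM.
  by rewrite submK //; apply/mnm_lepP => t; rewrite mnm1E; case: eqP => [<-|].
have := IH _ (meval_deriv_eq0 i q0) (m - U_(i))%MM; rewrite mcoeff_deriv -mE => h.
have /eqP : q@_m *+ ((m - U_(i))%MM i).+1 = 0.
  by apply: h; apply: succn_inj; rewrite -dm {2}mE mdegD mdeg1 addn1.
rewrite -mulr_natr mulf_eq0 => /orP[/eqP //|].
by rewrite (natr_eq0_char0 charK).
Qed.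
End PolynomialIdentities.

Section ResidueField.
Local Open Scope quotient_scope.
Variables (R : comNzRingType) (m : idealr R).
Hypothesis mm : is_maximal m.

Lemma residue_field : exists (L : fieldType) (pr : {rmorphism R -> L}),
  (forall a, pr a = 0 <-> a \in m).
Proof.
pose Q : comNzRingType := {ideal_quot m}.
have piE (a b : R) : (\pi_Q a = \pi_Q b) <-> (a - b \in m).
  by rewrite (Quotient.idealrBE m); split=> [->|/eqP].
have Qinv (x : Q) : x <> 0 -> exists y, y * x = 1.
  move=> x0; pose a := repr x; have xE : x = \pi_Q a by rewrite reprK.
  have am : a \notin m.
    by apply/negP=> am; apply: x0; rewrite xE; have <- : \pi_Q 0 = 0 :> Q := rmorph0 _; apply/piE; rewrite subr0.
  have [b hb] := maximal_inv mm am; exists (\pi_Q b); rewrite xE.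
  rewrite -[LHS]rmorphM -[RHS](rmorph1 (\pi_Q)); apply/piE.
  by rewrite -opprB rpredN mulrC.
pose inv (x : Q) : Q := if pselect (x <> 0) is left h then projT1 (cid (Qinv x h)) else 0.
have mV x : x != 0 -> inv x * x = 1.
  by move=> /eqP x0; rewrite /inv; case: pselect => // h; case: (cid _).
have i0 : inv 0 = 0 by rewrite /inv; case: pselect => // h; case: (h erefl).
pose L : fieldType := HB.pack Q (GRing.ComNzRing_isField.Build Q mV i0).
exists L, (\pi_Q : {rmorphism R -> Q}) => a.
have <- : \pi_Q 0 = 0 :> Q := rmorph0 _; rewrite -[X in X \in m]subr0; exact: piE.
Qed.
End ResidueField.

(* The determinant trick. *)
Lemma nakayama (R : comNzRingType) (m : idealr R) (M : lmodType R) n (x : 'I_n -> M) : is_maximal m ->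
  (forall y, exists c : 'I_n -> R, y = \sum_i c i *: x i) ->
  (forall i, exists s c, [/\ s \notin m, forall j : 'I_n, c j \in m & s *: x i = \sum_j c j *: x j]) ->
  exists2 b, b \notin m & annihilator M b.
Proof.
move=> mm gen H; have [L [pr prm]] := residue_field mm.
have [s hs] := boolp.choice H; have [c hc] := boolp.choice hs.
pose B : 'M[R]_n := \matrix_(i, j) (s i *+ (i == j) - c i j).
exists (\det B).
  apply/negP => /prm; rewrite -det_map_mx.
  have -> : map_mx pr B = diag_mx (\row_i pr (s i)).
    apply/matrixP => i j; rewrite !mxE rmorphB rmorphMn /=.
    have [_ h _] := hc i; have /prm -> := h j; by rewrite subr0.
  rewrite det_diag; apply/eqP/prodf_neq0 => i _; rewrite mxE.
  by have [h _ _] := hc i; apply/eqP => /prm; apply/negP.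
have Bx i : \sum_j B i j *: x j = 0.
  have [_ _ h] := hc i; under eq_bigr => j _ do rewrite mxE scalerBl.
  rewrite sumrB -h (bigD1 i) //= eqxx mulr1n big1 ?addr0 ?subrr // => j ij.
  by rewrite eq_sym (negPf ij) mulr0n scale0r.
have dx i : \det B *: x i = 0.
  transitivity (\sum_j \sum_k (\adj B i j * B j k) *: x k).
    rewrite exchange_big /= (bigD1 i) //= -scaler_suml.
    have e k : \sum_j \adj B i j * B j k = \det B *+ (i == k) by have /matrixP/(_ i k) := mul_adj_mx B; rewrite !mxE.
    rewrite e eqxx big1 ?addr0 // => k ki; by rewrite -scaler_suml e eq_sym (negPf ki) scale0r.
  apply: big1 => j _; under eq_bigr => k _ do rewrite -scalerA.
  by rewrite -scaler_sumr Bx scaler0.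
move=> y; have [d ->] := gen y; rewrite scaler_sumr big1 // => i _.
by rewrite scalerA mulrC -scalerA dx scaler0.
Qed.

Section MatrixAction.
Variables (K : fieldType) (X : lmodType K).

Definition mxa n n' (B : 'M[K]_(n', n)) (y : {ffun 'I_n -> X}) : {ffun 'I_n' -> X} := [ffun b => \sum_a B b a *: y a].

Lemma mxaM n n' n'' (B : 'M[K]_(n'', n')) (C : 'M[K]_(n', n)) y : mxa (B *m C) y = mxa B (mxa C y).
Proof.
apply/ffunP=> b; rewrite !ffunE; under eq_bigr => a _ do rewrite mxE scaler_suml.
rewrite exchange_big; apply: eq_bigr => c _; rewrite ffunE scaler_sumr; apply: eq_bigr => a _.
by rewrite scalerA.
Qed.

Lemma mxaD n n' (B C : 'M[K]_(n', n)) y : mxa (B + C) y = mxa B y + mxa C y.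
Proof. by apply/ffunP=> b; rewrite !ffunE -big_split; apply: eq_bigr => a _; rewrite mxE scalerDl. Qed.

Lemma mxa0 n n' y : mxa (0 : 'M[K]_(n', n)) y = 0.
Proof. by apply/ffunP=> b; rewrite !ffunE big1 // => a _; rewrite mxE scale0r. Qed.

Lemma mxaZ n n' c (B : 'M[K]_(n', n)) y : mxa (c *: B) y = c *: mxa B y.
Proof. by apply/ffunP=> b; rewrite !ffunE scaler_sumr; apply: eq_bigr => a _; rewrite mxE scalerA. Qed.

Lemma mxa_lin n n' (B : 'M[K]_(n', n)) : linear (mxa B).
Proof.
move=> c x y; apply/ffunP=> b; rewrite !ffunE scaler_sumr -big_split; apply: eq_bigr => a _.
by rewrite !ffunE scalerDr !scalerA mulrC.
Qed.

Lemma mxa_suml n n' (I : finType) (p : pred I) (B : I -> 'M[K]_(n', n)) y :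
  mxa (\sum_(i | p i) B i) y = \sum_(i | p i) mxa (B i) y.
Proof. by elim/big_rec2: _ => [|i C z _ <-]; rewrite ?mxa0 ?mxaD. Qed.

Lemma mxa1 n y : mxa (1%:M : 'M[K]_n) y = y.
Proof.
apply/ffunP=> b; rewrite ffunE (bigD1 b) //= mxE eqxx scale1r big1 ?addr0 // => a ab.
by rewrite mxE eq_sym (negPf ab) scale0r.
Qed.
End MatrixAction.

(** * Specialization to matrices of rank less than g *)

Section Specialization.
Variables (K : fieldType) (g : nat).
Hypotheses (charK : [pchar K] =i pred0) (g0 : (0 < g)%N).
Variable S : seq int -> GLrep K g.
Hypothesis hS : forall lambda, dominant g lambda -> is_Schur lambda (S lambda).
Variable P : Pieri_family S.
Arguments P : clear implicits.
Hypothesis hP : forall nu k, dominant g.-1 nu -> is_Pieri (P nu k).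
Variable nu : seq int.
Hypothesis dnu : dominant g.-1 nu.
Local Notation s k := 'I_(gl_dim (S (p_weight nu k))).
Local Notation PiL k L := (Pi P nu k L).

(** If xi P_L is nonzero on a weight vector, its weight is that of p(nu;k-1) plus 1_L. This must be
    at most p(nu;k) in the dominance order, while the two weights p agree before the block; so L has
    no element there. *)
Lemma form_Pi_low k (L : {set 'I_g}) (l : 'I_g) : hw_form S (p_weight nu (k - 1)) *m PiL k L != 0 -> l \in L ->
  (nu_prime nu k <= l)%N.
Proof.
set xi := hw_form S _ => xP lL; rewrite leqNgt; apply/negP => lk.
have dl := p_weight_dominant g0 k dnu; have dl' := p_weight_dominant g0 (k - 1) dnu.
have [r [bs [ws [hb gen]]]] := V_spanned (hw_vecP charK hS dl).
have [i hi] : exists i, xi *m (PiL k L *m bs i) != 0.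
  apply: contrapT => no; move/eqP: xP; apply; apply/matrixP => a j; rewrite ord1 [RHS]mxE.
  have [c cE] := gen (delta_mx j 0).
  have : xi *m PiL k L *m delta_mx j (0 : 'I_1) = 0.
    rewrite cE mulmx_sumr big1 // => i _; rewrite -scalemxAr -mulmxA.
    by have /eqP -> : xi *m (PiL k L *m bs i) == 0; rewrite ?scaler0 //; apply: contrapT => /negP h; apply: no; exists i.
  by rewrite -colE => /matrixP /(_ 0 0); rewrite [LHS]mxE [RHS]mxE.
have [kw wl] := hb i.
have kP := P_weight (Pi_equi charK hP (k := k) dnu) L kw.
have [_ _ xw] := hw_formP charK hS dl'.
have E a : wsub (ws i) L a = swt g (p_weight nu (k - 1)) a.
  apply: (intr_inj_char0 charK); apply/eqP; rewrite -subr_eq0.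
  have /eqP : (wsub (ws i) L a)%:~R *: (xi *m (PiL k L *m bs i)) = (swt g (p_weight nu (k - 1)) a)%:~R *: (xi *m (PiL k L *m bs i)).
    rewrite -/xi in xw; rewrite [LHS]scalemxAr -(kP a) /mact [LHS]mulmxA; by rewrite (xw a) -scalemxAl.
  by rewrite -subr_eq0 -scalerBl scaler_eq0 (negPf hi) orbF.
have [hw _] := wl; have := hw l.+1; rewrite /psum.
rewrite (eq_bigr (fun a => swt g (p_weight nu k) a + (a \in L)%:R)) => [|a al].
  rewrite big_split /= gerDl (bigD1 l) //= lL leNgt => /negP; apply.
  by apply: ltr_pwDl => //; apply: sumr_ge0 => a _; case: (a \in L).
have := E a; rewrite (swt_step g0 k dnu) !ffunE.
have -> : a \in Bset g nu k = false.
  by apply/negbTE; rewrite inE negb_and -ltnNge (leq_trans _ lk).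
by rewrite subr0 => /eqP; rewrite subr_eq => /eqP.
Qed.

Section OverField.
Variable f : nat.
Notation X := {ffun {set 'I_f} -> K^o}.
Implicit Types (Y : 'M[K]_(f, g)).

Definition dK Y k (u : {ffun s k -> X}) : {ffun s (k - 1) -> X} := dP idfun (@iotam K f g K^o Y) (Pi P nu k) u.

Lemma dK_sum Y k (u : {ffun s k -> X}) : dK Y u =
  \sum_(L : ext g (N_step nu k)) mxa (P nu k L) [ffun a => comps (@iotam K f g K^o Y) (val L) (u a)].
Proof.
apply/ffunP=> b; rewrite ffunE (sum_pext (N := N_step nu k)) => [|L LN]; last first.
  by rewrite big1 // => a _; rewrite /Pi pext_supp // mxE scale0r.
rewrite sum_ffunE; apply: eq_bigr => L _; rewrite ffunE; apply: eq_bigr => a _.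
by rewrite /Pi pext_val ffunE.
Qed.

(** Equivariance of the Pieri map turns a change of basis of the contractions into the action of x
    on the irreducible modules, so the specialized complexes at Y and Yx are isomorphic. *)
Lemma dK_conj Y x k (u : {ffun s k -> X}) : x \in unitmx ->
  mxa (gl_mx (S (p_weight nu (k - 1))) x) (dK (Y *m x) u) = dK Y (mxa (gl_mx (S (p_weight nu k)) x) u).
Proof.
move=> ux; pose cs (L : {set 'I_g}) : {ffun s k -> X} := [ffun a => comps (@iotam K f g K^o Y) L (u a)].
have csE (L' : ext g (N_step nu k)) : [ffun a => comps (@iotam K f g K^o (Y *m x)) (val L') (u a)] =
    \sum_(L : ext g (N_step nu k)) minor x L L' *: cs (val L) :> {ffun s k -> X}.
  apply/ffunP=> a; rewrite !ffunE sum_ffunE.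
  have -> : @iotam K f g K^o (Y *m x) = comb (fun i => iotam Y i : {linear X -> X}) x.
    apply/funext => j; apply/funext => y; rewrite /comb /iotam.
    under eq_bigr => i _ do rewrite mxE scaler_suml.
    rewrite exchange_big; apply: eq_bigr => i _; rewrite scaler_sumr; apply: eq_bigr => i' _.
    by rewrite scalerA mulrC.
  rewrite (comps_comb (@iotamC _ _ _ _ Y) (@iotam_sqr _ _ _ _ Y) _ _ (eqP (valP L'))) sum_ext.
  by apply: eq_bigr => L _; rewrite !ffunE minorS_ext.
rewrite !dK_sum (lin_sum _ _ _ (mxa_lin _)).
have lm (n n' : nat) (B : 'M[K]_(n', n)) (z : {ffun 'I_n -> X}) (c : K) : mxa B (c *: z) = c *: mxa B z.
  exact: (linZ _ _ (mxa_lin B)).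
transitivity (\sum_(L : ext g (N_step nu k)) mxa (P nu k L *m gl_mx (S (p_weight nu k)) x) (cs (val L))).
  have [_ hx] := hP k dnu.
  under [RHS]eq_bigr => L _ do rewrite (hx x ux L) mxa_suml.
  rewrite exchange_big; apply: eq_bigr => L' _; rewrite csE !(lin_sum _ _ _ (mxa_lin _)).
  by apply: eq_bigr => L _; rewrite !lm mxaZ mxaM.
apply: eq_bigr => L _; rewrite mxaM; congr (mxa _ _); apply/ffunP=> b; rewrite !ffunE.
have lc : linear (comps (@iotam K f g K^o Y) (val L)) by apply: comps_lin => j; apply: linearP.
rewrite (lin_sum _ _ _ lc); apply: eq_bigr => a _; by rewrite ffunE (linZ _ _ lc).
Qed.

(** The indices from nu'_0 up to, but excluding, the last one; there are N(nu;0) of them. *)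
Definition Jset : {set 'I_g} := [set j : 'I_g | (nu_prime nu 0 <= j)%N && (j < g.-1)%N].
(** A functional on t_{nu;0} specialized at Y: the form xi on the irreducible module, and full
    contraction along the columns in [Jset]. *)
Definition phi Y (u : {ffun s (1 - 1) -> X}) : K :=
  \sum_a hw_form S (p_weight nu (1 - 1)) 0 a * comps (@iotam K f g K^o Y) Jset (u a) set0.

Lemma phi_lin Y c u w : phi Y (c *: u + w) = c * phi Y u + phi Y w.
Proof.
have lc : linear (comps (@iotam K f g K^o Y) Jset) by apply: comps_lin => j; apply: linearP.
rewrite /phi mulr_sumr -big_split; apply: eq_bigr => a _; rewrite !ffunE lc !ffunE mulrDr; congr (_ + _).
exact: mulrCA.
Qed.

(** Composing with the differential contracts along L in addition. Such a term vanishes if L meets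
    [Jset], if L contains the last index (its column is 0), or if xi P_L = 0. *)
Lemma phi_dK Y (u : {ffun s 1 -> X}) : (forall i (j : 'I_g), j = g.-1 :> nat -> Y i j = 0) -> phi Y (dK Y u) = 0.
Proof.
move=> Y0; set J := (@iotam K f g K^o Y).
have lc L : linear (comps J L) by apply: comps_lin => j; apply: linearP.
rewrite dK_sum; pose sm := \sum_(L : ext g (N_step nu 1)) phi Y (mxa (P nu 1 L) [ffun a => comps J (val L) (u a)]).
have -> : phi Y (\sum_(L : ext g (N_step nu 1)) mxa (P nu 1 L) [ffun a => comps J (val L) (u a)]) = sm.
  have p0 : phi Y 0 = 0 by rewrite -[in LHS](scale0r (0 : {ffun s (1 - 1) -> X})) -[_ *: _]addr0 phi_lin mul0r add0r -[LHS]addr0 /phi big1 ?addr0 // => a _; rewrite ffunE (lin0 (lc _)) ffunE mulr0.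
  rewrite /sm; elim/big_rec2: _ => [//|L y z _ <-]; by rewrite -[X in X + _]scale1r phi_lin mul1r.
rewrite /sm big1 // => L _; rewrite /phi.
set xi := hw_form S _.
transitivity (\sum_a (xi *m P nu 1 L) 0 a * comps J Jset (comps J (val L) (u a)) set0).
  rewrite (eq_bigr (fun b => \sum_a xi 0 b * P nu 1 L b a * comps J Jset (comps J (val L) (u a)) set0)); last first.
    move=> b _; rewrite ffunE (lin_sum _ _ _ (lc _)) sum_ffunE mulr_sumr; apply: eq_bigr => a _.
    by rewrite (linZ _ _ (lc _)) !ffunE -mulrA.
  by rewrite exchange_big; apply: eq_bigr => a _; rewrite mxE mulr_suml.
have [->|xP] := eqVneq (xi *m P nu 1 L) 0; first by rewrite big1 // => a _; rewrite mxE mul0r.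
have low (l : 'I_g) : l \in val L -> (nu_prime nu 1 <= l)%N.
  by apply: form_Pi_low; rewrite /Pi pext_val.
rewrite big1 // => a _; rewrite (comps_comps (@iotamC _ _ _ _ Y) (@iotam_sqr _ _ _ _ Y)).
case: ifP => [dJ|_]; last by rewrite ffunE mulr0.
pose lst : 'I_g := Ordinal (ltac:(by rewrite ltn_predL) : (g.-1 < g)%N).
have J0 y : J lst y = 0 by rewrite /J /iotam big1 // => i _; rewrite Y0 // scale0r.
have [lL|lL] := boolP (lst \in val L).
  have lU : lst \in Jset :|: val L by rewrite inE lL orbT.
  set W := (Jset :|: val L) in lU *.
  have : J lst (comps J (W :\ lst) (u a)) = if lst \in W :\ lst then 0 else sg K lst (W :\ lst) *: comps J (lst |: W :\ lst) (u a).
    exact: (comps_cons (@iotamC _ _ _ _ Y) (@iotam_sqr _ _ _ _ Y)).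
  rewrite J0 !inE eqxx /= setD1K // => /esym /eqP; rewrite scaler_eq0 signr_eq0 /= => /eqP ->.
  by rewrite scaler0 ffunE mulr0.
(* In the remaining case [form_Pi_low] confines L to the indices from nu'_1 up to nu'_0 excluded,
   which are one fewer than the elements of L. *)
exfalso; have sub : val L \subset [set c : 'I_g | (c < nu_prime nu 0)%N] :\: [set c : 'I_g | (c < nu_prime nu 1)%N].
  apply/subsetP => l lL'; rewrite !inE -leqNgt low //= ltnNge; apply/negP => h0.
  have : l \notin Jset by apply: contraTN lL' => lJ; rewrite (disjointFr dJ lJ).
  rewrite inE h0 /= -leqNgt => h1; have lE : l = lst by apply: val_inj => /=; have := ltn_ord l; lia.
  by move: lL; rewrite -lE lL'.
have := subset_leq_card sub; rewrite (eqP (valP L)) /N_step.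
have h0 := nu_prime_le 0 dnu; have h1 := nu_prime_mono nu 1; rewrite -[1 - 1 : int]/(0 : int) in h1 *.
rewrite cardsD (setIidPr _) ?card_ord_lt; [lia|lia|lia|].
by apply/subsetP => c; rewrite !inE => h; apply: leq_trans h h1.
Qed.

Lemma phi_basis Y (D : {set 'I_f}) (v : 'cV[K]_(gl_dim (S (p_weight nu (1 - 1))))) : #|D| = #|Jset| -> minorS Y #|Jset| D Jset != 0 ->
  (hw_form S (p_weight nu (1 - 1)) *m v) 0 0 != 0 ->
  phi Y [ffun a => [ffun E : {set 'I_f} => (E == D)%:R * v a 0]] != 0.
Proof.
move=> cD mD hv; rewrite /phi.
have E a : comps (@iotam K f g K^o Y) Jset [ffun E : {set 'I_f} => (E == D)%:R * v a 0] set0 =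
    minorS Y #|Jset| D Jset * contract_sign K D D * v a 0.
  rewrite (comps_iotam _ _ erefl) sum_ffunE (bigD1 D) ?cD //= big1 ?addr0 => [|D' /andP[_ D'D]].
    rewrite !ffunE setU0 eqxx disjoints_subset setC0 subsetT mul1r; exact: mulrA.
  by rewrite !ffunE setU0 (negPf D'D) mul0r scaler0 if_same scaler0.
under eq_bigr => a _ do rewrite ffunE E mulrCA.
rewrite -mulr_sumr !mulf_neq0 //; first by rewrite signr_eq0.
by move: hv; rewrite mxE.
Qed.
End OverField.
End Specialization.

(** * The annihilator of the zeroth homology lies in each maximal ideal containing the minors *)

Section AnnihilatorInMaximal.
Variables (K : fieldType) (e g : nat).
Hypotheses (charK : [pchar K] =i pred0) (g0 : (0 < g)%N).
Variable S : seq int -> GLrep K g.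
Hypothesis hS : forall lambda, dominant g lambda -> is_Schur lambda (S lambda).
Variable P : Pieri_family S.
Arguments P : clear implicits.
Hypothesis hP : forall nu k, dominant g.-1 nu -> is_Pieri (P nu k).
Variable nu : seq int.
Hypothesis dnu : dominant g.-1 nu.
Hypothesis nu_range : {in nu, forall x, - 1 <= x <= e%:Z + 1}.
Notation f := (e + g)%N.
Notation A := (symA K f g).
Notation ps := (psi K f g : 'M[A]_(f, g)).
Notation T := (Tn S f nu).
Notation M := (t_H0 f P nu).
Local Notation s k := 'I_(gl_dim (S (p_weight nu k))).
Notation XA := {ffun {set 'I_f} -> A^o}.
Notation XK := {ffun {set 'I_f} -> K^o}.

Local Notation ph Y u := (@phi K g S nu f Y u).

Definition Phi (v : 'I_(f * g) -> K) : 'M[K]_(f, g) := map_mx (meval v) ps.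

Definition evm v k (u : {ffun s k -> XA}) : {ffun s k -> XK} := [ffun a => [ffun D => (u a D : {mpoly K[f * g]}).@[v]]].

Lemma evm_dA v k (u : {ffun s k -> XA}) : evm v (dA P u) = dK P (Phi v) (evm v u).
Proof.
apply/ffunP=> b; apply/ffunP=> E; have -> : evm v (dA P u) b E = (dA P u b E : {mpoly K[f * g]}).@[v] by rewrite !ffunE.
rewrite dA_expand [RHS]dP_expand.
rewrite (rmorph_sum (meval v)); apply: eq_bigr => L _; rewrite rmorphM /=; congr (_ * _).
  by rewrite /contract_sign rmorph_sign.
rewrite (rmorph_sum (meval v)); apply: eq_bigr => L' _; rewrite rmorphM /=; congr (_ * _).
  by rewrite /minor /Phi -map_mxsub det_map_mx.
rewrite (rmorph_sum (meval v)); apply: eq_bigr => a _; rewrite rmorphM /= mevalC; congr (_ * _).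
by rewrite !ffunE.
Qed.

(** An annihilating b makes b times a constant element of t_{nu;0} a boundary; evaluating this
    equation at the point v gives the statement over K. *)
Lemma annihilator_eval b v (u : {ffun s 0 -> XK}) : annihilator M b ->
  (forall a (D : {set 'I_f}), #|D|%:Z != N_degree g nu 0 -> u a D = 0) ->
  exists w : {ffun s 1 -> XK}, (b : {mpoly K[f * g]}).@[v] *: u = dK P (Phi v) w.
Proof.
move=> bM supp; pose x : T 0 := [ffun z : extz f (N_degree g nu 0) * s 0 => (u z.2 (val z.1) : K)%:MP : {mpoly K[f * g]}].
have /(augm_eq0 g0 P dnu nu_range) [y yE] : augm g0 P dnu nu_range (b *: x) = 0 by rewrite linearZ; apply: bM.
have e1 : t_map P (y : t_obj f S nu 1) = b *: x by rewrite -yE dn_0.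
exists (evm v (emb (y : t_obj f S nu 1))).
transitivity (evm v (emb (b *: x : t_obj f S nu 0))); last first.
  have E3 := evm_dA v (emb (y : t_obj f S nu 1)); rewrite dA_emb // in E3.
  exact: (etrans (congr1 (fun z : t_obj f S nu 0 => evm v (emb z)) (esym e1)) E3).
apply/ffunP=> a; apply/ffunP=> D.
have -> : evm v (emb (b *: x : t_obj f S nu 0)) a D = (emb (b *: x : t_obj f S nu 0) a D : {mpoly K[f * g]}).@[v] by rewrite /evm ffunE ffunE.
rewrite embE ffunE ffunE.
case: insubP => [E _ <-|hD]; last by rewrite supp // scaler0 meval0.
by rewrite ffunE [_ *: _]/(_ * _) mevalM ffunE mevalC.
Qed.

Lemma card_Jset : #|Jset g nu|%:Z = N_degree g nu 0.
Proof.
have h := nu_prime_le 0 dnu.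
have -> : Jset g nu = [set c : 'I_g | (c < g.-1)%N] :\: [set c : 'I_g | (c < nu_prime nu 0)%N].
  by apply/setP => c; rewrite !inE -leqNgt.
rewrite cardsD (setIidPr _) ?card_ord_lt ?leq_pred //; first by rewrite /N_degree; have := g0; lia.
  by apply: leq_trans h (leq_pred _).
by apply/subsetP => c; rewrite !inE => hc; apply: leq_trans hc h.
Qed.

(** Transport by x reduces to the matrix Y, where [phi] kills boundaries but is nonzero on e_D
    tensored with the highest weight vector; hence b must vanish at v. *)
Lemma annihilator_point b v (Y : 'M[K]_(f, g)) x (D : {set 'I_f}) : annihilator M b -> x \in unitmx -> Phi v = Y *m x ->
  (forall i (j : 'I_g), j = g.-1 :> nat -> Y i j = 0) -> #|D| = #|Jset g nu| -> minorS Y #|Jset g nu| D (Jset g nu) != 0 ->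
  (b : {mpoly K[f * g]}).@[v] = 0.
Proof.
move=> bM ux vE Y0 cD mD.
have dl := p_weight_dominant g0 (1 - 1) dnu.
have [xv _ _] := hw_formP charK hS dl.
pose w0 : {ffun s 0 -> XK} := [ffun a => [ffun E : {set 'I_f} => (E == D)%:R * hw_vec S (p_weight nu 0) a 0]].
have pw0 : ph Y w0 != 0 by apply: phi_basis => //; rewrite xv oner_neq0.
pose rho y := gl_mx (S (p_weight nu 0)) y.
have rr : rho x *m rho (invmx x) = 1%:M by rewrite -gl_mxM ?unitmx_inv // mulmxV // gl_mx1.
pose u := mxa (rho (invmx x)) w0.
have [a E|w] := @annihilator_eval b v u bM.
  move=> hE; rewrite ffunE sum_ffunE big1 // => c _; rewrite !ffunE.
  have -> : E == D = false by apply: contraNF hE => /eqP ->; rewrite cD card_Jset.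
  by rewrite mul0r scaler0.
move/(congr1 (mxa (rho x))); rewrite vE (linZ _ _ (mxa_lin _)) /u -mxaM rr mxa1.
have E2 : mxa (rho x) (dK P (Y *m x) w) = dK P Y (mxa (gl_mx (S (p_weight nu 1)) x) w) := dK_conj hP dnu Y w ux.
rewrite E2 => /(congr1 (@phi K g S nu f Y)).
rewrite (phi_dK charK g0 hS hP dnu _ Y0).
have -> : ph Y ((b : {mpoly K[f * g]}).@[v] *: w0) = (b : {mpoly K[f * g]}).@[v] * ph Y w0.
  have p0 : ph Y 0 = 0.
    have := @phi_lin K g S nu f Y 1 (0 : {ffun s (1 - 1) -> XK}) 0.
    by rewrite scale1r addr0 mul1r => /eqP; rewrite -subr_eq0 opprD addrA subrr sub0r oppr_eq0 => /eqP.
  by rewrite -[_ *: w0]addr0 phi_lin p0 addr0.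
by move/eqP; rewrite mulf_eq0 (negPf pw0) orbF => /eqP.
Qed.

Notation C := {mpoly K[f * g + g * g]}.
(** Generic matrices, the first with zero last column; their product parametrizes the matrices of
    rank less than g. *)
Definition Yg : 'M[C]_(f, g) := \matrix_(i, j) if (j : nat) == g.-1 then 0 else 'X_(lshift _ (mxvec_index i j)).
Definition Zg : 'M[C]_g := \matrix_(i, j) 'X_(rshift _ (mxvec_index i j)).
Definition gen_at (b : A) : C := mmap (@mpolyC _ K) (fun t => mxvec (Yg *m Zg) 0 t) b.

(** A polynomial identity: the pullback of b to the parametrization vanishes wherever the product h
    of a minor of Y and det Z does not, and h is not zero. *)
Lemma gen_at_eq0 b : annihilator M b -> gen_at b = 0.
Proof.
move=> bM; set n0 := #|Jset g nu|.
have n0f : (n0 <= f)%N.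
  by apply: leq_trans (max_card _) _; rewrite card_ord leq_addl.
pose D : {set 'I_f} := [set i : 'I_f | (i < n0)%N].
have cD : #|D| = n0 by apply: card_ord_lt.
pose h : C := minorS Yg n0 D (Jset g nu) * \det Zg.
have pt (v : 'I_(f * g + g * g) -> K) : h.@[v] != 0 -> (gen_at b).@[v] = 0.
  rewrite /h mevalM mulf_eq0 negb_or => /andP[h1 h2].
  pose v' t := mxvec (map_mx (meval v) (Yg *m Zg)) 0 t.
  have -> : (gen_at b).@[v] = (b : {mpoly K[f * g]}).@[v'].
    rewrite /gen_at; elim/mpoly_ring_ind: (b : {mpoly K[f * g]}) => [c|t|p q hp hq|p q hp hq].
    - by rewrite mmapC !mevalC.
    - rewrite mmapX mmap1U mevalXU /v'; case/mxvec_indexP: t => i j; by rewrite !mxvecE [RHS]mxE.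
    - by rewrite !rmorphD /= hp hq.
    by rewrite !rmorphM /= hp hq.
  apply: (@annihilator_point b v' (map_mx (meval v) Yg) (map_mx (meval v) Zg) D) => //.
  - by rewrite unitmxE unitfE det_map_mx.
  - rewrite -map_mxM; apply/matrixP => i j; rewrite !mxE mevalXU /v' mxvecE !mxE //.
  - by move=> i j jE; rewrite !mxE jE eqxx meval0.
  move: h1; rewrite /minorS; case: insub => [I|]; last by rewrite meval0.
  case: insub => [I'|]; last by rewrite meval0.
  by rewrite /minor -map_mxsub det_map_mx.
have hb0 : gen_at b * h = 0.
  apply: (mpoly_eq0_points charK) => v; have -> : (gen_at b * h).@[v] = (gen_at b).@[v] * h.@[v] := mevalM _ _ _.
  by have [->|/pt ->] := eqVneq h.@[v] 0; rewrite ?mulr0 ?mul0r.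
have h0 : h != 0.
  pose I : ext f n0 := Sub D (introT eqP cD); pose I' : ext g n0 := Sub (Jset g nu) (eqxx _ : #|Jset g nu| == n0).
  (* A point where h is 1: the chosen block of Y and the matrix Z are identities. *)
  pose v t := match split t with
    | inl t => mxvec (\matrix_(i, j) [exists r, (i == ext_nth I r) && (j == ext_nth I' r)]%:R) 0 t
    | inr t => mxvec (1%:M : 'M[K]_g) 0 t end.
  apply/eqP => /(congr1 (meval v)); rewrite meval0 /h mevalM.
  have -> : (\det Zg).@[v] = 1.
    rewrite -[LHS]/(meval v _) -det_map_mx -[RHS](det1 _ g); congr (\det _).
    by apply/matrixP => i j; rewrite mxE /= [Zg _ _]mxE mevalXU /v (unsplitK (inr _)) mxvecE.
  have -> : (minorS Yg n0 D (Jset g nu)).@[v] = 1; last by rewrite mulr1 => /eqP; rewrite oner_eq0.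
  have -> : minorS Yg n0 D (Jset g nu) = minor Yg I I' by exact: (minorS_ext Yg I I').
  rewrite /minor -[LHS]/(meval v _) -det_map_mx -[RHS](det1 _ n0); congr (\det _).
  apply/matrixP => i j; rewrite mxE /= [mxsub _ _ _ _ _]mxE [Yg _ _]mxE.
  have -> : ((ext_nth I' j : nat) == g.-1) = false.
    have : ext_nth I' j \in Jset g nu := ext_nth_in I' j.
    by rewrite inE => /andP[_ hj]; apply/negbTE; rewrite neq_ltn hj.
  rewrite mevalXU /v (unsplitK (inl _)) mxvecE !mxE; congr (_%:R).
  have [->|ij] := eqVneq i j; first by congr nat_of_bool; apply/existsP; exists j; rewrite !eqxx.
  congr nat_of_bool; apply/existsP => -[r /andP[/eqP/ext_nth_inj ir /eqP/ext_nth_inj jr]].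
  by move: ij; rewrite ir jr eqxx.
by move/eqP: hb0; rewrite mulf_eq0 (negPf h0) orbF => /eqP.
Qed.

(** Over the residue field the generic matrix has rank less than g, hence is a value of the
    parametrization Yg Zg, and the identity [gen_at_eq0] specializes there. The residue field may be
    larger than K, which is why an identity rather than points over K is needed. *)
Lemma annihilator_in_maximal b (m : idealr A) : is_maximal m -> (forall a, minors_ideal a -> a \in m) ->
  annihilator M b -> b \in m.
Proof.
move=> mm Im bM; have [L [pr prm]] := residue_field mm; apply/prm.
pose Ps : 'M[L]_(f, g) := map_mx pr ps.
have dets (h : 'I_g -> 'I_f) : \det (rowsub h Ps) = 0.
  have -> : rowsub h Ps = map_mx pr (rowsub h ps) by rewrite map_mxsub.
  rewrite det_map_mx; apply/prm; apply: Im; exists (fun s0 => (s0 == finfun h)%:R).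
  rewrite (bigD1 (finfun h)) //= eqxx mul1r big1 ?addr0 => [|s0 /negPf ->]; last by rewrite mul0r.
  congr (\det _); apply/matrixP => i j; by rewrite !mxE ffunE.
have rk : (\rank Ps < g)%N.
  rewrite ltn_neqAle rank_leq_col andbT; apply/negP => rf.
  have rF : row_full Ps by [].
  have := fullrowsub_unit rF.
  by rewrite unitmxE dets unitr0.
(* The rank factorization; the partial identity of rank less than g has zero last column. *)
pose Y := col_ebase Ps *m (pid_mx (\rank Ps) : 'M[L]_(f, g)); pose Z := row_ebase Ps.
have YZ : Y *m Z = Ps by apply: mulmx_ebase.
pose w (t : 'I_(f * g + g * g)) : L := match split t with inl t => mxvec Y 0 t | inr t => mxvec Z 0 t end.
pose sg := mmap (pr \o @mpolyC _ K) w : C -> L.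
have sY : map_mx sg Yg = Y.
  apply/matrixP => i j; rewrite mxE [Yg _ _]mxE; case: eqP => jE.
    rewrite [RHS]mxE big1 ?[LHS]raddf0 // => t _; rewrite mxE.
    suff -> : (t == j :> nat) && (t < \rank Ps)%N = false by rewrite mulr0.
    apply/negbTE; rewrite negb_and; have [tj|//] := eqVneq (t : nat) j.
    by rewrite /= tj jE -leqNgt; have := rk; lia.
  by rewrite /sg mmapX mmap1U /w (unsplitK (inl _)) mxvecE.
have sZ : map_mx sg Zg = Z.
  by apply/matrixP => i j; rewrite mxE [Zg _ _]mxE /sg mmapX mmap1U /w (unsplitK (inr _)) mxvecE.
have -> : pr b = sg (gen_at b); last by rewrite gen_at_eq0 // /sg raddf0.
rewrite /gen_at; elim/mpoly_ring_ind: (b : {mpoly K[f * g]}) => [c|t|p q hp hq|p q hp hq].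
- by rewrite mmapC /sg mmapC.
- rewrite mmapX mmap1U; case/mxvec_indexP: t => i j; rewrite mxvecE.
  transitivity (Ps i j); first by rewrite !mxE.
  by rewrite -YZ -sY -sZ -map_mxM mxE.
- by rewrite [in LHS]rmorphD [in RHS]rmorphD /= /sg rmorphD /= -/sg hp hq.
by rewrite [in LHS]rmorphM [in RHS]rmorphM /= /sg rmorphM /= -/sg hp hq.
Qed.
End AnnihilatorInMaximal.

(** * Localization at a maximal ideal *)

Section Localize.
Local Open Scope quotient_scope.
Variables (R : comNzRingType) (m : idealr R).
Hypothesis mm : is_maximal m.

Lemma maximal_mul s t : s \notin m -> t \notin m -> s * t \notin m.
Proof.
have [L [pr prm]] := residue_field mm; move=> hs ht; apply/negP => /prm /eqP.
by rewrite rmorphM mulf_eq0 => /orP[] /eqP /prm; apply/negP.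
Qed.

Lemma maximal_1 : (1 : R) \notin m. Proof. by rewrite (idealr1 m). Qed.

Definition den := {s : R | s \notin m}.
Definition den1 : den := exist _ 1 maximal_1.
Definition denM (s t : den) : den := exist _ (val s * val t) (maximal_mul (valP s) (valP t)).

Section Module.
Variable M : lmodType R.

Definition loc_eqv (p q : M * den) : bool := `[< exists2 u, u \notin m & u *: (val q.2 *: p.1) = u *: (val p.2 *: q.1) >].

Lemma loc_eqv_refl : reflexive loc_eqv.
Proof. by move=> p; apply/asboolP; exists 1; rewrite ?maximal_1. Qed.
Lemma loc_eqv_sym : ssrbool.symmetric loc_eqv.
Proof. by move=> p q; apply/asboolP/asboolP => -[u um h]; exists u. Qed.
Lemma loc_eqv_trans : transitive loc_eqv.
Proof.
move=> q p r /asboolP[u um h] /asboolP[w wm h']; apply/asboolP; exists (u * w * val q.2).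
  by rewrite !maximal_mul ?(valP q.2).
rewrite !scalerA; have -> : u * w * val q.2 * val r.2 = w * val r.2 * (u * val q.2) by ring.
rewrite -scalerA -[(u * _) *: _]scalerA h !scalerA.
have -> : w * val r.2 * u * val p.2 = (u * val p.2) * (w * val r.2) by ring.
rewrite -scalerA -[(w * _) *: _]scalerA h' !scalerA; congr (_ *: _); ring.
Qed.
Definition loc_equiv := EquivRel loc_eqv loc_eqv_refl loc_eqv_sym loc_eqv_trans.
Definition locm := {eq_quot loc_equiv}.
HB.instance Definition _ := Choice.on locm.

Definition fr (x : M) (s : den) : locm := \pi_locm (x, s).

Lemma frE x s y t : (fr x s = fr y t) <-> exists2 u, u \notin m & u *: (val t *: x) = u *: (val s *: y).
Proof.
split=> [/eqP|h]; first by rewrite piE => /asboolP.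
by apply/eqP; rewrite piE; apply/asboolP.
Qed.

Lemma fr_eq x s y t : val t *: x = val s *: y -> fr x s = fr y t.
Proof. by move=> h; apply/frE; exists 1; rewrite ?maximal_1 // h. Qed.

Lemma frP (z : locm) : exists x s, z = fr x s.
Proof. by exists (repr z).1, (repr z).2; rewrite /fr -surjective_pairing reprK. Qed.

Definition fadd (z w : locm) := fr (val (repr w).2 *: (repr z).1 + val (repr z).2 *: (repr w).1) (denM (repr z).2 (repr w).2).
Definition fopp (z : locm) := fr (- (repr z).1) (repr z).2.
Definition fzero := fr 0 den1.

Lemma repr_fr x s : exists2 u, u \notin m & u *: (val s *: (repr (fr x s)).1) = u *: (val (repr (fr x s)).2 *: x).
Proof. by apply/frE; rewrite /fr -surjective_pairing reprK. Qed.

Lemma faddE x y s : fadd (fr x s) (fr y s) = fr (x + y) s.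
Proof.
rewrite /fadd; have [u um] := repr_fr x s; have [w wm] := repr_fr y s.
move: (repr _) (repr _) => [x' s'] [y' t'] /= hy hx; apply/frE; exists (u * w); first exact: maximal_mul.
rewrite /= !scalerDr !scalerA; congr (_ + _).
  have -> : u * w * (sval s * sval t') = (w * sval t') * (u * sval s) by ring.
  have -> : u * w * (sval s' * sval t') = (w * sval t') * (u * sval s') by ring.
  by rewrite -[LHS]scalerA -[RHS]scalerA -![(u * _) *: _]scalerA hx.
have -> : u * w * (sval s * sval s') = (u * sval s') * (w * sval s) by ring.
have -> : u * w * (sval s' * sval t') = (u * sval s') * (w * sval t') by ring.
by rewrite -[LHS]scalerA -[RHS]scalerA -![(w * _) *: _]scalerA hy.
Qed.

Lemma foppE x s : fopp (fr x s) = fr (- x) s.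
Proof.
rewrite /fopp; have [u um h] := repr_fr x s; apply/frE; exists u => //.
by rewrite !scalerN h.
Qed.

Lemma fr_scale x s t : fr x s = fr (val t *: x) (denM s t).
Proof. by apply: fr_eq; rewrite /= !scalerA. Qed.

Lemma fr0 s : fzero = fr 0 s. Proof. by apply: fr_eq; rewrite !scaler0. Qed.

Lemma fr_common2 (z w : locm) : exists x y s, z = fr x s /\ w = fr y s.
Proof.
have [x [s ->]] := frP z; have [y [t ->]] := frP w.
exists (val t *: x), (val s *: y), (denM s t); split; first exact: fr_scale.
by apply: fr_eq; rewrite /= !scalerA mulrC.
Qed.

Lemma fr_common3 (z w v : locm) : exists x y x' s, [/\ z = fr x s, w = fr y s & v = fr x' s].
Proof.
have [x [y [s [-> ->]]]] := fr_common2 z w; have [x' [t ->]] := frP v.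
exists (val t *: x), (val t *: y), (val s *: x'), (denM s t); split; try exact: fr_scale.
by apply: fr_eq; rewrite /= !scalerA mulrC.
Qed.

Lemma faddA : associative fadd.
Proof. by move=> z w v; have [x [y [x' [s [-> -> ->]]]]] := fr_common3 z w v; rewrite !faddE addrA. Qed.
Lemma faddC : commutative fadd.
Proof. by move=> z w; have [x [y [s [-> ->]]]] := fr_common2 z w; rewrite !faddE addrC. Qed.
Lemma fadd0 : left_id fzero fadd.
Proof. by move=> z; have [x [s ->]] := frP z; rewrite (fr0 s) faddE add0r. Qed.
Lemma faddN : left_inverse fzero fopp fadd.
Proof. by move=> z; have [x [s ->]] := frP z; rewrite foppE faddE addNr -fr0. Qed.

HB.instance Definition _ := GRing.isZmodule.Build locm faddA faddC fadd0 faddN.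
End Module.

Section Act.
Variable M : lmodType R.
Definition fact (a : locm R^o) (z : locm M) : locm M := fr ((repr a).1 *: (repr z).1) (denM (repr a).2 (repr z).2).

Lemma factE (a : R) s (x : M) t : fact (fr (a : R^o) s) (fr x t) = fr (a *: x) (denM s t).
Proof.
rewrite /fact; have [u um] := repr_fr (a : R^o) s; have [w wm] := repr_fr x t.
move: (repr _) (repr _) => [a' s'] [x' t'] /= hx ha; apply/frE; exists (u * w); first exact: maximal_mul.
rewrite /= !scalerA.
have -> : u * w * (val s * val t) * (a' : R) = (u * (val s * (a' : R))) * (w * val t) by ring.
have ha' : u * (val s * (a' : R)) = u * (val s' * a) := ha.
rewrite ha' -scalerA -[(w * _) *: _]scalerA hx !scalerA /=; congr (_ *: _); ring.
Qed.

Lemma factDl (z : locm M) a b : fact (a + b) z = fact a z + fact b z.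
Proof.
have [a' [b' [s [-> ->]]]] := fr_common2 a b; have [x [t ->]] := frP z.
by rewrite -[_ + _]/(fadd _ _) faddE !factE -[RHS]/(fadd _ _) faddE -scalerDl.
Qed.
Lemma factDr a (z w : locm M) : fact a (z + w) = fact a z + fact a w.
Proof.
have [x [y [s [-> ->]]]] := fr_common2 z w; have [a' [t ->]] := frP a.
by rewrite -[_ + _]/(fadd _ _) faddE !factE -[RHS]/(fadd _ _) faddE -scalerDr.
Qed.
Lemma fact1 (z : locm M) : fact (fr (1 : R^o) den1) z = z.
Proof. by have [x [s ->]] := frP z; rewrite factE; apply: fr_eq; rewrite /= scale1r mul1r. Qed.
End Act.

Lemma factA (M : lmodType R) a b (z : locm M) : fact a (fact b z) = fact (fact a b) z.
Proof.
have [a' [s ->]] := frP a; have [b' [t ->]] := frP b; have [x [u ->]] := frP z.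
rewrite (factE (b' : R) t x u) (factE (a' : R) s (b' : R^o) t) (factE (a' : R) s _ (denM t u)) (factE ((a' : R) * (b' : R)) (denM s t) x u).
by apply: fr_eq; rewrite /= !scalerA; congr (_ *: _); ring.
Qed.

Definition locr := locm R^o.
HB.instance Definition _ := GRing.Zmodule.on locr.
Definition fmul (a b : locr) : locr := fact a b.

Lemma fmulC : commutative fmul.
Proof.
move=> a b; have [a' [s ->]] := frP a; have [b' [t ->]] := frP b; rewrite /fmul !factE.
by apply: fr_eq; rewrite /= /GRing.scale /=; ring.
Qed.
Lemma fmulA : associative fmul. Proof. by move=> a b c; apply: factA. Qed.
Lemma fmul1 : left_id (fr (1 : R^o) den1 : locr) fmul. Proof. exact: fact1. Qed.
Lemma fmulDl : left_distributive fmul +%R. Proof. by move=> a b c; apply: factDl. Qed.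
Lemma fone_neq0 : (fr (1 : R^o) den1 : locr) != 0.
Proof.
apply/eqP => /frE [u um]; rewrite scaler0 scaler0 => h; move/negP: um; apply.
suff -> : u = 0 by rewrite rpred0.
by have : u * (1 * 1) = 0 := h; rewrite !mulr1.
Qed.
HB.instance Definition _ := GRing.Zmodule_isComNzRing.Build locr fmulA fmulC fmul1 fmulDl fone_neq0.

Section LmodLoc.
Variable M : lmodType R.
HB.instance Definition _ := GRing.Zmodule_isLmodule.Build locr (locm M)
  (fun a b z => @factA M a b z) (@fact1 M) (@factDr M) (@factDl M).

Definition to_loc (x : M) : locm M := fr x den1.
Lemma to_loc_zmod : zmod_morphism to_loc.
Proof. by move=> x y; rewrite /to_loc -[RHS]/(fadd _ (fopp _)) foppE faddE. Qed.
HB.instance Definition _ := GRing.isZmodMorphism.Build M (locm M) to_loc to_loc_zmod.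
End LmodLoc.

Definition to_locr (a : R) : locr := fr (a : R^o) den1.
Lemma to_locr_zmod : zmod_morphism to_locr. Proof. exact: (@to_loc_zmod R^o). Qed.
HB.instance Definition _ := GRing.isZmodMorphism.Build R locr to_locr to_locr_zmod.
Lemma to_locr_mon : monoid_morphism to_locr.
Proof.
split=> // a b; rewrite /to_locr -[RHS]/(fact _ _) factE; apply: fr_eq; by rewrite /= mul1r.
Qed.
HB.instance Definition _ := GRing.isMonoidMorphism.Build R locr to_locr to_locr_mon.

Lemma locr_localization : is_ring_localization m (to_locr : {rmorphism R -> locr}).
Proof.
split=> [s sm|z|a /frE [u um]].
- exists (fr (1 : R^o) (exist _ s sm)); rewrite -[LHS]/(fact _ _) factE; apply: fr_eq.
  by rewrite /= scale1r mul1r.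
- have [a [s ->]] := frP z; exists a, (val s); split; first exact: (valP s).
  by rewrite -[LHS]/(fact _ _) factE; apply: fr_eq; rewrite /= !mul1r scale1r.
by rewrite !scaler0 => h; exists u => //; rewrite -[RHS]h /= scale1r.
Qed.

Lemma locm_localization (M : lmodType R) :
  is_module_localization m (to_locr : {rmorphism R -> locr}) (@to_loc M : {additive M -> locm M}).
Proof.
split=> [a x|z|x /frE [u um]].
- by rewrite /= -[RHS]/(fact _ _) factE; apply: fr_eq; rewrite /= mul1r.
- have [x [s ->]] := frP z; exists (val s), x; split; first exact: (valP s).
  by rewrite -[LHS]/(fact _ _) factE; apply: fr_eq; rewrite /= !mul1r scale1r.
by rewrite !scaler0 => h; exists u => //; rewrite -[RHS]h /= scale1r.
Qed.

Definition locn_pred : {pred locr} := fun z => `[< exists a s, a \in m /\ z = fr (a : R^o) s >].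
Lemma locn_closed : idealr_closed locn_pred.
Proof.
split.
- by apply/asboolP; exists 0, den1; rewrite rpred0.
- apply/negP => /asboolP [a [s [am /frE [u um h]]]].
  have : u * (val s * 1) \in m.
    by have -> : u * (val s * 1) = u * (1 * a) := h; rewrite mulrCA idealMr // idealMr.
  by apply/negP; rewrite mulr1 maximal_mul // (valP s).
move=> a u v /asboolP[b [s [bm ->]]] /asboolP[b' [s' [bm' ->]]]; apply/asboolP.
have [a' [t ->]] := frP a.
exists (val s' * (a' * b) + (val t * val s) * b'), (denM (denM t s) s'); split; first by rewrite rpredD ?idealMr.
have e1 : (fr a' t : locr) * fr (b : R^o) s = fr ((a' : R) * b : R^o) (denM t s) := factE (a' : R) t (b : R^o) s.
rewrite e1 (fr_scale ((a' : R) * b : R^o) (denM t s) s').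
have -> : fr (b' : R^o) s' = fr (val (denM t s) *: (b' : R^o)) (denM (denM t s) s').
  by apply: fr_eq; rewrite /= !scalerA mulrC.
by rewrite -[LHS]/(fadd _ _) faddE.
Qed.
Definition locn : idealr locr := pid_pred (PIdeal locn_closed).

Lemma in_locn (a : R) s : a \in m -> fr (a : R^o) s \in (locn : idealr locr).
Proof. by move=> am; apply/asboolP; exists a, s. Qed.

Lemma locn_maximal : is_maximal locn.
Proof.
move=> J sub z zJ; have [a [s zE]] := frP z; apply/asboolP; exists a, s; split=> //.
apply: contrapT => /negP am; have := idealr1 J => /negP; apply.
have -> : (1 : locr) = (fr (val s : R^o) (exist _ a am) : locr) * z.
  rewrite zE -[RHS]/(fact _ _) factE; apply: fr_eq.
  have h : (a : R) * sval s * 1 = 1 * (sval s * (a : R)) by ring.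
  exact: h.
exact: idealMr.
Qed.
End Localize.

Section LocalizedRegularity.
Local Open Scope quotient_scope.
Variables (R : comNzRingType) (m : idealr R) (mm : is_maximal m).
Variables (S : comNzRingType) (phi : {rmorphism R -> S}) (M : lmodType R) (M' : lmodType S) (h : {additive M -> M'}).
Hypotheses (hS : is_ring_localization m phi) (hM : is_module_localization m phi h).

Lemma loc_inv s (y : M') : s \notin m -> exists t, t *: (phi s *: y) = y.
Proof.
move=> sm; have [h1 _ _] := hS; have [t st] := h1 s sm; exists t.
by rewrite scalerA mulrC st scale1r.
Qed.

(** Clear the denominators of the finitely many coefficients; the common denominator and the element
    killing the remaining difference combine into t. *)
Lemma in_seq_loc (ws : seq R) (x : M) :
  in_seq_mul [seq phi w | w <- ws] (h x) <-> exists2 t, t \notin m & in_seq_mul ws (t *: x).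
Proof.
have [hZ hs h0] := hM; split=> [/in_seq_mulE [z hz]|[t tm /in_seq_mulE [z hz]]]; last first.
  have [t' ht'] := loc_inv (h x) tm; rewrite -ht' -hZ hz raddf_sum scaler_sumr.
  apply/in_seq_mulE; exists (fun i => t' *: h (z i)); rewrite size_map; apply: eq_bigr => i _.
  by rewrite hZ (nth_map 0) // !scalerA mulrC.
have H i : exists sx : R * M, sx.1 \notin m /\ phi sx.1 *: z i = h sx.2.
  by have [s [x0 [sm sE]]] := hs (z i); exists (s, x0).
have [sx hsx] := boolp.choice H.
have key n : (n <= size ws)%N -> exists (s : R) (u : M), [/\ s \notin m, in_seq_mul ws u &
    phi s *: (\sum_(i < n) phi ws`_i *: z i) = h u].
  elim: n => [_|n IH nw].
    exists 1, 0; split; [exact: maximal_1 | exact: in_seq_mul0 | by rewrite big_ord0 scaler0 raddf0].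
  have [s [u [sm uw uE]]] := IH (ltnW nw); have [s'm s'E] := hsx n.
  exists (s * (sx n).1), ((sx n).1 *: u + (s * ws`_n) *: (sx n).2); split; first exact: maximal_mul.
    by apply: in_seq_mulD; [exact: in_seq_mulZ | rewrite -scalerA; apply: in_seq_mulZ; apply: in_seq_mem; exact: mem_nth].
  rewrite big_ord_recr /= (raddfD h) !hZ -uE -s'E scalerDr !scalerA -!rmorphM; congr (_ *: _ + _ *: _).
    by rewrite mulrC.
  by rewrite mulrAC.
have [s [u [sm uw uE]]] := key _ (leqnn _).
have : h (s *: x - u) = 0.
  rewrite raddfB hZ hz -uE size_map; apply/eqP; rewrite subr_eq0; apply/eqP; congr (_ *: _).
  by apply: eq_bigr => i _; rewrite (nth_map 0).
move/h0 => [t tm tE]; exists (t * s); first exact: maximal_mul.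
have -> : (t * s) *: x = t *: u by apply/eqP; rewrite -subr_eq0 -scalerA -scalerBr tE.
exact: in_seq_mulZ.
Qed.

Lemma wreg_loc (ws : seq R) : wreg ws M -> wreg [seq phi w | w <- ws] M'.
Proof.
have [hZ hs h0] := hM; move=> wr i; rewrite size_map => iw y; rewrite -map_take (nth_map 0) //.
have [s [x [sm sE]]] := hs y; have [t tE] := loc_inv y sm => hy.
have : in_seq_mul [seq phi w | w <- take i ws] (h (ws`_i *: x)).
  by rewrite hZ -sE !scalerA mulrC -scalerA; apply: in_seq_mulZ.
case/in_seq_loc => u um; rewrite scalerA mulrC -scalerA => /(wr _ iw) hu.
rewrite -tE sE; apply: in_seq_mulZ; apply/in_seq_loc; by exists u.
Qed.
End LocalizedRegularity.

Section MaximalPreimage.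
Local Open Scope quotient_scope.
Variables (A : comNzRingType) (I : idealr A).
Notation Q := {ideal_quot I}.

Lemma maximal_preimage (m : idealr Q) : is_maximal m ->
  exists m' : idealr A, is_maximal m' /\ forall a, (a \in m') = (\pi_Q a \in m).
Proof.
move=> mm; have piM a b : \pi_Q (a * b) = \pi_Q a * \pi_Q b by exact: (rmorphM (\pi_Q)).
have piD a b : \pi_Q (a + b) = \pi_Q a + \pi_Q b by exact: (rmorphD (\pi_Q)).
pose p : {pred A} := fun a => \pi_Q a \in m.
have pc : idealr_closed p.
  split.
  - have : \pi_Q 0 \in m; last by [].
    by have -> : \pi_Q 0 = 0 by [exact: (rmorph0 (\pi_Q))]; rewrite rpred0.
  - have : \pi_Q 1 \notin m; last by [].
    by have -> : \pi_Q 1 = 1 by [exact: (rmorph1 (\pi_Q))]; rewrite (idealr1 m).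
  move=> a u v hu hv; have : \pi_Q (a * u + v) \in m by rewrite piD piM; apply: rpredD => //; exact: idealMr.
  by [].
exists (pid_pred (PIdeal pc)); split=> // J sub a aJ; apply: contraT => am.
have [y hy] := maximal_inv mm (am : \pi_Q a \notin m).
have := idealr1 J => /negP; case; have -> : 1 = (1 - a * repr y) + repr y * a by rewrite [repr y * a]mulrC subrK.
apply: rpredD; last exact: idealMr.
apply: sub; rewrite [_ \in _]/(\pi_Q (1 - a * repr y) \in m).
have -> : \pi_Q (1 - a * repr y) = \pi_Q 1 - \pi_Q a * \pi_Q (repr y).
  by rewrite -piM; exact: (rmorphB (\pi_Q)).
by have -> : \pi_Q 1 = 1 by [exact: (rmorph1 (\pi_Q))]; rewrite reprK.
Qed.
End MaximalPreimage.

(** * Modules over the quotient by an ideal that annihilates them *)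

Section QuotientModule.
Local Open Scope quotient_scope.
Variables (A : comNzRingType) (I : idealr A) (M : lmodType A).
Hypothesis IM : forall a, a \in I -> annihilator M a.
Notation Q := {ideal_quot I}.

Definition qscale (q : Q) (x : M) : M := repr q *: x.

Lemma qscaleE a x : qscale (\pi_Q a) x = a *: x.
Proof.
apply/eqP; rewrite -subr_eq0 -scalerBl; apply/eqP; apply: IM.
by rewrite (Quotient.idealrBE I) reprK.
Qed.

Lemma qscaleA a b x : qscale a (qscale b x) = qscale (a * b) x.
Proof.
rewrite -[a]reprK -[b]reprK (qscaleE (repr b)) qscaleE scalerA -qscaleE.
by congr qscale; exact: (rmorphM (\pi_Q)).
Qed.
Lemma qscale1 : left_id 1 qscale.
Proof. by move=> x; have <- : \pi_Q 1 = 1 := rmorph1 _; rewrite qscaleE scale1r. Qed.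
Lemma qscaleDr : right_distributive qscale +%R.
Proof. by move=> a x y; rewrite /qscale scalerDr. Qed.
Lemma qscaleDl x : {morph qscale^~ x : a b / a + b}.
Proof.
move=> a b; rewrite -[a]reprK -[b]reprK !qscaleE -scalerDl -qscaleE.
by congr qscale; apply/esym; exact: (rmorphD (\pi_Q)).
Qed.

(** The carrier of M under a name that records the proof of annihilation, so that the module
    structure over the quotient ring can be attached to it. *)
Definition qmod : Type := (fun _ : forall a, a \in I -> annihilator M a => GRing.Lmodule.sort M) IM.
HB.instance Definition _ := GRing.Zmodule.copy qmod (GRing.Lmodule.sort M).
HB.instance Definition _ := GRing.Zmodule_isLmodule.Build Q qmod qscaleA qscale1 qscaleDr qscaleDl.

Lemma qmodE a (x : qmod) : (\pi_Q a : Q) *: x = (a *: (x : M) : M). Proof. exact: qscaleE. Qed.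

Lemma in_seq_qmod ws (x : M) : in_seq_mul [seq \pi_Q w : Q | w <- ws] (x : qmod) <-> in_seq_mul ws x.
Proof.
split=> /in_seq_mulE [z hz]; apply/in_seq_mulE; exists z; rewrite hz size_map; apply: eq_bigr => i _;
  by rewrite (nth_map 0) // qmodE.
Qed.

Lemma wreg_qmod ws : wreg ws M -> wreg [seq \pi_Q w : Q | w <- ws] qmod.
Proof.
move=> wr i; rewrite size_map => iw y; rewrite -map_take (nth_map 0) // qmodE.
by move/in_seq_qmod => h; apply/in_seq_qmod; apply: wr.
Qed.

Lemma qmod_finitely_generated : finitely_generated M -> finitely_generated qmod.
Proof.
move=> [n [x hx]]; exists n, x => y; have [c ->] := hx y; exists (fun i => \pi_Q (c i)).
by apply: eq_bigr => i _; rewrite qmodE.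
Qed.

End QuotientModule.

(** * Perfection and the maximal Cohen-Macaulay property *)

Section PerfectAndCohenMacaulay.
Local Open Scope quotient_scope.
Variables (K : fieldType) (e g : nat).
Hypotheses (charK : [pchar K] =i pred0) (g0 : (0 < g)%N).
Variable S : seq int -> GLrep K g.
Hypothesis hS : forall lambda, dominant g lambda -> is_Schur lambda (S lambda).
Variable P : Pieri_family S.
Arguments P : clear implicits.
Hypothesis hP : forall nu k, dominant g.-1 nu -> is_Pieri (P nu k).
Variable nu : seq int.
Hypothesis dnu : dominant g.-1 nu.
Hypothesis nu_range : {in nu, forall x, - 1 <= x <= e%:Z + 1}.
Notation f := (e + g)%N.
Notation A := (symA K f g).
Notation ps := (psi K f g : 'M[A]_(f, g)).
Notation M := (t_H0 f P nu).
Notation AM := (annihilator M).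

(** If 1 annihilated the module, its pullback to matrices of rank less than g would vanish. *)
Lemma t_H0_neq0 : exists y : M, y <> 0.
Proof.
apply: contrapT => no; have h : AM 1.
  by move=> x; rewrite scale1r; apply: contrapT => x0; apply: no; exists x.
have := gen_at_eq0 charK g0 hS hP dnu nu_range h; rewrite /gen_at rmorph1 => /eqP; by rewrite oner_eq0.
Qed.

Lemma delta_minors_ideal k : minors_ideal (delta K (e := e) g0 k : A).
Proof.
exists (fun s0 => (s0 == finfun (drow g0 k))%:R).
rewrite (bigD1 (finfun (drow g0 k))) //= eqxx mul1r big1 ?addr0 => [|s0 /negPf ->]; last by rewrite mul0r.
by congr (\det _); apply/matrixP => i j; rewrite !mxE ffunE.
Qed.

Lemma deltas_annihilate a : a \in deltas K e g0 -> AM a.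
Proof.
case/mapP => k _ ->; apply: (annihilator_minors_ideal charK g0 hS hP dnu nu_range); exact: delta_minors_ideal.
Qed.

(** The e+1 minors bound the projective dimension from below, and the resolution of length e+1
    bounds the grade from above, both through [projdim_grade]. *)
Lemma t_H0_perfect : perfect M.
Proof.
have [y y0] := t_H0_neq0; split; first exact: (t_H0_fin g0 P dnu nu_range).
have wd : wreg (deltas K e g0) A^o by exact: wreg_deltas.
have sd : size (deltas K e g0) = e.+1 by exact: size_deltas.
exists e.+1; split; first split.
- exact: (t_H0_pdim_le charK g0 hS hP dnu nu_range).
- move=> m [R hR]; rewrite leqNgt; apply/negP => me; apply: y0.
  by apply: (projdim_grade hR wd deltas_annihilate); rewrite sd.
split.
  exists (deltas K e g0); split=> //; first exact: deltas_annihilate.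
  split; first exact: wd.
  by exists (1 : A); apply: (@deltas_proper K e g g0 (fun=> 'X)) => t; rewrite ?monicX ?size_polyX.
move=> xs xsM [wx _]; rewrite leqNgt; apply/negP => h; apply: y0.
have [R hR] := t_H0_pdim_le charK g0 hS hP dnu nu_range.
exact: (projdim_grade hR wx xsM).
Qed.

Definition minors_pred : {pred A} := fun a => `[< minors_ideal a >].

Lemma minors_closed : idealr_closed minors_pred.
Proof.
split.
- by apply/asboolP; exists (fun=> 0); rewrite big1 // => s0 _; rewrite mul0r.
- apply/negP => /asboolP [c /(congr1 (meval (fun=> 0 : K)))]; rewrite meval1 (rmorph_sum (meval _)) big1.
    by move/eqP; rewrite oner_eq0.
  move=> s0 _; rewrite rmorphM /= -[X in _ * X]/(meval _ _) -det_map_mx.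
  have -> : map_mx (meval (fun=> 0 : K)) (rowsub s0 ps) = 0.
    by apply/matrixP => i j; rewrite !mxE /= mevalXU.
  have -> : \det (0 : 'M[K]_g) = 0 by case: (g) g0 => // g' _; rewrite det0.
  by rewrite mulr0.
move=> a u v /asboolP[c ->] /asboolP[c' ->]; apply/asboolP; exists (fun s0 => a * c s0 + c' s0).
by rewrite mulr_sumr -big_split; apply: eq_bigr => s0 _; rewrite mulrDl mulrA.
Qed.
Definition minors_idealr : idealr A := pid_pred (PIdeal minors_closed).
Notation I := minors_idealr.

Lemma minors_idealrP a : a \in I <-> minors_ideal a.
Proof. by split=> h; [exact: (asboolW h) | exact: (introT (asboolP _) h)]. Qed.

Lemma minors_annihilate a : a \in I -> AM a.
Proof. by move/minors_idealrP; apply: annihilator_minors_ideal. Qed.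
Notation M' := (qmod minors_annihilate).
Notation Q := {ideal_quot I}.

Section AtMaximal.
Variable m : idealr Q.
Hypothesis mm : is_maximal m.
Notation L := (locr mm).
Notation d := (f * g - e.+1)%N.
Notation ph := (to_locr mm : {rmorphism Q -> L}).

(** Primes of the local ring are pulled back to the polynomial ring, where they contain the minors;
    the separating elements are taken as numerators. *)
Lemma loc_chain_bound (p : nat -> prime_idealr L) n :
  (forall j, (j < n)%N -> {subset p j <= p j.+1} /\ exists2 x, x \in p j.+1 & x \notin p j) -> (n <= d)%N.
Proof.
move=> ch; pose q j (a : A) := ph (\pi_Q a) \in p j.
have piD a b : \pi_Q (a + b) = \pi_Q a + \pi_Q b by exact: (rmorphD (\pi_Q)).
have piM a b : \pi_Q (a * b) = \pi_Q a * \pi_Q b by exact: (rmorphM (\pi_Q)).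
have H j : exists x : A, (j < n)%N -> q j.+1 x /\ ~ q j x.
  have [jn|jn] := boolP (j < n)%N; last by exists 0.
  have [_ [z zp zn]] := ch j jn; have [inv fr _] := locr_localization mm; have [a [s [sm sE]]] := fr z.
  exists (repr a) => _; rewrite /q reprK -sE; split; first exact: idealMr.
  have [t tE] := inv s sm; move/(idealMr t) => h; move/negP: zn; apply.
  by move: h; rewrite mulrA [t * _]mulrC tE mul1r.
have [x hx] := boolp.choice H.
apply: (@chain_bound K e g g0 q n x).
- by move=> j a b; rewrite /q piD rmorphD => ha hb; apply: rpredD.
- by move=> j a b; rewrite /q piM rmorphM => hb; apply: idealMr.
- by move=> j a b _; rewrite /q piM rmorphM prime_idealrM => /orP.
- by move=> j jn; case: (hx j jn).
- by move=> j jn; case: (hx j jn).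
- by move=> j a jn; case: (ch j jn) => sub _; apply: sub.
- move=> j _; rewrite /q; have -> : \pi_Q 1 = 1 by [exact: (rmorph1 (\pi_Q))].
  by rewrite rmorph1; apply/negP; rewrite (idealr1 (p j)).
move=> k; rewrite /q; have -> : \pi_Q (delta K g0 k) = 0.
  have <- : \pi_Q 0 = 0 by [exact: (rmorph0 (\pi_Q))].
  apply/eqP; rewrite -(Quotient.idealrBE I) subr0; apply/minors_idealrP; exact: delta_minors_ideal.
by rewrite rmorph0 rpred0.
Qed.

Lemma prime_chain_bound J n p : @prime_chain L J n p -> (n <= d)%N.
Proof.
move=> [_ ch]; apply: (@loc_chain_bound (fun j => p (inord j))) => j jn.
by apply: ch; rewrite !inordK // ltnW.
Qed.

(** Modulo the maximal ideal each coordinate is algebraic over K, which gives a monic polynomial in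
    it lying in the ideal; the coordinates used are those complementary to the minors. *)
Lemma residual_sequence : exists xs : seq A, [/\ size xs = d, forall x, x \in xs -> \pi_Q x \in m & wreg xs M].
Proof.
have [mA [mAm mAE]] := maximal_preimage mm.
have H t := maximal_algebraic mAm (uvar K g0 t).
have [p hp] := boolp.choice H.
have pm t : p t \is monic by case: (hp t).
have ps1 t : (1 < size (p t))%N by case: (hp t).
exists [seq qvar g0 p t | t <- enum [pred t | ~~ is_z (e := e) g0 t]]; split.
- by rewrite size_map -cardE card_nz.
- by move=> x /mapP [t _ ->]; rewrite -mAE; case: (hp t).
apply: wreg_t_H0 => //; first exact: enum_uniq.
by apply/allP => t; rewrite mem_enum.
Qed.

(** Otherwise the determinant trick produces an annihilator of the module outside the maximal ideal,
    against [annihilator_in_maximal]. *)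
Lemma local_proper xs : (forall x, x \in xs -> \pi_Q x \in m) ->
  exists y : locm mm M', ~ in_seq_mul [seq ph w | w <- [seq \pi_Q x : Q | x <- xs]] y.
Proof.
move=> xsm; apply: contrapT => no.
have [mA [mAm mAE]] := maximal_preimage mm.
have all_in y : in_seq_mul [seq ph w | w <- [seq \pi_Q x : Q | x <- xs]] (y : locm mm M').
  by apply: contrapT => h; apply: no; exists y.
have [n [x hx]] := t_H0_fin g0 P dnu nu_range.
have hM' := locm_localization mm M'.
have H i : exists s c, [/\ s \notin mA, forall j : 'I_n, c j \in mA & s *: x i = \sum_j c j *: x j].
  have /(in_seq_loc mm (locr_localization mm) hM') [t tm] := all_in (to_loc mm (x i : M')).
  have -> : t *: (x i : M') = (repr t *: (x i : M) : M) by rewrite -qmodE reprK.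
  move/in_seq_qmod/in_seq_mulE => [z hz].
  have [c hc] := boolp.choice (fun k => hx (z k)).
  exists (repr t), (fun j => \sum_(k < size xs) xs`_k * c k j); split.
  - by rewrite mAE reprK.
  - move=> j; apply: rpred_sum => k _; rewrite mulrC; apply: idealMr.
    by rewrite mAE; apply: xsm; apply: mem_nth.
  rewrite hz; under [RHS]eq_bigr => j _ do rewrite scaler_suml.
  rewrite exchange_big; apply: eq_bigr => k _; rewrite [in LHS]hc scaler_sumr; apply: eq_bigr => j _.
  by rewrite scalerA.
have [b bm bM] := nakayama mAm hx H.
move/negP: bm; apply; apply: (annihilator_in_maximal charK g0 hS hP dnu nu_range mAm _ bM) => a Ia.
rewrite mAE; have -> : \pi_Q a = 0; last by rewrite rpred0.
have <- : \pi_Q 0 = 0 by [exact: (rmorph0 (\pi_Q))].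
by apply/eqP; rewrite -(Quotient.idealrBE I) subr0; apply/minors_idealrP.
Qed.

(** The regular sequence of length fg - e - 1 yields a chain of primes above the annihilator, and no
    chain in the local ring is longer; since every regular sequence yields such a chain, the depth
    is bounded as well. *)
Lemma local_max_CM : local_maxCM (locn mm) (locm mm M').
Proof.
have [xs [sx xm wx]] := residual_sequence.
pose xs' := [seq ph w | w <- [seq \pi_Q x : Q | x <- xs]].
have sx' : size xs' = d by rewrite !size_map.
have reg : regular_seq xs' (locm mm M').
  split; last exact: local_proper.
  apply: (wreg_loc mm (locr_localization mm) (locm_localization mm M')).
  exact: wreg_qmod.
have [p hp] := regular_prime_chain reg; rewrite sx' in p hp.
exists d; split.
- split.
    exists xs'; split=> // z /mapP[w /mapP[x xx ->] ->]; apply: in_locn; exact: xm.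
  move=> ys _ /regular_prime_chain [p' /prime_chain_bound //].
- by split; [exists p | move=> n p'; apply: prime_chain_bound].
split; last by move=> n p'; apply: prime_chain_bound.
exists p; split; last by case: hp.
by move=> i x ->; rewrite rpred0.
Qed.
End AtMaximal.

Lemma t_H0_maxCM : maxCM_quotient (@minors_ideal K f g) M.
Proof.
exists I; split; first exact: minors_idealrP.
have hz : zmod_morphism (fun x : M => (x : M')) by [].
pose h : {additive M -> M'} := HB.pack (fun x : M => (x : M')) (GRing.isZmodMorphism.Build M M' _ hz).
exists M', h; split.
- by exists (fun x : M' => (x : M)).
- by move=> a x; rewrite qmodE.
split; first by apply: qmod_finitely_generated; exact: (t_H0_fin g0 P dnu nu_range).
move=> m mm; exists (locr mm), (locn mm), (to_locr mm : {rmorphism _ -> _}), (locm mm M'), (to_loc mm (M := M') : {additive _ -> _}).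
split; [exact: locr_localization | exact: locm_localization | exact: locn_maximal | exact: local_max_CM].
Qed.
End PerfectAndCohenMacaulay.

(** * Uniqueness and duals of highest weight modules *)

Section HighestWeightIso.
Variables (K : fieldType) (g : nat).
Hypothesis charK : [pchar K] =i pred0.
Variables (n : nat) (e : 'I_g -> 'I_g -> 'M[K]_n) (lam : {ffun 'I_g -> int}) (v : 'cV[K]_n) (xi : 'rV[K]_n).
Hypotheses (H : hwm e lam v) (Hxi : is_xi e lam v xi).
Variables (n' : nat) (e' : 'I_g -> 'I_g -> 'M[K]_n') (v' : 'cV[K]_n') (xi' : 'rV[K]_n').
Hypotheses (H' : hwm e' lam v') (Hxi' : is_xi e' lam v' xi').

Notation F := ('cV[K]_n * 'cV[K]_n')%type.
Definition pact (a b : 'I_g) (z : F) : F := (e a b *m z.1, e' a b *m z.2).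

Lemma pact_gl : gl_action pact.
Proof.
have [br _ _ _ _] := H; have [br' _ _ _ _] := H'; split=> [a b c [x y] [x' y']|a b c d [x y]].
  have lin m m' (M : 'M[K]_(m, m')) (z z' : 'cV[K]_m') : M *m (c *: z + z') = c *: (M *m z) + M *m z'.
    by rewrite mulmxDr -scalemxAr.
  by rewrite /pact -[(_ + _)]/(_ + _, _ + _) /= !lin.
have h m (M : 'I_g -> 'I_g -> 'M[K]_m) (z : 'cV[K]_m) : glmx M ->
    M a b *m (M c d *m z) = M c d *m (M a b *m z) + ((b == c)%:R *: (M a d *m z) - (d == a)%:R *: (M c b *m z)).
  by move=> bM; rewrite !mulmxA bM !mulmxDl mulNmx -!scalemxAl.
have pE (z w : F) : z.1 = w.1 -> z.2 = w.2 -> z = w by case: z w => [? ?] [? ?] /= -> ->.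
by apply: pE; [exact: h br | exact: h br'].
Qed.

(* The submodule generated by (v, v') under the lowering operators is the graph of an isomorphism: it lies in the
   subspace where xi and xi' agree. *)
Let G (z : F) := forall Q, lowered pact Q -> Q (v, v') -> (forall x, zeroP x -> Q x) -> Q z.

Let G_stable : gl_stable pact G.
Proof.
have [_ _ kv rv _] := H; have [_ _ kv' rv' _] := H'.
apply: (lowered_gl_stable pact_gl (zero_gl_stable pact_gl) (k := lam)).
  move=> a; rewrite /pact /=; have := kv a; have := kv' a; rewrite /mact => -> -> //.
by move=> a b ab; have := rv a b ab; have := rv' a b ab; rewrite /mact /pact /zeroP /= => -> ->.
Qed.

Let G_vv : G (v, v'). Proof. by move=> Q. Qed.

Let G_xi z : G z -> xi *m z.1 = xi' *m z.2.
Proof.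
have [x1 xl xw] := Hxi; have [x1' xl' xw'] := Hxi'.
move=> Gz; apply: (Gz (fun z => xi *m z.1 = xi' *m z.2)); first split; first split.
- by rewrite !mulmx0.
- by move=> a x y h1 h2; rewrite /= !mulmxDr -!scalemxAr h1 h2.
- by move=> a b x ab _; rewrite /pact /= !mulmxA xl ?xl' // !mul0mx.
- by apply/matrixP => i j; rewrite !ord1 x1 x1'.
by move=> x ->; rewrite !mulmx0.
Qed.

Let G_fst x : exists y, G (x, y).
Proof.
have [_ v0 _ _ irr] := H; have [[G0 Gl] Gs] := G_stable.
apply: (irr (fun x => exists y, G (x, y)) _ v) => //; last by exists v'.
split; first split; first by exists 0.
  by move=> a z w [y hy] [y' hy']; exists (a *: y + y'); exact: (Gl a (z, y) (w, y')).
by move=> a b z [y hy]; exists (e' a b *m y); exact: (Gs a b (z, y)).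
Qed.

Let G_snd0 y : G (0, y) -> y = 0.
Proof.
have [_ _ _ _ irr] := H'; have [[G0 Gl] Gs] := G_stable; have [x1' _ _] := Hxi'.
move=> Gy; apply: contrapT => y0.
have : G (0, v').
  apply: (irr (fun y => G (0, y)) _ y) => //.
  split; first split; first exact: G0.
    by move=> a z w hz hw; have := Gl a _ _ hz hw; rewrite /= -[(_ + _)]/(_ + _, _ + _) /= scaler0 addr0.
  by move=> a b z hz; have := Gs a b _ hz; rewrite /pact /= mulmx0.
by move/G_xi => /= /matrixP/(_ 0 0); rewrite x1' mulmx0 mxE => /eqP; rewrite eq_sym oner_eq0.
Qed.

Let G_mx : exists B : 'M[K]_(n', n), forall x, G (x, B *m x).
Proof.
have [f hf] := boolp.choice G_fst; have [[G0 Gl] _] := G_stable.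
exists (\matrix_(i, j) f (delta_mx j 0) i 0) => x; set B := \matrix_(i, j) _.
have -> : x = \sum_j x j 0 *: delta_mx j 0.
  by rewrite {1}[x]matrix_sum_delta; apply: eq_bigr => j _; rewrite big_ord1.
rewrite mulmx_sumr; elim/big_ind2: _ => [|a b c d h1 h2|j _]; first exact: G0.
  by have := Gl 1 _ _ h1 h2; rewrite -[(_ + _)]/(_ + _, _ + _) /= !scale1r.
have -> : B *m (x j 0 *: delta_mx j 0) = x j 0 *: f (delta_mx j 0).
  by rewrite -scalemxAr -colE; congr (_ *: _); apply/matrixP => i k; rewrite !mxE ord1.
have := Gl (x j 0) _ _ (hf (delta_mx j 0)) G0; by rewrite -[(_ + _)]/(_ + _, _ + _) /= !addr0.
Qed.

(** The submodule generated by (v, v') projects onto the first factor and contains no (0, y) with y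
    nonzero, so it is the graph of an equivariant map, which is injective by the same argument on
    the other side. *)
Lemma hwm_hom : exists B : 'M[K]_(n', n), (forall a b, B *m e a b = e' a b *m B) /\ forall x : 'cV[K]_n, B *m x = 0 -> x = 0.
Proof.
have [B hB] := G_mx; have [[G0 Gl] Gs] := G_stable; exists B; split=> [a b|x Bx].
  have col (C : 'M[K]_(n', n)) : (forall x : 'cV[K]_n, C *m x = 0) -> C = 0.
    by move=> h; apply/matrixP => i j; have /matrixP/(_ i 0) := h (delta_mx j 0); rewrite -colE !mxE.
  apply/eqP; rewrite -subr_eq0; apply/eqP; apply: col => x; rewrite mulmxBl -!mulmxA.
  apply: G_snd0; have := Gl (-1) _ _ (Gs a b _ (hB x)) (hB (e a b *m x)).
  by rewrite -[(_ + _)]/(_ + _, _ + _) /= !scaleN1r addNr addrC.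
have [_ v0 _ _ irr] := H; have [x1 _ _] := Hxi.
apply: contrapT => x0.
have Gv : G (v, 0).
  apply: (irr (fun x => G (x, 0)) _ x) => //; last by rewrite -[X in (_, X)]Bx.
  split; first split; first exact: G0.
    by move=> a z w hz hw; have := Gl a _ _ hz hw; rewrite -[(_ + _)]/(_ + _, _ + _) /= scaler0 addr0.
  by move=> a b z hz; have := Gs a b _ hz; rewrite /pact /= mulmx0.
by have /matrixP/(_ 0 0) := G_xi Gv; rewrite /= x1 mulmx0 mxE => /eqP; rewrite oner_eq0.
Qed.
End HighestWeightIso.

Lemma hwm_iso (K : fieldType) (g : nat) (charK : [pchar K] =i pred0) n (e : 'I_g -> 'I_g -> 'M[K]_n) lam v xi
  n' (e' : 'I_g -> 'I_g -> 'M[K]_n') v' xi' :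
  hwm e lam v -> is_xi e lam v xi -> hwm e' lam v' -> is_xi e' lam v' xi' ->
  exists (B : 'M[K]_(n', n)) (C : 'M[K]_(n, n')), [/\ C *m B = 1%:M, B *m C = 1%:M & forall a b, B *m e a b = e' a b *m B].
Proof.
move=> H Hx H' Hx'; have [B [eB iB]] := hwm_hom H Hx H' Hx'; have [B' [_ iB']] := hwm_hom H' Hx' H Hx.
have free (p q : nat) (D : 'M[K]_(p, q)) : (forall x : 'cV[K]_q, D *m x = 0 -> x = 0) -> row_free D^T.
  move=> hD; rewrite -kermx_eq0; apply/eqP/row_matrixP => i; rewrite row0; apply: trmx_inj; rewrite trmx0.
  apply: hD; apply: trmx_inj; rewrite trmx_mul trmxK trmx0.
  by apply/sub_kermxP; apply: row_sub.
have f1 := free _ _ _ iB; have f2 := free _ _ _ iB'.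
have nn : n = n'.
  apply/eqP; rewrite eqn_leq; move: f1 f2; rewrite /row_free => /eqP r1 /eqP r2.
  by rewrite -{1}r1 rank_leq_col /= -{1}r2 rank_leq_col.
subst n'; exists B, (invmx B).
have uB : B \in unitmx by rewrite -unitmx_tr -row_free_unit.
by split; rewrite ?mulVmx ?mulmxV.
Qed.

Section DualModule.
Variables (K : fieldType) (g : nat).
Hypothesis charK : [pchar K] =i pred0.
Variables (n : nat) (e : 'I_g -> 'I_g -> 'M[K]_n) (lam : {ffun 'I_g -> int}) (v : 'cV[K]_n) (xi : 'rV[K]_n).
Hypotheses (H : hwm e lam v) (Hxi : is_xi e lam v xi).
Variables (W W' : 'M[K]_n).
Hypotheses (WW : W *m W' = 1%:M) (eW : forall a b, W *m e a b = e (rev_ord a) (rev_ord b) *m W).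
Variable c : int.

(** The contragredient module twisted by the c-th power of the determinant. *)
Definition dual_e (a b : 'I_g) : 'M[K]_n := (c%:~R *+ (a == b))%:M - (e a b)^T.
Definition dual_wt : {ffun 'I_g -> int} := [ffun a => c - lam (rev_ord a)].

Lemma dual_glmx : glmx dual_e.
Proof.
have [br _ _ _ _] := H; move=> a b a' b'; rewrite /dual_e.
have YZ : (e a b)^T *m (e a' b')^T = (e a' b' *m e a b)^T by rewrite trmx_mul.
have ZY : (e a' b')^T *m (e a b)^T = (e a' b' *m e a b)^T + ((b == a')%:R *: (e a b')^T - (b' == a)%:R *: (e a' b)^T).
  by apply/matrixP => i j; rewrite -trmx_mul br; rewrite !mxE; ring.
rewrite !mulmxBl !mulmxBr !mul_scalar_mx !mul_mx_scalar YZ ZY [b' == a]eq_sym [a' == b]eq_sym.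
move: (_^T) (_^T) (_^T) (_^T) (_^T) => Z Y X U V; apply/matrixP => i j; rewrite !mxE.
by case: (a == b); case: (a' == b'); case: (b == a'); case: (a == b'); case: (i == j);
  rewrite ?mulr0n ?mulr1n; ring.
Qed.

(** xi is killed by lowering operators acting on the right; conjugation by W, which reverses the
    order of the indices, turns this into a highest weight condition on the transpose. *)
Lemma dual_hwm : hwm dual_e dual_wt (xi *m W)^T.
Proof.
have [br v0 kv rv irr] := H; have [x1 xl xw] := Hxi.
have xW (a b : 'I_g) : dual_e a b *m (xi *m W)^T = (c%:~R *+ (a == b)) *: (xi *m W)^T - (xi *m e (rev_ord a) (rev_ord b) *m W)^T.
  by rewrite /dual_e mulmxBl mul_scalar_mx -trmx_mul -[xi *m W *m _]mulmxA eW !mulmxA.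
split.
- exact: dual_glmx.
- move/(congr1 trmx); rewrite trmxK trmx0 => /(congr1 (mulmx^~ W')); rewrite -mulmxA WW mulmx1 mul0mx => x0.
  by move: x1; rewrite x0 mul0mx mxE => /eqP; rewrite eq_sym oner_eq0.
- move=> a; rewrite /mact xW eqxx mulr1n xw -scalemxAl linearZ /= -scalerBl; congr (_ *: _).
  by rewrite ffunE rmorphB.
- move=> a b ab; rewrite /zeroP /mact xW (ltn_eqF ab : (a == b) = false) ?mulr0n ?scale0r ?sub0r.
  have -> : xi *m e (rev_ord a) (rev_ord b) = 0.
    by apply: xl; rewrite /= ltn_sub2l // (leq_ltn_trans ab (ltn_ord b)).
  by rewrite mul0mx trmx0 oppr0.
move=> B [sB hB] u Bu u0 w.
have hBT a b x : B x -> B ((e a b)^T *m x).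
  move=> Bx; have -> : (e a b)^T *m x = c%:~R *+ (a == b) *: x - dual_e a b *m x.
    by rewrite /dual_e mulmxBl mul_scalar_mx opprB addrC subrK.
  by apply: (subB sB); [apply: subZ | exact: hB].
(* Irreducibility passes to the dual through orthogonals: the orthogonal of a nonzero submodule is a
   proper submodule, hence zero, so the submodule is everything. *)
pose D (x : 'cV[K]_n) := forall y, B y -> y^T *m x = 0.
have sD : gl_stable (mact e) D.
  split; first split; first by move=> y _; rewrite mulmx0.
    by move=> a x y hx hy z Bz; rewrite mulmxDr -scalemxAr hx // hy // scaler0 addr0.
  move=> a b x hx y By; rewrite /mact mulmxA.
  have -> : y^T *m e a b = ((e a b)^T *m y)^T by rewrite trmx_mul trmxK.
  by apply: hx; exact: hBT.
have D0 x : D x -> x = 0.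
  move=> Dx; apply: contrapT => x0; apply: u0; have Dall := irr D sD x Dx x0.
  by apply: trmx_inj; rewrite trmx0; apply/rowP => j; have /matrixP/(_ 0 0) := Dall (delta_mx j 0) u Bu; rewrite -colE !mxE.
have [U hU] := subspace_vspace sB; apply/hU.
have [->|nf] := eqVneq U fullv; first exact: memvf.
have dU : (\dim U < n)%N.
  have : (\dim U < \dim (fullv : {vspace 'cV[K]_n}))%N.
    by rewrite ltn_neqAle dimvS ?subvf // andbT; apply: contraNneq nf => h; rewrite eqEdim subvf h leqnn.
  by rewrite dimvf /dim /= muln1.
pose N : 'M[K]_(n, \dim U) := \matrix_(i, j) ((vbasis U)`_j : 'cV[K]_n) i 0.
have : kermx N != 0.
  by rewrite kermx_eq0 /row_free neq_ltn (leq_ltn_trans (rank_leq_col N) dU).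
case/rowV0Pn => r /sub_kermxP rN r0; exfalso; move/negP: r0; apply; apply/eqP/trmx_inj; rewrite trmx0.
apply: D0 => y /hU yU; rewrite (coord_vbasis yU) linear_sum mulmx_suml big1 //= => j _.
rewrite linearZ -scalemxAl /= -trmx_mul; apply/eqP; rewrite scaler_eq0; apply/orP; right; apply/eqP/trmx_inj.
rewrite trmxK trmx0; apply/matrixP => i i'; rewrite !ord1; have h0 : (r *m N) 0 j = 0 by rewrite rN mxE.
by rewrite [RHS]mxE -[RHS]h0 !mxE; apply: eq_bigr => k _; rewrite mxE.
Qed.
End DualModule.

(** * Duality of Pieri maps *)

Section EquivarianceCoefficients.
Variables (K : fieldType) (g : nat).

(** The coefficients of the action of E_ab on exterior powers, read off from the minors of 1 +
    E_ab. *)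
Definition kappa (a b : 'I_g) (L' L : {set 'I_g}) : K := minorS (1%:M + delta_mx a b) #|L| L' L - (L' == L)%:R.

Lemma iotaS_commutator (X : lmodType K) a b (L : {set 'I_g}) (y : {ffun {set 'I_g} -> X}) :
  iotaS L (eps b (iota a y)) - eps b (iota a (iotaS L y)) =
  \sum_(L' : {set 'I_g} | #|L'| == #|L|) kappa a b L' L *: iotaS L' y.
Proof.
have := comps_elem a b 1 L y; rewrite (comps_iotam _ _ erefl) !scale1r => h.
apply: (@addrI _ (iotaS L y)); rewrite -h [in RHS](eq_bigr (fun L' : {set 'I_g} => minorS (1%:M + delta_mx a b) #|L| L' L *: iotaS L' y - (L' == L)%:R *: iotaS L' y)).
  rewrite sumrB [X in _ - X](bigD1 L) //= eqxx scale1r [X in _ - (_ + X)]big1 ?addr0; last first.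
    by move=> L' /andP[_ /negPf ->]; rewrite scale0r.
  by rewrite addrCA subrr addr0.
by move=> L' _; rewrite scalerBl.
Qed.

(** Equivariance as linear equations on the coefficients P_L. In this form it is visibly preserved
    by transposition together with passage to the dual modules. *)
Lemma equiP n (e : 'I_g -> 'I_g -> 'M[K]_n) n' (e' : 'I_g -> 'I_g -> 'M[K]_n') (P : {set 'I_g} -> 'M[K]_(n', n)) :
  equi e e' P <-> forall a b L,
    e' a b *m P L - P L *m e a b + \sum_(L' : {set 'I_g} | #|L'| == #|L|) kappa a b L L' *: P L' = 0.
Proof.
pose R a b L := e' a b *m P L - P L *m e a b + \sum_(L' : {set 'I_g} | #|L'| == #|L|) kappa a b L L' *: P L'.
have key a b x : dF (R a b) x = Fa e' a b (dF P x) - dF P (Fa e a b x).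
  apply/ffunP => I; rewrite [LHS]ffunE [RHS]ffunE [X in _ = _ + X]ffunE Fa_at.
  pose Ei y := eps b (iota a y).
  have E1 (m : nat) (Q : {set 'I_g} -> 'M[K]_(m, n)) (z : {ffun {set 'I_g} -> 'cV[K]_n}) J : dF Q z J = \sum_L Q L *m iotaS L z J by rewrite ffunE.
  have E2 : eps b (iota a (dF P x)) I = \sum_L P L *m eps b (iota a (iotaS L x)) I.
    rewrite ffunE; case: ifP => bI; last by rewrite big1 // => L _; rewrite [X in _ *m X]ffunE bI mulmx0.
    rewrite ffunE; case: ifP => aI; first by rewrite scaler0 big1 // => L _; rewrite [X in _ *m X]ffunE bI [X in _ *m (_ *: X)]ffunE aI scaler0 mulmx0.
    by rewrite E1 !scaler_sumr; apply: eq_bigr => L _; rewrite [X in _ = _ *m X]ffunE bI [X in _ = _ *m (_ *: X)]ffunE aI !scalemxAr.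
  rewrite E2 !E1 mulmx_sumr.
  have -> : \sum_L P L *m iotaS L (Fa e a b x) I = \sum_L P L *m e a b *m iotaS L x I
     - \sum_L P L *m iotaS L (eps b (iota a x)) I.
    rewrite -sumrB; apply: eq_bigr => L _; rewrite /Fa linearB /= [X in _ *m X]ffunE [X in _ *m (_ + X)]ffunE mulmxBr; congr (_ - _).
    by rewrite /pw iotaS_mul ffunE mulmxA.
  have -> : \sum_L R a b L *m iotaS L x I = \sum_L e' a b *m (P L *m iotaS L x I) - \sum_L P L *m e a b *m iotaS L x I +
     \sum_L P L *m (iotaS L (eps b (iota a x)) - eps b (iota a (iotaS L x))) I.
    under eq_bigr => L _ do rewrite /R mulmxDl mulmxBl.
    rewrite big_split sumrB /=; congr (_ - _ + _); first by apply: eq_bigr => L _; rewrite mulmxA.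
    under [RHS]eq_bigr => L _ do rewrite iotaS_commutator sum_ffunE mulmx_sumr.
    rewrite [RHS](exchange_big_dep predT) //=; apply: eq_bigr => L _; rewrite mulmx_suml.
    apply: eq_big => [L'|L' _]; first by rewrite eq_sym.
    by rewrite [X in _ = _ *m X]ffunE -scalemxAl -scalemxAr.
  under [X in _ + X = _]eq_bigr => L _ do rewrite [X in _ *m X]ffunE [X in _ *m (_ + X)]ffunE mulmxBr.
  rewrite sumrB opprB !addrA; move: (\sum_L _) (\sum_L _) (\sum_L _) (\sum_L _) => s1 s2 s3 s4.
  by rewrite -!addrA; congr (_ + _); rewrite addrCA [RHS]addrCA; congr (_ + _); rewrite addrC.
split=> [h a b L|h a b x].
  by apply: (dF0_eq0 (P := R a b)) => x; rewrite key h subrr.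
apply/esym/eqP; rewrite -subr_eq0 -key; apply/eqP/ffunP => I; rewrite !ffunE big1 // => L _.
by rewrite [R a b L]h mul0mx.
Qed.

Lemma equi_dual n (e : 'I_g -> 'I_g -> 'M[K]_n) n' (e' : 'I_g -> 'I_g -> 'M[K]_n') (P : {set 'I_g} -> 'M[K]_(n', n)) c :
  equi e e' P -> equi (dual_e e' c) (dual_e e c) (fun L => (P L)^T).
Proof.
move/equiP => h; apply/equiP => a b L; have := congr1 trmx (h a b L); rewrite trmx0 => h0; rewrite -[RHS]h0.
rewrite [in RHS]linearD [in RHS]linearB [in RHS]linear_sum /= !trmx_mul.
congr (_ + _); last by apply: eq_bigr => L' _; rewrite linearZ.
by rewrite /dual_e mulmxBl mulmxBr mul_scalar_mx mul_mx_scalar opprB addrC addrA subrK.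
Qed.

Lemma equi_comp n (e : 'I_g -> 'I_g -> 'M[K]_n) n' (e' : 'I_g -> 'I_g -> 'M[K]_n') (P : {set 'I_g} -> 'M[K]_(n', n))
  m (d : 'I_g -> 'I_g -> 'M[K]_m) m' (d' : 'I_g -> 'I_g -> 'M[K]_m') (B : 'M[K]_(m', n')) (C : 'M[K]_(n, m)) :
  (forall a b, B *m e' a b = d' a b *m B) -> (forall a b, e a b *m C = C *m d a b) ->
  equi e e' P -> equi d d' (fun L => B *m P L *m C).
Proof.
move=> hB hC /equiP h; apply/equiP => a b L.
have := congr1 (fun M => B *m M *m C) (h a b L); rewrite mulmx0 mul0mx mulmxDr mulmxDl mulmxBr mulmxBl => hh.
rewrite -[RHS]hh; congr (_ - _ + _).
- by rewrite !mulmxA hB.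
- by rewrite -!mulmxA hC.
by rewrite mulmx_sumr mulmx_suml; apply: eq_bigr => L' _; rewrite -scalemxAr -scalemxAl.
Qed.
End EquivarianceCoefficients.

Section DualWeights.
Variables (g : nat) (e : int) (nu : seq int).
Hypothesis dnu : dominant g.-1 nu.

Definition dual_nu := rev [seq e - x | x <- nu].

Let snu : size nu = g.-1. Proof. by case/andP: dnu => /eqP. Qed.

Lemma nth_dual_nu j : (j < g.-1)%N -> dual_nu`_j = e - nu`_(g.-1 - j.+1).
Proof. by move=> jg; rewrite nth_rev size_map snu // (nth_map 0) // snu; lia. Qed.

Lemma dual_nu_dominant : dominant g.-1 dual_nu.
Proof.
have [_ h] := dominantP dnu; apply: mkdominant => [|i ig]; first by rewrite size_rev size_map.
rewrite !nth_dual_nu //; last by lia.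
by rewrite lerD2l lerN2; apply: h; lia.
Qed.

Lemma nu_prime_dual j k : j + k = e + 1 -> (nu_prime dual_nu j + nu_prime nu k)%N = g.-1.
Proof.
move=> jk; rewrite /nu_prime count_rev count_map -snu -(count_predC (fun x : int => k <= x) nu) addnC.
by congr (_ + _)%N; apply: eq_count => x /=; lia.
Qed.

Hypothesis g0 : (0 < g)%N.

(** This is why mu is nu reversed and subtracted from e: positions j and k with j + k = e+1 have
    weights dual to each other up to the twist by e+1. *)
Lemma p_weight_dual j k (a : 'I_g) : j + k = e + 1 ->
  swt g (p_weight dual_nu j) a = e + 1 - swt g (p_weight nu k) (rev_ord a).
Proof.
move=> jk; have s := nu_prime_dual jk; have ag := ltn_ord a.
rewrite !ffunE (nth_p_weightg g0 j dual_nu_dominant ag) (nth_p_weightg g0 k dnu (ltn_ord (rev_ord a))).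
rewrite /=; move: (nu_prime dual_nu j) (nu_prime nu k) s => m m' s.
case: (ltngtP a m) => am; case: (ltngtP (g - a.+1)%N m') => am'; try (exfalso; lia).
- rewrite nth_dual_nu; last lia.
  have -> : (g.-1 - a.+1 = (g - a.+1).-1)%N by lia.
  by move: (nu`_ _); lia.
- rewrite nth_dual_nu; last lia.
  have -> : (g.-1 - a.-1.+1 = g - a.+1)%N by lia.
  by move: (nu`_ _); lia.
by lia.
Qed.

Lemma N_degree_dual j k : j + k = e + 1 -> N_degree g dual_nu j + N_degree g nu k = e + g%:Z.
Proof. by move=> jk; have := nu_prime_dual jk; rewrite /N_degree; lia. Qed.
End DualWeights.

Section PieriDuality.
Variables (K : fieldType) (g : nat).
Hypotheses (charK : [pchar K] =i pred0) (g0 : (0 < g)%N).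
Variable S : seq int -> GLrep K g.
Hypothesis hS : forall lambda, dominant g lambda -> is_Schur lambda (S lambda).
Variable P : Pieri_family S.
Arguments P : clear implicits.
Hypothesis hP : forall nu k, dominant g.-1 nu -> is_Pieri (P nu k).
Variables (e : int) (nu : seq int).
Hypothesis dnu : dominant g.-1 nu.
Notation mu := (dual_nu e nu).
Notation V k := (S (p_weight nu k)).
Notation V' j := (S (p_weight mu j)).

(** Both sides are irreducible with the same highest weight, by [dual_hwm] and [p_weight_dual]. *)
Lemma dual_iso j k : j + k = e + 1 -> exists (B : 'M[K]_(gl_dim (V' j), gl_dim (V k))) (C : 'M[K]_(gl_dim (V k), gl_dim (V' j))),
  [/\ C *m B = 1%:M, B *m C = 1%:M & forall a b, B *m dual_e (gle (V k)) (e + 1) a b = gle (V' j) a b *m B].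
Proof.
move=> jk; have dm := dual_nu_dominant e dnu.
have pk := p_weight_dominant g0 k dnu; have pj := p_weight_dominant g0 j dm.
have [W [W' [WW _ eW]]] := gle_rev charK (V k).
have D := dual_hwm (hw_vecP charK hS pk) (hw_formP charK hS pk) WW eW (e + 1).
have [xi hxi] := xi_exists charK D.
have E : dual_wt (swt g (p_weight nu k)) (e + 1) = swt g (p_weight mu j).
  by apply/ffunP => a; rewrite [LHS]ffunE (p_weight_dual dnu g0 a jk).
have [B [C [h1 h2 h3]]] := hwm_iso charK D hxi (eq_ind_r (fun l => hwm _ l _) (hw_vecP charK hS pj) E)
  (eq_ind_r (fun l => is_xi _ l _ _) (hw_formP charK hS pj) E).
by exists B, C.
Qed.

(** The transposed Pieri map of nu, moved through the isomorphisms with the duals, is an equivariant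
    map between the modules of mu; by [equi_unique] it is a multiple of the Pieri map of mu, and one
    isomorphism is rescaled to absorb the factor. *)
Lemma Pieri_dual j k : j + k = e + 2 -> exists B0 C0 B1 C1,
  [/\ C0 *m B0 = 1%:M, B0 *m C0 = 1%:M, C1 *m B1 = 1%:M, B1 *m C1 = 1%:M
  & forall L, C0 *m Pi P mu j L = (Pi P nu k L)^T *m C1].
Proof.
move=> jk; have dm := dual_nu_dominant e dnu.
have [B0 [C0 [c0 b0 e0]]] := @dual_iso (j - 1) k ltac:(lia).
have [B1 [C1 [c1 b1 e1]]] := @dual_iso j (k - 1) ltac:(lia).
pose Q L := B0 *m (Pi P nu k L)^T *m C1.
have eQ : equi (gle (V' j)) (gle (V' (j - 1))) Q.
  apply: (equi_comp e0 _ (equi_dual (e + 1) (Pi_equi charK hP dnu))) => a b.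
  by rewrite -[LHS]mul1mx -c1 -mulmxA [B1 *m _]mulmxA e1 -!mulmxA b1 mulmx1.
have [L0 L0P] := Pi_neq0 hP k dnu.
have Q0 : Q L0 != 0.
  apply: contraNneq L0P => h; apply/eqP/trmx_inj; rewrite trmx0.
  have := congr1 (fun M => C0 *m M *m B1) h; rewrite /Q mulmx0 mul0mx !mulmxA c0 mul1mx -mulmxA c1 mulmx1 //.
have pj := p_weight_dominant g0 j dm; have pj1 := p_weight_dominant g0 (j - 1) dm.
have [a ha] := equi_unique charK (hw_vecP charK hS pj) (hw_vecP charK hS pj1) (hw_formP charK hS pj1)
  (swt_step g0 j dm) eQ (Pi_equi charK hP dm) Q0.
have [L1 L1P] := Pi_neq0 hP j dm.
have a0 : a != 0 by apply: contraNneq L1P => a0; rewrite ha a0 scale0r.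
exists (a *: B0), (a^-1 *: C0), B1, C1; split=> // [||L].
- by rewrite -scalemxAl -scalemxAr scalerA mulVf // scale1r.
- by rewrite -scalemxAl -scalemxAr scalerA mulfV // scale1r.
by rewrite ha -scalemxAl -scalemxAr scalerA mulVf // scale1r /Q !mulmxA c0 mul1mx.
Qed.
End PieriDuality.

(** * The wedge pairing and the dual complex *)

Section WedgePairing.
Variables (A : comNzRingType) (f : nat).
Notation X := {ffun {set 'I_f} -> A^o}.
Implicit Types (x y : X) (D : {set 'I_f}).

(** With this sign the pairing of complementary degrees makes every contraction self-adjoint
    ([wpair_iota]). *)
Definition osgn D : A := (-1) ^+ (\sum_(i in D) i)%N.
Definition wpair x y : A := \sum_D osgn D * (x D * y (~: D)).

Lemma sqr_sign m : (-1) ^+ m * (-1) ^+ m = 1 :> A.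
Proof. by rewrite -exprD addnn -mul2n exprM sqrrN !expr1n. Qed.

Lemma wpairl_lin y : linear (fun x => wpair x y : A^o).
Proof.
move=> a x x'; rewrite /wpair scaler_sumr -big_split; apply: eq_bigr => D _ /=.
by rewrite !ffunE mulrDl mulrDr; congr (_ + _); rewrite -[_ *: _]/(_ * _) -[in LHS]mulrA mulrCA.
Qed.

Lemma wpairr_lin x : linear (wpair x : X -> A^o).
Proof.
move=> a y y'; rewrite /wpair scaler_sumr -big_split; apply: eq_bigr => D _ /=.
rewrite !ffunE -[_ *: _]/(_ * _) -[in X in _ = X + _]/(a * _) mulrDr mulrDr; congr (_ + _).
by rewrite [x D * _]mulrCA [LHS]mulrCA.
Qed.

Lemma wpair_sumr x (I : finType) (F : I -> X) : wpair x (\sum_i F i) = \sum_i wpair x (F i).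
Proof. exact: (lin_sum _ _ _ (wpairr_lin x)). Qed.

Lemma wpairZr x a y : wpair x (a *: y) = a * wpair x y.
Proof. exact: (linZ _ _ (wpairr_lin x)). Qed.

Lemma sg_setC i D : sg A i D * sg A i (~: D) = (-1) ^+ i.
Proof.
rewrite /sg -exprD; congr (_ ^+ _); rewrite -[RHS](card_ord_lt (ltnW (ltn_ord i))) -[RHS](cardsID D).
by congr (_ + _)%N; apply: eq_card => j; rewrite !inE andbC.
Qed.

(** Reindexing by D with i added, the counts of elements below i in D and in its complement together
    give i, which is the change in [osgn]. *)
Lemma wpair_iota i x y : wpair (iota i x) y = wpair x (iota i y).
Proof.
rewrite /wpair [LHS](bigID (fun D => i \in D)) /= big1 ?add0r => [|D iD]; last by rewrite ffunE iD mul0r mulr0.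
rewrite [RHS](bigID (fun D => i \notin D)) /= [X in _ = X + _]big1 ?add0r => [|D iD]; last first.
  by rewrite [iota _ _ _]ffunE inE (negPf iD) !mulr0.
rewrite [RHS](reindex_onto (fun D => i |: D) (fun D => D :\ i)) /= => [|D]; last by rewrite negbK => iD; rewrite setD1K.
apply: eq_big => [D|D iD].
  rewrite setU11 /=; have [iD|iD] := boolP (i \in D).
    by apply/esym/negbTE; apply: contraTneq iD => <-; rewrite !inE eqxx.
  by rewrite setU1K ?eqxx.
rewrite !ffunE (negPf iD) !inE eqxx /=.
have -> : ~: (i |: D) = ~: D :\ i by apply/setP => j; rewrite !inE negb_or.
have iD' : i \in ~: D by rewrite inE.
rewrite setD1K // sgD1_eq -![_ *: _]/(_ * _).
have -> : osgn (i |: D) = sg A i D * sg A i (~: D) * osgn D by rewrite sg_setC /osgn big_setU1 // exprD.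
have := sgK A i (~: D); move: (sg A i (~: D)) (sg A i D) (osgn D) => s1 s2 s3 h.
transitivity (s3 * s2 * (x (i |: D) : A) * (y (~: D) : A) * (s1 * s1)); last by ring.
by rewrite h; ring.
Qed.

Section Contractions.
Variables (g : nat) (ps : 'M[A]_(f, g)).
Notation J := (@iotam A f g A^o ps).

Lemma wpair_iotam j x y : wpair (J j x) y = wpair x (J j y).
Proof.
rewrite /iotam (lin_sum _ _ _ (wpairl_lin y)) (lin_sum _ _ _ (wpairr_lin x)); apply: eq_bigr => i _.
by rewrite (linZ _ _ (wpairl_lin y)) (linZ _ _ (wpairr_lin x)) wpair_iota.
Qed.

(* Moving J_s through the pairing reverses the order of its factors. *)
Lemma wpair_foldr s x y : wpair (foldr J x s) y = (-1) ^+ 'C(size s, 2) * wpair x (foldr J y s).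
Proof.
have anti a t z : foldr J (J a z) t = (-1) ^+ size t *: J a (foldr J z t).
  elim: t => [|b t IH] /=; first by rewrite expr0 scale1r.
  by rewrite IH linearZ /= iotamC scalerN exprS mulN1r scaleNr.
elim: s y => [|a s IH] y /=; first by rewrite mul1r.
rewrite wpair_iotam IH anti (linZ _ _ (wpairr_lin x)) -[_ *: _]/(_ * _) mulrA -exprD; congr (_ ^+ _ * _).
by rewrite binS bin1.
Qed.
End Contractions.
End WedgePairing.

Section ModulePairing.
Variables (K : fieldType) (A : comNzRingType) (c : {rmorphism K -> A}) (f : nat).
Notation X := {ffun {set 'I_f} -> A^o}.

Definition mpair n m (C : 'M[K]_(n, m)) (u : {ffun 'I_m -> X}) (v : {ffun 'I_n -> X}) : A :=
  \sum_a \sum_b c (C a b) * wpair (u b) (v a).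

Lemma mpairl_lin n m (C : 'M[K]_(n, m)) v : linear (fun u => mpair C u v : A^o).
Proof.
move=> k u u'; rewrite /mpair scaler_sumr -big_split; apply: eq_bigr => a _ /=.
rewrite scaler_sumr -big_split; apply: eq_bigr => b _ /=.
by rewrite !ffunE wpairl_lin mulrDr; congr (_ + _); apply: mulrCA.
Qed.

Lemma mpairr_lin n m (C : 'M[K]_(n, m)) u : linear (mpair C u : _ -> A^o).
Proof.
move=> k v v'; rewrite /mpair scaler_sumr -big_split; apply: eq_bigr => a _ /=.
rewrite scaler_sumr -big_split; apply: eq_bigr => b _ /=.
by rewrite !ffunE wpairr_lin mulrDr; congr (_ + _); apply: mulrCA.
Qed.

(** Self-adjointness of the contractions moves J_L across, reversing its N factors; the matrices C0
    and C1 exchange the coefficients with the transposed ones. *)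
Lemma mpair_dP g (ps : 'M[A]_(f, g)) m m' n n' (Q : {set 'I_g} -> 'M[K]_(m', m)) (P : {set 'I_g} -> 'M[K]_(n', n))
    (C0 : 'M[K]_(n, m')) (C1 : 'M[K]_(n', m)) N u v :
  (forall L : {set 'I_g}, #|L| != N -> P L = 0) -> (forall L, C0 *m Q L = (P L)^T *m C1) ->
  mpair C0 (dP c (@iotam A f g A^o ps) Q u) v = (-1) ^+ 'C(N, 2) * mpair C1 u (dP c (@iotam A f g A^o ps) P v).
Proof.
move=> P0 CQ; set J := @iotam A f g A^o ps.
transitivity (\sum_L \sum_a \sum_b c ((C0 *m Q L) a b) * wpair (comps J L (u b)) (v a)).
  rewrite [RHS]exchange_big; apply: eq_bigr => a _.
  under [LHS]eq_bigr => b' _.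
    rewrite ffunE (lin_sum _ _ _ (wpairl_lin _)) mulr_sumr.
    under eq_bigr => L _.
      rewrite (lin_sum _ _ _ (wpairl_lin _)) mulr_sumr.
      under eq_bigr => b _ do rewrite (linZ _ _ (wpairl_lin _)) -[_ *: _]/(_ * _) mulrA -rmorphM.
      over.
    over.
  rewrite [LHS]exchange_big; apply: eq_bigr => L _; rewrite [LHS]exchange_big; apply: eq_bigr => b _.
  by rewrite mxE rmorph_sum mulr_suml.
transitivity (\sum_L \sum_a \sum_b c (((P L)^T *m C1) a b) * ((-1) ^+ 'C(N, 2) * wpair (u b) (comps J L (v a)))).
  apply: eq_bigr => L _; rewrite CQ; have [cL|/P0 ->] := eqVneq #|L| N; last first.
    by rewrite trmx0 mul0mx !big1 // => a _; rewrite big1 // => b _; rewrite mxE rmorph0 mul0r.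
  apply: eq_bigr => a _; apply: eq_bigr => b _; congr (_ * _).
  by rewrite /comps wpair_foldr -cardE cL.
rewrite /mpair mulr_sumr.
under [RHS]eq_bigr => a' _.
  rewrite mulr_sumr; under eq_bigr => b _.
    rewrite [dP _ _ _ _ _]ffunE; rewrite wpair_sumr mulr_sumr mulr_sumr.
    under eq_bigr => L _.
      rewrite wpair_sumr mulr_sumr mulr_sumr.
      under eq_bigr => a _ do rewrite wpairZr.
      over.
    over.
  rewrite exchange_big; over.
rewrite [RHS]exchange_big; apply: eq_bigr => L _ /=.
under [RHS]eq_bigr => a' _ do rewrite exchange_big.
rewrite [RHS]exchange_big; apply: eq_bigr => a _; rewrite [RHS]exchange_big; apply: eq_bigr => b _.
rewrite mxE rmorph_sum mulr_suml; apply: eq_bigr => a' _.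
by rewrite mxE rmorphM; ring.
Qed.

(** A Hodge star: it takes complements of index sets and applies B. With t = [osgn] it converts the
    pairing into the coordinatewise one, and with the complementary sign it is inverted. *)
Definition star n m (t : {set 'I_f} -> A) (B : 'M[K]_(m, n)) (y : {ffun 'I_n -> X}) : {ffun 'I_m -> X} :=
  [ffun b => [ffun D : {set 'I_f} => t D * \sum_a c (B b a) * (y a (~: D) : A) : A^o]].

Lemma starE n m t (B : 'M[K]_(m, n)) y b D : star t B y b D = t D * \sum_a c (B b a) * (y a (~: D) : A).
Proof. by rewrite !ffunE. Qed.

Lemma starK n m t t' (B : 'M[K]_(m, n)) (C : 'M[K]_(n, m)) : B *m C = 1%:M -> (forall D, t D * t' (~: D) = 1) ->
  cancel (star t' C) (star t B).
Proof.
move=> BC tt w; apply/ffunP => b; apply/ffunP => D; rewrite starE.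
under eq_bigr => a _ do rewrite starE setCK mulrCA mulr_sumr.
rewrite -mulr_sumr mulrA tt mul1r exchange_big /= (bigD1 b) //= [X in _ + X]big1 ?addr0 => [|b' bb'].
  have := congr1 (fun M : 'M_m => c (M b b)) BC; rewrite !mxE eqxx rmorph1 rmorph_sum /= => h.
  by rewrite -[RHS]mul1r -h mulr_suml; apply: eq_bigr => a _; rewrite rmorphM mulrA.
have := congr1 (fun M : 'M_m => c (M b b')) BC; rewrite !mxE eq_sym (negPf bb') rmorph0 rmorph_sum /= => h.
transitivity ((\sum_(i < n) c (B b i * C i b')) * (w b' D : A)); last by rewrite h mul0r.
by rewrite mulr_suml; apply: eq_bigr => a _; rewrite rmorphM mulrA.
Qed.

Lemma mpair_star n m (B : 'M[K]_(m, n)) (C : 'M[K]_(n, m)) y v : C *m B = 1%:M ->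
  mpair C (star (@osgn A f) B y) v = \sum_a \sum_D (y a D : A) * v a D.
Proof.
move=> CB; apply: eq_bigr => a _.
rewrite [RHS](reindex_inj (inv_inj (@setCK _))) /wpair.
under [LHS]eq_bigr => b _ do rewrite mulr_sumr.
rewrite [LHS]exchange_big; apply: eq_bigr => D _ /=.
have := starK (t := fun=> 1) (t' := fun=> 1) CB (fun _ => mulr1 1) y => /ffunP/(_ a)/ffunP/(_ (~: D)) <-.
rewrite starE mul1r mulr_suml; apply: eq_bigr => b _; rewrite !starE mul1r setCK.
have := sqr_sign A (\sum_(i in D) i)%N; rewrite -/(osgn A D); move: (osgn A D) (\sum__ _) (c _) (v a (~: D) : A) => s z k w ss.
by rewrite -[s * z * w]mulrA [s * (s * _)]mulrA ss mul1r mulrA.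
Qed.
End ModulePairing.

Section TPairing.
Variables (K : fieldType) (g f : nat).
Variable S : seq int -> GLrep K g.
Notation A := (symA K f g).
Notation c := (@mpolyC (f * g) K : {rmorphism K -> A}).
Notation T := (t_obj f S).
Notation s nu k := 'I_(gl_dim (S (p_weight nu k))).
Notation X := {ffun {set 'I_f} -> A^o}.

Lemma emb_off nu k (x : T nu k) a (D : {set 'I_f}) : #|D|%:Z != N_degree g nu k -> emb x a D = 0.
Proof. by move=> hD; rewrite embE insubF //; apply/negbTE. Qed.

Lemma resK nu k (u : {ffun s nu k -> X}) : (forall b (D : {set 'I_f}), #|D|%:Z != N_degree g nu k -> u b D = 0) -> emb (res u) = u.
Proof.
move=> h; apply/ffunP => b; apply/ffunP => D; rewrite embE; case: insubP => [E _ <-|hE]; last by rewrite h.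
by rewrite ffunE.
Qed.

Lemma emb_dot nu k (y x : T nu k) : \sum_a \sum_D (emb y a D : A) * emb x a D = \sum_z (y z : A) * x z.
Proof.
rewrite [RHS](eq_bigr (fun z => (y (z.1, z.2) : A) * x (z.1, z.2))) => [|[E a] _ //].
rewrite -(pair_bigA _ (fun E a => (y (E, a) : A) * x (E, a))) /= [RHS]exchange_big; apply: eq_bigr => a _.
rewrite (bigID (fun D : {set 'I_f} => #|D|%:Z == N_degree g nu k)) /= [X in _ + X]big1 ?addr0 => [|D hD]; last first.
  by rewrite emb_off // mul0r.
rewrite (reindex_omap (val : extz f (N_degree g nu k) -> {set 'I_f}) insub) => [|D hD]; last by rewrite (insubT (fun D : {set 'I_f} => #|D|%:Z == N_degree g nu k) hD).
by apply: eq_big => [E|E _]; rewrite ?valK ?eqxx ?(valP E) // !embE valK.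
Qed.

Definition coordv nu k (z : extz f (N_degree g nu k) * s nu k) : T nu k := [ffun z' => (z' == z)%:R].

Lemma dot_coordv nu k (y : T nu k) z : \sum_z' (y z' : A) * (coordv z z' : A) = y z.
Proof.
rewrite (bigD1 z) //= ffunE eqxx mulr1 big1 ?addr0 // => z' zz.
by rewrite ffunE (negPf zz) mulr0.
Qed.

Lemma T_coordv nu k (x : T nu k) : x = \sum_z (x z : A) *: coordv z.
Proof.
apply/ffunP => z; rewrite sum_ffunE -[LHS](dot_coordv x z); apply: eq_bigr => z' _.
by rewrite !ffunE eq_sym.
Qed.

Section Perfect.
Variables (nu : seq int) (k : int) (mu : seq int) (j : int).
Hypothesis hN : N_degree g mu j + N_degree g nu k = f%:Z.
Variables (B : 'M[K]_(gl_dim (S (p_weight mu j)), gl_dim (S (p_weight nu k))))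
          (C : 'M[K]_(gl_dim (S (p_weight nu k)), gl_dim (S (p_weight mu j)))).

Definition tpair (w : T mu j) (x : T nu k) : A := mpair c C (emb w) (emb x).

Lemma tpairl_lin x : linear (fun w => tpair w x : A^o).
Proof. by move=> a w w'; rewrite /tpair emb_lin mpairl_lin. Qed.

Lemma tpairr_lin w : linear (tpair w : T nu k -> A^o).
Proof. by move=> a x x'; rewrite /tpair emb_lin mpairr_lin. Qed.

Lemma emb_star t (y : T nu k) : emb (res (star c t B (emb y)) : T mu j) = star c t B (emb y).
Proof.
apply: resK => b D hD; rewrite starE big1 ?mulr0 // => a _; rewrite emb_off ?mulr0 //.
by apply: contraNneq hD => h; have := cardsC D; rewrite card_ord; lia.
Qed.
End Perfect.

Section Perfect2.
Variables (nu : seq int) (k : int) (mu : seq int) (j : int).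
Hypothesis hN : N_degree g mu j + N_degree g nu k = f%:Z.
Variables (B : 'M[K]_(gl_dim (S (p_weight mu j)), gl_dim (S (p_weight nu k))))
          (C : 'M[K]_(gl_dim (S (p_weight nu k)), gl_dim (S (p_weight mu j)))).
Hypotheses (CB : C *m B = 1%:M) (BC : B *m C = 1%:M).

Lemma tpair_star (y x : T nu k) : tpair C (res (star c (@osgn A f) B (emb y))) x = \sum_z (y z : A) * x z.
Proof. by rewrite /tpair emb_star // mpair_star // emb_dot. Qed.

(** The coordinates of the functional, transported by [star], give the representing element. *)
Lemma tpair_repr (phi : {linear T nu k -> A^o}) : exists w : T mu j, forall x, phi x = tpair C w x.
Proof.
pose y : T nu k := [ffun z => phi (coordv z)]; exists (res (star c (@osgn A f) B (emb y))) => x.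
rewrite tpair_star {1}[x]T_coordv linear_sum; apply: eq_bigr => z _.
by rewrite linearZ ffunE mulrC.
Qed.

Lemma tpair_inj (w : T mu j) : (forall x, tpair C w x = 0) -> w = 0.
Proof.
pose y : T nu k := res (star c (fun D => osgn A (~: D)) C (emb w)).
have ey : emb y = star c (fun D => osgn A (~: D)) C (emb w) by apply: emb_star; rewrite addrC.
have -> : w = res (star c (@osgn A f) B (emb y)).
  by rewrite ey starK ?embK // => D; rewrite setCK sqr_sign.
move=> h; have -> : y = 0.
  by apply/ffunP => z; rewrite -(dot_coordv y z) -tpair_star h ffunE.
apply/ffunP => z; rewrite ffunE starE big1 ?mulr0 ?ffunE // => a _.
by rewrite (lin0 (@emb_lin K g S f nu k)) !ffunE mulr0.
Qed.
End Perfect2.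

Section Adjoint.
Variable P : Pieri_family S.
Arguments P : clear implicits.
Hypothesis g0 : (0 < g)%N.
Variables (nu : seq int) (k : int) (mu : seq int) (j : int).
Hypothesis dnu : dominant g.-1 nu.
Variables (C0 : 'M[K]_(gl_dim (S (p_weight nu k)), gl_dim (S (p_weight mu (j - 1)))))
          (C1 : 'M[K]_(gl_dim (S (p_weight nu (k - 1))), gl_dim (S (p_weight mu j)))).
Hypothesis CP : forall L, C0 *m Pi P mu j L = (Pi P nu k L)^T *m C1.

Lemma tpair_t_map w x : tpair C0 (t_map P w) x = (-1) ^+ 'C(N_step nu k, 2) * tpair C1 w (t_map P x).
Proof.
rewrite /tpair -!dA_emb //.
by apply: (@mpair_dP K A c f g (psi K f g) _ _ _ _ (Pi P mu j) (Pi P nu k) C0 C1) => // L hL; rewrite Pi_supp.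
Qed.

Hypothesis hN : N_degree g mu j + N_degree g nu (k - 1) = f%:Z.
Variable B1 : 'M[K]_(gl_dim (S (p_weight mu j)), gl_dim (S (p_weight nu (k - 1)))).
Hypotheses (CB : C1 *m B1 = 1%:M).

(** The two differentials are adjoint up to a sign of square 1, so boundaries of the complex of mu
    correspond to coboundaries of the dual of the complex of nu. Positions are related by an
    equation rather than by computation, as in [tm]. *)
Lemma tpair_coboundary k' (H : k - 1 = k') (phi : {linear T nu k -> A^o}) :
  (exists v : T mu j, forall x, phi x = tpair C0 (t_map P v) x) <->
  exists h : {linear T nu k' -> A^o}, forall x, phi x = h (@tm K g S P f nu k k' H x).
Proof.
case: _ / H; pose s : A := (-1) ^+ 'C(N_step nu k, 2).
have ss : s * s = 1 by exact: sqr_sign.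
split=> [[v hv]|[h hh]].
  exists (lin_of (tpairr_lin C1 (s *: v))) => x; by rewrite hv tpair_t_map /= (linZ _ _ (tpairl_lin C1 _)).
have [v hv] := tpair_repr hN CB h; exists (s *: v) => x.
by rewrite hh hv tpair_t_map (linZ _ _ (tpairl_lin C1 _)) -[_ *: _]/(_ * _) mulrA ss mul1r.
Qed.
End Adjoint.
End TPairing.

(** * Computation of Ext *)

Section Ext.
Variables (K : fieldType) (e g : nat).
Hypotheses (charK : [pchar K] =i pred0) (g0 : (0 < g)%N).
Variable S : seq int -> GLrep K g.
Hypothesis hS : forall lambda, dominant g lambda -> is_Schur lambda (S lambda).
Variable P : Pieri_family S.
Arguments P : clear implicits.
Hypothesis hP : forall nu k, dominant g.-1 nu -> is_Pieri (P nu k).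
Variable nu : seq int.
Hypothesis dnu : dominant g.-1 nu.
Hypothesis nu_range : {in nu, forall x, - 1 <= x <= e%:Z + 1}.
Notation f := (e + g)%N.
Notation A := (symA K f g).
Notation mu := (dual_nu e%:Z nu).

Lemma dual_nu_range : {in mu, forall x, - 1 <= x <= e%:Z + 1}.
Proof. by move=> x; rewrite mem_rev => /mapP [y /nu_range h ->]; lia. Qed.

(** Functionals on the last term t_{nu;e+1} are represented by t_{mu;0}, those on t_{nu;e} by
    t_{mu;1}, compatibly with the differentials; so the last cohomology of the dual complex is the
    cokernel of the first differential of t_mu. *)
Lemma t_H0_Ext : is_Ext e.+1 (t_H0 f P nu) A^o (t_H0 f P mu).
Proof.
have dmu := dual_nu_dominant e%:Z dnu.
pose k : int := (e.+1)%:Z.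
have [B0 [C0 [B1 [C1 [cb0 bc0 cb1 bc1 CP]]]]] := @Pieri_dual K g charK g0 S hS P hP e%:Z nu dnu 1 k ltac:(rewrite /k; lia).
have N0 : N_degree g mu (1 - 1) + N_degree g nu k = f%:Z by rewrite (N_degree_dual dnu) ?PoszD // /k; lia.
have N1 : N_degree g mu 1 + N_degree g nu (k - 1) = f%:Z by rewrite (N_degree_dual dnu) ?PoszD // /k; lia.
have [rep hrep] := boolp.choice (fun phi : {linear t_obj f S nu k -> A^o} => tpair_repr N0 cb0 phi).
have repE (phi : {linear t_obj f S nu k -> A^o}) (w : t_obj f S mu (1 - 1)) : (forall x, phi x = tpair C0 w x) -> rep phi = w.
  move=> h; apply/eqP; rewrite -subr_eq0; apply/eqP; apply: (tpair_inj N0 cb0 bc0) => x.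
  by rewrite (linB _ _ (tpairl_lin C0 x)) -hrep h subrr.
exists (t_resolution charK g0 hS hP dnu nu_range), (fun phi => augm g0 P dmu dual_nu_range (rep phi)); split.
- move=> a phi phi' phi'' _ _ h; rewrite -linearP; congr (augm _ _ _ _ _); apply: repE => x.
  by rewrite h !hrep -(tpairl_lin C0 x).
- move=> z; have [w <-] := augm_surj g0 dmu dual_nu_range z.
  pose phi : {linear t_obj f S nu k -> A^o} := lin_of (tpairr_lin C0 w).
  have ph : rep phi = w := repE phi w (fun x => erefl (tpair C0 w x)).
  exists phi; last by rewrite ph.
  (* Every functional on the last term is a cocycle, the term at position e+2 being zero. *)
  move=> x; have -> : x = 0 by apply: (T_top g0 dnu nu_range).
  by rewrite linear0 linear0.
move=> phi _; apply: (iff_trans (augm_eq0 g0 P dmu dual_nu_range _)).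
apply: (iff_trans _ (tpair_coboundary g0 dnu CP N1 cb1 (subSz e) phi)); split=> [[v hv]|[v hv]]; exists v.
  by move=> x; rewrite hrep -hv dn_0.
by rewrite dn_0; apply/esym; apply: repE.
Qed.
End Ext.

Theorem mainTheorem5 (K : fieldType) (charK : [pchar K] =i pred0)
  (e g f : nat) (he : (1 <= e)%N) (hg : (1 <= g)%N) (hf : f = (e + g)%N)
  (S : seq int -> GLrep K g)
  (hS : forall lambda, dominant g lambda -> is_Schur lambda (S lambda))
  (P : Pieri_family S)
  (hP : forall nu k, dominant g.-1 nu -> is_Pieri (P nu k))
  (nu : seq int) (hnu : dominant g.-1 nu)
  (hnu_range : {in nu, forall x, - 1 <= x <= e%:Z + 1}) :
  let mu := rev [seq e%:Z - x | x <- nu] in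
  (perfect (t_H0 f P nu) /\
   is_Ext e.+1 (t_H0 f P nu) (symA K f g)^o (t_H0 f P mu)) /\
  maxCM_quotient (@minors_ideal K f g) (t_H0 f P nu).
Proof.
subst f; split; last exact: (t_H0_maxCM charK hg hS hP hnu hnu_range).
by split; [exact: (t_H0_perfect charK hg hS hP hnu hnu_range) | exact: (t_H0_Ext charK hg hS hP hnu hnu_range)].
Qed.
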